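(* Assume that $\mathcal{F}$ satisfies (Causality), (Strong continuity), (Affine boundedness), (Piecewise monotonicity), (Piecewise Lipschitz continuity), ($L^1$-type accretivity), (Lipschitz continuity) and the (Monotonicity-type property), and that $u^0\in V$, $w^0\in L^2(\Omega)$ and $f\in H^1(0,T;L^2(\Omega))$. Let $u$ be the weak solution of the quasilinear problem $\partial_t[u+\mathcal{W}(u,w^0)]-\Delta u=f$, let $w=\mathcal{W}(u,w^0)$, and let $(u_h^k)_{k=0}^K$, $(w_h^k)_{k=0}^K$, $u_{h\tau}$ be given by the fully discrete scheme described in the context with $u_h^0=R_hu^0$. Then there is a constant $C>0$ independent of $h$, $\tau$ and $k$ such that for all $k=1,2,\dots,K$ $$\|u(t_k)-u_h^k\|_{L^2(\Omega)}+\|w(t_k)-w_h^k\|_{L^2(\Omega)}+\int_0^{t_k}\|u(t)-u_{h\tau}(t)\|_{H^1(\Omega)}^2\,dt\le C\left(\tau^{1/2}+h\right).$$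
   Context: Hysteresis operator. $T>0$ and $\mathcal{F}\colon C[0,T]\times\mathbb{R}\to C[0,T]$. The hypotheses on $\mathcal F$ are: (Causality) if $u_1=u_2$ on $[0,t]$ then $[\mathcal F(u_1,w^0)](t)=[\mathcal F(u_2,w^0)](t)$, for all $u_1,u_2\in C[0,T]$, $w^0\in\mathbb{R}$, $t\in[0,T]$. (Strong continuity) if $u_n\to u$ in $C[0,T]$ and $w_n^0\to w^0$ in $\mathbb R$, then $\mathcal F(u_n,w_n^0)\to\mathcal F(u,w^0)$ in $C[0,T]$. (Affine boundedness) there are constants $C_1,C_2\ge0$ with $\|\mathcal F(u,w^0)\|_{C[0,T]}\le C_1(\|u\|_{C[0,T]}+|w^0|)+C_2$ for all $(u,w^0)$. (Piecewise monotonicity) for all $(u,w^0)\in C[0,T]\times\mathbb R$ and $[t_1,t_2]\subset[0,T]$, if $u$ is nondecreasing (resp. nonincreasing) on $[t_1,t_2]$, then so is $\mathcal F(u,w^0)$. (Lipschitz continuity) there is $L>0$ with $\|\mathcal F(u_1,w_1^0)-\mathcal F(u_2,w_2^0)\|_{C[0,T]}\le L\max\{\|u_1-u_2\|_{C[0,T]},|w_1^0-w_2^0|\}$ for all $u_1,u_2\in C[0,T]$, $w^0_1,w^0_2\in\mathbb R$. (Piecewise Lipschitz continuity) there is $L>0$ such that for all $u\in C[0,T]$, $w^0\in\mathbb{R}$ and $[t_1,t_2]\subset[0,T]$, if $u$ is affine on $[t_1,t_2]$ then $|[\mathcal F(u,w^0)](t_1)-[\mathcal F(u,w^0)](t_2)|\le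 L|u(t_1)-u(t_2)|$. ($L^1$-type accretivity) for $(u_i,w_i^0)\in W^{1,1}(0,T)\times\mathbb R$ ($i=1,2$) and every measurable $s\colon[0,T]\to\mathbb R$ with $s\in\operatorname{sign}(u_1-u_2)$ a.e. in $(0,T)$ (the set-valued sign, $\operatorname{sign}(0)=[-1,1]$), setting $\bar w=\mathcal F(u_1,w_1^0)-\mathcal F(u_2,w_2^0)$, one has $\frac{d\bar w}{dt}s\ge\frac{d}{dt}|\bar w|$ a.e. in $(0,T)$. (Monotonicity-type property) there is a constant $c>0$ such that for all $(u_i,w_i^0)\in W^{1,1}(0,T)\times\mathbb R$ ($i=1,2$), with $w_i=\mathcal F(u_i,w_i^0)$, $\bar u=u_1-u_2$, $\bar w=w_1-w_2$, and every $[t_1,t_2]\subset[0,T]$, $$\int_{t_1}^{t_2}\frac{d\bar w}{dt}\,\bar u\,dt\ge\frac1{2c}\left[\bar w(t_2)^2-\bar w(t_1)^2\right].$$ The space-distributed operator is $[\mathcal W(u,w^0)](x,t):=[\mathcal F(u(x,\cdot),w^0(x))](t)$ for $(x,t)\in\Omega\times[0,T]$. Continuous problem. $\Omega\subset\mathbb{R}^N$ ($N\ge1$) is a convex polyhedral domain; $V=H^1_0(\Omega)$ (homogeneous Dirichlet condition) or $V=H^1(\Omega)$ (homogeneous Neumann condition); $(u,v)=\int_\Omega uv\,dx$, $a(u,v)=\int_\Omega\nabla u\cdot\nabla v\,dx$. Under the hypotheses of the claim there is a unique weak solution $u\in H^1(0,T;L^2(\Omega))\cap L^\infty(0,T;V)\cap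 L^2(0,T;H^2(\Omega))$, i.e. $u(\cdot,0)=u^0$, $w:=\mathcal W(u,w^0)\in L^2(\Omega;C[0,T])\cap H^1(0,T;L^2(\Omega))$, and for a.e. $t\in(0,T)$, $\left(\frac{\partial u}{\partial t},\varphi\right)+\left(\frac{\partial w}{\partial t},\varphi\right)+a(u,\varphi)=(f,\varphi)$ for all $\varphi\in V$. Discretization. $\mathcal T_h$ is a regular (conforming, shape-regular) family of affine-equivalent simplicial triangulations of $\bar\Omega$, $h=\max_{K\in\mathcal T_h}h_K$ with $h_K$ the diameter of $K$, and $V_h\subset V$ is the space of continuous piecewise-linear finite element functions. The elliptic projection $R_h\colon V\to V_h$ is defined by $a(u-R_hu,\varphi_h)+\lambda(u-R_hu,\varphi_h)=0$ for all $\varphi_h\in V_h$, where $\lambda$ is a fixed constant for which $R_h$ is well defined and satisfies $\|v-R_hv\|_{H^l(\Omega)}\le Ch^{m-l}\|v\|_{H^m(\Omega)}$ for $1\le m\le2$, $0\le l\le1$, with $C$ independent of $h$. For a positive integer $K$ let $\tau=T/K$, $t_k=k\tau$, $\bar f^{k+1}=\frac1\tau\int_{t_k}^{t_{k+1}}f\,ds$. The fully discrete (backward Euler) scheme: given $u_h^0\in V_h$, find $u_h^{k+1}\in V_h$, $k=0,\dots,K-1$, such that for all $\varphi_h\in V_h$, $$\left(\frac{u_h^{k+1}-u_h^k}{\tau},\varphi_h\right)+\left(\frac{w_h^{k+1}-w_h^k}{\tau},\varphi_h\right)+a(u_h^{k+1},\varphi_h)=(\bar f^{k+1},\varphi_h),$$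 where $u_{h\tau}$ is the continuous piecewise-linear-in-time interpolant, $u_{h\tau}((k+s)\tau)=su_h^{k+1}+(1-s)u_h^k$ for $s\in[0,1]$, $w_{h\tau}=\mathcal W(u_{h\tau},w^0)$ and $w_h^k=w_{h\tau}(t_k)$. (By causality the scheme advances sequentially in time.) The constant $C$ in the claim may depend on the exact solution, the data $f,u^0,w^0$, $T$, $\Omega$, the shape-regularity of the mesh family, $\lambda$ and the constants of $\mathcal F$. *)

(* Defs.v *)
From HB Require Import structures.
From mathcomp Require Import all_boot all_order all_algebra.
From mathcomp Require Import all_classical all_reals all_analysis.
Set Implicit Arguments.
Unset Strict Implicit.
Unset Printing Implicit Defensive.
Import Order.TTheory GRing.Theory Num.Theory.
Import numFieldNormedType.Exports.
Local Open Scope classical_set_scope.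
Local Open Scope ring_scope.

(* An element of C[0,T] is represented by any function R -> R whose restriction
   to [0,T] is continuous; values outside [0,T] are irrelevant. *)
Definition contT (R : realType) (T : R) : set (R -> R) :=
  [set u | {within `[0, T], continuous u}].

Definition supnorm (R : realType) (T : R) (u : R -> R) : R :=
  sup [set `|u t| | t in `[0, T]].

Definition test_fun_time (R : realType) (T : R) (phi : R -> R) : Prop :=
  (forall (m : nat) (t : R), derivable (derive1n m phi) t 1) /\
  exists a b : R, [/\ 0 < a, b < T &
    forall t, ~ (a <= t <= b) -> phi t = 0].

Definition weak_deriv (R : realType) (T : R) (u g : R -> R) : Prop :=
  lebesgue_measure.-integrable `]0, T[ (EFin \o g) /\
  forall phi, test_fun_time T phi ->
    \int[lebesgue_measure]_(t in `]0, T[) (u t * derive1 phi t) =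
    - \int[lebesgue_measure]_(t in `]0, T[) (g t * phi t).

(* W^{1,1}(0,T), each class being identified with its continuous
   representative. *)
Definition W11 (R : realType) (T : R) : set (R -> R) :=
  [set u | contT T u /\ exists g, weak_deriv T u g].

Definition sign_set (R : realType) (r : R) : set R :=
  if r == 0 then [set` `[-1, 1]] else [set Num.sg r].

Definition nondecreasing_on (R : realType) (t1 t2 : R) (u : R -> R) : Prop :=
  {in `[t1, t2] &, {homo u : x y / x <= y}}.

Definition nonincreasing_on (R : realType) (t1 t2 : R) (u : R -> R) : Prop :=
  {in `[t1, t2] &, {homo u : x y / x <= y >-> y <= x}}.

Definition affine_on_interval (R : realType) (t1 t2 : R) (u : R -> R) : Prop :=
  exists a b : R, forall t, t1 <= t <= t2 -> u t = a * t + b.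

Section Hysteresis.
Context {R : realType}.
Variables (T : R) (F : (R -> R) -> R -> (R -> R)).

Definition maps_to_contT : Prop :=
  forall u w0, contT T u -> contT T (F u w0).

(* Taking t = T, causality makes F independent of the values of its argument
   outside [0,T]. *)
Definition causality : Prop :=
  forall u1 u2 w0 t, contT T u1 -> contT T u2 -> 0 <= t <= T ->
    (forall s, 0 <= s <= t -> u1 s = u2 s) -> F u1 w0 t = F u2 w0 t.

Definition strong_continuity : Prop :=
  forall (un : nat -> R -> R) (u : R -> R) (wn : nat -> R) (w : R),
    (forall m, contT T (un m)) -> contT T u ->
    supnorm T (un m \- u) @[m --> \oo] --> 0 ->
    wn m @[m --> \oo] --> w ->
    supnorm T (F (un m) (wn m) \- F u w) @[m --> \oo] --> 0.

Definition affine_boundedness : Prop :=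
  exists C1 C2 : R, [/\ 0 <= C1, 0 <= C2 &
    forall u w0, contT T u ->
      supnorm T (F u w0) <= C1 * (supnorm T u + `|w0|) + C2].

Definition piecewise_monotonicity : Prop :=
  forall u w0 t1 t2, contT T u -> 0 <= t1 -> t1 <= t2 -> t2 <= T ->
    (nondecreasing_on t1 t2 u -> nondecreasing_on t1 t2 (F u w0)) /\
    (nonincreasing_on t1 t2 u -> nonincreasing_on t1 t2 (F u w0)).

Definition lipschitz_continuity : Prop :=
  exists L : R, 0 < L /\
    forall u1 u2 w1 w2, contT T u1 -> contT T u2 ->
      supnorm T (F u1 w1 \- F u2 w2) <=
        L * Num.max (supnorm T (u1 \- u2)) `|w1 - w2|.

Definition piecewise_lipschitz_continuity : Prop :=
  exists L : R, 0 < L /\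
    forall u w0 t1 t2, contT T u -> 0 <= t1 -> t1 <= t2 -> t2 <= T ->
      affine_on_interval t1 t2 u ->
      `|F u w0 t1 - F u w0 t2| <= L * `|u t1 - u t2|.

(* Here and below the time derivatives of F u1 w1 - F u2 w2 and of its absolute
   value are weak derivatives, hence determined up to a null set; the quantifier
   over g and G thus only fixes representatives. *)
Definition L1_accretivity : Prop :=
  forall u1 u2 w1 w2 s, W11 T u1 -> W11 T u2 ->
    measurable_fun `[0, T] s ->
    {ae lebesgue_measure, forall t, 0 < t < T -> sign_set (u1 t - u2 t) (s t)} ->
    let wbar := F u1 w1 \- F u2 w2 in
    forall g G, weak_deriv T wbar g -> weak_deriv T (fun t => `|wbar t|) G ->
      {ae lebesgue_measure, forall t, 0 < t < T -> G t <= g t * s t}.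

Definition monotonicity_type : Prop :=
  exists c : R, 0 < c /\
    forall u1 u2 w1 w2, W11 T u1 -> W11 T u2 ->
      let ubar := u1 \- u2 in
      let wbar := F u1 w1 \- F u2 w2 in
      forall g, weak_deriv T wbar g ->
      forall t1 t2, 0 <= t1 -> t1 <= t2 -> t2 <= T ->
        (2 * c)^-1 * (wbar t2 ^+ 2 - wbar t1 ^+ 2) <=
          \int[lebesgue_measure]_(t in `[t1, t2]) (g t * ubar t).

End Hysteresis.

(* The space-distributed operator W(u,w0); functions of space-time are written
   as u t x, with u t the spatial slice. *)
Definition distributed (R : realType) (E : Type) (F : (R -> R) -> R -> (R -> R))
    (u : R -> E -> R) (w0 : E -> R) : R -> E -> R :=
  fun t x => F (u ^~ x) (w0 x) t.

(* Bochner spaces over (D, nu) with values in X, a space of functions A -> R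
   normed by nX. *)
Section Bochner.
Context {d : measure_display} {S : measurableType d} {R : realType}.
Variables (nu : {measure set S -> \bar R}) (D : set S).
Variables (A : Type) (X : set (A -> R)) (nX : (A -> R) -> \bar R).

Record simple_map := SimpleMap {
  sm_size : nat ;
  sm_set : 'I_sm_size -> set S ;
  sm_val : 'I_sm_size -> A -> R ;
  sm_setP : forall i, [/\ measurable (sm_set i), sm_set i `<=` D &
                          (nu (sm_set i) < +oo)%E] ;
  sm_valP : forall i, X (sm_val i) }.

Definition sm_fun (s : simple_map) : S -> A -> R :=
  fun t a => \sum_(i < sm_size s) \1_(sm_set i) t * sm_val i a.

Definition sm_integral (s : simple_map) : A -> R :=
  fun a => \sum_(i < sm_size s) fine (nu (sm_set i)) * sm_val i a.

Definition ae_approx (s : nat -> simple_map) (u : S -> A -> R) : Prop :=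
  {ae nu, forall t, D t -> X (u t) /\
     nX (sm_fun (s m) t \- u t) @[m --> \oo] --> 0%E}.

Definition strongly_measurable (u : S -> A -> R) : Prop :=
  exists s : nat -> simple_map, ae_approx s u.

Definition bochner_L2 (u : S -> A -> R) : Prop :=
  strongly_measurable u /\ (\int[nu]_(t in D) (nX (u t)) ^+ 2 < +oo)%E.

Definition bochner_Linfty (u : S -> A -> R) : Prop :=
  strongly_measurable u /\
  exists M : R, {ae nu, forall t, D t -> (nX (u t) <= M%:E)%E}.

Definition is_bochner_integral (u : S -> A -> R) (I : A -> R) : Prop :=
  X I /\ exists s : nat -> simple_map,
    [/\ ae_approx s u,
        (\int[nu]_(t in D) nX (sm_fun (s m) t \- u t)%R)%E @[m --> \oo] --> 0%E &
        nX (sm_integral (s m) \- I) @[m --> \oo] --> 0%E].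

End Bochner.

(* The space dimension is N = n.+1. *)
Definition borelRn (R : realType) (n : nat) :=
  g_sigma_algebraType (@open 'rV[R]_n.+1).

(* This determines the measure uniquely. *)
Definition is_lebesgue_measure (R : realType) (n : nat)
    (mu : {measure set (borelRn R n) -> \bar R}) : Prop :=
  forall a b : 'rV[R]_n.+1, (forall i, a 0 i <= b 0 i) ->
    mu [set x : 'rV[R]_n.+1 | forall i, a 0 i <= x 0 i <= b 0 i] =
    (\prod_(i < n.+1) (b 0 i - a 0 i))%:E.

Definition partial (R : realType) (n : nat) (i : 'I_n.+1)
    (f : 'rV[R]_n.+1 -> R) : 'rV[R]_n.+1 -> R :=
  fun x => 'D_(delta_mx 0 i) f x.

Fixpoint class_C (R : realType) (n m : nat) (f : 'rV[R]_n.+1 -> R) : Prop :=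
  continuous f /\
  match m with
  | 0 => True
  | m'.+1 => forall i : 'I_n.+1,
      (forall x, derivable f x (delta_mx 0 i)) /\ class_C m' (partial i f)
  end.

Definition eucl_norm (R : realType) (n : nat) (x : 'rV[R]_n.+1) : R :=
  Num.sqrt (\sum_i x 0 i ^+ 2).

Definition dot (R : realType) (n : nat) (x y : 'rV[R]_n.+1) : R :=
  \sum_i x 0 i * y 0 i.

Definition convex_polyhedral_domain (R : realType) (n : nat)
    (Omega : set 'rV[R]_n.+1) : Prop :=
  [/\ Omega !=set0, bounded_set Omega &
      exists (m : nat) (a : 'I_m -> 'rV[R]_n.+1) (b : 'I_m -> R),
        Omega = [set x | forall j, dot (a j) x < b j]].

Inductive boundary_condition := Dirichlet | Neumann.

Section Sobolev.
Context {R : realType} {n : nat}.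
Variables (Omega : set 'rV[R]_n.+1).
Variables (mu : {measure set (borelRn R n) -> \bar R}).
Notation E := 'rV[R]_n.+1.

Definition test_fun (phi : E -> R) : Prop :=
  (forall m, class_C m phi) /\
  exists K : set E, [/\ compact K, K `<=` Omega &
    forall x, ~ K x -> phi x = 0].

Definition L2_norm (f : E -> R) : \bar R := Lnorm mu 2%:E (EFin \o (f \_ Omega)).

Definition L2 : set (E -> R) :=
  [set f | measurable_fun (Omega : set (borelRn R n)) f /\ (L2_norm f < +oo)%E].

Definition inner (f g : E -> R) : R := \int[mu]_(x in Omega) (f x * g x).

Definition is_weak_partial (i : 'I_n.+1) (f g : E -> R) : Prop :=
  forall phi, test_fun phi -> inner f (partial i phi) = - inner g phi.

(* A representative of the weak partial derivative (which is unique a.e.). *)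
Definition weak_partial (i : 'I_n.+1) (f : E -> R) : E -> R :=
  xget (cst 0) [set g | L2 g /\ is_weak_partial i f g].

Definition H1 : set (E -> R) :=
  [set f | L2 f /\ forall i, exists g, L2 g /\ is_weak_partial i f g].

Definition H1_norm (f : E -> R) : \bar R :=
  sqrte ((L2_norm f) ^+ 2 + \sum_i (L2_norm (weak_partial i f)) ^+ 2)%E.

Definition H2 : set (E -> R) :=
  [set f | H1 f /\ forall i, H1 (weak_partial i f)].

Definition H2_norm (f : E -> R) : \bar R :=
  sqrte ((H1_norm f) ^+ 2 +
    \sum_i \sum_j (L2_norm (weak_partial j (weak_partial i f))) ^+ 2)%E.

(* The spaces H^m(Omega) for m = 0, 1, 2. *)
Definition Hm (m : nat) : set (E -> R) :=
  match m with 0 => L2 | 1 => H1 | _ => H2 end.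

Definition Hm_norm (m : nat) (f : E -> R) : \bar R :=
  match m with 0 => L2_norm f | 1 => H1_norm f | _ => H2_norm f end.

Definition H10 : set (E -> R) :=
  [set f | H1 f /\ exists phi : nat -> E -> R, (forall m, test_fun (phi m)) /\
     H1_norm (phi m \- f) @[m --> \oo] --> 0%E].

Definition Vspace (bc : boundary_condition) : set (E -> R) :=
  match bc with Dirichlet => H10 | Neumann => H1 end.

Definition dirichlet_form (f g : E -> R) : R :=
  \sum_i inner (weak_partial i f) (weak_partial i g).

(* u belongs to H^1(0,T;L^2(Omega)) and ut is its weak time derivative. *)
Definition H1_time (T : R) (u ut : R -> E -> R) : Prop :=
  [/\ bochner_L2 lebesgue_measure `]0, T[ L2 L2_norm u,
      bochner_L2 lebesgue_measure `]0, T[ L2 L2_norm ut &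
      forall phi, test_fun_time T phi -> exists I,
        is_bochner_integral lebesgue_measure `]0, T[ L2 L2_norm
          (fun t x => derive1 phi t * u t x) I /\
        is_bochner_integral lebesgue_measure `]0, T[ L2 L2_norm
          (fun t x => - (phi t * ut t x)) I].

(* The first clause selects the representative of u under the embeddings of
   H^1(0,T;L^2(Omega)) into C([0,T];L^2(Omega)) and L^2(Omega;C[0,T]): u(t) makes
   sense for every t, and F(u(x,.),w0(x)) for every x in Omega. *)
Definition weak_solution (bc : boundary_condition) (T : R)
    (F : (R -> R) -> R -> (R -> R)) (u0 w0 : E -> R) (f u : R -> E -> R) : Prop :=
  let w := distributed F u w0 in
  [/\ (forall t, 0 <= t <= T -> L2 (u t)) /\
      (forall x, Omega x -> contT T (u ^~ x)),
      bochner_Linfty lebesgue_measure `]0, T[ (Vspace bc) H1_norm u /\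
      bochner_L2 lebesgue_measure `]0, T[ H2 H2_norm u,
      {ae mu, forall x, Omega x -> u 0 x = u0 x},
      bochner_L2 mu Omega (contT T) (fun v => (supnorm T v)%:E)
        (fun x => w ^~ x) &
      exists ut wt, [/\ H1_time T u ut, H1_time T w wt &
        {ae lebesgue_measure, forall t, 0 < t < T ->
          forall phi, Vspace bc phi ->
            inner (ut t) phi + inner (wt t) phi + dirichlet_form (u t) phi =
            inner (f t) phi}]].

(* A simplex is given by the matrix whose N+1 rows are its vertices. *)
Definition vertex_matrix : Type := 'M[R]_(n.+2, n.+1).

Definition vertices (K : vertex_matrix) : set E := range (fun i => row i K).

Definition affinely_independent (K : vertex_matrix) : Prop :=
  forall c : 'I_n.+2 -> R, \sum_i c i = 0 -> \sum_i c i *: row i K = 0 ->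
    forall i, c i = 0.

(* The convex hull of those vertices of K which belong to P. *)
Definition face (K : vertex_matrix) (P : set E) : set E :=
  [set x | exists c : 'I_n.+2 -> R,
     [/\ forall i, 0 <= c i, forall i, ~ P (row i K) -> c i = 0,
         \sum_i c i = 1 & x = \sum_i c i *: row i K]].

Definition simplex (K : vertex_matrix) : set E := face K setT.

Definition diameter (K : vertex_matrix) : R :=
  sup [set r | exists x y, [/\ simplex K x, simplex K y & r = eucl_norm (x - y)]].

(* The supremum of the diameters of the balls contained in K. *)
Definition inball_diameter (K : vertex_matrix) : R :=
  sup [set r | exists (x : E) (rho : R), [/\ 0 <= rho, r = 2 * rho &
    [set y | eucl_norm (y - x) <= rho] `<=` simplex K]].

Definition triangulation : Type := seq vertex_matrix.

Definition conforming_triangulation (Th : triangulation) : Prop :=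
  [/\ forall K, K \in Th -> affinely_independent K,
      closure Omega = [set x | exists2 K, K \in Th & simplex K x] &
      forall K K', K \in Th -> K' \in Th ->
        simplex K `&` simplex K' = face K (vertices K')].

Definition shape_regular (fam : set triangulation) : Prop :=
  exists sigma : R, forall Th K, fam Th -> K \in Th ->
    diameter K <= sigma * inball_diameter K.

Definition regular_family (fam : set triangulation) : Prop :=
  (forall Th, fam Th -> conforming_triangulation Th) /\ shape_regular fam.

Definition mesh_size (Th : triangulation) : R :=
  \big[Num.max/0]_(K <- Th) diameter K.

Definition Vh (bc : boundary_condition) (Th : triangulation) : set (E -> R) :=
  [set v | [/\ Vspace bc v, {within closure Omega, continuous v} &
     forall K, K \in Th -> exists (a : E) (b : R),
       forall x, simplex K x -> v x = dot a x + b]].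

Definition is_elliptic_projection (bc : boundary_condition) (lambda : R)
    (Th : triangulation) (v vh : E -> R) : Prop :=
  Vh bc Th vh /\
  forall phi, Vh bc Th phi ->
    dirichlet_form (v \- vh) phi + lambda * inner (v \- vh) phi = 0.

Definition elliptic_projection_property (bc : boundary_condition) (lambda : R)
    (fam : set triangulation) : Prop :=
  (forall Th v, fam Th -> Vspace bc v ->
     exists vh, is_elliptic_projection bc lambda Th v vh /\
       forall vh', is_elliptic_projection bc lambda Th v vh' ->
         forall x, Omega x -> vh' x = vh x) /\
  exists C : R, forall Th v vh m l, fam Th -> (1 <= m <= 2)%N -> (l <= 1)%N ->
    Vspace bc v -> Hm m v -> is_elliptic_projection bc lambda Th v vh ->
    (Hm_norm l (v \- vh)%R <= (C * mesh_size Th ^+ (m - l))%:E * Hm_norm m v)%E.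

Definition time_interpolant (tau : R) (K : nat) (uh : nat -> E -> R)
    (uht : R -> E -> R) : Prop :=
  forall (k : nat) (s : R), (k < K)%N -> 0 <= s <= 1 ->
    forall x, uht ((k%:R + s) * tau) x = s * uh k.+1 x + (1 - s) * uh k x.

(* I is the Bochner integral of f over (t_k, t_{k+1}). *)
Definition discrete_solution (bc : boundary_condition) (T : R)
    (F : (R -> R) -> R -> (R -> R)) (w0 : E -> R) (f : R -> E -> R)
    (Th : triangulation) (K : nat) (uh : nat -> E -> R) (uht : R -> E -> R) :
    Prop :=
  let tau := T / K%:R in
  let wh k := distributed F uht w0 (k%:R * tau) in
  [/\ forall k, (k <= K)%N -> Vh bc Th (uh k),
      time_interpolant tau K uh uht &
      forall k, (k < K)%N -> exists2 I,
        is_bochner_integral lebesgue_measure `]k%:R * tau, k.+1%:R * tau[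
          L2 L2_norm f I &
        forall phi, Vh bc Th phi ->
          inner (fun x => (uh k.+1 x - uh k x) / tau) phi +
          inner (fun x => (wh k.+1 x - wh k x) / tau) phi +
          dirichlet_form (uh k.+1) phi =
          inner (fun x => tau^-1 * I x) phi].

End Sobolev.

(* Main.v *)
(* Let e = u - u_htau and rho = u - R_h u. At almost every time the difference
   of the weak equation and of the scheme is tested with R_h u - u_htau = e - rho,
   which lies in V_h; Young's inequality gives
     |grad e|^2 + 2 (N, e) <= C h^2 (|N|^2 + |u|_{H^2}^2) + 3 |grad d_k|^2,
   where d_k = u_h^{k+1} - u_h^k and N collects the differences of the time
   derivatives of u and w and of the data.  For fixed x, the time integral of N e
   up to t_j dominates e^2/2 + wbar^2/(2c) up to O(tau).  Indeed the nodal slope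
   of w_h and the mean of f over a slab differ from dw_h/dt and f by functions of
   mean zero, so that on each slab only the oscillation of e enters, and the
   monotonicity-type property applies to the remaining integral of e dwbar/dt.
   The O(tau) terms are bounded by testing the scheme with its own increments,
   where the hysteresis term has a sign because F is piecewise monotone.  All
   products are absorbed by Young's inequality, and no Gronwall argument is
   needed. *)
Require Import Defs.
From HB Require Import structures.
From mathcomp Require Import all_boot all_order all_algebra.
From mathcomp Require Import all_classical all_reals all_analysis.
From mathcomp Require Import measurable_realfun ring lra.
Set Implicit Arguments.
Unset Strict Implicit.
Unset Printing Implicit Defensive.
Import Order.TTheory GRing.Theory Num.Theory.
Import numFieldNormedType.Exports.
Local Open Scope classical_set_scope.
Local Open Scope ring_scope.

(** * Integration *)

(** The residual [N] stays bounded in L2 of space-time but does not become small. It is paired with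
    the projection error, which is O(h^2) in L2 by H2 regularity, and with [e], where its mean-zero
    parts meet only the oscillation of [e] on a slab; this gives tau + h^2 for the squared errors,
    hence tau^(1/2) + h. The dissipation inequality is used in two directions: without the gradient
    it bounds the work 2 (N, e) from above, which closes the energy inequality; the energy
    inequality in turn bounds -2 (N, e), which closes the gradient estimate. The obstacle is
    measure-theoretic. F acts on trajectories at fixed x, whereas the data are Bochner classes of
    functions of x at fixed t, with null sets depending on t. Hence jointly measurable
    representatives of the time derivatives and of f are built, and for almost every x the
    trajectories are shown to be primitives of them. Measurability in x of the discrete output of F
    has to be proved, and the unknown measurability in t of the spatial norms is circumvented. *)

Lemma ae_imp d (T : measurableType d) (R : realType)
    (m : {measure set T -> \bar R}) (P Q : T -> Prop) :
  {ae m, forall x, P x} -> (forall x, P x -> Q x) -> {ae m, forall x, Q x}.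
Proof. by move=> h PQ; apply: filterS h. Qed.

Lemma ae_imp2 d (T : measurableType d) (R : realType)
    (m : {measure set T -> \bar R}) (P Q S : T -> Prop) :
  {ae m, forall x, P x} -> {ae m, forall x, Q x} ->
  (forall x, P x -> Q x -> S x) -> {ae m, forall x, S x}.
Proof. by move=> h h' PQ; apply: filterS2 h h'. Qed.

Lemma ae_imp3 d (T : measurableType d) (R : realType)
    (m : {measure set T -> \bar R}) (P Q S U : T -> Prop) :
  {ae m, forall x, P x} -> {ae m, forall x, Q x} -> {ae m, forall x, S x} ->
  (forall x, P x -> Q x -> S x -> U x) -> {ae m, forall x, U x}.
Proof. by move=> h h' h'' PQ; apply: filterS3 h h' h''. Qed.

Lemma ae_forall d (T : measurableType d) (R : realType)
    (m : {measure set T -> \bar R}) (P : nat -> T -> Prop) :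
  (forall k, {ae m, forall x, P k x}) -> {ae m, forall x, forall k, P k x}.
Proof. by move=> h; apply/ae_foralln. Qed.

Section RealIntegrable.
Context d (T : measurableType d) (R : realType).
Variable m : {measure set T -> \bar R}.
Variable D : set T.
Hypothesis mD : measurable D.
Implicit Types f g : T -> R.
Local Notation ri f := (m.-integrable D (EFin \o f)).

Lemma riD f g : ri f -> ri g -> ri (fun x => f x + g x).
Proof. by move=> hf hg; exact: (integrableD mD hf hg). Qed.

Lemma riN f : ri f -> ri (fun x => - f x).
Proof. by move=> hf; exact: (integrableN hf). Qed.

Lemma riB f g : ri f -> ri g -> ri (fun x => f x - g x).
Proof. by move=> hf hg; exact: (riD hf (riN hg)). Qed.

Lemma riZ a f : ri f -> ri (fun x => a * f x).
Proof. by move=> hf; exact: (integrableZl mD a hf). Qed.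

Lemma ri_measurable f : ri f -> measurable_fun D f.
Proof. by move=> /measurable_int /measurable_EFinP. Qed.

Lemma ri_abs f : ri f -> ri (fun x => `|f x|).
Proof. by move=> hf; exact: (integrable_abse hf). Qed.

Lemma ri_le f g : measurable_fun D f -> (forall x, D x -> `|f x| <= g x) ->
  ri g -> ri f.
Proof.
move=> mf fg; apply: le_integrable => //; first exact/measurable_EFinP.
move=> x Dx /=; rewrite lee_fin (le_trans (fg x Dx))//.
exact: ler_norm.
Qed.

Lemma ri0 : ri (fun _ => 0).
Proof. exact: integrable0. Qed.

Lemma ri_sum (I : Type) (s : seq I) (F : I -> T -> R) :
  (forall i, ri (F i)) -> ri (fun x => \sum_(i <- s) F i x).
Proof.
move=> h; elim: s => [|i s IH].
  by under [X in _.-integrable _ (_ \o X)]funext => x do rewrite big_nil; exact: ri0.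
under [X in _.-integrable _ (_ \o X)]funext => x do rewrite big_cons.
exact: riD.
Qed.

Lemma ri_sub (D' : set T) f : measurable D' -> D' `<=` D -> ri f ->
  m.-integrable D' (EFin \o f).
Proof. by move=> mD' sub; exact: integrableS. Qed.

Lemma Rint_le_ae f g : ri f -> ri g ->
  {ae m, forall x, D x -> f x <= g x} ->
  \int[m]_(x in D) f x <= \int[m]_(x in D) g x.
Proof.
move=> hf hg fg; rewrite -subr_ge0 -RintegralB//.
have mgf : measurable_fun D (fun x => (g x - f x)%:E).
  by apply/measurable_EFinP; exact: ri_measurable (riB hg hf).
(* The difference is nonnegative only almost everywhere; its positive part is nonnegative everywhere
   and has the same integral. *)
rewrite /Rintegral (@ae_eq_integral _ _ _ m D (fun x => (Num.max (g x - f x) 0)%:E))//.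
- apply: fine_ge0; apply: integral_ge0 => x Dx.
  by rewrite lee_fin le_max lexx orbT.
- apply/measurable_EFinP; apply: measurable_maxr => //.
  exact: ri_measurable (riB hg hf).
- apply: filterS fg => x fgx Dx; congr EFin.
  by rewrite max_l// subr_ge0 fgx.
Qed.

Lemma ri_ae f g : ri f -> measurable_fun D g ->
  {ae m, forall x, D x -> f x = g x} -> ri g.
Proof.
move=> hf mg fg; apply/integrableP; split; first exact/measurable_EFinP.
have [mf fi] := integrableP _ _ _ hf; rewrite (le_lt_trans _ fi)//.
apply: ae_ge0_le_integral => //; do ?exact: measurableT_comp.
- by apply: measurableT_comp => //; exact/measurable_EFinP.
- by apply: filterS fg => x fgx Dx /=; rewrite fgx.
Qed.

Lemma Rint_ae f g : measurable_fun D f -> measurable_fun D g ->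
  {ae m, forall x, D x -> f x = g x} ->
  \int[m]_(x in D) f x = \int[m]_(x in D) g x.
Proof.
move=> mf mg fg; congr fine; apply: ae_eq_integral => //.
- exact/measurable_EFinP.
- exact/measurable_EFinP.
- by apply: filterS fg => x fgx Dx /=; rewrite fgx.
Qed.

Lemma Rint_fin f : ri f -> (\int[m]_(x in D) (f x)%:E)%E = (\int[m]_(x in D) f x)%:E.
Proof. by move=> hf; rewrite /Rintegral fineK//; exact: integrable_fin_num. Qed.

Lemma Rint_sum (I : Type) (s : seq I) (F : I -> T -> R) :
  (forall i, ri (F i)) ->
  \int[m]_(x in D) (\sum_(i <- s) F i x) = \sum_(i <- s) \int[m]_(x in D) F i x.
Proof.
move=> h; elim: s => [|i s IH].
  under eq_Rintegral => x _ do rewrite big_nil.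
  by rewrite Rintegral_cst// mul0r big_nil.
under eq_Rintegral => x _ do rewrite big_cons.
by rewrite RintegralD// ?IH ?big_cons//; exact: ri_sum.
Qed.

Lemma Rint_abs_eq0 f : ri f -> \int[m]_(x in D) `|f x| = 0 ->
  {ae m, forall x, D x -> f x = 0}.
Proof.
move=> hf h0; have {}h0 := congr1 EFin h0; move: h0; rewrite -Rint_fin; last exact: ri_abs.
move=> h0; have := (@ae_eq_integral_abs _ _ _ m D mD (EFin \o f)).
move=> /(_ _)[|h _]; first exact: measurable_int hf.
by apply: filterS (h h0) => x /= hx Dx; have := hx Dx => -[].
Qed.

(** Measurability of [f] is a separate clause because it does not follow from that of its square. *)
Definition sqi f := measurable_fun D f /\ ri (fun x => f x ^+ 2).

Lemma sqiM f g : sqi f -> sqi g -> ri (fun x => f x * g x).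
Proof.
move=> [mf hf] [mg hg].
apply: (@ri_le _ (fun x => f x ^+ 2 + g x ^+ 2)); [exact: measurable_funM| |exact: riD].
move=> x _; rewrite ler_norml; apply/andP; split; nra.
Qed.

Lemma sqiZ a f : sqi f -> sqi (fun x => a * f x).
Proof.
move=> [mf hf]; split; first exact: measurable_funM.
by under [X in _ \o X]funext => x do rewrite exprMn; exact: riZ.
Qed.

Lemma sqiD f g : sqi f -> sqi g -> sqi (fun x => f x + g x).
Proof.
move=> [mf hf] [mg hg]; split; first exact: measurable_funD.
apply: (@ri_le _ (fun x => 2 * f x ^+ 2 + 2 * g x ^+ 2)).
- by apply: measurable_funX; exact: measurable_funD.
- by move=> x _; rewrite ger0_norm ?sqr_ge0//; have := sqr_ge0 (f x - g x); nra.
- by apply: riD; exact: riZ.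
Qed.

Lemma sqiN f : sqi f -> sqi (fun x => - f x).
Proof.
move=> /(sqiZ (-1)); rewrite /sqi => h.
by under [X in measurable_fun _ X]funext => x do rewrite -mulN1r;
  under [X in _ \o X]funext => x do rewrite -mulN1r.
Qed.

Lemma sqiB f g : sqi f -> sqi g -> sqi (fun x => f x - g x).
Proof. by move=> hf hg; exact: (sqiD hf (sqiN hg)). Qed.

Lemma sqi_abs f : sqi f -> sqi (fun x => `|f x|).
Proof.
move=> [mf hf]; split; first exact: measurableT_comp.
by under [X in _ \o X]funext => x do rewrite real_normK ?num_real//.
Qed.

Lemma sqi_ae f g : sqi f -> measurable_fun D g ->
  {ae m, forall x, D x -> f x = g x} -> sqi g.
Proof.
move=> [mf hf] mg fg; split=> //; apply: (ri_ae hf); first exact: measurable_funX.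
by apply: filterS fg => x h Dx; rewrite h.
Qed.

Lemma sqi_le f g : measurable_fun D f -> (forall x, D x -> `|f x| <= `|g x|) ->
  sqi g -> sqi f.
Proof.
move=> mf fg [mg hg]; split => //; apply: ri_le hg; first exact: measurable_funX.
move=> x Dx; rewrite ger0_norm ?sqr_ge0//.
by rewrite -[leLHS]real_normK ?num_real// -[leRHS]real_normK ?num_real// lerXn2r ?nnegrE ?fg.
Qed.

Lemma sqi_cst (a : R) : (m D < +oo)%E -> sqi (fun _ => a).
Proof.
move=> fD; split => //.
apply/integrableP; split; first exact: measurable_cst.
rewrite /= integral_cst// muleC lte_mul_pinfty//; first by rewrite ge0_fin_numE.
exact: ltry.
Qed.

Lemma sqi_ri f : (m D < +oo)%E -> sqi f -> ri f.
Proof.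
move=> fD hf; have := sqiM hf (sqi_cst 1 fD).
by under [X in _ \o X]funext => x do rewrite mulr1.
Qed.

Lemma sqi_sum (I : Type) (s : seq I) (F : I -> T -> R) :
  (forall i, sqi (F i)) -> sqi (fun x => \sum_(i <- s) F i x).
Proof.
move=> h; elim: s => [|i s IH].
  under [X in sqi X]funext => x do rewrite big_nil.
  split; first exact: measurable_cst.
  by under [X in _ \o X]funext => x do rewrite expr0n; exact: ri0.
under [X in sqi X]funext => x do rewrite big_cons.
exact: sqiD.
Qed.

Lemma sqi_sub (D' : set T) f : measurable D' -> D' `<=` D -> sqi f ->
  measurable_fun D' f /\ m.-integrable D' (EFin \o (fun x => f x ^+ 2)).
Proof.
move=> mD' sub [mf hf]; split; first exact: measurable_funS mf.
exact: ri_sub hf.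
Qed.

End RealIntegrable.

(** * Integrals of functions that need not be measurable *)

Section NonMeasurable.
Context d (T : measurableType d) (R : realType).
Variable m : {measure set T -> \bar R}.

(* The integral of a nonnegative function is defined as a supremum over the
   simple functions below it, hence is monotone without any measurability; the
   norms of vector-valued functions integrated in the theorem are not known to
   be measurable in time. *)
Lemma ge0_le_integral_any (D : set T) (f g : T -> \bar R) :
  (forall x, D x -> (0 <= f x)%E) -> (forall x, D x -> (f x <= g x)%E) ->
  (\int[m]_(x in D) f x <= \int[m]_(x in D) g x)%E.
Proof.
move=> f0 fg.
have g0 x : D x -> (0 <= g x)%E by move=> Dx; exact: le_trans (f0 x Dx) (fg x Dx).
rewrite !ge0_integralE//; apply: ereal_sup_le => _ [h /= hf <-].
exists h => //= x; apply: le_trans (hf x) _; rewrite /patch.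
by case: ifPn => [/set_mem xD|//]; exact: fg.
Qed.

(** Raising the majorant to [+oo] on the exceptional null set keeps its integral and makes the
    inequality hold everywhere; so measurability is asked of the majorant alone. *)
Lemma lower_integral_le_ae (D : set T) (f g : T -> \bar R) : measurable D ->
  (forall x, D x -> (0 <= f x)%E) -> (forall x, D x -> (0 <= g x)%E) ->
  measurable_fun D g -> {ae m, forall x, D x -> (f x <= g x)%E} ->
  (\int[m]_(x in D) f x <= \int[m]_(x in D) g x)%E.
Proof.
move=> mD f0 g0 mg [N [mN N0 sN]].
have -> : (\int[m]_(x in D) g x = \int[m]_(x in D) (g x + (\1_N x)%:E * +oo)%E)%E.
  apply: ae_eq_integral => //.
    apply: emeasurable_funD => //; apply: emeasurable_funM => //.
    by apply/measurable_EFinP; exact: measurable_indic.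
  exists N; split => // x /= /existsNP[_ /= xN]; apply: contrapT => nN.
  by apply: xN; rewrite indicE memNset// mul0e adde0.
apply: ge0_le_integral_any => // x Dx.
case: (pselect (N x)) => xN.
  rewrite indicE mem_set// mul1e addey ?leey//.
  by rewrite gt_eqF//; apply: lt_le_trans (g0 x Dx); rewrite ltNy0.
rewrite indicE memNset// mul0e adde0.
by apply: contrapT => h; apply: xN; apply: sN => /= /(_ Dx).
Qed.

(** The dual device: the minorant is the measurable side and is set to 0 on the exceptional null
    set. *)
Lemma integral_le_lower_ae (D : set T) (f g : T -> \bar R) : measurable D ->
  (forall x, D x -> (0 <= f x)%E) -> (forall x, D x -> (0 <= g x)%E) ->
  measurable_fun D f -> {ae m, forall x, D x -> (f x <= g x)%E} ->
  (\int[m]_(x in D) f x <= \int[m]_(x in D) g x)%E.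
Proof.
move=> mD f0 g0 mf [N [mN N0 sN]].
have -> : (\int[m]_(x in D) f x = \int[m]_(x in D) (f x * (\1_(~` N) x)%:E)%E)%E.
  apply: ae_eq_integral => //.
    apply: emeasurable_funM => //; apply/measurable_EFinP.
    by apply: measurable_indic; exact: measurableC.
  exists N; split => // x /= /existsNP[_ /= xN]; apply: contrapT => nN.
  by apply: xN; rewrite indicE mem_set// mule1.
apply: ge0_le_integral_any => x Dx.
  by rewrite mule_ge0 ?f0// lee_fin.
case: (pselect (N x)) => xN; rewrite indicE.
  by rewrite memNset/= ?mule0 ?g0//; exact.
rewrite mem_set//= mule1.
by apply: contrapT => h; apply: xN; apply: sN => /= /(_ Dx).
Qed.

End NonMeasurable.

Section SquareIntegral.
Context d (T : measurableType d) (R : realType).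
Variable m : {measure set T -> \bar R}.
Variable D : set T.
Implicit Types f g : T -> R.

Definition sqint f : \bar R := (\int[m]_(x in D) (f x ^+ 2)%:E)%E.

Lemma sqint_ge0 f : (0 <= sqint f)%E.
Proof. by apply: integral_ge0 => x _; rewrite lee_fin sqr_ge0. Qed.

Hypothesis mD : measurable D.

Lemma sqint_ae f g : {ae m, forall x, D x -> f x = g x} ->
  measurable_fun D f -> measurable_fun D g ->
  sqint f = sqint g.
Proof.
move=> fg mf mg; apply: ae_eq_integral => //.
- by apply/measurable_EFinP; exact: measurable_funX.
- by apply/measurable_EFinP; exact: measurable_funX.
- by apply: (ae_imp fg) => x h Dx /=; rewrite h.
Qed.

Lemma sqint_le f g : measurable_fun D f ->
  measurable_fun D g ->
  (sqint (fun x : T => (f x + g x)%R) <= 2%:E * sqint f + 2%:E * sqint g)%E.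
Proof.
move=> mf mg; rewrite /sqint -!ge0_integralZl//; try (by move=> x _; rewrite lee_fin sqr_ge0);
  try (by apply/measurable_EFinP; exact: measurable_funX).
rewrite -ge0_integralD//; try (by move=> x _; rewrite -EFinM lee_fin mulr_ge0 ?sqr_ge0);
  try (by apply/measurable_EFinP; apply: measurable_funM => //; exact: measurable_funX).
apply: ge0_le_integral => //.
- by move=> x _; rewrite lee_fin sqr_ge0.
- by apply/measurable_EFinP; apply: measurable_funX; exact: measurable_funD.
- by apply/measurable_EFinP; apply: measurable_funD; apply: measurable_funM => //; exact: measurable_funX.
- by move=> x _; rewrite -!EFinM -EFinD lee_fin; have := sqr_ge0 (f x - g x); nra.
Qed.

End SquareIntegral.

(** * The space L2(Omega) and its inner product *)

Section L2.
Context {R : realType} {n : nat}.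
Variable mu : {measure set (borelRn R n) -> \bar R}.
Variable Omega : set 'rV[R]_n.+1.
Local Notation E := 'rV[R]_n.+1.
Implicit Types f g : E -> R.
Local Notation sqint := (sqint mu (Omega : set (borelRn R n))).

Lemma L2_normE f : L2_norm Omega mu f = sqrte (sqint f).
Proof.
rewrite /L2_norm unlock /= poweR12_sqrt; last first.
  by apply: integral_ge0 => x _; rewrite lee_fin powR_ge0.
congr sqrte; rewrite /sqint [RHS]integral_mkcond; apply: eq_integral => x _ /=.
rewrite /patch; case: ifPn => _ /=.
  by rewrite (powR_mulrn 2)// real_normK// num_real.
by rewrite /point /= normr0 powR0.
Qed.

Lemma L2_norm_ge0 f : (0 <= L2_norm Omega mu f)%E.
Proof. by rewrite L2_normE sqrte_ge0. Qed.

Lemma L2_norm_sqr f : (L2_norm Omega mu f ^+ 2 = sqint f)%E.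
Proof. by rewrite L2_normE sqr_sqrte// sqint_ge0. Qed.

Hypothesis mO : (measurable (Omega : set (borelRn R n))).

Lemma L2P f : L2 Omega mu f <-> sqi mu Omega f.
Proof.
rewrite /L2 /= L2_normE /sqi; split => -[mf h]; split => //.
  apply/integrableP; split.
    by apply/measurable_EFinP; exact: measurable_funX.
  under eq_integral => x _ do rewrite /= ger0_norm ?sqr_ge0//.
  move: h; rewrite -/(sqint f); have := sqint_ge0 mu (Omega : set (borelRn R n)) f.
  by case: (sqint f) => // r _ _; exact: ltry.
move/integrableP : h => [_].
under eq_integral => x _ do rewrite /= ger0_norm ?sqr_ge0//.
rewrite -/(sqint f); have := sqint_ge0 mu (Omega : set (borelRn R n)) f.
by case: (sqint f) => // r _ _; exact: ltry.
Qed.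

Lemma sqint_fin f : L2 Omega mu f -> sqint f = (inner Omega mu f f)%:E.
Proof.
move=> /L2P [mf h]; rewrite /sqint /inner -Rint_fin//.
Qed.

Lemma L2_norm_fin f : L2 Omega mu f ->
  L2_norm Omega mu f = (Num.sqrt (inner Omega mu f f))%:E.
Proof. by move=> hf; rewrite L2_normE (sqint_fin hf). Qed.

Lemma inner_ge0 f : 0 <= inner Omega mu f f.
Proof. by apply: Rintegral_ge0 => x _; rewrite -expr2 sqr_ge0. Qed.

Lemma innerC f g : inner Omega mu f g = inner Omega mu g f.
Proof. by apply: eq_Rintegral => x _; rewrite mulrC. Qed.

Lemma inner_lin a b f g h : L2 Omega mu f -> L2 Omega mu g -> L2 Omega mu h ->
  inner Omega mu (fun x => a * f x + b * g x) h =
  a * inner Omega mu f h + b * inner Omega mu g h.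
Proof.
move=> /L2P hf /L2P hg /L2P hh; rewrite /inner.
have ifh := sqiM mO hf hh; have igh := sqiM mO hg hh.
rewrite -!RintegralZl// -RintegralD//; [|exact: (riZ mO)|exact: (riZ mO)].
by apply: eq_Rintegral => x _; rewrite mulrDl !mulrA.
Qed.

Lemma innerBl f g h : L2 Omega mu f -> L2 Omega mu g -> L2 Omega mu h ->
  inner Omega mu (fun x => f x - g x) h = inner Omega mu f h - inner Omega mu g h.
Proof.
move=> hf hg hh; have := inner_lin 1 (-1) hf hg hh; rewrite mul1r mulN1r => <-.
by apply: eq_Rintegral => x _; rewrite mul1r mulN1r.
Qed.

Lemma innerDl f g h : L2 Omega mu f -> L2 Omega mu g -> L2 Omega mu h ->
  inner Omega mu (fun x => f x + g x) h = inner Omega mu f h + inner Omega mu g h.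
Proof.
move=> hf hg hh; have := inner_lin 1 1 hf hg hh; rewrite !mul1r => <-.
by apply: eq_Rintegral => x _; rewrite !mul1r.
Qed.

Lemma innerZl a f h : L2 Omega mu f -> L2 Omega mu h ->
  inner Omega mu (fun x => a * f x) h = a * inner Omega mu f h.
Proof.
move=> hf hh; have := inner_lin a 0 hf hf hh; rewrite mul0r addr0 => <-.
by apply: eq_Rintegral => x _; rewrite mul0r addr0.
Qed.

Lemma L2_lin a b f g : L2 Omega mu f -> L2 Omega mu g ->
  L2 Omega mu (fun x => a * f x + b * g x).
Proof. by move=> /L2P hf /L2P hg; apply/L2P; apply: sqiD => //; exact: sqiZ. Qed.

Lemma L2B f g : L2 Omega mu f -> L2 Omega mu g -> L2 Omega mu (fun x => f x - g x).
Proof. by move=> /L2P hf /L2P hg; apply/L2P; exact: sqiB. Qed.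

Lemma L2D f g : L2 Omega mu f -> L2 Omega mu g -> L2 Omega mu (fun x => f x + g x).
Proof. by move=> /L2P hf /L2P hg; apply/L2P; exact: sqiD. Qed.

Lemma inner_ae f g h : measurable_fun (Omega : set (borelRn R n)) f ->
  measurable_fun (Omega : set (borelRn R n)) g ->
  measurable_fun (Omega : set (borelRn R n)) h ->
  {ae mu, forall x, Omega x -> f x = g x} -> inner Omega mu f h = inner Omega mu g h.
Proof.
move=> mf mg mh fg; apply: Rint_ae => //; do ?exact: measurable_funM.
by apply: (ae_imp fg) => x e Dx; rewrite e.
Qed.

Lemma inner_young a f g : 0 < a -> L2 Omega mu f -> L2 Omega mu g ->
  inner Omega mu f g <= a * inner Omega mu f f + (4 * a)^-1 * inner Omega mu g g.
Proof.
move=> a0 hf hg; have /L2P sf := hf; have /L2P sg := hg; rewrite /inner.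
have iff := sqiM mO sf sf; have igg := sqiM mO sg sg; have ifg := sqiM mO sf sg.
rewrite -!RintegralZl// -RintegralD//; [|exact: (riZ mO)|exact: (riZ mO)].
apply: le_Rintegral => //; first by apply: (riD mO); exact: (riZ mO).
move=> x _; rewrite -subr_ge0.
have -> : a * (f x * f x) + (4 * a)^-1 * (g x * g x) - f x * g x =
    (4 * a)^-1 * (2 * a * f x - g x) ^+ 2 by field; rewrite gt_eqF.
by rewrite mulr_ge0 ?sqr_ge0// invr_ge0 mulr_ge0// ltW.
Qed.

Lemma L2_norm_cvg0 (s : nat -> E -> R) :
  L2_norm Omega mu (s k) @[k --> \oo] --> 0%E -> sqint (s k) @[k --> \oo] --> 0%E.
Proof.
move=> h; have -> : (fun k => sqint (s k)) =
    (fun k => L2_norm Omega mu (s k) * L2_norm Omega mu (s k))%E.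
  by apply/funext => k; rewrite -L2_norm_sqr.
by have := cvgeM _ h h; rewrite mule0; apply.
Qed.

End L2.

(** * Fubini and Tonelli on the product of two measurable sets *)

Section Rect.
Context d1 d2 (T1 : measurableType d1) (T2 : measurableType d2) (R : realType).
Variables (m1 : {sigma_finite_measure set T1 -> \bar R})
          (m2 : {sigma_finite_measure set T2 -> \bar R}).
Variables (D1 : set T1) (D2 : set T2).
Hypotheses (mD1 : measurable D1) (mD2 : measurable D2).
Local Notation P := (m1 \x m2)%E.
Local Notation Q := (D1 `*` D2).
Implicit Types J : T1 * T2 -> R.

Lemma measurable_slice1 J x : measurable_fun setT J -> measurable_fun setT (fun y => J (x, y)).
Proof. by move=> mJ; apply: (measurableT_comp mJ); exact: pair1_measurable. Qed.

Lemma measurable_slice2 J y : measurable_fun setT J -> measurable_fun setT (fun x => J (x, y)).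
Proof. by move=> mJ; apply: (measurableT_comp mJ); exact: pair2_measurable. Qed.

Let mQ : measurable Q. Proof. exact: measurableX. Qed.

(** A slice of the extension by zero is the extension by zero of the slice, or vanishes. This
    transfers the theorems on the whole product to the rectangle. *)
Let patch1 (f : T1 * T2 -> \bar R) x :
  (fun y => (f \_ Q) (x, y)) = if x \in D1 then (fun y => f (x, y)) \_ D2 else cst 0%E.
Proof.
apply/funext => y; rewrite /patch; case: ifPn => /= [/set_mem [/= x1 y2]|].
  by rewrite (mem_set x1) (mem_set y2).
case: ifPn => //= x1; case: ifPn => //= y2 /negP; case.
by apply/mem_set; split; exact/set_mem.
Qed.

Let patch2 (f : T1 * T2 -> \bar R) y :
  (fun x => (f \_ Q) (x, y)) = if y \in D2 then (fun x => f (x, y)) \_ D1 else cst 0%E.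
Proof.
apply/funext => x; rewrite /patch; case: ifPn => /= [/set_mem [/= x1 y2]|].
  by rewrite (mem_set y2) (mem_set x1).
case: ifPn => //= y2; case: ifPn => //= x1 /negP; case.
by apply/mem_set; split; exact/set_mem.
Qed.

Let F1 (f : T1 * T2 -> \bar R) :
  fubini_F m2 (f \_ Q) = (fun x => \int[m2]_(y in D2) f (x, y))%E \_ D1.
Proof.
apply/funext => x; rewrite /fubini_F patch1 /patch; case: ifPn => x1.
  by rewrite -integral_mkcond.
by rewrite integral0.
Qed.

Let F2 (f : T1 * T2 -> \bar R) :
  fubini_G m1 (f \_ Q) = (fun y => \int[m1]_(x in D1) f (x, y))%E \_ D2.
Proof.
apply/funext => y; rewrite /fubini_G patch2 /patch; case: ifPn => x1.
  by rewrite -integral_mkcond.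
by rewrite integral0.
Qed.

Lemma rect_ae1 J : P.-integrable Q (EFin \o J) ->
  {ae m1, forall x, D1 x -> m2.-integrable D2 (EFin \o (fun y => J (x, y)))}.
Proof.
move=> /(integrable_mkcond _ mQ)/ae_integrable1 h; apply: (ae_imp h) => x {}h D1x.
by move: h; rewrite patch1 mem_set// => h; apply/integrable_mkcond.
Qed.

Lemma rect_ae2 J : P.-integrable Q (EFin \o J) ->
  {ae m2, forall y, D2 y -> m1.-integrable D1 (EFin \o (fun x => J (x, y)))}.
Proof.
move=> /(integrable_mkcond _ mQ)/ae_integrable2 h; apply: (ae_imp h) => y {}h D2y.
by move: h; rewrite patch2 mem_set// => h; apply/integrable_mkcond.
Qed.

(** The inner integral of a Fubini theorem is finite only almost everywhere; taking [fine] changes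
    it on a null set only. *)
Let finei d (T : measurableType d) (m : {measure set T -> \bar R}) (D : set T)
    (f : T -> \bar R) : measurable D -> m.-integrable D f ->
  m.-integrable D (EFin \o (fun x => fine (f x))) /\
  \int[m]_(x in D) fine (f x) = fine (\int[m]_(x in D) f x)%E.
Proof.
move=> mD hf; have mf := measurable_int m hf.
have mff : measurable_fun D (fun x => fine (f x)) by exact: measurableT_comp.
split.
  apply: le_integrable hf => //; first exact/measurable_EFinP.
  by move=> x Dx /=; case: (f x) => [r| |] /=; rewrite ?leey// normr0.
congr fine; apply: ae_eq_integral => //; first exact/measurable_EFinP.
have := integrable_ae mD hf; apply: filterS => x h Dx /=.
by rewrite fineK//; exact: h.
Qed.

Let integrableG (f : T1 * T2 -> \bar R) : P.-integrable setT f ->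
  m2.-integrable setT (fubini_G m1 f).
Proof.
move=> h; have mf := measurable_int P h; apply/integrableP; split.
  exact: measurable_fubini_G h.
have maf : measurable_fun setT (abse \o f) by exact: measurableT_comp.
apply: le_lt_trans ((integrable21ltyP m1 m2 mf).1 h); apply: ge0_le_integral => //.
- by apply: measurableT_comp => //; exact: measurable_fubini_G h.
- by have := @measurable_fun_fubini_tonelli_G _ _ _ _ _ m1 _ maf; apply => z; exact: abse_ge0.
- move=> y _; apply: le_abse_integral => //.
  by apply: (measurableT_comp mf); exact: pair2_measurable.
Qed.

Lemma rect_integrable1 J : P.-integrable Q (EFin \o J) ->
  m1.-integrable D1 (EFin \o (fun x => \int[m2]_(y in D2) J (x, y))).
Proof.
move=> /(integrable_mkcond _ mQ)/integrable_fubini_F; rewrite F1.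
by move=> /(integrable_mkcond _ mD1) /(finei mD1)[].
Qed.

Lemma rect_integrable2 J : P.-integrable Q (EFin \o J) ->
  m2.-integrable D2 (EFin \o (fun y => \int[m1]_(x in D1) J (x, y))).
Proof.
by move=> /(integrable_mkcond _ mQ)/integrableG; rewrite F2 =>
  /(integrable_mkcond _ mD2) /(finei mD2)[].
Qed.

Lemma rect_fubini1 J : P.-integrable Q (EFin \o J) ->
  \int[m1]_(x in D1) \int[m2]_(y in D2) J (x, y) = \int[P]_(z in Q) J z.
Proof.
move=> h; have := h => /(integrable_mkcond _ mQ) h'.
have := integral12_prod_meas1 h'; rewrite F1 -integral_mkcond -integral_mkcond => e.
transitivity (fine (\int[m1]_(x in D1) \int[m2]_(y in D2) (J (x, y))%:E)%E); last exact: congr1 e.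
rewrite -(finei mD1 _).2//.
by move: h' => /integrable_fubini_F; rewrite F1 => /(integrable_mkcond _ mD1).
Qed.

Lemma rect_fubini2 J : P.-integrable Q (EFin \o J) ->
  \int[m2]_(y in D2) \int[m1]_(x in D1) J (x, y) = \int[P]_(z in Q) J z.
Proof.
move=> h; have := h => /(integrable_mkcond _ mQ) h'.
have := integral21_prod_meas1 h'; rewrite F2 -integral_mkcond -integral_mkcond => e.
transitivity (fine (\int[m2]_(y in D2) \int[m1]_(x in D1) (J (x, y))%:E)%E); last exact: congr1 e.
rewrite -(finei mD2 _).2//.
by move: h' => /integrableG; rewrite F2 => /(integrable_mkcond _ mD2).
Qed.

Lemma rect_fubini J : P.-integrable Q (EFin \o J) ->
  \int[m1]_(x in D1) \int[m2]_(y in D2) J (x, y) =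
  \int[m2]_(y in D2) \int[m1]_(x in D1) J (x, y).
Proof. by move=> h; rewrite rect_fubini1// rect_fubini2. Qed.

Lemma rect_tonelli_measurable1 J : measurable_fun setT J -> (forall z, 0 <= J z) ->
  measurable_fun D1 (fun x => \int[m2]_(y in D2) (J (x, y))%:E)%E.
Proof.
move=> mJ J0; have mf : measurable_fun setT ((EFin \o J) \_ Q).
  by apply/(measurable_restrictT _ mQ); apply: measurable_funTS; exact/measurable_EFinP.
have := @measurable_fun_fubini_tonelli_F _ _ _ _ _ m2 _ mf; rewrite F1 => h.
apply/(measurable_restrictT _ mD1); apply: h => z; apply: erestrict_ge0 => z' _.
by rewrite lee_fin.
Qed.

Lemma rect_tonelli_measurable2 J : measurable_fun setT J -> (forall z, 0 <= J z) ->
  measurable_fun D2 (fun y => \int[m1]_(x in D1) (J (x, y))%:E)%E.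
Proof.
move=> mJ J0; have mf : measurable_fun setT ((EFin \o J) \_ Q).
  by apply/(measurable_restrictT _ mQ); apply: measurable_funTS; exact/measurable_EFinP.
have := @measurable_fun_fubini_tonelli_G _ _ _ _ _ m1 _ mf; rewrite F2 => h.
apply/(measurable_restrictT _ mD2); apply: h => z; apply: erestrict_ge0 => z' _.
by rewrite lee_fin.
Qed.

Lemma rect_tonelli J : measurable_fun setT J -> (forall z, 0 <= J z) ->
  (\int[m1]_(x in D1) \int[m2]_(y in D2) (J (x, y))%:E =
   \int[m2]_(y in D2) \int[m1]_(x in D1) (J (x, y))%:E)%E.
Proof.
move=> mJ J0; have mf : measurable_fun setT ((EFin \o J) \_ Q).
  by apply/(measurable_restrictT _ mQ); apply: measurable_funTS; exact/measurable_EFinP.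
have : (\int[m1]_x fubini_F m2 ((EFin \o J) \_ Q) x =
    \int[m2]_y fubini_G m1 ((EFin \o J) \_ Q) y)%E.
  by apply: fubini_tonelli => // z; apply: erestrict_ge0 => z' _; rewrite lee_fin.
by rewrite F1 F2 -!integral_mkcond.
Qed.

Lemma rect_integrableP J : measurable_fun setT J ->
  (\int[m1]_(x in D1) \int[m2]_(y in D2) `|J (x, y)|%:E < +oo)%E ->
  P.-integrable Q (EFin \o J).
Proof.
move=> mJ h; apply/integrable_mkcond => //; apply/integrable12ltyP.
  by apply/(measurable_restrictT _ mQ); apply: measurable_funTS; exact/measurable_EFinP.
apply: le_lt_trans h; rewrite [leRHS]integral_mkcond.
rewrite le_eqVlt; apply/orP; left; apply/eqP; apply: eq_integral => x _.
rewrite /patch; case: ifPn => x1.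
  rewrite [RHS]integral_mkcond; apply: eq_integral => y _; rewrite /patch.
  rewrite (_ : ((x, y) \in Q) = (y \in D2)); first by case: ifPn => //= _; exact: abse0.
  by apply/idP/idP => /set_mem h; apply/mem_set; [case: h|split => //; exact/set_mem].
rewrite integral0_eq// => y _; case: ifPn => [/set_mem[/= h _]|_]; last exact: abse0.
by move/negP: x1; case; exact/mem_set.
Qed.

Lemma rect_sqi J : measurable_fun setT J ->
  (\int[m1]_(x in D1) \int[m2]_(y in D2) ((J (x, y)) ^+ 2)%:E < +oo)%E ->
  sqi P Q J.
Proof.
move=> mJ h; split; first exact: measurable_funTS.
apply: rect_integrableP; first exact: measurable_funX.
by move: h; under eq_integral => x _ do
  under eq_integral => y _ do rewrite -[_ ^+ 2]ger0_norm ?sqr_ge0//.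
Qed.

Lemma rect_sqi_ae1 J : measurable_fun setT J -> sqi P Q J ->
  {ae m1, forall x, D1 x -> sqi m2 D2 (fun y => J (x, y))}.
Proof.
move=> mJ [_ /rect_ae1 h]; apply: (ae_imp h) => x hx Dx; split; last exact: hx.
by apply: measurable_funTS; exact: measurable_slice1.
Qed.

Lemma rect_sqi_ae2 J : measurable_fun setT J -> sqi P Q J ->
  {ae m2, forall y, D2 y -> sqi m1 D1 (fun x => J (x, y))}.
Proof.
move=> mJ [_ /rect_ae2 h]; apply: (ae_imp h) => x hx Dx; split; last exact: hx.
by apply: measurable_funTS; exact: measurable_slice2.
Qed.

End Rect.

Lemma nneseries_term_cvg0 (R : realType) (u : (\bar R)^nat) : (forall k, (0 <= u k)%E) ->
  (\sum_(0 <= k <oo) u k < +oo)%E -> u k @[k --> \oo] --> 0%E.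
Proof.
move=> u0 hs; have h := @nneseries_tail_cvg R u xpredT hs (fun k _ => u0 k).
apply: (@squeeze_cvge _ _ _ R (cst 0%E) _ _ _ 0%E) h => //; last exact: cvg_cst.
near=> k; rewrite u0/=.
have := @nneseries_lim_ge R u xpredT k k.+1 (fun i _ _ => u0 i).
by rewrite big_nat1.
Unshelve. all: by end_near. Qed.

Lemma ecvg0P (R : realType) (u : (\bar R)^nat) : (forall k, (0 <= u k)%E) ->
  u k @[k --> \oo] --> 0%E <->
  forall e : R, 0 < e -> exists K, forall k, (K <= k)%N -> (u k <= e%:E)%E.
Proof.
move=> u0; split => [/fine_cvgP[[K1 _ fu] /cvgr0Pnorm_le cu] e e0|h].
  have [K2 _ hK2] := cu _ e0; exists (maxn K1 K2) => k; rewrite geq_max => /andP[k1 k2].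
  rewrite -(fineK (fu k k1)) lee_fin (le_trans (ler_norm _))//; exact: (hK2 k k2).
have fu : \forall k \near \oo, u k \is a fin_num.
  have [K hK] := h 1 ltr01; exists K => // k /= /hK uk1.
  by rewrite ge0_fin_numE// (le_lt_trans uk1)// ltry.
apply/fine_cvgP; split => //; apply/cvgr0Pnorm_le => e e0.
have [K hK] := h e e0; near=> k => /=.
rewrite ger0_norm ?fine_ge0// -lee_fin fineK; last by near: k.
by apply: hK; near: k; exists K.
Unshelve. all: by end_near. Qed.

(** * Joint measurability of a limit of slices *)

Section JointLimit.
Context d1 d2 (T1 : measurableType d1) (T2 : measurableType d2) (R : realType).
Variables (m1 : {sigma_finite_measure set T1 -> \bar R})
          (m2 : {sigma_finite_measure set T2 -> \bar R}).
Variables (D1 : set T1) (D2 : set T2).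
Hypotheses (mD1 : measurable D1) (mD2 : measurable D2).
Hypotheses (fD1 : (m1 D1 < +oo)%E) (fD2 : (m2 D2 < +oo)%E).
Variables (S : nat -> T1 * T2 -> R) (v : T1 -> T2 -> R).
Hypothesis mS : forall k, measurable_fun setT (S k).
Hypothesis Sv : {ae m1, forall t, D1 t -> measurable_fun D2 (v t) /\
  sqint m2 D2 (fun x => S k (t, x) - v t x) @[k --> \oo] --> 0%E}.

Let N k l t := sqint m2 D2 (fun x => S k (t, x) - S l (t, x)).
Let a k t := esups (fun l => N k l t) k.
Let b k t := mine 1%E (a k t).
Let q k t := sqint m2 D2 (fun x => S k (t, x) - v t x).

Let mN k l : measurable_fun D1 (N k l).
Proof.
apply: (rect_tonelli_measurable1 m2 mD1 mD2 (J := fun z => (S k z - S l z) ^+ 2)).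
  by apply: measurable_funX; exact: measurable_funB.
by move=> z; exact: sqr_ge0.
Qed.

Let mb k : measurable_fun D1 (b k).
Proof. by apply: measurable_mine => //; apply: measurable_fun_esups => l; exact: mN. Qed.

Let N_ge0 k l t : (0 <= N k l t)%E. Proof. exact: sqint_ge0. Qed.

Let N_le_a k l t : (k <= l)%N -> (N k l t <= a k t)%E.
Proof. by move=> kl; apply: ereal_sup_ubound; exists l. Qed.

Let a_ge0 k t : (0 <= a k t)%E.
Proof. exact: le_trans (N_ge0 k k t) (N_le_a _ _). Qed.

Let b_ge0 k t : (0 <= b k t)%E.
Proof. by rewrite /b le_min a_ge0 andbT lee01. Qed.

Let b_le1 k t : (b k t <= 1)%E.
Proof. by rewrite /b ge_min lexx. Qed.

Let mSt k t : measurable_fun D2 (fun x => S k (t, x)).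
Proof. by apply: measurable_funTS; exact: measurable_slice1. Qed.

Let b_cvg0 : {ae m1, forall t, D1 t -> b k t @[k --> \oo] --> 0%E}.
Proof.
apply: (ae_imp Sv) => t h /h[mv {}h].
have Nq k l : (N k l t <= 2%:E * q k t + 2%:E * q l t)%E.
  have := @sqint_le _ _ _ m2 D2 mD2 (fun x => S k (t, x) - v t x)
     (fun x => v t x - S l (t, x)) (measurable_funB (mSt k t) mv) (measurable_funB mv (mSt l t)).
  congr (_ <= _ + _)%E.
    by congr (sqint _ _ _); apply/funext => x; ring.
  by congr (_ * _)%E; apply: eq_integral => x _; congr EFin; ring.
apply/ecvg0P => [k|e e0]; first exact: b_ge0.
have q0 k : (0 <= q k t)%E by exact: sqint_ge0.
have e4 : 0 < e / 4 by rewrite divr_gt0.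
have [K hK] := (ecvg0P q0).1 h _ e4.
exists K => k Kk; rewrite /b ge_min; apply/orP; right.
apply: ge_ereal_sup => _ [l /= kl <-]; apply: le_trans (Nq k l) _.
have := leeD (lee_wpmul2l (_ : (0 <= 2%:E)%E) (hK k Kk))
             (lee_wpmul2l (_ : (0 <= 2%:E)%E) (hK l (leq_trans Kk kl))).
move=> /(_ _ _)/le_trans; apply=> //; rewrite ?lee_fin//.
by lra.
Qed.

(** The truncation at 1 supplies the integrable bound for dominated convergence, [D1] having finite
    measure. *)
Let intb : (\int[m1]_(t in D1) b k t)%E @[k --> \oo] --> 0%E.
Proof.
have icst : m1.-integrable D1 (EFin \o (fun _ => 1 : R)).
  exact: sqi_ri (sqi_cst _ _ _).
have dom : {ae m1, forall t, forall k, D1 t -> (`|b k t| <= 1)%E}.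
  by apply: aeW => t k _; rewrite gee0_abs.
by have [] := @dominated_convergence _ _ _ m1 D1 mD1 b (cst 0%E) (EFin \o (fun=> 1)) mb
  (measurable_cst _) b_cvg0 icst dom; rewrite integral0.
Qed.

(* [b k t] bounds the Cauchy tail of the slices, truncated at 1; along a
   subsequence with summable integrals the slices converge almost everywhere to
   a function that is jointly measurable by construction. *)
Lemma joint_limit : exists V : T1 * T2 -> R, measurable_fun setT V /\
  {ae m1, forall t, D1 t -> {ae m2, forall x, D2 x -> V (t, x) = v t x}}.
Proof.
have ib0 k : (0 <= \int[m1]_(t in D1) b k t)%E by exact: integral_ge0.
have /choice[phi hphi] : forall j : nat, exists k,
    (\int[m1]_(t in D1) b k t <= (1 / (2 ^ j.+1)%:R)%:E)%E.
  move=> j; have [|K hK] := (ecvg0P ib0).1 intb (1 / (2 ^ j.+1)%:R).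
    by rewrite divr_gt0// ltr0n expn_gt0.
  by exists K; exact: hK.
have sumb : {ae m1, forall t, D1 t -> (\sum_(0 <= j <oo) b (phi j) t < +oo)%E}.
  have isum : m1.-integrable D1 (fun t => \sum_(0 <= j <oo) b (phi j) t)%E.
    apply/integrableP; split; first by apply: ge0_emeasurable_sum => // *; exact: b_ge0.
    under eq_integral => t _ do rewrite gee0_abs ?nneseries_ge0//.
    rewrite integral_nneseries//; apply: le_lt_trans (_ : (0 + 1%:E < +oo)%E); last by rewrite add0e ltry.
    apply: (@le_trans _ _ (\sum_(0 <= j <oo) (0 + (1 / (2 ^ j.+1)%:R)%:E))%E).
      apply: lee_nneseries.
        by move=> *; exact: ib0.
      by move=> j _; rewrite add0e; exact: hphi.
    have := @epsilon_trick R (fun=> 0%E) 1 xpredT (fun=> lexx _) ler01.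
    by rewrite [X in (_ <= X + _)%E -> _]eseries0.
  apply: (ae_imp (integrable_ae mD1 isum)) => t h /h.
  by rewrite ge0_fin_numE// nneseries_ge0.
pose V z := fine (limn_esup (fun j => (S (phi j) z)%:E)).
exists V; split.
  apply: measurableT_comp => //; apply: measurable_fun_limn_esup => j.
  exact/measurable_EFinP.
apply: (ae_imp2 Sv sumb) => t h1 h2 Dt; have [mv {}h1] := h1 Dt; have {}h2 := h2 Dt.
(* [C] covers two cases: if the tail [a] is at least 1, the truncated function [g] below has
   integral at most [m2 D2]; otherwise its integral is at most twice the tail. *)
pose C := (2%:E + m2 D2)%E.
have fC : (C < +oo)%E by rewrite lte_add_pinfty// ltry.
have C0 : (0 <= C)%E by rewrite adde_ge0// lee_fin.
pose g j x : R := Num.min 1 ((S (phi j) (t, x) - v t x) ^+ 2).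
have g0 j x : 0 <= g j x by rewrite le_min ler01 sqr_ge0.
have mg j : measurable_fun D2 (g j).
  apply: measurable_minr => //; apply: measurable_funX; exact: measurable_funB.
(* Passing through a far index [l], whose slice is already close to [v t], bounds the distance to
   [v t] by the Cauchy tail. *)
have q_le k : (q k t <= 2%:E * a k t)%E.
  have q0 l : (0 <= q l t)%E by exact: sqint_ge0.
  apply/lee_addgt0Pr => e e0.
  have e2 : 0 < e / 2 by rewrite divr_gt0.
  have [K hK] := (ecvg0P q0).1 h1 _ e2.
  pose l := maxn k K.
  have := @sqint_le _ _ _ m2 D2 mD2 (fun x => S k (t, x) - S l (t, x))
     (fun x => S l (t, x) - v t x) (measurable_funB (mSt k t) (mSt l t)) (measurable_funB (mSt l t) mv).
  rewrite (_ : (fun x => _) = (fun x => S k (t, x) - v t x)); last by apply/funext => x; ring.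
  move/le_trans; apply; apply: leeD.
    by apply: lee_wpmul2l; [rewrite lee_fin|apply: N_le_a; exact: leq_maxl].
  have := lee_wpmul2l (_ : (0 <= 2%:E)%E) (hK l (leq_maxr _ _)).
  rewrite lee_fin ler0n => /(_ isT)/le_trans; apply.
  by rewrite -EFinM lee_fin; lra.
have ig j : (\int[m2]_(x in D2) (g j x)%:E <= C * b (phi j) t)%E.
  rewrite /b; case: (leP 1%E (a (phi j) t)) => a1.
    rewrite mule1; apply: (@le_trans _ _ (m2 D2)); last by rewrite leeDr// lee_fin.
    rewrite -[leRHS]mul1e -integral_cst//; apply: ge0_le_integral => //.
    - by move=> x _; rewrite lee_fin.
    - exact/measurable_EFinP.
    - by move=> x _; rewrite lee_fin ge_min lexx.
  apply: (@le_trans _ _ (2%:E * a (phi j) t)%E); last first.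
    by apply: lee_wpmul2r => //; rewrite leeDl.
  apply: le_trans (q_le _); apply: ge0_le_integral => //.
  - by move=> x _; rewrite lee_fin.
  - exact/measurable_EFinP.
  - by apply/measurable_EFinP; apply: measurable_funX; exact: measurable_funB.
  - by move=> x _; rewrite lee_fin ge_min lexx orbT.
have gs0 x : (0 <= \sum_(0 <= j <oo) (g j x)%:E)%E.
  by apply: nneseries_ge0 => *; rewrite lee_fin.
have isum : m2.-integrable D2 (fun x => \sum_(0 <= j <oo) (g j x)%:E)%E.
  apply/integrableP; split.
    by apply: ge0_emeasurable_sum => *; rewrite ?lee_fin//; exact/measurable_EFinP.
  under eq_integral => x _ do rewrite gee0_abs ?gs0//.
  rewrite integral_nneseries//; first last.
  - by move=> *; rewrite lee_fin.
  - by move=> j; exact/measurable_EFinP.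
  apply: (@le_lt_trans _ _ (\sum_(0 <= j <oo) (C * b (phi j) t))%E).
    by apply: lee_nneseries => // *; apply: integral_ge0 => *; rewrite lee_fin.
  have -> : C = (fine C)%:E by rewrite fineK ?ge0_fin_numE.
  rewrite nneseriesZl; last by move=> *; exact: b_ge0.
  by apply: lte_mul_pinfty; rewrite // lee_fin fine_ge0.
apply: (ae_imp (integrable_ae mD2 isum)) => x h /h {}h.
have {}h : (\sum_(0 <= j <oo) (g j x)%:E < +oo)%E.
  by rewrite -ge0_fin_numE ?h// nneseries_ge0// => *; rewrite lee_fin.
have /ecvg0P gx : ((g j x)%:E @[j --> \oo] --> 0%E).
  by apply: nneseries_term_cvg0 => // j; rewrite lee_fin.
rewrite /V; suff Sx : S (phi j) (t, x) @[j --> \oo] --> v t x.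
  have /cvg_limn_einf_sup[_ ->] : ((S (phi j) (t, x))%:E @[j --> \oo] --> (v t x)%:E)%E.
    by apply/fine_cvgP; split; [exact: nearW|exact: Sx].
  by [].
apply/cvgrPdist_le => e e0.
(* A value of [g] below 1/2 shows that the truncation is inactive, so [g] is the squared difference
   itself. *)
have m0 : 0 < Num.min (2^-1) (e ^+ 2) by rewrite lt_min invr_gt0 ltr0n exprn_gt0.
have [j|K hK] := gx _ _ m0; first by rewrite lee_fin.
exists K => // j /= /hK; rewrite lee_fin le_min /g => /andP[g1 g2].
rewrite distrC -(@ler_pXn2r _ 2)// ?nnegrE ?(ltW e0)// real_normK ?num_real//.
by move: g1 g2; case: (leP 1 ((S (phi j) (t, x) - v t x) ^+ 2)) => // _ h1' _; exfalso; move: h1'; lra.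
Qed.

End JointLimit.

(** * Weak derivatives in one variable *)

Section Smooth.
Context {R : realType}.
Implicit Types f g : R -> R.

(** Differentiability [m + 1] times, by recursion on the derivative instead of through [derive1n],
    so that closure under sums, products and affine substitution is a plain induction. *)
Fixpoint Cder (m : nat) f : Prop :=
  (forall t, derivable f t 1) /\ if m is m'.+1 then Cder m' f^`()%classic else True.

Definition smooth f := forall m t, derivable (derive1n m f) t 1.

Lemma smoothP f : smooth f <-> forall m, Cder m f.
Proof.
split => [sf m|h m].
  elim: m f sf => [|m IH] f sf; first by split => // t; exact: (sf 0%N).
  split => [t|]; first exact: (sf 0%N).
  by apply: IH => k t; have := sf k.+1 t; rewrite derive1Sn.
elim: m f h => [|m IH] f h t; first by have [] := h 0%N.
by rewrite derive1Sn; apply: IH => k; have [] := h k.+1.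
Qed.

Lemma CderS m f : Cder m.+1 f -> Cder m f.
Proof. by elim: m f => [|m IH] f [df h]; split => //; exact: IH. Qed.

Lemma CderD m f g : Cder m f -> Cder m g -> Cder m (fun t => f t + g t).
Proof.
elim: m f g => [|m IH] f g [df hf] [dg hg]; (split; first by move=> t; exact: (@derivableD _ _ _ f g t 1 (df t) (dg t))); first by [].
rewrite (_ : (fun t => _)^`()%classic = fun t => f^`()%classic t + g^`()%classic t).
  exact: IH.
by apply/funext => t; rewrite !derive1E; exact: (@deriveD _ _ _ f g t 1).
Qed.

Lemma Cder_cst m (a : R) : Cder m (fun=> a).
Proof.
elim: m a => [|m IH] a; split => //.
rewrite (_ : (fun=> a)^`()%classic = fun=> 0); first exact: IH.
by apply/funext => t; rewrite derive1E derive_cst.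
Qed.

Lemma CderM m f g : Cder m f -> Cder m g -> Cder m (fun t => f t * g t).
Proof.
elim: m f g => [|m IH] f g [df hf] [dg hg]; (split; first by move=> t; exact: (@derivableM _ _ f g t 1 (df t) (dg t))); first by [].
rewrite (_ : (fun t => _)^`()%classic = fun t => f t * g^`()%classic t + g t * f^`()%classic t).
  by apply: CderD; apply: IH => //; exact: CderS.
by apply/funext => t; rewrite !derive1E; exact: (@deriveM _ _ f g t 1).
Qed.

Lemma CderZ m a f : Cder m f -> Cder m (fun t => a * f t).
Proof. by move=> hf; apply: CderM => //; exact: Cder_cst. Qed.

Lemma is_derive_affine (a b t : R) : is_derive t 1 (fun s => a * s + b) a.
Proof.
have -> : (fun s : R => a * s + b) = (a *: (@id R) + cst b)%R by apply/funext.
by apply: is_derive_eq; rewrite addr0 [LHS]mulr1.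
Qed.

Lemma is_derive_comp_affine (a b t d : R) f : is_derive (a * t + b) 1 f d ->
  is_derive t 1 (fun s => f (a * s + b)) (d * a).
Proof. by move=> h; exact: (@is_derive1_comp R f (fun s => a * s + b) t d a h (is_derive_affine a b t)). Qed.

Lemma Cder_affine m a b f : Cder m f -> Cder m (fun t => f (a * t + b)).
Proof.
elim: m f => [|m IH] f [df hf];
  (split; first by move=> t; have [] := is_derive_comp_affine (derivableP (df (a * t + b)))); first by [].
rewrite (_ : (fun t => _)^`()%classic = fun t => a * f^`()%classic (a * t + b)).
  by apply: CderZ; exact: IH.
apply/funext => t; have [_] := is_derive_comp_affine (derivableP (df (a * t + b))).
by rewrite !derive1E mulrC.
Qed.

(* The derivatives of exp(-1/x) stay in the linear span of this family. *)
Definition expinv (k : nat) (x : R) : R := if 0 < x then x ^- k * expR (- x^-1) else 0.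

(** From [exp y >= y^(k+2) / (k+2)!] at [y = 1/x]. Quadratic decay at 0 makes every member of the
    family differentiable there, with derivative 0. *)
Lemma expinv_le k x : `|expinv k x| <= (k.+2)`!%:R * x ^+ 2.
Proof.
rewrite /expinv; case: ifPn => [x0|_]; last by rewrite normr0 mulr_ge0// sqr_ge0.
rewrite ger0_norm ?mulr_ge0 ?expR_ge0// ?invr_ge0 ?exprn_ge0 ?(ltW x0)//.
have xV0 : 0 <= x^-1 by rewrite invr_ge0 ltW.
have := expR_ge1Dxn k.+1 xV0 => h.
have {}h : x^-1 ^+ k.+2 / (k.+2)`!%:R <= expR x^-1.
  by apply: le_trans h; rewrite lerDr.
rewrite expRN mulrC ler_pdivrMr ?exprn_gt0//.
rewrite -[leLHS]div1r ler_pdivrMr ?expR_gt0//.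
move: h; rewrite ler_pdivrMr ?ltr0n ?fact_gt0// mulrC => h.
have -> : (k.+2)`!%:R * x ^+ 2 * x ^+ k * expR x^-1 = (k.+2)`!%:R * expR x^-1 * x ^+ k.+2.
  by rewrite -(mulrA _ (x ^+ 2)) -exprD addSn add1n mulrAC.
apply: le_trans (ler_wpM2r _ h); last by rewrite exprn_ge0// ltW.
by rewrite -exprMn mulVf ?gt_eqF// expr1n.
Qed.

Lemma is_derive0_sqr_bound f C : (forall x, `|f x| <= C * x ^+ 2) -> is_derive (0 : R) (1 : R) f (0 : R).
Proof.
move=> hf; have f0 : f 0 = 0 by apply/normr0_eq0/eqP; rewrite eq_le normr_ge0 andbT (le_trans (hf 0))// expr0n mulr0.
have cv : h^-1 *: ((f \o shift 0) (h *: 1) - f 0) @[h --> 0^'] --> (0 : R).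
  apply/cvgr0Pnorm_le => e e0.
  have C0 : 0 <= C by have := hf 1; rewrite expr1n mulr1; apply: le_trans.
  have ed : 0 < e / (C + 1) by rewrite divr_gt0// ltr_wpDl.
  near=> h; have h0 : h != 0 by near: h; exact: nbhs_dnbhs_neq.
  rewrite f0 subr0 /= addr0 [h *: 1]mulr1 normrZ normfV.
  rewrite ler_pdivrMl ?normr_gt0// (le_trans (hf h))//.
  rewrite -[h ^+ 2]real_normK ?num_real// expr2 mulrA mulrC ler_wpM2l//.
  have h1 : `|h| <= e / (C + 1).
    by near: h; exact: dnbhs0_le.
  by apply: le_trans (ler_wpM2l C0 h1) _; rewrite mulrCA ger_pMr// ler_pdivrMr ?mul1r ?lerDl// ltr_wpDl.
by split; [apply/cvg_ex; exists 0|exact: cvg_lim].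
Unshelve. all: by end_near. Qed.

Lemma is_derive_expinv k (x : R) : is_derive x 1 (expinv k) (expinv k.+2 x - k%:R * expinv k.+1 x).
Proof.
have [x0|x0|->] := ltgtP x 0.
- have -> : expinv k.+2 x - k%:R * expinv k.+1 x = 0.
    by rewrite /expinv (lt_gtF x0) mulr0 subr0.
  have h : \forall y \near x, cst (0 : R) y = expinv k y.
    near=> y; have y0 : y < 0 by near: y; exact: lt_nbhsl.
    by rewrite /expinv /= (lt_gtF y0).
  exact: (near_eq_is_derive h (is_derive_cst _ _ _)).
- have h : \forall y \near x, (y ^+ k)^-1 * expR (- y^-1) = expinv k y.
    near=> y; have y0 : 0 < y by near: y; exact: lt_nbhsr.
    by rewrite /expinv /= y0.
  apply: (near_eq_is_derive h); rewrite /expinv x0.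
  have xn0 : x != 0 by rewrite gt_eqF.
  have d1 : is_derive x 1 (fun y : R => y^-1) (- x ^- 2).
    have := @is_deriveV R id x 1 1 xn0 (is_derive_id x 1).
    by rewrite /GRing.scale /= mulr1.
  have d2 : is_derive x 1 (fun y : R => expR (- y^-1)) (expR (- x^-1) * (- - x ^- 2)).
    exact: (@is_derive1_comp R expR (fun y : R => - y^-1) x _ _ (is_derive_expR _) (is_deriveN d1)).
  have dX : is_derive x 1 (fun y : R => y ^+ k) (k%:R * x ^+ k.-1).
    have := is_deriveX k (is_derive_id x 1).
    by rewrite /GRing.scale /= mulr1; congr (is_derive _ _ _ _); exact: exprfctE.
  have d3 := @is_deriveV R (fun y => y ^+ k) x _ 1 (expf_neq0 k xn0) dX.
  have d4 : is_derive x 1 (fun y : R => y ^- k * expR (- y^-1)) _ := is_deriveM d3 d2.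
  apply: (is_derive_eq d4).
  rewrite opprK /GRing.scale /=; set E := expR _.
  case: (k) => [|k']; first by rewrite !expr0 invr1; field.
  by rewrite /= !exprS; field; rewrite xn0 expf_neq0.
- rewrite /expinv ltxx mulr0 subr0; exact: is_derive0_sqr_bound (expinv_le k).
Unshelve. all: by end_near. Qed.

Lemma Cder_expinv m k : Cder m (expinv k).
Proof.
elim: m k => [|m IH] k; (split; first by move=> t; have [] := is_derive_expinv k t); first by [].
rewrite (_ : (expinv k)^`()%classic = fun t => expinv k.+2 t + (- k%:R) * expinv k.+1 t).
  by apply: CderD => //; exact: CderZ.
by apply/funext => t; rewrite derive1E; have [_ ->] := is_derive_expinv k t; rewrite mulNr.
Qed.

Lemma expinv0_ge0 x : 0 <= expinv 0 x.
Proof. by rewrite /expinv; case: ifPn => // _; rewrite expr0 invr1 mul1r expR_ge0. Qed.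

Lemma expinv0_le1 x : expinv 0 x <= 1.
Proof.
rewrite /expinv; case: ifPn => // x0; rewrite expr0 invr1 mul1r -expR0 ler_expR.
by rewrite oppr_le0 invr_ge0 ltW.
Qed.

Lemma expinv0_gt0 x : (0 < expinv 0 x) = (0 < x).
Proof. by rewrite /expinv; case: ifPn => [_|]; rewrite ?ltxx// expr0 invr1 mul1r expR_gt0. Qed.

Lemma expinv0_eq0 x : x <= 0 -> expinv 0 x = 0.
Proof. by rewrite /expinv leNgt => /negbTE ->. Qed.

Lemma expinv0_cvg x : 0 < x -> expinv 0 (n.+1%:R * x) @[n --> \oo] --> (1 : R).
Proof.
move=> x0; have -> : (fun n : nat => expinv 0 (n.+1%:R * x)) = (fun n => expR (- (n.+1%:R^-1 * x^-1))).
  by apply/funext => n; rewrite /expinv mulr_gt0// expr0 invr1 mul1r invfM.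
rewrite -[X in _ --> X]expR0; apply: continuous_cvg; first exact: continuous_expR.
rewrite -[X in _ --> X]oppr0; apply: cvgN; rewrite -[X in _ --> X](mul0r x^-1).
by apply: cvgM; [exact: cvg_harmonic|exact: cvg_cst].
Qed.

Lemma smooth_continuous f : smooth f -> continuous f.
Proof.
by move=> sf t; apply: differentiable_continuous; apply/derivable1_diffP; exact: (sf 0%N).
Qed.

Lemma smooth_derive f : smooth f -> smooth f^`()%classic.
Proof. by move=> sf m t; have := sf m.+1 t; rewrite derive1Sn. Qed.

End Smooth.

(** * Primitives of integrable functions and integration by parts *)

Section Primitive.
Context {R : realType}.
Local Notation leb := (@lebesgue_measure R).
Implicit Types f g : R -> R.

Definition prim f (t : R) : R := \int[leb]_(s in `]0, t[) f s.

Lemma leb_oo_fin (a b : R) : (leb `]a, b[ < +oo)%E.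
Proof. by rewrite lebesgue_measure_itv /=; case: ifP => _; rewrite ?ltry// -EFinB ltry. Qed.

Lemma prim_le0 f t : t <= 0 -> prim f t = 0.
Proof. by move=> t0; rewrite /prim set_itv_ge ?Rintegral_set0// bnd_simp -leNgt. Qed.

(** Gives the primitive a domain of integration independent of [t], so that products with it become
    double integrals over a square. *)
Let below f T t : t <= T ->
  \int[leb]_(s in `]0, T[) (if s < t then f s else 0) = prim f t.
Proof.
move=> tT; rewrite Rintegral_mkcond /prim [RHS]Rintegral_mkcond.
apply: eq_Rintegral => s _; rewrite /patch !mem_setE !in_itv /=.
case: (ltP s t) => st; last by rewrite andbF; case: ifP.
by rewrite (lt_le_trans st tT) !andbT.
Qed.

Section IntegrationByParts.
Variable T : R.
Local Notation D := (`]0%R, T[%classic : set (measurableTypeR R)).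
Local Notation ri f := (leb.-integrable D (EFin \o f)).
Let mD : measurable D. Proof. exact: measurable_itv. Qed.

Let Jint f g : ri f -> ri g ->
  (leb \x leb)%E.-integrable (D `*` D) (EFin \o (fun z => (f \_ D) z.2 * (g \_ D) z.1)).
Proof.
move=> hf hg.
have mf : measurable_fun setT (f \_ D) by apply/(measurable_restrictT _ mD); exact: ri_measurable hf.
have mg : measurable_fun setT (g \_ D) by apply/(measurable_restrictT _ mD); exact: ri_measurable hg.
apply: rect_integrableP => //.
  apply: measurable_funM; first exact: (measurableT_comp mf measurable_snd).
  exact: (measurableT_comp mg measurable_fst).
have hf' : ri (f \_ D) by apply: (ri_ae mD hf); [exact: measurable_funTS|apply: aeW => x Dx; rewrite patchE mem_set].
have hg' : ri (g \_ D) by apply: (ri_ae mD hg); [exact: measurable_funTS|apply: aeW => x Dx; rewrite patchE mem_set].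
have af := ri_abs hf'; have ag := ri_abs hg'.
have e x : (\int[leb]_(y in D) `|(f \_ D) y * (g \_ D) x|%:E)%E =
    (\int[leb]_(y in D) `|(f \_ D) y| * `|(g \_ D) x|)%:E.
  under eq_integral => y _ do rewrite normrM mulrC.
  rewrite -RintegralZr//.
  rewrite -Rint_fin//; last by under [X in _ \o X]funext => y do rewrite mulrC; exact: riZ.
  by apply: eq_integral => y _; rewrite mulrC.
under eq_integral => x _ do rewrite e.
rewrite Rint_fin ?ltry//; exact: riZ.
Qed.

Let Jint1 f g : ri f -> ri g ->
  (leb \x leb)%E.-integrable (D `*` D)
    (EFin \o (fun z => if z.2 < z.1 then (f \_ D) z.2 * (g \_ D) z.1 else 0)).
Proof.
move=> hf hg; have h := Jint hf hg.
have mQ : measurable (D `*` D) by exact: measurableX.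
apply: (ri_le mQ _ _ (ri_abs h)).
  apply: measurable_fun_if => //.
  - apply: measurable_fun_ltr; apply: measurable_funTS; [exact: measurable_snd|exact: measurable_fst].
  - by apply: measurable_funS (ri_measurable h) => // z [].
by move=> z _; case: ifP => //; rewrite normr0.
Qed.

Lemma prim_mul_integrable f g : ri f -> ri g -> ri (fun t => prim f t * g t).
Proof.
move=> hf hg; have := rect_integrable1 mD mD (Jint1 hf hg).
apply: eq_integrable => // t /set_mem Dt /=; congr EFin.
move: (Dt); rewrite /= in_itv /= => /andP[t0 tT].
rewrite -(below f (ltW tT)) -RintegralZr//; last first.
  apply: (ri_le mD _ _ (ri_abs hf)).
    apply: measurable_fun_if => //; first exact: measurable_fun_ltr.
    by apply: measurable_funS (ri_measurable hf) => // z [].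
  by move=> z _; case: ifP => //; rewrite normr0.
apply: eq_Rintegral => s sD; rewrite /patch sD (mem_set Dt).
by case: ifP => //; rewrite mul0r.
Qed.

(** The two terms are the integrals of [f s * g t] over the triangles on either side of the
    diagonal; Fubini joins them into the whole square. *)
Lemma prim_ibp f g : ri f -> ri g ->
  \int[leb]_(t in D) (prim f t * g t) + \int[leb]_(t in D) (f t * prim g t) =
  prim f T * prim g T.
Proof.
move=> hf hg.
have ltf (h : R -> R) t : ri h -> ri (fun s => if s < t then h s else 0).
  move=> hh; apply: (ri_le mD _ _ (ri_abs hh)).
    apply: measurable_fun_if => //; first exact: measurable_fun_ltr.
    by apply: measurable_funS (ri_measurable hh) => // z [].
  by move=> z _; case: ifP => //; rewrite normr0.
have lef (h : R -> R) t : ri h -> ri (fun s => if s < t then 0 else h s).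
  move=> hh; have := riB mD hh (ltf h t hh); apply: eq_integrable => // s _ /=.
  by congr EFin; case: ifP; rewrite ?subrr ?subr0.
have e1 : \int[leb]_(t in D) (prim f t * g t) = \int[leb]_(t in D) \int[leb]_(s in D)
    (if s < t then (f \_ D) s * (g \_ D) t else 0).
  apply: eq_Rintegral => t Dt; move: (Dt); rewrite mem_setE in_itv /= => /andP[t0 tT].
  rewrite -(below f (ltW tT)) -RintegralZr//; last exact: ltf.
  by apply: eq_Rintegral => s sD; rewrite /patch sD Dt; case: ifP => //; rewrite mul0r.
have e2 : \int[leb]_(t in D) (f t * prim g t) = \int[leb]_(t in D) \int[leb]_(s in D)
    (if s < t then (g \_ D) s * (f \_ D) t else 0).
  apply: eq_Rintegral => t Dt; move: (Dt); rewrite mem_setE in_itv /= => /andP[t0 tT].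
  rewrite -(below g (ltW tT)) mulrC -RintegralZr//; last exact: ltf.
  by apply: eq_Rintegral => s sD; rewrite /patch sD Dt; case: ifP => //; rewrite mul0r.
have e3 := rect_fubini mD mD (Jint1 hg hf).
rewrite e1 e2 e3 {e1 e2 e3} -RintegralD; first last.
- exact: rect_integrable2 (Jint1 hg hf).
- exact: rect_integrable1 (Jint1 hf hg).
- exact: mD.
(* Exchanging the variables turned the second triangle into [t < s], which differs from the
   complement of [s < t] only at [s = t]. *)
have n1 t : \int[leb]_(s in D) (if t < s then (g \_ D) t * (f \_ D) s else 0) =
    \int[leb]_(s in D) (if s < t then 0 else (f \_ D) s * (g \_ D) t).
  apply: Rint_ae => //.
  - apply: measurable_fun_if => //; first exact: measurable_fun_ltr.
    apply: measurable_funM => //; apply: measurable_funTS.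
    by apply/(measurable_restrictT _ mD); exact: ri_measurable hf.
  - apply: measurable_fun_if => //; first exact: measurable_fun_ltr.
    apply: measurable_funM => //; apply: measurable_funTS.
    by apply/(measurable_restrictT _ mD); exact: ri_measurable hf.
  - exists [set t]; split => //; first exact: lebesgue_measure_set1.
    move=> s /= /existsNP[Ds]; apply: contra_notP => st.
    by case: (ltgtP t s) => [ts|ts|ts]; [rewrite mulrC| |move: st; rewrite ts].
under eq_Rintegral => t _ do rewrite n1.
rewrite {n1} mulrC -RintegralZr//; apply: eq_Rintegral => t Dt.
rewrite -RintegralD//.
- rewrite [RHS]mulrC /prim -RintegralZr//; apply: eq_Rintegral => s Ds; rewrite /patch Ds Dt.
  by case: ifP; rewrite ?addr0 ?add0r.
- have := riZ mD ((g \_ D) t) (ltf _ t hf); apply: eq_integrable => // s Ds /=; congr EFin.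
  by rewrite /patch Ds Dt; case: ifP; rewrite ?mulr0// mulrC.
- have := riZ mD ((g \_ D) t) (lef _ t hf); apply: eq_integrable => // s Ds /=; congr EFin.
  by rewrite /patch Ds Dt; case: ifP; rewrite ?mulr0// mulrC.
Qed.

End IntegrationByParts.
End Primitive.

(** * Weak derivatives of primitives *)

Section WeakDerivative.
Context {R : realType}.
Local Notation leb := (@lebesgue_measure R).
Implicit Types f g : R -> R.

Lemma ri_closed (a b : R) f :
  leb.-integrable (`]a, b[%classic : set (measurableTypeR R)) (EFin \o f) ->
  leb.-integrable (`[a, b]%classic : set (measurableTypeR R)) (EFin \o f).
Proof.
move=> h; have mf : measurable_fun (`[a, b]%classic : set (measurableTypeR R)) f.
  apply/measurable_fun_itv_bndo_bndcP/measurable_fun_itv_obnd_cbndP.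
  by apply/measurable_EFinP; exact: measurable_int h.
apply/integrableP; split; first exact/measurable_EFinP.
have [_] := integrableP _ _ _ h; rewrite -(integral_itv_bndo_bndc (f := fun x => `|(EFin \o f) x|%E)).
  rewrite -(integral_itv_obnd_cbnd (f := fun x => `|(EFin \o f) x|%E))//.
  by apply: measurableT_comp => //; exact: measurable_int h.
apply: measurableT_comp => //; apply/measurable_EFinP; apply: measurable_funS mf => //.
by apply: subset_itvl; rewrite bnd_simp.
Qed.

Lemma Rint_closed (a b : R) f :
  leb.-integrable (`]a, b[%classic : set (measurableTypeR R)) (EFin \o f) ->
  \int[leb]_(x in `]a, b[) f x = \int[leb]_(x in `[a, b]) f x.
Proof.
move=> h; rewrite Rintegral_itv_obnd_cbnd// Rintegral_itv_bndo_bndc//.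
apply: integrableS (ri_closed h); [exact: measurable_itv|exact: measurable_itv|].
by apply: subset_itvl; rewrite bnd_simp.
Qed.

Lemma ri_continuous (a b : R) f : {within `[a, b], continuous f} ->
  leb.-integrable (`]a, b[%classic : set (measurableTypeR R)) (EFin \o f).
Proof.
move=> cf; apply: (@integrableS _ _ _ _ (`[a, b]%classic : set (measurableTypeR R))) => //.
- exact: subset_itv_oo_cc.
- by apply: continuous_compact_integrable => //; exact: segment_compact.
Qed.

Lemma Rint_derive (a b : R) f : a <= b -> (forall t, derivable f t 1) ->
  continuous f^`()%classic ->
  \int[leb]_(x in `]a, b[) f^`()%classic x = f b - f a.
Proof.
rewrite le_eqVlt => /predU1P[->|ab] df cf.
  by rewrite set_itv_ge ?bnd_simp ?ltxx// Rintegral_set0 subrr.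
have cw (h : R -> R) : continuous h -> {within `[a, b], continuous h}.
  by move=> ch; exact: continuous_subspaceT.
rewrite Rint_closed; last exact/ri_continuous/cw.
have cF : continuous f.
  by move=> t; apply: differentiable_continuous; exact/derivable1_diffP.
have Fc : derivable_oo_LRcontinuous f a b.
  split; first by move=> t _; exact: df.
    by apply: cvg_at_right_filter; exact: cF.
  by apply: cvg_at_left_filter; exact: cF.
have ef : {in `]a, b[, f^`()%classic =1 f^`()%classic} by move=> t _.
by rewrite /Rintegral (continuous_FTC2 ab (cw _ cf) Fc ef).
Qed.

Lemma derive1n_smooth (T : R) phi : test_fun_time T phi -> smooth phi.
Proof. by case. Qed.

Lemma test_fun_time_0 (T : R) phi : test_fun_time T phi -> phi 0 = 0 /\ phi T = 0.
Proof.
move=> [_ [a [b [a0 bT h]]]]; split; apply: h => /andP[h1 h2]; first by move: a0; rewrite ltNge h1.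
by move: bT; rewrite ltNge h2.
Qed.

Lemma test_fun_time_prim (T : R) phi t : 0 <= t -> test_fun_time T phi ->
  prim phi^`()%classic t = phi t.
Proof.
move=> t0 tp; rewrite /prim Rint_derive//.
- by rewrite (test_fun_time_0 tp).1 subr0.
- by have := derive1n_smooth tp => h s; exact: (h 0%N).
- exact: (smooth_continuous (smooth_derive (derive1n_smooth tp))).
Qed.

Lemma ri_smooth (a b : R) phi : smooth phi ->
  leb.-integrable (`]a, b[%classic : set (measurableTypeR R)) (EFin \o phi).
Proof.
by move=> sp; apply: ri_continuous; apply: continuous_subspaceT; exact: smooth_continuous.
Qed.

Lemma test_fun_ibp (T : R) phi g : 0 <= T -> test_fun_time T phi ->
  leb.-integrable (`]0%R, T[%classic : set (measurableTypeR R)) (EFin \o g) ->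
  \int[leb]_(t in `]0, T[) (prim g t * phi^`()%classic t) =
  - \int[leb]_(t in `]0, T[) (g t * phi t).
Proof.
move=> T0 tp ig; have sp := derive1n_smooth tp.
have := prim_ibp ig (ri_smooth _ _ (smooth_derive sp)).
rewrite (test_fun_time_prim T0 tp) (test_fun_time_0 tp).2 mulr0 => /eqP.
rewrite addr_eq0 => /eqP ->; congr (- _); apply: eq_Rintegral => t.
by rewrite mem_setE in_itv /= => /andP[t0 _]; rewrite (test_fun_time_prim (ltW t0) tp).
Qed.

Lemma weak_deriv_prim (T : R) (y g : R -> R) : 0 <= T ->
  leb.-integrable (`]0%R, T[%classic : set (measurableTypeR R)) (EFin \o g) ->
  (forall t, 0 <= t <= T -> y t = y 0 + prim g t) -> weak_deriv T y g.
Proof.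
move=> T0 ig yg; split => // phi tp; have sp := derive1n_smooth tp.
have ip := ri_smooth 0 T (smooth_derive sp).
have mD : measurable (`]0%R, T[%classic : set (measurableTypeR R)) by exact: measurable_itv.
rewrite -test_fun_ibp//.
have -> : \int[leb]_(t in `]0, T[) (y t * phi^`()%classic t) =
    \int[leb]_(t in `]0, T[) (y 0 * phi^`()%classic t + prim g t * phi^`()%classic t).
  apply: eq_Rintegral => t; rewrite mem_setE in_itv /= => /andP[t0 tT].
  by rewrite yg ?(ltW t0) ?(ltW tT)// mulrDl.
rewrite RintegralD//; [|exact: riZ|exact: prim_mul_integrable].
rewrite RintegralZl// -/(prim _ T) (test_fun_time_prim T0 tp).
by rewrite (test_fun_time_0 tp).2 mulr0 add0r.
Qed.

Lemma prim_energy (T : R) g : leb.-integrable (`]0%R, T[%classic : set (measurableTypeR R)) (EFin \o g) ->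
  2 * \int[leb]_(t in `]0, T[) (g t * prim g t) = prim g T ^+ 2.
Proof.
move=> ig; rewrite expr2 -prim_ibp// mulr_natl mulr2n; congr (_ + _).
by apply: eq_Rintegral => t _; rewrite mulrC.
Qed.

(** Integration by parts of [g] against its own primitive takes the place of the chain rule for the
    square of an absolutely continuous function. *)
Lemma AC_energy (T : R) (y g : R -> R) : 0 <= T ->
  leb.-integrable (`]0%R, T[%classic : set (measurableTypeR R)) (EFin \o g) ->
  (forall t, 0 <= t <= T -> y t = y 0 + prim g t) ->
  2 * \int[leb]_(t in `]0, T[) (g t * y t) = y T ^+ 2 - y 0 ^+ 2.
Proof.
move=> T0 ig yg.
have mD : measurable (`]0%R, T[%classic : set (measurableTypeR R)) by exact: measurable_itv.
have -> : \int[leb]_(t in `]0, T[) (g t * y t) =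
    \int[leb]_(t in `]0, T[) (y 0 * g t + prim g t * g t).
  apply: eq_Rintegral => t; rewrite mem_setE in_itv /= => /andP[t0 tT].
  by rewrite yg ?(ltW t0) ?(ltW tT)// mulrDr mulrC [g t * _]mulrC.
rewrite RintegralD//; [|exact: riZ|exact: prim_mul_integrable].
rewrite RintegralZl// -/(prim g T).
have -> : \int[leb]_(t in `]0, T[) (prim g t * g t) = \int[leb]_(t in `]0, T[) (g t * prim g t).
  by apply: eq_Rintegral => t _; rewrite mulrC.
by rewrite mulrDr prim_energy// (yg T) ?T0 ?lexx//; ring.
Qed.

Lemma prim_diff (T : R) g a b : 0 <= a -> a <= b -> b <= T ->
  leb.-integrable (`]0%R, T[%classic : set (measurableTypeR R)) (EFin \o g) ->
  prim g b - prim g a = \int[leb]_(t in `]a, b[) g t.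
Proof.
move=> a0 ab bT ig.
have igs (c d : R) : 0 <= c -> d <= T ->
    leb.-integrable (`]c, d[%classic : set (measurableTypeR R)) (EFin \o g).
  move=> c0 dT; apply: integrableS ig; [exact: measurable_itv|exact: measurable_itv|].
  by apply: subset_itv; rewrite bnd_simp.
move: a0; rewrite le_eqVlt => /predU1P[<-|a0]; first by rewrite (prim_le0 g (lexx 0)) subr0.
move: ab; rewrite le_eqVlt => /predU1P[->|ab].
  by rewrite subrr set_itv_ge ?bnd_simp ?ltxx// Rintegral_set0.
rewrite /prim (Rintegral_itv_bndo_bndc (igs 0 a (lexx _) (le_trans (ltW ab) bT))).
by rewrite Rintegral_itvB; [|exact: igs|rewrite bnd_simp ltW|rewrite bnd_simp].
Qed.

Lemma prim_continuous (T : R) g : 0 <= T ->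
  leb.-integrable (`]0%R, T[%classic : set (measurableTypeR R)) (EFin \o g) ->
  contT T (prim g).
Proof.
move=> T0 ig; have := parameterized_integral_continuous T0 (ri_closed ig).
move=> h; apply: subspace_eq_continuous h => t.
rewrite mem_setE in_itv /= => /andP[t0 tT].
rewrite /from_subspace /parameterized_integral /prim Rint_closed//.
apply: integrableS ig; [exact: measurable_itv|exact: measurable_itv|].
by apply: subset_itvl; rewrite bnd_simp.
Qed.

End WeakDerivative.

(** * The lemma of Du Bois-Reymond *)

Section DuBoisReymond.
Context {R : realType}.
Local Notation leb := (@lebesgue_measure R).
Local Notation oo a b := (`]a, b[%classic : set (measurableTypeR R)).
Implicit Types f g y z : R -> R.

Lemma contTP (T : R) y : contT T y <->
  forall t : R, 0 <= t <= T -> forall e : R, 0 < e -> exists d : R, 0 < d /\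
    forall s : R, 0 <= s <= T -> `|t - s| < d -> `|y t - y s| < e.
Proof.
have A t : 0 <= t <= T <-> (`[0, T]%classic : set R) t by rewrite /= in_itv.
split => [cy t /A At e e0|h t].
  have h : y @ nbhs_subspace (t : subspace `[0, T]%classic) --> y t := cy t.
  rewrite -nbhs_subspace_in// in h.
  have [d /= d0 hd] := (cvgrPdist_lt _ _).1 h e e0.
  by exists d; split=> // s /A As ts; exact: hd.
suff hh : y @ nbhs_subspace (t : subspace `[0, T]%classic) --> y t by exact: hh.
have [At|nAt] := pselect ((`[0, T]%classic : set R) t); last first.
  by rewrite -nbhs_subspace_out// => P /nbhs_singleton Pt s /= ->.
rewrite -nbhs_subspace_in//; apply/cvgrPdist_lt => e e0.
have [d [d0 hd]] := h t (proj2 (A t) At) e e0.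
by exists d => // s /= ts /A As; exact: hd.
Qed.

Definition bumpf (a e t : R) : R := expinv 0 (t - a) * expinv 0 (a + e - t).

Lemma Cder_bumpf m a e : Cder m (bumpf a e).
Proof.
apply: CderM.
  have := @Cder_affine R m 1 (- a) _ (Cder_expinv m 0).
  by congr Cder; apply/funext => t; rewrite mul1r.
have := @Cder_affine R m (-1) (a + e) _ (Cder_expinv m 0).
by congr Cder; apply/funext => t; rewrite mulN1r addrC.
Qed.

Lemma bumpf_ge0 a e t : 0 <= bumpf a e t.
Proof. by rewrite mulr_ge0 ?expinv0_ge0. Qed.

Lemma bumpf_gt0 a e t : a < t < a + e -> 0 < bumpf a e t.
Proof. by case/andP=> h1 h2; rewrite mulr_gt0// expinv0_gt0 subr_gt0. Qed.

Lemma bumpf_eq0 a e t : (t <= a) || (a + e <= t) -> bumpf a e t = 0.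
Proof.
rewrite /bumpf; case/orP => h.
  by rewrite [expinv 0 (t - a)]expinv0_eq0 ?mul0r// subr_le0.
by rewrite [expinv 0 (a + e - t)]expinv0_eq0 ?mulr0// subr_le0.
Qed.

Lemma smooth_bumpf a e : smooth (bumpf a e).
Proof. by apply/smoothP => m; exact: Cder_bumpf. Qed.

Variable T : R.
Local Notation D := (oo 0%R T).
Let mD : measurable D. Proof. exact: measurable_itv. Qed.

Definition mass a e := \int[leb]_(t in D) bumpf a e t.

Lemma mass_gt0 a e : 0 <= a -> 0 < e -> a + e <= T -> 0 < mass a e.
Proof.
move=> a0 e0 aeT; rewrite lt_neqAle Rintegral_ge0 ?andbT; last by move=> *; exact: bumpf_ge0.
apply/eqP => m0; have ib : leb.-integrable D (EFin \o bumpf a e) by exact/ri_smooth/smooth_bumpf.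
have : {ae leb, forall t, D t -> bumpf a e t = 0}.
  apply: Rint_abs_eq0 => //; rewrite [RHS]m0; apply: eq_Rintegral => t _.
  by rewrite ger0_norm// bumpf_ge0.
move=> [N [mN N0 sN]]; have : (leb `]a, (a + e)%R[ <= leb N)%E.
  apply: le_measure; [by rewrite inE; exact: measurable_itv|by rewrite inE|].
  move=> t /=; rewrite in_itv /= => tae; apply: sN => /= h.
  have := bumpf_gt0 tae; rewrite h ?ltxx// in_itv /=.
  by case/andP: tae => h1 h2; rewrite (le_lt_trans a0 h1) (lt_le_trans h2 aeT).
rewrite N0 lebesgue_measure_itv /= lte_fin ltrDl e0 -EFinB lee_fin.
by rewrite addrAC subrr add0r leNgt e0.
Qed.

(* Both bumps are normalized, so the primitive of [kern] is a test function;
   testing with it compares the averages of a function near [a] and near [b]. *)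
Definition kern a b e t := bumpf a e t / mass a e - bumpf b e t / mass b e.

(** The lower limit -1 lies strictly to the left of the support, so that the fundamental theorem of
    calculus applies at [t = 0] as well. *)
Definition kern_prim a b e t := \int[leb]_(s in `[-1, t]) kern a b e s.

Section Kern.
Variables a b e : R.
Hypotheses (a0 : 0 < a) (b0 : 0 < b) (e0 : 0 < e) (aT : a + e < T) (bT : b + e < T).

Lemma Cder_kern m : Cder m (kern a b e).
Proof.
rewrite (_ : kern a b e = fun t => (mass a e)^-1 * bumpf a e t + (- (mass b e)^-1) * bumpf b e t).
  by apply: CderD; apply: CderZ; exact: Cder_bumpf.
by apply/funext => t; rewrite mulNr /kern ![_ / _]mulrC.
Qed.

Lemma smooth_kern : smooth (kern a b e).
Proof. by apply/smoothP => m; exact: Cder_kern. Qed.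

Let kern_out t : ~ (Num.min a b <= t <= Num.max a b + e) -> kern a b e t = 0.
Proof.
move=> h; rewrite /kern !bumpf_eq0 ?mul0r ?subr0//; apply: contra_notT h.
  rewrite negb_or -!ltNge => /andP[h1 h2]; rewrite ge_min (ltW h1) orbT /=.
  by rewrite (le_trans (ltW h2))// lerD2r le_max lexx orbT.
rewrite negb_or -!ltNge => /andP[h1 h2]; rewrite ge_min (ltW h1) /=.
by rewrite (le_trans (ltW h2))// lerD2r le_max lexx.
Qed.

Let min0 : 0 < Num.min a b. Proof. by rewrite lt_min a0 b0. Qed.
Let maxT : Num.max a b + e < T. Proof. by rewrite -ltrBrDr gt_max !ltrBrDr aT bT. Qed.

Lemma Rint_kern0 : \int[leb]_(t in D) kern a b e t = 0.
Proof.
rewrite /kern RintegralB//; last 2 first.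
- by under [X in _ \o X]funext => t do rewrite mulrC; apply: riZ => //; exact/ri_smooth/smooth_bumpf.
- by under [X in _ \o X]funext => t do rewrite mulrC; apply: riZ => //; exact/ri_smooth/smooth_bumpf.
rewrite !RintegralZr//; try exact/ri_smooth/smooth_bumpf.
by rewrite -/(mass a e) -/(mass b e) !divff ?subrr// gt_eqF// mass_gt0// ltW.
Qed.

Let kern_prim0 t : t <= Num.min a b -> kern_prim a b e t = 0.
Proof.
move=> tm; rewrite /kern_prim.
have h s : s \in (`[-1, t]%classic : set R) -> kern a b e s = 0.
  rewrite mem_setE in_itv /= => /andP[_ st]; rewrite /kern !bumpf_eq0 ?mul0r ?subr0//.
    by rewrite (le_trans st) ?(le_trans tm)// ge_min lexx orbT.
  by rewrite (le_trans st) ?(le_trans tm)// ge_min lexx.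
by rewrite (@eq_Rintegral _ _ _ leb _ (fun=> 0))// Rintegral_cst ?mul0r//; exact: measurable_itv.
Qed.

Lemma is_derive_kern_prim (t : R) : is_derive t 1 (kern_prim a b e) (kern a b e t).
Proof.
have [t0|t0] := ltP t 0.
  have -> : kern a b e t = 0.
    by apply: kern_out => /andP[h _]; move: (lt_trans (le_lt_trans h t0) min0); rewrite ltxx.
  have h : \forall s \near t, cst (0 : R) s = kern_prim a b e s.
    near=> s; have s0 : s < 0 by near: s; exact: lt_nbhsl.
    by rewrite kern_prim0// (le_trans (ltW s0))// ltW.
  exact: (near_eq_is_derive h (is_derive_cst _ _ _)).
have cK := smooth_continuous smooth_kern.
have [||||dF eF] := @continuous_FTC1_closed R (kern a b e) (-1) t (t + 1).
- by rewrite ltrDl.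
- by apply: ri_closed; exact: ri_smooth smooth_kern.
- by rewrite (lt_le_trans _ t0)// oppr_lt0.
- exact: cK.
- by split; [exact: dF|rewrite -derive1E; exact: eF].
Unshelve. all: by end_near. Qed.

Lemma kern_prim_derive : (kern_prim a b e)^`()%classic = kern a b e.
Proof. by apply/funext => t; rewrite derive1E; have [_ ->] := is_derive_kern_prim t. Qed.

Lemma kern_prim_test : test_fun_time T (kern_prim a b e).
Proof.
split.
  apply/smoothP => m; case: m => [|m]; (split; first by move=> t; have [] := is_derive_kern_prim t) => //.
  by rewrite kern_prim_derive; exact: Cder_kern.
exists (Num.min a b), (Num.max a b + e); split=> // t tn.
have [tm|tm] := leP t (Num.min a b); first exact: kern_prim0.
have tM : Num.max a b + e < t by rewrite ltNge; apply/negP => h; apply: tn; rewrite (ltW tm).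
(* To the right of the support the integral already runs over all of [kern], whose total mass is
   zero; hence the compact support. *)
rewrite -Rint_kern0 /kern_prim Rintegral_mkcond [RHS]Rintegral_mkcond; apply: eq_Rintegral => s _.
rewrite /patch !mem_setE !in_itv /=.
case: (pselect (Num.min a b <= s <= Num.max a b + e)) => [/andP[h1 h2]|/kern_out ->]; last by do 2 case: ifP.
rewrite (le_trans h2 (ltW tM)) (le_lt_trans h2 maxT) (lt_le_trans min0 h1) andbT.
by rewrite (le_trans _ (ltW (lt_le_trans min0 h1)))// oppr_le0.
Qed.

End Kern.

Lemma bumpf_average y a e d : 0 < a -> 0 < e -> a + e < T -> contT T y ->
  (forall t, a <= t <= a + e -> `|y t - y a| <= d) ->
  `|\int[leb]_(t in D) (y t * (bumpf a e t / mass a e)) - y a| <= d.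
Proof.
move=> a0 e0 aT cy h; have m0 : 0 < mass a e by rewrite mass_gt0// ltW.
have ib : leb.-integrable D (EFin \o (fun t => bumpf a e t / mass a e)).
  by under [X in _ \o X]funext => t do rewrite mulrC; apply: riZ => //; exact/ri_smooth/smooth_bumpf.
have iyb : leb.-integrable D (EFin \o (fun t => y t * (bumpf a e t / mass a e))).
    apply: ri_continuous => t; apply: cvgM; first exact: cy.
  have cb : {within `[0, T], continuous (fun t => bumpf a e t / mass a e)}.
    apply: continuous_subspaceT => s; apply: cvgM; last exact: cvg_cst.
    exact: (smooth_continuous (smooth_bumpf (a := a) (e := e))).
  exact: cb.
have e1 : \int[leb]_(t in D) (bumpf a e t / mass a e) = 1.
  rewrite RintegralZr//; last exact/ri_smooth/smooth_bumpf.
  by rewrite -/(mass a e) divff// gt_eqF.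
have -> : y a = \int[leb]_(t in D) (y a * (bumpf a e t / mass a e)).
  by rewrite RintegralZl// e1 mulr1.
rewrite -RintegralB//; last exact: riZ.
have iyy : leb.-integrable D (EFin \o (fun t => y t * (bumpf a e t / mass a e) - y a * (bumpf a e t / mass a e))).
  by apply: riB => //; exact: riZ.
apply: le_trans (le_normr_Rintegral mD iyy) _.
rewrite -[leRHS]mulr1 -e1 -RintegralZl//; apply: le_Rintegral => //.
- exact: ri_abs.
- exact: riZ.
move=> t Dt; rewrite -mulrBl normrM [X in _ * X]ger0_norm ?divr_ge0 ?bumpf_ge0 ?(ltW m0)//.
have [tae|tae] := pselect (a <= t <= a + e).
  by rewrite ler_wpM2r ?divr_ge0 ?bumpf_ge0 ?(ltW m0)// h.
rewrite bumpf_eq0 ?mul0r ?mulr0//; apply: contra_notT tae.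
by rewrite negb_or -!ltNge => /andP[h1 h2]; rewrite !ltW.
Qed.

Lemma rat_dense_oo (t d : R) : 0 < T -> 0 <= t <= T -> 0 < d ->
  exists q : rat, 0 < (ratr q : R) < T /\ `|t - ratr q| < d.
Proof.
move=> T0 /andP[t0 tT] d0.
have [q] : exists q : rat, (ratr q : R) \in `]Num.max 0 (t - d), (Num.min T (t + d))[.
  by apply: rat_in_itvoo; rewrite gt_max !lt_min T0/=; apply/and3P; split; lra.
rewrite in_itv /= gt_max lt_min => /andP[/andP[q0 qt] /andP[qT qd]].
exists q; rewrite q0 qT; split => //; rewrite ltr_norml; lra.
Qed.

Lemma rat_const_const z : 0 < T -> contT T z ->
  (forall a b : rat, 0 < (ratr a : R) < T -> 0 < (ratr b : R) < T -> z (ratr a) = z (ratr b)) ->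
  forall t, 0 <= t <= T -> z t = z 0.
Proof.
move=> T0 /contTP cz h t tT; apply/eqP; rewrite -subr_eq0 -normr_le0; apply/ler_addgt0Pr => e e0.
have e2 : 0 < e / 2 by rewrite divr_gt0.
have T00 : (0 : R) <= 0 <= T by rewrite lexx ltW.
have [d [d0 hd]] := cz t tT _ e2; have [d' [d'0 hd']] := cz 0 T00 _ e2.
have [q [qT tq]] := rat_dense_oo T0 tT d0; have [q' [q'T tq']] := rat_dense_oo T0 T00 d'0.
have w x : 0 < x < T -> 0 <= x <= T by case/andP => *; rewrite !ltW.
have h1 := hd _ (w _ qT) tq; have h2 := hd' _ (w _ q'T) tq'.
rewrite add0r (_ : z t - z 0 = (z t - z (ratr q)) - (z 0 - z (ratr q'))); last first.
  by rewrite (h q q')//; ring.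
by apply: le_trans (ler_normB _ _) _; lra.
Qed.

(* Only countably many test functions are needed, which is what allows the
   exceptional null sets of a space-dependent family to be united. *)
Lemma weak_prim y g : 0 < T -> contT T y -> leb.-integrable D (EFin \o g) ->
  (forall (a b : rat) (m : nat), 0 < ratr a :> R -> 0 < ratr b :> R ->
     ratr a + m.+1%:R^-1 < T -> ratr b + m.+1%:R^-1 < T ->
     let phi := kern_prim (ratr a) (ratr b) m.+1%:R^-1 in
     \int[leb]_(t in D) (y t * phi^`()%classic t) = - \int[leb]_(t in D) (g t * phi t)) ->
  forall t, 0 <= t <= T -> y t = y 0 + prim g t.
Proof.
move=> T0 cy ig h.
have cp := prim_continuous (ltW T0) ig.
(* [z] has weak derivative zero. Tested with [kern_prim], this says that its averages near two
   rational points agree; shrinking the bumps makes the values agree, and continuity makes [z]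
   constant. *)
pose z t := y t - prim g t.
have cz : contT T z by move=> t; apply: cvgB; [exact: cy|exact: cp].
suff zc : forall t : R, 0 <= t <= T -> z t = z 0.
  move=> t tT; have := zc t tT; rewrite /z (prim_le0 g (lexx 0)) subr0 => <-.
  by rewrite subrK.
apply: rat_const_const => // a b aT bT.
apply/eqP; rewrite -subr_eq0 -normr_le0; apply/ler_addgt0Pr => e e0; rewrite add0r.
have e2 : 0 < e / 2 by rewrite divr_gt0.
have w x : 0 < x < T -> 0 <= x <= T by case/andP => *; rewrite !ltW.
have [d [d0 hd]] := (contTP _ _).1 cz _ (w _ aT) _ e2.
have [d' [d'0 hd']] := (contTP _ _).1 cz _ (w _ bT) _ e2.
case/andP: aT => a0 aT; case/andP: bT => b0 bT.
(* Bumps narrower than [r] stay inside the interval and inside the neighbourhoods where [z] is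
   within [e / 2] of its values at the two points. *)
pose r := Num.min (Num.min d d') (Num.min (T - ratr a) (T - ratr b)).
have r0 : 0 < r by rewrite !lt_min d0 d'0 !subr_gt0 aT bT.
have [m hm] : exists m, m.+1%:R^-1 < r.
  exists (Num.truncn r^-1); rewrite -[ltRHS]invrK ltf_pV2 ?posrE ?invr_gt0 ?ltr0n//.
  by apply: truncnS_gt.
move: hm; rewrite !lt_min => /andP[/andP[md md'] /andP[ma mb]].
set k := m.+1%:R^-1 in md md' ma mb; have k0 : 0 < k by rewrite invr_gt0 ltr0n.
have aT' : ratr a + k < T by lra.
have bT' : ratr b + k < T by lra.
have tk := kern_prim_test a0 b0 k0 aT' bT'.
have ib c : leb.-integrable D (EFin \o (fun t => z t * (bumpf (ratr c) k t / mass (ratr c) k))).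
  apply: ri_continuous => t; apply: cvgM; first exact: cz.
  have cb : {within `[0, T], continuous (fun t => bumpf (ratr c) k t / mass (ratr c) k)}.
    apply: continuous_subspaceT => s; apply: cvgM; last exact: cvg_cst.
    exact: (smooth_continuous (smooth_bumpf (a := ratr c) (e := k))).
  exact: cb.
have isk := smooth_kern (a := ratr a) (b := ratr b) (e := k).
have cphi : {within `[0, T], continuous (kern (ratr a) (ratr b) k)}.
  by apply: continuous_subspaceT; exact: smooth_continuous.
have z0 : \int[leb]_(t in D) (z t * kern (ratr a) (ratr b) k t) = 0.
  have := h a b m a0 b0 aT' bT'; rewrite /= -(test_fun_ibp (ltW T0) tk ig).
  rewrite kern_prim_derive// => hh.
  rewrite (_ : (fun t => z t * _) = fun t => y t * kern (ratr a) (ratr b) k t - prim g t * kern (ratr a) (ratr b) k t);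
    last by apply/funext => t; rewrite /z mulrBl.
  rewrite RintegralB//; first by apply/eqP; rewrite subr_eq0; apply/eqP.
    by apply: ri_continuous => t; apply: cvgM; [exact: cy|exact: cphi].
  by apply: ri_continuous => t; apply: cvgM; [exact: cp|exact: cphi].
have av c dd : 0 < (ratr c : R) -> ratr c + k < T -> k < dd ->
    (forall s, 0 <= s <= T -> `|ratr c - s| < dd -> `|z (ratr c) - z s| < e / 2) ->
    `|\int[leb]_(t in D) (z t * (bumpf (ratr c) k t / mass (ratr c) k)) - z (ratr c)| <= e / 2.
  move=> c0 cT kd hc; apply: bumpf_average => // t /andP[t1 t2].
  rewrite distrC ltW// hc//; first by apply/andP; split; lra.
  by rewrite ltr_norml; apply/andP; split; lra.
have := av a d a0 aT' md hd; have := av b d' b0 bT' md' hd'.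
have : \int[leb]_(t in D) (z t * (bumpf (ratr a) k t / mass (ratr a) k)) =
   \int[leb]_(t in D) (z t * (bumpf (ratr b) k t / mass (ratr b) k)).
  apply/eqP; rewrite -subr_eq0 -RintegralB// -[X in _ == X]z0; apply/eqP.
  by apply: eq_Rintegral => t _; rewrite /kern mulrBr.
move=> ->; set I := \int[leb]_(t in D) _ => h1 h2.
rewrite (_ : z (ratr a) - z (ratr b) = (I - z (ratr b)) - (I - z (ratr a))); last by ring.
by apply: le_trans (ler_normB _ _) _; lra.
Qed.

End DuBoisReymond.

(** * Densities of monotone Lipschitz functions *)

Section LipschitzPrimitive.
Context {R : realType}.
Local Notation leb := (@lebesgue_measure R).
Local Notation oo a b := (`]a, b[%classic : set (measurableTypeR R)).
Local Notation oc a b := (`]a, b]%classic : set (measurableTypeR R)).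
Implicit Types f g y z : R -> R.

Lemma stieltjes_oc (f : cumulative R R) (a b : R) : a <= b ->
  lebesgue_stieltjes_measure f `]a, b] = (f b - f a)%:E.
Proof.
move=> ab; rewrite /lebesgue_stieltjes_measure /measure_extension measurable_mu_extE /=.
  by rewrite wlength_itv_bnd.
by exists (a, b).
Qed.

Lemma lipschitz_continuous (f : R -> R) (M : R) : 0 <= M ->
  (forall a b : R, a <= b -> `|f b - f a| <= M * (b - a)) -> continuous f.
Proof.
move=> M0 h t; apply/cvgrPdist_le => e e0.
have ed : 0 < e / (M + 1) by rewrite divr_gt0// ltr_wpDl.
near=> s; have ts : `|t - s| <= e / (M + 1).
  by near: s; apply: cvgr_dist_le => //; exact: cvg_id.
have h' : `|f t - f s| <= M * `|t - s|.
  have [st|st] := leP s t; first by rewrite (ger0_norm (_ : 0 <= t - s)) ?subr_ge0// h.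
  by rewrite distrC (ltr0_norm (_ : t - s < 0)) ?subr_lt0// opprB h// ltW.
apply: le_trans h' _; apply: le_trans (ler_wpM2l M0 ts) _.
by rewrite mulrCA ger_pMr// ler_pdivrMr ?mul1r ?lerDl// ltr_wpDl.
Unshelve. all: by end_near. Qed.

(* Both [z] and [M t - z] are nondecreasing, so the Stieltjes measure of [z] is
   dominated by M times Lebesgue measure, and Radon-Nikodym gives the density. *)
Lemma lipschitz_density (T : R) z (M : R) : 0 <= T -> 0 <= M ->
  (forall a b : R, 0 <= a -> a <= b -> b <= T -> 0 <= z b - z a <= M * (b - a)) ->
  exists G : R -> R, [/\ forall t, 0 <= G t, leb.-integrable (oo 0 T) (EFin \o G) &
    forall a b : R, 0 <= a -> a <= b -> b <= T -> \int[leb]_(t in `]a, b[) G t = z b - z a].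
Proof.
(* Clamping to [0,T] extends [z] to a nondecreasing Lipschitz function on the whole line, as a
   Stieltjes measure requires. *)
move=> T0 M0 hz; pose cl (t : R) := Num.max 0 (Num.min t T).
have cl0 t : 0 <= cl t by rewrite le_max lexx.
have clT t : cl t <= T by rewrite ge_max T0 ge_min lexx orbT.
have clid t : 0 <= t <= T -> cl t = t.
  by case/andP=> t0 tT; rewrite /cl (min_idPl tT) (max_idPr t0).
have clm (a b : R) : a <= b -> 0 <= cl b - cl a <= b - a.
  move=> ab; rewrite /cl /Order.max /Order.min.
  by case: (ltP a T) => ?; case: (ltP b T) => ?; case: (ltP 0 a) => ?;
    case: (ltP 0 b) => ?; case: (ltP 0 T) => ?; apply/andP; split; lra.
pose f1 t := z (cl t); pose f2 t := M * t - f1 t.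
have f1m (a b : R) : a <= b -> 0 <= f1 b - f1 a <= M * (b - a).
  move=> ab; have /andP[c1 c2] := clm _ _ ab.
  have cab : cl a <= cl b by rewrite -subr_ge0.
  have /andP[h1 h2] := hz _ _ (cl0 a) cab (clT b).
  by rewrite h1 (le_trans h2)// ler_wpM2l.
have f2m (a b : R) : a <= b -> 0 <= f2 b - f2 a <= M * (b - a).
  by move=> /f1m /andP[h1 h2]; rewrite /f2; apply/andP; split; lra.
have nd f : (forall a b : R, a <= b -> 0 <= f b - f a <= M * (b - a)) -> nondecreasing f.
  by move=> h a b /h /andP[h1 _]; rewrite -subr_ge0.
have rc f : (forall a b : R, a <= b -> 0 <= f b - f a <= M * (b - a)) -> right_continuous f.
  move=> h t; apply: cvg_at_right_filter; apply: (lipschitz_continuous M0) => a b /h /andP[h1 h2].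
  by rewrite ger0_norm.
pose F1 : cumulative R R := HB.pack f1 (isCumulative.Build R _ R f1 (nd _ f1m) (rc _ f1m)).
pose F2 : cumulative R R := HB.pack f2 (isCumulative.Build R _ R f2 (nd _ f2m) (rc _ f2m)).
have f3m (a b : R) : a <= b -> 0 <= M * b - M * a <= M * (b - a).
  by move=> ab; rewrite -mulrBr mulr_ge0 ?subr_ge0// lexx.
pose F3 : cumulative R R := HB.pack (fun t : R => M * t) (isCumulative.Build R _ R _ (nd _ f3m) (rc _ f3m)).
pose nu1 := lebesgue_stieltjes_measure F1; pose nu2 := lebesgue_stieltjes_measure F2.
(* As [f1 + f2] is [M * t], the measures agree on half-open intervals and hence on Borel sets. Since
   [nu2] is nonnegative, Lebesgue null sets are null for [nu1]. *)
have sum_nu A : measurable A -> (lebesgue_stieltjes_measure F3 A = nu1 A + nu2 A)%E.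
  move=> mA; rewrite -measure_addE; apply: lebesgue_stieltjes_measure_unique => // X [[a b] _ <-] /=.
  transitivity (nu1 (oc a b) + nu2 (oc a b))%E; last exact/esym/measure_addE.
  have [ab|ab] := leP a b; last first.
    by rewrite set_itv_ge ?bnd_simp -?leNgt ?(ltW ab)// /nu1 /nu2 !measure0 adde0.
  rewrite /nu1 /nu2 !stieltjes_oc// -EFinD; congr EFin; rewrite /= /f2; ring.
have scale A : measurable A -> (lebesgue_stieltjes_measure F3 A = M%:E * leb A)%E.
  move=> mA; rewrite -[RHS]/(mscale (NngNum M0) leb A).
  apply: lebesgue_stieltjes_measure_unique => // X [[a b] _ <-] /=.
  rewrite /mscale; have [ab|ab] := leP a b; last first.
    by rewrite set_itv_ge ?bnd_simp -?leNgt ?(ltW ab)// !measure0 mule0.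
  rewrite !stieltjes_oc//= lebesgue_measure_itv /= lte_fin.
  move: ab; rewrite le_eqVlt => /predU1P[->|ab]; first by rewrite ltxx mule0 subrr.
  by rewrite ab -EFinB -EFinM mulrBr.
have mD : measurable (oc 0 T) by exact: measurable_itv.
have fD : (nu1 (oc 0%R T) < +oo)%E by rewrite /nu1 stieltjes_oc// ltry.
pose nu : {finite_measure set (measurableTypeR R) -> \bar R} := mfrestr mD fD.
have dom : nu `<< leb.
  apply/null_content_dominatesP => A mA A0.
  rewrite /nu /= /mfrestr /mrestr; apply/eqP; rewrite eq_le measure_ge0 andbT.
  have mAD : measurable (A `&` oc 0 T) by exact: measurableI.
  have /eqP lAD : leb (A `&` oc 0 T) == 0%E.
    by rewrite eq_le measure_ge0 andbT -A0 le_measure ?inE.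
  have := sum_nu _ mAD; rewrite scale// lAD mule0 => e.
  by rewrite [leRHS]e leeDl.
have [g [g0 gfin ig nug]] := radon_nikodym_sigma_finite dom.
exists (fun t => fine (g t)); split.
- by move=> t; exact: fine_ge0.
- have : leb.-integrable (oo 0 T) g by apply: integrableS ig => //; exact: measurable_itv.
  by apply: eq_integrable => // t _ /=; rewrite fineK.
move=> a b a0 ab bT.
rewrite /Rintegral; under eq_integral => t _ do rewrite fineK//.
have mg (c d : R) : measurable_fun (`]c, d[%classic : set (measurableTypeR R)) g.
  by apply: measurable_funTS; exact: measurable_int ig.
have igs (c d : R) : (\int[leb]_(t in `]c, d[) g t = \int[leb]_(t in `]c, d]) g t)%E.
  by apply: integral_itv_bndo_bndc; exact: mg.
rewrite igs -nug; last exact: measurable_itv.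
rewrite /nu /= /mfrestr /mrestr (_ : `]a, b] `&` `]0, T] = `]a, b]%classic); last first.
  apply/setIidPl; apply: subset_itv; rewrite bnd_simp//.
by rewrite /nu1 stieltjes_oc//= /f1 !clid// ?a0 ?(le_trans a0 ab) ?bT ?(le_trans ab bT).
Qed.

End LipschitzPrimitive.

(** * Test functions on polyhedra *)

Section TestFunctions.
Context {R : realType} {n : nat}.
Local Notation E := 'rV[R]_n.+1.
Implicit Types (f g : E -> R) (x c v : E).

Lemma class_CS m f : class_C m.+1 f -> class_C m f.
Proof.
elim: m f => [|m IH] f [cf h]; split => // i; have [df hf] := h i.
by split => //; exact: IH.
Qed.

Lemma class_C_cst m (a : R) : class_C m (fun _ : E => a).
Proof.
elim: m a => [|m IH] a; (split; first exact: cst_continuous) => // i.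
split; first by move=> x; exact: derivable_cst.
rewrite (_ : partial i _ = fun _ : E => 0); first exact: IH.
by apply/funext => x; rewrite /partial derive_cst.
Qed.

Lemma class_CD m f g : class_C m f -> class_C m g -> class_C m (fun x => f x + g x).
Proof.
elim: m f g => [|m IH] f g [cf hf] [cg hg]; (split; first by move=> x; exact: (@continuousD _ _ _ f g x (cf x) (cg x))) => // i.
have [df hf'] := hf i; have [dg hg'] := hg i.
split; first by move=> x; exact: (@derivableD _ _ _ f g).
rewrite (_ : partial i _ = fun x => partial i f x + partial i g x); first exact: IH.
by apply/funext => x; rewrite /partial (@deriveD _ _ _ f g).
Qed.

Lemma class_CM m f g : class_C m f -> class_C m g -> class_C m (fun x => f x * g x).
Proof.
elim: m f g => [|m IH] f g [cf hf] [cg hg]; (split; first by move=> x; exact: (@continuousM _ _ f g x (cf x) (cg x))) => // i.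
have [df hf'] := hf i; have [dg hg'] := hg i.
split; first by move=> x; exact: (@derivableM _ _ f g).
rewrite (_ : partial i _ = fun x => f x * partial i g x + g x * partial i f x).
  by apply: class_CD; apply: IH => //; exact: class_CS.
by apply/funext => x; rewrite /partial (@deriveM _ _ f g).
Qed.

Lemma dotDr c x v : dot c (x + v) = dot c x + dot c v.
Proof. by rewrite /dot -big_split; apply: eq_bigr => i _; rewrite mxE mulrDr. Qed.

Lemma dotZr c a x : dot c (a *: x) = a * dot c x.
Proof. by rewrite /dot mulr_sumr; apply: eq_bigr => i _; rewrite mxE mulrCA. Qed.

Lemma dot_continuous c : continuous (dot c).
Proof.
have h i : continuous (fun x : E => c 0 i * x 0 i).
  move=> x; apply: (@continuousM R _ (fun=> c 0 i) (fun x : E => x 0 i) x).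
    exact: cst_continuous.
  exact: coord_continuous.
rewrite /dot; elim: (index_enum _) => [|i s IH].
  rewrite (_ : (fun _ => _) = fun _ : E => 0); first exact: cst_continuous.
  by apply/funext => x; rewrite big_nil.
rewrite (_ : (fun _ => _) = fun x : E => c 0 i * x 0 i + \sum_(i <- s) c 0 i * x 0 i).
  by move=> x; exact: (@continuousD _ _ _ _ _ x (h i x) (IH x)).
by apply/funext => x; rewrite big_cons.
Qed.

Lemma affine_continuous c (b : R) : continuous (fun x => dot c x + b).
Proof.
move=> x; apply: (@continuousD _ _ _ (dot c) (fun _ : E => b) x); first exact: dot_continuous.
exact: cst_continuous.
Qed.

Lemma ridge_continuous (psi : R -> R) c (b : R) : continuous psi -> continuous (fun x => psi (dot c x + b)).
Proof.
move=> cp x; apply: (@continuous_comp _ _ _ (fun x => dot c x + b) psi x); first exact: affine_continuous.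
exact: cp.
Qed.

(** Along a line a ridge function depends on one variable, so its difference quotient is literally
    that of [psi] composed with an affine map. *)
Lemma is_derive_ridge (psi : R -> R) c (b : R) x v (d : R) : is_derive (dot c x + b) 1 psi d ->
  is_derive x v (fun y => psi (dot c y + b)) (d * dot c v).
Proof.
move=> h; have h' : is_derive (dot c v * 0 + (dot c x + b)) 1 psi d by rewrite mulr0 add0r.
have [dg eg] := is_derive_comp_affine h'.
have e : (fun t : R => t^-1 *: (((fun y => psi (dot c y + b)) \o shift x) (t *: v) - psi (dot c x + b))) =
   (fun t : R => t^-1 *: (((fun s => psi (dot c v * s + (dot c x + b))) \o shift 0) (t *: 1) - psi (dot c v * 0 + (dot c x + b)))).
  apply/funext => t; rewrite /= dotDr dotZr mulr0 add0r addr0 [t *: 1]mulr1; congr (_ *: (psi _ - _)).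
  by ring.
by split; [rewrite /derivable e|rewrite /derive e].
Qed.

Lemma class_C_ridge m (psi : R -> R) c b : Cder m.+1 psi -> class_C m (fun x => psi (dot c x + b)).
Proof.
have cpsi (f : R -> R) : (forall t, derivable f t 1) -> continuous f.
  by move=> df t; apply: differentiable_continuous; exact/derivable1_diffP.
elim: m psi => [|m IH] psi [dp hp]; (split; first exact: ridge_continuous (cpsi _ dp)) => //.
move=> i; split => [x|].
  by have [] := is_derive_ridge (c := c) (b := b) (x := x) (delta_mx 0 i) (derivableP (dp (dot c x + b))).
rewrite (_ : partial i _ = fun x => dot c (delta_mx 0 i) * psi^`()%classic (dot c x + b)).
  by apply: class_CM; [exact: class_C_cst|exact: IH].
apply/funext => x; rewrite /partial.
have [_ ->] := is_derive_ridge (c := c) (b := b) (x := x) (delta_mx 0 i) (derivableP (dp (dot c x + b))).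
by rewrite derive1E mulrC.
Qed.

(** The shift by -1 confines each factor to the closed set where [dot l.1 x + l.2] is at least
    1/(k+1), while the factor [k.+1] drives the product to the indicator of the open polyhedron. *)
Definition cutoff (L : seq (E * R)) (k : nat) (x : E) : R :=
  \prod_(l <- L) expinv 0 (k.+1%:R * (dot l.1 x + l.2) - 1).

Definition halfspaces (L : seq (E * R)) : set E := [set x | all (fun l => 0 < dot l.1 x + l.2) L].

Lemma class_C_cutoff m L k : class_C m (cutoff L k).
Proof.
rewrite /cutoff; elim: L => [|l L IH].
  by under [X in class_C _ X]funext => x do rewrite big_nil; exact: class_C_cst.
under [X in class_C _ X]funext => x do rewrite big_cons.
apply: class_CM => //.
have := @class_C_ridge m (expinv 0) (k.+1%:R *: l.1) (k.+1%:R * l.2 - 1) (Cder_expinv _ _).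
congr class_C; apply/funext => x; congr expinv.
rewrite mulrDr -addrA; congr (_ + _).
by rewrite /dot mulr_sumr; apply: eq_bigr => i _; rewrite mxE mulrA.
Qed.

Lemma cutoff_ge0 L k x : 0 <= cutoff L k x.
Proof. by apply: prodr_ge0 => l _; exact: expinv0_ge0. Qed.

Lemma cutoff_le1 L k x : cutoff L k x <= 1.
Proof. by apply: prodr_ile1 => l _; rewrite expinv0_ge0 expinv0_le1. Qed.

(** Eventually [(k+1) * y - 1] is at least [(k+1) * y / 2], so the shift is harmless and
    [expinv0_cvg] at [y / 2] squeezes the sequence. *)
Lemma expinv0_cvg1 (y : R) : 0 < y -> expinv 0 (k.+1%:R * y - 1) @[k --> \oo] --> (1 : R).
Proof.
move=> y0; have := @expinv0_cvg R (y / 2) (divr_gt0 y0 (ltr0n _ 2)).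
move=> h; have hc : (fun _ : nat => 1 : R) @ \oo --> (1 : R) by exact: cvg_cst.
apply: (squeeze_cvgr _ h hc).
near=> k; rewrite expinv0_le1 andbT.
have hk : 1 <= k.+1%:R * (y / 2).
  rewrite -ler_pdivrMr ?divr_gt0// div1r.
  have h2 : (y / 2)^-1 <= k%:R by near: k; exact: nbhs_infty_ger.
  by rewrite (le_trans h2)// ler_nat.
have p1 : 0 < k.+1%:R * (y / 2) by apply: lt_le_trans hk.
have p2 : k.+1%:R * (y / 2) <= k.+1%:R * y - 1 by lra.
rewrite /expinv p1 (lt_le_trans p1 p2) !expr0 !invr1 !mul1r ler_expR lerN2.
by rewrite lef_pV2 ?posrE// (lt_le_trans p1 p2).
Unshelve. all: by end_near. Qed.

Lemma cutoff_cvg L x : cutoff L k x @[k --> \oo] --> (\1_(halfspaces L) x : R).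
Proof.
rewrite indicE; elim: L => [|l L IH].
  rewrite mem_set// (_ : cutoff [::] ^~ x = cst 1); first exact: cvg_cst.
  by apply/funext => k; rewrite /cutoff big_nil.
rewrite (_ : cutoff (l :: L) ^~ x =
    fun k => expinv 0 (k.+1%:R * (dot l.1 x + l.2) - 1) * cutoff L k x); last first.
  by apply/funext => k; rewrite /cutoff big_cons.
have [l0|l0] := ltP 0 (dot l.1 x + l.2); last first.
  rewrite memNset; last by rewrite /halfspaces /= ltNge l0.
  rewrite (_ : (fun k => _) = cst 0); first exact: cvg_cst.
  apply/funext => k; rewrite expinv0_eq0 ?mul0r//.
  by rewrite subr_le0 (le_trans _ ler01)// mulr_ge0_le0.
rewrite (_ : (x \in _) = (x \in halfspaces L)); last first.
  by apply/idP/idP => /set_mem h; apply/mem_set; move: h; rewrite /halfspaces /= l0.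
by rewrite -[X in _ --> X]mul1r; apply: cvgM => //; exact: expinv0_cvg1.
Qed.

End TestFunctions.

(** * The fundamental lemma of the calculus of variations on a polyhedron *)

Section FundamentalLemma.
Context {R : realType} {n : nat}.
Local Notation E := 'rV[R]_n.+1.
Variable mu : {measure set (borelRn R n) -> \bar R}.
Implicit Types (f g : E -> R) (x c v : E) (L : seq (E * R)).

Lemma open_measurable_borelRn (A : set E) : open A -> measurable (A : set (borelRn R n)).
Proof. by move=> oA; exact: sub_sigma_algebra. Qed.

Lemma closed_measurable_borelRn (A : set E) : closed A -> measurable (A : set (borelRn R n)).
Proof.
move=> cA; rewrite -(setCK A); apply: measurableC; apply: open_measurable_borelRn.
exact: closed_openC.
Qed.

Lemma continuous_measurable_borelRn f : continuous f ->
  measurable_fun (setT : set (borelRn R n)) f.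
Proof.
move=> /continuousP cf; apply: (measurability _ (RGenOpens.measurableE R)).
move=> _ [_ [a [b ->] <-]]; rewrite setTI; apply: open_measurable_borelRn.
by apply: cf; exact: itv_open.
Qed.

Lemma halfspacesE L x : halfspaces L x = all (fun l => 0 < dot l.1 x + l.2) L :> Prop.
Proof. by []. Qed.

Lemma halfspaces_cat L L' : halfspaces (L ++ L') = halfspaces L `&` halfspaces L'.
Proof.
by apply/seteqP; split => x; rewrite /halfspaces /= all_cat => /andP.
Qed.

Lemma open_halfspaces L : open (halfspaces L).
Proof.
elim: L => [|l L IH].
  rewrite (_ : halfspaces [::] = setT); first exact: openT.
  by apply/seteqP; split.
rewrite (_ : halfspaces _ = (fun x => dot l.1 x + l.2) @^-1` [set r : R | 0 < r] `&` halfspaces L); last first.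
  by apply/seteqP; split => x; rewrite /halfspaces /= => /andP.
apply: openI => //; apply: open_comp; last exact: open_gt.
by move=> x _; exact: affine_continuous.
Qed.

Lemma closed_halfspaces L k : closed [set x : E | all (fun l => 0 <= k.+1%:R * (dot l.1 x + l.2) - 1) L].
Proof.
elim: L => [|l L IH].
  rewrite (_ : [set x | _] = setT); first exact: closedT.
  by apply/seteqP; split.
rewrite (_ : [set x | _] = (fun x => dot l.1 x + l.2) @^-1` [set r : R | k.+1%:R^-1 <= r]
    `&` [set x : E | all (fun l => 0 <= k.+1%:R * (dot l.1 x + l.2) - 1) L]); last first.
  apply/seteqP; split => x /= => [/andP[h1 h2]|[h1 h2]]; [split=> //|rewrite h2 andbT].
    by rewrite -div1r ler_pdivrMr// mulrC -subr_ge0.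
  by rewrite subr_ge0 mulrC -ler_pdivrMr// div1r.
apply: closedI => //; apply: preimage_closed; last exact: closed_ge.
by move=> x _; exact: affine_continuous.
Qed.

(** The factors of [LO] confine the support to a compact subset of the bounded polyhedron; the
    half-spaces in [L] may therefore be arbitrary. *)
Lemma cutoff_test_fun L LO k : bounded_set (halfspaces LO) ->
  test_fun (halfspaces LO) (cutoff (L ++ LO) k).
Proof.
move=> bO; split; first by move=> m; exact: class_C_cutoff.
pose K := [set x : E | all (fun l => 0 <= k.+1%:R * (dot l.1 x + l.2) - 1) LO].
have KO : K `<=` halfspaces LO.
  move=> x /= /allP h; apply/allP => l /h; rewrite subr_ge0 mulrC -ler_pdivrMr// div1r.
  by apply: lt_le_trans; rewrite invr_gt0.
exists K; split => //.
  apply: bounded_closed_compact; last exact: closed_halfspaces.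
  by apply: (sub_boundedr _ bO) => P hP x Kx; exact/hP/KO.
move=> x /= /negP; rewrite -has_predC => /hasP[l lL] /=; rewrite -ltNge => l0.
apply/eqP; rewrite /cutoff prodf_seq_eq0; apply/hasP; exists l.
  by rewrite mem_cat lL orbT.
by rewrite /= expinv0_eq0// ltW.
Qed.

Definition hboxes : set (set E) := range halfspaces.

(** The open sup-norm ball with rational centre [q] and radius 1/(k+1), written as a polyhedron. *)
Definition coord_box (q : 'rV[rat]_n.+1) (k : nat) : seq (E * R) :=
  [seq (delta_mx 0 i, k.+1%:R^-1 - ratr (q 0 i)) | i <- index_enum 'I_n.+1] ++
  [seq (- delta_mx 0 i, k.+1%:R^-1 + ratr (q 0 i)) | i <- index_enum 'I_n.+1].

Lemma dot_delta i x : dot (delta_mx 0 i) x = x 0 i.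
Proof.
rewrite /dot (bigD1 i)//= mxE !eqxx mul1r big1 ?addr0// => j ji.
by rewrite mxE eqxx (negbTE ji) mul0r.
Qed.

Lemma dotN c x : dot (- c) x = - dot c x.
Proof. by rewrite /dot -sumrN; apply: eq_bigr => i _; rewrite mxE mulNr. Qed.

Lemma coord_boxP q k x : halfspaces (coord_box q k) x <->
  forall i, `|x 0 i - ratr (q 0 i)| < k.+1%:R^-1.
Proof.
rewrite halfspacesE /coord_box all_cat !all_map; split.
  move=> /andP[/allP h1 /allP h2] i; have := h1 i (mem_index_enum i); have := h2 i (mem_index_enum i).
  rewrite /= dotN dot_delta ltr_norml; move: (k.+1%:R^-1) => r h3 h4.
  by apply/andP; split; lra.
move=> h; apply/andP; split; apply/allP => i _ /=; have := h i;
  by rewrite ?dotN dot_delta ltr_norml; move: (k.+1%:R^-1) => r /andP[h1 h2]; lra.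
Qed.

(** An open set is the union of the rational cubes that it contains, and these are countably
    many. *)
Lemma open_sub_hboxes (A : set E) : open A -> <<s hboxes>> A.
Proof.
move=> oA; pose I := [set p : 'rV[rat]_n.+1 * nat | halfspaces (coord_box p.1 p.2) `<=` A].
have -> : A = \bigcup_(p : 'rV[rat]_n.+1 * nat) (if p \in I then halfspaces (coord_box p.1 p.2) else set0).
  apply/seteqP; split => x; last by case=> p _; case: ifP => // /set_mem; apply.
  move=> Ax; have /nbhs_ballP[e /= e0 eA] : nbhs x A by exact: open_nbhs_nbhs.
  have [k hk] : exists k, k.+1%:R^-1 < e / 2.
    exists (Num.truncn (e / 2)^-1); rewrite -[ltRHS]invrK ltf_pV2 ?posrE ?invr_gt0 ?ltr0n ?divr_gt0//.
    by apply: truncnS_gt.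
  have k0 : (0 : R) < k.+1%:R^-1 by rewrite invr_gt0.
  have /choice[q hq] : forall i : 'I_n.+1, exists q : rat, `|x 0 i - ratr q| < k.+1%:R^-1.
    move=> i; have hi : x 0 i - k.+1%:R^-1 < x 0 i + k.+1%:R^-1.
      by rewrite ltrBlDr -addrA ltrDl addr_gt0.
    have [q] := rat_in_itvoo hi.
    rewrite in_itv /= => hq; exists q; rewrite ltr_norml; move: (k.+1%:R^-1) hq => r /andP[h1 h2].
    by apply/andP; split; lra.
  have xb : halfspaces (coord_box (\row_i q i) k) x.
    by apply/coord_boxP => i; rewrite mxE.
  exists (\row_i q i, k) => //; rewrite mem_set//= => y /coord_boxP /= hy; apply: eA.
  split=> // a i; rewrite (ord1 a) /ball /=; have := hy i; have := hq i; rewrite mxE.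
  rewrite (_ : x 0 i - y 0 i = (x 0 i - ratr (q i)) - (y 0 i - ratr (q i))); last by ring.
  move=> h1 h2; apply: le_lt_trans (ler_normB _ _) _.
  by move: (k.+1%:R^-1) hk h1 h2 => r *; lra.
apply: (@countable_bigcupT_measurable _ (g_sigma_algebraType hboxes)) => [|p].
  exact: countableP.
case: ifP => _; last exact: measurable0.
by apply: sub_sigma_algebra; exists (coord_box p.1 p.2).
Qed.

Lemma setI_closed_hboxes : setI_closed hboxes.
Proof. by move=> _ _ [L _ <-] [L' _ <-]; exists (L ++ L') => //; rewrite halfspaces_cat. Qed.

Section Vanishing.
Variables (LO : seq (E * R)) (g : E -> R).
Local Notation O := (halfspaces LO : set (borelRn R n)).
Hypothesis bO : bounded_set (halfspaces LO).
Hypothesis ig : mu.-integrable O (EFin \o g).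
Hypothesis g0 : forall phi, test_fun (halfspaces LO) phi -> \int[mu]_(x in O) (g x * phi x) = 0.

Let mO : measurable O. Proof. apply: open_measurable_borelRn; exact: open_halfspaces. Qed.

Let igA (A : set E) : measurable (A : set (borelRn R n)) ->
  mu.-integrable O (EFin \o (fun x => g x * \1_A x)).
Proof.
move=> mA; apply: (ri_le mO _ _ (ri_abs ig)).
  by apply: measurable_funM; [exact: ri_measurable ig|exact: measurable_indic].
by move=> x _; rewrite normrM ler_piMr// indicE normr_nat; case: (_ \in _).
Qed.

Let zero_halfspaces L : \int[mu]_(x in O) (g x * \1_(halfspaces L) x) = 0.
Proof.
have mL : measurable (halfspaces L : set (borelRn R n)).
  apply: open_measurable_borelRn; exact: open_halfspaces.
have mc k : measurable_fun O (cutoff (L ++ LO) k).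
  apply: measurable_funTS; apply: continuous_measurable_borelRn.
  by have [] := @class_C_cutoff R n 0 (L ++ LO) k.
have h : {ae mu, forall x, O x -> (g x * cutoff (L ++ LO) k x)%:E @[k --> \oo] --> (g x * \1_(halfspaces L) x)%:E}.
  apply: aeW => x Ox; apply/fine_cvgP; split; first exact: nearW.
  apply: cvgM; first exact: cvg_cst.
  have := @cutoff_cvg R n (L ++ LO) x; congr (_ --> _).
  rewrite !indicE halfspaces_cat in_setI; congr (_ %:R).
  by rewrite [X in _ && X]mem_set// andbT.
have dom : {ae mu, forall x, forall k : nat, O x -> (`|(g x * cutoff (L ++ LO) k x)%:E| <= (`|g x|)%:E)%E}.
  apply: aeW => x k Ox; rewrite lee_fin normrM ler_piMr// ger0_norm ?cutoff_ge0//.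
  exact: cutoff_le1.
have mf k : measurable_fun O (fun x => (g x * cutoff (L ++ LO) k x)%:E).
  by apply/measurable_EFinP; apply: measurable_funM => //; exact: ri_measurable ig.
have [_ _ h1] := @dominated_convergence _ _ _ mu O mO (fun k x => (g x * cutoff (L ++ LO) k x)%:E)
  (fun x => (g x * \1_(halfspaces L) x)%:E) (fun x => (`|g x|)%:E) mf
  (measurable_int mu (igA mL)) h (ri_abs ig) dom.
have h0 : (fun k => \int[mu]_(x in O) (g x * cutoff (L ++ LO) k x)%:E)%E = cst 0%E.
  apply/funext => k; rewrite Rint_fin ?(g0 (cutoff_test_fun L k bO))//.
  apply: (ri_le mO _ _ (ri_abs ig)); first by apply/measurable_EFinP; exact: mf.
  move=> x _; rewrite normrM ler_piMr// ger0_norm ?cutoff_ge0//.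
  exact: cutoff_le1.
rewrite h0 in h1; have := cvg_lim (@ereal_hausdorff R) h1; rewrite lim_cst// => e.
by rewrite /Rintegral -(e _).
Qed.

(** The sets with this property form a Dynkin system: complements use that [g] itself has integral
    zero, which is the case of the empty list of half-spaces, and disjoint unions use partial sums
    dominated by the modulus of [g]. *)
Let zero_measurable (A : set E) : measurable (A : set (borelRn R n)) ->
  \int[mu]_(x in O) (g x * \1_A x) = 0.
Proof.
pose H := [set A : set E | measurable (A : set (borelRn R n)) /\ \int[mu]_(x in O) (g x * \1_A x) = 0].
have HA : <<d hboxes>> `<=` H.
  have zT : \int[mu]_(x in O) (g x * \1_setT x) = 0.
    rewrite -(zero_halfspaces [::]); apply: eq_Rintegral => x _.
    by rewrite !indicE in_setT mem_set.
  apply: smallest_sub; last first.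
    move=> _ [L _ <-]; split; last exact: zero_halfspaces.
    by apply: open_measurable_borelRn; exact: open_halfspaces.
  split; first by split.
    move=> B [mB hB]; split; first exact: measurableC.
    transitivity (\int[mu]_(x in O) (g x * \1_setT x - g x * \1_B x)).
      apply: eq_Rintegral => x _; rewrite -mulrBr; congr (_ * _).
      by rewrite !indicE in_setT in_setC; case: (_ \in _); rewrite ?subrr ?subr0.
    by rewrite RintegralB ?zT ?hB ?subrr//; [exact: igA|exact: igA].
  move=> F tF HF; have mF k : measurable (F k : set (borelRn R n)) by have [] := HF k.
  split; first exact: bigcupT_measurable.
  pose S k x := \sum_(i < k) g x * \1_(F i) x.
  have iS k : mu.-integrable O (EFin \o S k) by apply: (ri_sum mO) => i; exact: igA.
  have one x k : F k x -> forall j, j != k -> (\1_(F j) x : R) = 0.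
    move=> Fkx j jk; rewrite indicE memNset//= => Fjx.
    by move/eqP : jk; apply; apply: tF => //; exists x.
  have Sle x k : `|S k x| <= `|g x|.
    rewrite /S -mulr_sumr normrM ler_piMr//.
    have [[j Fjx]|nF] := pselect (exists j, F j x); last first.
      rewrite big1 ?normr0// => i _; rewrite indicE memNset//= => Fix.
      by apply: nF; exists i.
    have [jk|kj] := ltnP j k; last first.
      by rewrite big1 ?normr0// => i _; rewrite (one x j)// ltn_eqF// (leq_trans _ kj).
    rewrite (bigD1 (Ordinal jk))//= big1 ?addr0; last first.
      by move=> i ij; rewrite (one x j)//; apply: contra ij => /eqP e; apply/eqP/val_inj.
    by rewrite indicE normr_nat; case: (_ \in _).
  have cvS : {ae mu, forall x, O x -> (S k x)%:E @[k --> \oo] --> (g x * \1_(\bigcup_k F k) x)%:E}.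
    apply: aeW => x _; have [[j Fjx]|nF] := pselect (exists j, F j x); last first.
      rewrite (_ : (fun k => _) = cst (g x * \1_(\bigcup_k F k) x)%:E); first exact: cvg_cst.
      apply/funext => k; rewrite /S [in RHS]indicE memNset ?mulr0 ?big1//.
        by move=> i _; rewrite indicE memNset ?mulr0//= => Fix; apply: nF; exists i.
      by case=> i _ Fix; apply: nF; exists i.
    apply: cvg_near_cst; exists j.+1 => // k /= jk; congr EFin.
    rewrite /S (bigD1 (Ordinal jk))//= big1 ?addr0; last first.
      by move=> i ij; rewrite (one x j) ?mulr0//; apply: contra ij => /eqP e; apply/eqP/val_inj.
    by rewrite !indicE !mem_set//; exists j.
  have mS k : measurable_fun O (fun x => (S k x)%:E) by exact: measurable_int (iS k).
  have dom : {ae mu, forall x, forall k : nat, O x -> (`|(S k x)%:E| <= (`|g x|)%:E)%E}.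
    by apply: aeW => x k _; rewrite lee_fin.
  have mU : measurable (\bigcup_k F k : set (borelRn R n)) by exact: bigcupT_measurable.
  have [_ _ h1] := @dominated_convergence _ _ _ mu O mO (fun k x => (S k x)%:E)
    (fun x => (g x * \1_(\bigcup_k F k) x)%:E) (fun x => (`|g x|)%:E) mS
    (measurable_int mu (igA mU)) cvS (ri_abs ig) dom.
  have h0 : (fun k => \int[mu]_(x in O) (S k x)%:E)%E = cst 0%E.
    apply/funext => k; rewrite (Rint_fin mO (iS k)) Rint_sum//; last by move=> i; exact: igA.
    by rewrite big1// => i _; have [] := HF i.
  rewrite h0 in h1; have := cvg_lim (@ereal_hausdorff R) h1; rewrite lim_cst// => e.
  by rewrite /Rintegral -(e _).
move=> mA; suff : H A by case.
apply: HA; rewrite setI_closed_g_dynkin_g_sigma_algebra; last exact: setI_closed_hboxes.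
move: A mA; apply: smallest_sub; first exact: smallest_sigma_algebra.
exact: open_sub_hboxes.
Qed.

(* The smooth cutoffs converge to the indicators of open polyhedra, which form a
   pi-system generating the Borel sets. *)
Lemma vanish_ae : {ae mu, forall x, halfspaces LO x -> g x = 0}.
Proof.
apply: (Rint_abs_eq0 mO ig).
have mg := ri_measurable ig.
have mP : measurable (O `&` g @^-1` `[0, +oo[%classic) by apply: mg => //; exact: measurable_itv.
have iP := zero_measurable mP.
have iO := zero_measurable mO.
(* The modulus of [g] is twice [g] restricted to the set where it is nonnegative, minus [g]; both
   parts integrate to zero. *)
transitivity (\int[mu]_(x in O) (2 * (g x * \1_(O `&` g @^-1` `[0, +oo[%classic) x) - g x * \1_O x)).
  apply: eq_Rintegral => x Ox; rewrite !indicE Ox mulr1 in_setI Ox /=.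
  have -> : (x \in g @^-1` `[0, +oo[) = (0 <= g x).
    by apply/idP/idP => [/set_mem|h]; [|apply/mem_set]; rewrite /= in_itv /= andbT.
  case: (boolP (0 <= g x)) => [g0x|]; first by rewrite ger0_norm//= mulr1; ring.
  by rewrite -ltNge => g0x; rewrite ltr0_norm//= mulr0; ring.
rewrite RintegralB//; [|by apply: riZ => //; exact: igA|exact: igA].
by rewrite RintegralZl ?iP ?iO ?mulr0 ?subrr//; exact: igA.
Qed.

End Vanishing.

End FundamentalLemma.

Section SigmaFinite.
Context d (T : measurableType d) (R : realType).

(** The proof of sigma-finiteness is an argument of the alias, so that the structure required by
    product measures can be attached to an unchanged measure. *)
Definition sigma_finite_alias (m : {measure set T -> \bar R}) of sigma_finite setT m :
  set T -> \bar R := m.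

Variables (m : {measure set T -> \bar R}) (h : sigma_finite setT m).
HB.instance Definition _ := Measure.copy (sigma_finite_alias h) m.
HB.instance Definition _ := Measure_isSigmaFinite.Build _ _ _ (sigma_finite_alias h) h.

Definition sigma_finite_of : {sigma_finite_measure set T -> \bar R} := sigma_finite_alias h.

End SigmaFinite.

Lemma sigma_finite_ofE d (T : measurableType d) (R : realType)
    (m : {measure set T -> \bar R}) (h : sigma_finite setT m) :
  sigma_finite_of h = m :> {measure set T -> \bar R}.
Proof. by case: m h. Qed.

(** * The polyhedral domain: openness, finite measure, square integrability *)

Section Domain.
Context {R : realType} {n : nat}.
Local Notation E := 'rV[R]_n.+1.
Variable mu : {measure set (borelRn R n) -> \bar R}.

Definition cube (k : nat) : set E := [set x | forall i, - k%:R <= x 0 i <= k%:R].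

Lemma closed_cube k : closed (cube k).
Proof.
rewrite (_ : cube k = \bigcap_(i in [set: 'I_n.+1]) ((fun x : E => x 0 i) @^-1` `[- k%:R, k%:R]%classic)).
  apply: closed_bigI => i _; apply: preimage_closed; last exact: interval_closed.
  by move=> x _; exact: coord_continuous.
apply/seteqP; split => x /= h i; first by move=> _; rewrite set_itvcc; exact: h.
by have := h i I; rewrite /= in_itv.
Qed.

Lemma coord_le_norm (x : E) i : `|x 0 i| <= `|x|.
Proof. by rewrite [leRHS]/Num.Def.normr /= mx_normrE; apply/bigmax_geP; right => /=; exists (0, i). Qed.

Lemma bounded_cube k : bounded_set (cube k).
Proof.
exists k%:R; split => // M kM x xk; rewrite /= [leLHS]/Num.Def.normr /= mx_normrE.
apply: bigmax_le => [|[a i] _]; first by apply: le_trans (ltW kM).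
by rewrite (ord1 a) (le_trans _ (ltW kM))// ler_norml; exact: xk.
Qed.

Lemma bounded_sub_cube (A : set E) : bounded_set A -> exists k, A `<=` cube k.
Proof.
case=> M [_ hM]; exists (Num.truncn `|M|).+2 => x Ax i; rewrite -ler_norml.
apply: le_trans (coord_le_norm x i) _; apply: hM => //.
apply: le_lt_trans (ler_norm _) _; apply: lt_le_trans (truncnS_gt _) _.
by rewrite ler_nat.
Qed.

Hypothesis hmu : is_lebesgue_measure mu.

Lemma cube_fin k : (mu (cube k : set (borelRn R n)) < +oo)%E.
Proof.
have := hmu (a := const_mx (- k%:R)) (b := const_mx k%:R).
rewrite (_ : [set x : E | _] = cube k); last first.
  by apply/seteqP; split => x h i; have := h i; rewrite !mxE.
by move=> ->; rewrite ?ltry// => i; rewrite !mxE; apply: (@le_trans _ _ 0); rewrite ?oppr_le0.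
Qed.

Lemma sigma_finite_lebesgue : sigma_finite (setT : set (borelRn R n)) mu.
Proof.
exists (fun k => cube k : set (borelRn R n)); last first.
  by move=> k; split; [exact: closed_measurable_borelRn (@closed_cube k)|exact: cube_fin].
apply/seteqP; split => // x _; have [|k hk] := @bounded_sub_cube [set x]; last first.
  by exists k => //; exact: hk.
by exists `|x : E|; split; [exact: num_real|move=> M hM y ->; exact: ltW].
Qed.

Variable Omega : set E.
Hypothesis hO : convex_polyhedral_domain Omega.

Lemma domain_halfspaces : exists LO, Omega = halfspaces LO.
Proof.
have [_ _ [m [a [b ->]]]] := hO.
exists [seq (- a j, b j) | j <- index_enum 'I_m]; apply/seteqP; split => x /=.
  by move=> h; apply/allP => _ /mapP[j _ ->] /=; rewrite dotN addrC subr_gt0.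
move=> /allP h j; have := h (- a j, b j); rewrite /= dotN addrC subr_gt0; apply.
by apply/mapP; exists j => //; exact: mem_index_enum.
Qed.

Lemma domain_open : open Omega.
Proof. by have [LO ->] := domain_halfspaces; exact: open_halfspaces. Qed.

Lemma domain_measurable : measurable (Omega : set (borelRn R n)).
Proof. by apply: open_measurable_borelRn; exact: domain_open. Qed.

Lemma domain_bounded : bounded_set Omega. Proof. by have [] := hO. Qed.

Lemma domain_fin : (mu (Omega : set (borelRn R n)) < +oo)%E.
Proof.
have [k hk] := bounded_sub_cube domain_bounded; apply: le_lt_trans (cube_fin k).
apply: le_measure => //; rewrite inE; first exact: domain_measurable.
exact: closed_measurable_borelRn (@closed_cube k).
Qed.

Lemma continuous_L2 (f : E -> R) : continuous f -> L2 Omega mu f.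
Proof.
move=> cf; apply/L2P.
have [k hk] := bounded_sub_cube domain_bounded.
have ck : compact (f @` cube k).
  apply: continuous_compact; first exact: continuous_subspaceT.
  apply: bounded_closed_compact; [exact: bounded_cube|exact: closed_cube].
have [M [_ hM]] := compact_bounded ck.
have mO := domain_measurable.
apply: (sqi_le mO (g := fun=> `|M| + 1)); last exact: sqi_cst domain_fin.
  by apply: measurable_funTS; exact: continuous_measurable_borelRn.
move=> x Ox; rewrite [leRHS]ger0_norm ?addr_ge0//; apply: (hM (`|M| + 1)).
  by rewrite ltr_pwDr// ler_norm.
by exists x => //; exact: hk.
Qed.

Lemma ae_eq_test (f g : E -> R) : L2 Omega mu f -> L2 Omega mu g ->
  (forall phi, test_fun Omega phi -> inner Omega mu f phi = inner Omega mu g phi) ->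
  {ae mu, forall x, Omega x -> f x = g x}.
Proof.
move=> hf hg h; have [LO OE] := domain_halfspaces; have bO := domain_bounded.
have mO : measurable (Omega : set (borelRn R n)) := domain_measurable.
have cL2 := continuous_L2.
have hfg : L2 Omega mu (fun x => f x - g x) by apply: (L2B mO).
have i0 : mu.-integrable Omega (EFin \o (fun x => f x - g x)).
  by apply: (sqi_ri domain_measurable domain_fin); apply/L2P.
have : {ae mu, forall x, Omega x -> f x - g x = 0}.
  subst Omega; apply: (vanish_ae bO i0) => phi hphi.
  have [/(_ 0%N) [cphi _] _] := hphi; have hp := cL2 _ cphi.
  rewrite -[LHS]/(inner _ _ _ _) (innerBl mO hf hg hp).
  by rewrite h// subrr.
move=> h0; apply: (ae_imp h0) => x {}h0 Ox; apply/eqP.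
by rewrite -subr_eq0 h0.
Qed.

End Domain.

(** * Sobolev spaces *)

(** Young's inequality with weight [b], where [b] may vanish, being a squared mesh size or a norm in
    the applications. In that case [g] is zero in L2 and the weight is taken arbitrarily small
    instead. *)
Lemma inner_le_scaled (R : realType) (n : nat) (mu : {measure set (borelRn R n) -> \bar R})
    (Omega : set 'rV[R]_n.+1) (mO : measurable (Omega : set (borelRn R n)))
    (b c : R) (f g : 'rV[R]_n.+1 -> R) : 0 <= b -> 0 <= c -> L2 Omega mu f -> L2 Omega mu g ->
  inner Omega mu g g <= b ^+ 2 * c -> inner Omega mu f g <= b * (inner Omega mu f f + c).
Proof.
move=> b0 c0 hf hg hgg; have i0 := inner_ge0 mu Omega f.
have [{}b0|b00] := ltrP 0 b.
  apply: le_trans (inner_young mO b0 hf hg) _; rewrite mulrDr lerD2l.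
  rewrite invfM -mulrA ler_pdivrMl ?ltr0n//.
  by rewrite ler_pdivrMl//; nra.
have b_0 : b = 0 by apply/eqP; rewrite eq_le b0 b00.
have gg0 : inner Omega mu g g = 0.
  apply/eqP; rewrite eq_le inner_ge0 andbT; apply: le_trans hgg _.
  by rewrite b_0 expr0n/= mul0r.
rewrite b_0 mul0r; apply/ler_addgt0Pr => e e0; rewrite add0r.
have p : 0 < e / (inner Omega mu f f + 1) by rewrite divr_gt0// ltr_wpDl.
apply: le_trans (inner_young mO p hf hg) _; rewrite gg0 mulr0 addr0.
by rewrite mulrAC ler_pdivrMr ?ltr_wpDl// mulrDr mulr1 lerDl ltW.
Qed.

Section Sobolev.
Context {R : realType} {n : nat}.
Local Notation E := 'rV[R]_n.+1.
Variable mu : {measure set (borelRn R n) -> \bar R}.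
Hypothesis hmu : is_lebesgue_measure mu.
Variable Omega : set E.
Hypothesis hO : convex_polyhedral_domain Omega.
Implicit Types f g h phi : E -> R.
Local Notation L2 := (L2 Omega mu).
Local Notation H1 := (H1 Omega mu).
Local Notation H2 := (H2 Omega mu).
Local Notation inner := (inner Omega mu).
Local Notation wp := (weak_partial Omega mu).
Local Notation is_wp := (is_weak_partial Omega mu).
Local Notation D := (dirichlet_form Omega mu).

Let mO : measurable (Omega : set (borelRn R n)). Proof. exact: domain_measurable. Qed.

Lemma test_fun_L2 phi : test_fun Omega phi -> L2 phi.
Proof. by move=> [/(_ 0%N)[c _] _]; exact: continuous_L2. Qed.

Lemma test_fun_partial_L2 phi i : test_fun Omega phi -> L2 (partial i phi).
Proof. by move=> [/(_ 1%N)[_ /(_ i)[_ [c _]]] _]; exact: continuous_L2. Qed.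

Lemma H1_L2 f : H1 f -> L2 f. Proof. by case. Qed.

Lemma weak_partialP i f : H1 f -> L2 (wp i f) /\ is_wp i f (wp i f).
Proof.
move=> [_ /(_ i)[g hg]].
by have := @xgetPex _ (cst 0) [set g | L2 g /\ is_wp i f g]; apply; exists g.
Qed.

Lemma weak_partial_ae i f g : H1 f -> L2 g -> is_wp i f g ->
  {ae mu, forall x, Omega x -> wp i f x = g x}.
Proof.
move=> hf hg hfg; have [h1 h2] := weak_partialP i hf.
apply: (ae_eq_test hmu hO) => // phi hphi; apply: oppr_inj.
by rewrite -h2// -hfg.
Qed.

Lemma is_wp_lin i a b f g f' g' : L2 f -> L2 g -> L2 f' -> L2 g' -> is_wp i f f' ->
  is_wp i g g' -> is_wp i (fun x => a * f x + b * g x) (fun x => a * f' x + b * g' x).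
Proof.
move=> hf hg hf' hg' h h' phi hphi.
have p1 := test_fun_L2 hphi; have p2 := test_fun_partial_L2 i hphi.
by rewrite !inner_lin// h// h'//; ring.
Qed.

Lemma H1_lin a b f g : H1 f -> H1 g -> H1 (fun x => a * f x + b * g x).
Proof.
move=> hf hg; split; first by apply: L2_lin => //; exact: H1_L2.
move=> i; have [f1 f2] := weak_partialP i hf; have [g1 g2] := weak_partialP i hg.
exists (fun x => a * wp i f x + b * wp i g x); split; first exact: L2_lin.
by apply: is_wp_lin => //; exact: H1_L2.
Qed.

(** Linearity holds only up to null sets, because [weak_partial] picks a representative for each
    function separately. *)
Lemma weak_partial_lin i a b f g : H1 f -> H1 g ->
  {ae mu, forall x, Omega x -> wp i (fun x => a * f x + b * g x) x = a * wp i f x + b * wp i g x}.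
Proof.
move=> hf hg; have [f1 f2] := weak_partialP i hf; have [g1 g2] := weak_partialP i hg.
apply: weak_partial_ae; [exact: H1_lin|exact: L2_lin|].
by apply: is_wp_lin => //; exact: H1_L2.
Qed.

Lemma L2_mfun f : L2 f -> measurable_fun (Omega : set (borelRn R n)) f. Proof. by case. Qed.

Lemma dirichlet_formC f g : D f g = D g f.
Proof. by apply: eq_bigr => i _; rewrite innerC. Qed.

Lemma dirichlet_form_lin a b f g h : H1 f -> H1 g -> H1 h ->
  D (fun x => a * f x + b * g x) h = a * D f h + b * D g h.
Proof.
move=> hf hg hh; rewrite /dirichlet_form !mulr_sumr -big_split; apply: eq_bigr => i _ /=.
have [f1 _] := weak_partialP i hf; have [g1 _] := weak_partialP i hg.
have [h1 _] := weak_partialP i hh; have [l1 _] := weak_partialP i (H1_lin a b hf hg).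
rewrite -inner_lin//; apply: inner_ae => //; [exact: L2_mfun|apply: L2_mfun; exact: L2_lin|exact: L2_mfun|].
exact: weak_partial_lin.
Qed.

Lemma dirichlet_form_ge0 f : 0 <= D f f.
Proof. by apply: sumr_ge0 => i _; exact: inner_ge0. Qed.

Lemma dirichlet_form_young a f g : 0 < a -> H1 f -> H1 g ->
  D f g <= a * D f f + (4 * a)^-1 * D g g.
Proof.
move=> a0 hf hg; rewrite /dirichlet_form !mulr_sumr -big_split; apply: ler_sum => i _ /=.
by apply: inner_young => //; [have [] := weak_partialP i hf|have [] := weak_partialP i hg].
Qed.

Lemma H1_norm_ge0 f : (0 <= H1_norm Omega mu f)%E.
Proof. exact: sqrte_ge0. Qed.

Lemma H2_norm_ge0 f : (0 <= H2_norm Omega mu f)%E.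
Proof. exact: sqrte_ge0. Qed.

Lemma sqre_sum_ge0 (I : finType) (F : I -> \bar R) : (0 <= \sum_i F i ^+ 2)%E.
Proof. by apply: sume_ge0 => i _; exact: sqre_ge0. Qed.

Lemma H1_norm_sqrE f : (H1_norm Omega mu f ^+ 2 =
  sqint mu (Omega : set (borelRn R n)) f + \sum_i sqint mu (Omega : set (borelRn R n)) (wp i f))%E.
Proof.
rewrite /H1_norm sqr_sqrte; last by apply: adde_ge0; [exact: sqre_ge0|exact: sqre_sum_ge0].
by rewrite L2_norm_sqr; congr (_ + _)%E; apply: eq_bigr => i _; rewrite L2_norm_sqr.
Qed.

Lemma H1_norm_sqr f : H1 f -> (H1_norm Omega mu f ^+ 2 = (inner f f + D f f)%:E)%E.
Proof.
move=> hf; rewrite H1_norm_sqrE (sqint_fin mO (H1_L2 hf)) EFinD; congr (_ + _)%E.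
rewrite /dirichlet_form -sumEFin; apply: eq_bigr => i _; rewrite sqint_fin//.
by have [] := weak_partialP i hf.
Qed.

Lemma H2_norm_sqrE f : (H2_norm Omega mu f ^+ 2 =
  H1_norm Omega mu f ^+ 2 +
  \sum_i \sum_j sqint mu (Omega : set (borelRn R n)) (wp j (wp i f)))%E.
Proof.
rewrite /H2_norm sqr_sqrte; last first.
  by apply: adde_ge0; [exact: sqre_ge0|apply: sume_ge0 => i _; exact: sqre_sum_ge0].
by congr (_ + _)%E; apply: eq_bigr => i _; apply: eq_bigr => j _; rewrite L2_norm_sqr.
Qed.

Definition hessian_form f : R := \sum_i \sum_j inner (wp j (wp i f)) (wp j (wp i f)).

Definition H2sq f : R := inner f f + D f f + hessian_form f.

Lemma H2_norm_sqr f : H2 f -> (H2_norm Omega mu f ^+ 2 = (H2sq f)%:E)%E.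
Proof.
move=> [hf hf']; rewrite H2_norm_sqrE H1_norm_sqr// [in RHS]EFinD; congr (_ + _)%E.
rewrite -sumEFin; apply: eq_bigr => i _; rewrite -sumEFin; apply: eq_bigr => j _.
by rewrite sqint_fin//; have [] := weak_partialP j (hf' i).
Qed.

Lemma H2sq_ge0 f : 0 <= H2sq f.
Proof.
rewrite !addr_ge0//; [exact: inner_ge0|exact: dirichlet_form_ge0|].
by apply: sumr_ge0 => i _; apply: sumr_ge0 => j _; exact: inner_ge0.
Qed.

(** Weak derivatives do not see null sets. Second derivatives need this, since the inner
    [weak_partial] of a combination is known only almost everywhere. *)
Lemma H1_ae f g : H1 f -> L2 g -> {ae mu, forall x, Omega x -> f x = g x} ->
  H1 g /\ forall i, {ae mu, forall x, Omega x -> wp i g x = wp i f x}.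
Proof.
move=> hf hg fg; have [l2f _] := hf.
have w i : is_wp i g (wp i f).
  move=> phi hphi; have [_ <-//] := weak_partialP i hf; apply/esym; apply: inner_ae => //.
  - exact: L2_mfun.
  - exact: L2_mfun.
  - exact: L2_mfun (test_fun_partial_L2 i hphi).
have hg1 : H1 g by split => // i; exists (wp i f); split => //; have [] := weak_partialP i hf.
split=> // i; apply: weak_partial_ae => //; first by have [] := weak_partialP i hf.
Qed.

Lemma weak_partial2_lin a b f g : H2 f -> H2 g ->
  H2 (fun x => a * f x + b * g x) /\ forall i j, {ae mu, forall x, Omega x ->
    wp j (wp i (fun x => a * f x + b * g x)) x = a * wp j (wp i f) x + b * wp j (wp i g) x}.
Proof.
move=> [hf hf'] [hg hg'].
have h i : H1 (wp i (fun x => a * f x + b * g x)) /\ forall j, {ae mu, forall x, Omega x ->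
    wp j (wp i (fun x => a * f x + b * g x)) x = wp j (fun x => a * wp i f x + b * wp i g x) x}.
  apply: H1_ae; first exact: H1_lin.
    by have [] := weak_partialP i (H1_lin a b hf hg).
  by apply: (ae_imp (weak_partial_lin i a b hf hg)) => x hx /hx.
split; first by split; [exact: H1_lin|move=> i; have [] := h i].
move=> i j; have [_ /(_ j) h1] := h i; have h2 := weak_partial_lin j a b (hf' i) (hg' i).
by apply: (ae_imp2 h1 h2) => x e1 e2 Ox; rewrite e1// e2.
Qed.

Lemma inner_le2 a b f g k : L2 k -> L2 f -> L2 g ->
  {ae mu, forall x, Omega x -> k x = a * f x + b * g x} ->
  inner k k <= 2 * a ^+ 2 * inner f f + 2 * b ^+ 2 * inner g g.
Proof.
move=> hk hf hg kfg; have /L2P sf := hf; have /L2P sg := hg; have /L2P sk := hk.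
rewrite /inner -!RintegralZl//; [|exact: sqiM|exact: sqiM].
rewrite -RintegralD//; [|by apply: riZ => //; exact: sqiM|by apply: riZ => //; exact: sqiM].
apply: Rint_le_ae => //; [exact: sqiM|by apply: riD => //; apply: riZ => //; exact: sqiM|].
apply: (ae_imp kfg) => x e Ox; rewrite e//; have := sqr_ge0 (a * f x - b * g x); nra.
Qed.

Lemma dirichlet_form_le2 a b f g : H1 f -> H1 g ->
  D (fun x => a * f x + b * g x) (fun x => a * f x + b * g x) <=
  2 * a ^+ 2 * D f f + 2 * b ^+ 2 * D g g.
Proof.
move=> hf hg; rewrite /dirichlet_form !mulr_sumr -big_split; apply: ler_sum => i _ /=.
apply: inner_le2; last exact: weak_partial_lin.
- by have [] := weak_partialP i (H1_lin a b hf hg).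
- by have [] := weak_partialP i hf.
- by have [] := weak_partialP i hg.
Qed.

Lemma H2sq_le2 a b f g : H2 f -> H2 g ->
  H2sq (fun x => a * f x + b * g x) <= 2 * a ^+ 2 * H2sq f + 2 * b ^+ 2 * H2sq g.
Proof.
move=> hf hg; have [[hl hl'] h2] := weak_partial2_lin a b hf hg.
move: hf hg => [hf hf'] [hg hg'].
have h0 : inner (fun x => a * f x + b * g x) (fun x => a * f x + b * g x) <=
    2 * a ^+ 2 * inner f f + 2 * b ^+ 2 * inner g g.
  by apply: inner_le2; [exact: H1_L2|exact: H1_L2|exact: H1_L2|apply: aeW].
have h1 := dirichlet_form_le2 a b hf hg; rewrite /H2sq.
have h3 : hessian_form (fun x => a * f x + b * g x) <=
    2 * a ^+ 2 * hessian_form f + 2 * b ^+ 2 * hessian_form g.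
  rewrite /hessian_form !mulr_sumr -big_split; apply: ler_sum => i _ /=.
  rewrite !mulr_sumr -big_split; apply: ler_sum => j _ /=.
  apply: inner_le2; last exact: h2.
  - by have [] := weak_partialP j (hl' i).
  - by have [] := weak_partialP j (hf' i).
  - by have [] := weak_partialP j (hg' i).
rewrite !mulrDr; apply: le_trans (lerD (lerD h0 h1) h3) _.
by rewrite [leRHS]addrACA; apply: lerD => //; rewrite addrACA.
Qed.

End Sobolev.

(** * Jointly measurable representatives *)

Section TimeSpace.
Context {R : realType} {n : nat}.
Local Notation E := 'rV[R]_n.+1.
Local Notation leb := (@lebesgue_measure R).
Local Notation oo a b := (`]a, b[%classic : set (measurableTypeR R)).
Variable mu : {sigma_finite_measure set (borelRn R n) -> \bar R}.
Variable Omega : set E.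
Local Notation O := (Omega : set (borelRn R n)).
Hypothesis mO : measurable O.
Hypothesis fO : (mu O < +oo)%E.
Implicit Types (v : R -> E -> R) (V : measurableTypeR R * borelRn R n -> R).
Local Notation L2 := (L2 Omega mu).
Local Notation L2_norm := (L2_norm Omega mu).

Lemma measurable_patch (g : E -> R) : measurable_fun O g ->
  measurable_fun (setT : set (borelRn R n)) (g \_ Omega).
Proof. by move=> mg; apply/(measurable_restrictT _ mO). Qed.

Lemma measurable_prod (f : R -> R) (g : E -> R) :
  measurable_fun (setT : set (measurableTypeR R)) f ->
  measurable_fun (setT : set (borelRn R n)) g ->
  measurable_fun setT (fun z : measurableTypeR R * borelRn R n => f z.1 * g z.2).
Proof.
move=> mf mg; apply: measurable_funM.
  by apply: (measurableT_comp mf); exact: measurable_fst.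
by apply: (measurableT_comp mg); exact: measurable_snd.
Qed.

(** The values of a simple map are measurable on [Omega] only; extension by zero gives a function
    measurable on the whole product. *)
Definition sm_joint (D : set (measurableTypeR R)) (s : simple_map lebesgue_measure D L2)
    (z : measurableTypeR R * borelRn R n) : R :=
  \sum_(i < sm_size s) \1_(sm_set (s := s) i) z.1 * (sm_val (s := s) i \_ Omega) z.2.

Lemma measurable_sm_joint D (s : simple_map lebesgue_measure D L2) :
  measurable_fun setT (sm_joint s).
Proof.
apply: measurable_sum => i.
have [mA _ _] := sm_setP (s := s) i; have [mv _] := sm_valP (s := s) i.
by apply: measurable_prod; [exact: measurable_indic|exact: measurable_patch].
Qed.

Lemma sm_jointE D (s : simple_map lebesgue_measure D L2) t x : Omega x ->
  sm_joint s (t, x) = sm_fun s t x.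
Proof. by move=> Ox; apply: eq_bigr => i _; rewrite /= patchE mem_set. Qed.

Lemma sqint_eq (f g : E -> R) : (forall x, Omega x -> f x = g x) -> sqint mu O f = sqint mu O g.
Proof. by move=> fg; apply: eq_integral => x /set_mem Ox; rewrite fg. Qed.

Section Representative.
Variables a b : R.
Local Notation D := (oo a b).
Let mD : measurable D. Proof. exact: measurable_itv. Qed.

Lemma bochner_joint v : strongly_measurable leb D L2 L2_norm v ->
  exists V, measurable_fun setT V /\
    {ae leb, forall t, D t -> {ae mu, forall x, Omega x -> V (t, x) = v t x}}.
Proof.
case=> s hs.
apply: (@joint_limit _ _ _ _ R leb mu D O mD mO (leb_oo_fin a b) fO (fun k => sm_joint (s k)) v).
  by move=> k; exact: measurable_sm_joint.
apply: (ae_imp hs) => t {}hs Dt; have [[mv _] cv] := hs Dt; split => //.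
have -> : (fun k => sqint mu O (fun x => sm_joint (s k) (t, x) - v t x)) =
    (fun k => sqint mu O (sm_fun (s k) t \- v t)).
  by apply/funext => k; apply: sqint_eq => x Ox; rewrite sm_jointE.
exact: L2_norm_cvg0.
Qed.

Lemma joint_sqint v V t : measurable_fun setT V -> measurable_fun O (v t) ->
  {ae mu, forall x, Omega x -> V (t, x) = v t x} ->
  sqint mu O (v t) = sqint mu O (fun x => V (t, x)).
Proof.
move=> mV lv Vv; apply: sqint_ae => //.
  by apply: (ae_imp Vv) => x e Ox; rewrite e.
by apply: measurable_funTS; exact: measurable_slice1.
Qed.

(** The norm of [v t] is not known to be measurable in [t]; the integral built from [V] is
    measurable by Tonelli, and it is on the side of the comparison where this suffices. *)
Lemma bochner_L2_sqi v V : measurable_fun setT V ->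
  {ae leb, forall t, D t -> {ae mu, forall x, Omega x -> V (t, x) = v t x}} ->
  bochner_L2 leb D L2 L2_norm v -> sqi (leb \x mu)%E (D `*` O) V.
Proof.
move=> mV Vv [sv fv].
have lv : {ae leb, forall t, D t -> L2 (v t)}.
  by case: sv => s hs; apply: (ae_imp hs) => t {}hs Dt; have [] := hs Dt.
apply: (rect_sqi mD mO mV); apply: le_lt_trans fv.
apply: integral_le_lower_ae => //.
- by move=> t _; exact: sqint_ge0.
- by move=> t _; exact: sqre_ge0.
- apply: (rect_tonelli_measurable1 mu mD mO (J := fun z => V z ^+ 2)).
    exact: measurable_funX.
  by move=> z; exact: sqr_ge0.
apply: (ae_imp2 lv Vv) => t hl hV Dt; rewrite L2_norm_sqr.
have [mv _] := hl Dt; rewrite (joint_sqint mV mv (hV Dt)).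
exact: lexx.
Qed.

Lemma L1_le_L2 (g : E -> R) : L2 g -> (\int[mu]_(x in O) `|g x|%:E <= (fine (mu O) + 1)%:E * L2_norm g)%E.
Proof.
move=> hg; have /L2P sg := hg; have sag := sqi_abs sg.
have s1 : sqi mu O (fun=> 1 : R) by exact: sqi_cst.
rewrite (L2_norm_fin mO hg) Rint_fin//; last by apply: (sqi_ri mO fO).
(* Cauchy-Schwarz up to a constant: with first factor 1, weight [b] the L2 norm of [g] and [c = 1],
   the bound is [b * (mu O + 1)]. *)
have := inner_le_scaled (mu := mu) mO (b := Num.sqrt (inner Omega mu g g)) (c := 1) (f := fun=> 1)
  (g := fun x => `|g x|) (sqrtr_ge0 _) ler01.
have e1 : inner Omega mu (fun=> 1) (fun=> 1) = fine (mu O).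
  by rewrite /inner; under eq_Rintegral do rewrite mul1r; rewrite Rintegral_cst// mul1r.
have e2 : inner Omega mu (fun=> 1) (fun x => `|g x|) = \int[mu]_(x in O) `|g x|.
  by rewrite /inner; under eq_Rintegral do rewrite mul1r.
have e3 : inner Omega mu (fun x => `|g x|) (fun x => `|g x|) = inner Omega mu g g.
  by apply: eq_Rintegral => x _; rewrite -expr2 -[RHS]expr2 real_normK ?num_real.
rewrite e1 e2 e3 mulr1 sqr_sqrtr ?inner_ge0//.
by move=> /(_ _ _ _)/wrap[]; [exact/L2P|exact/L2P|exact: lexx|rewrite -EFinM lee_fin mulrC].
Qed.

Lemma sm_joint_slice (s : simple_map leb D L2) x :
  leb.-integrable D (EFin \o (fun t => sm_joint s (t, x))).
Proof.
have i1 : leb.-integrable D (EFin \o (fun=> 1 : R)).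
  by apply: (sqi_ri mD (leb_oo_fin a b)); exact: sqi_cst (leb_oo_fin a b).
apply: (ri_sum mD) => i; have [mA _ _] := sm_setP (s := s) i.
under [X in _ \o X]funext => t do rewrite /= mulrC.
apply: (riZ mD); apply: (ri_le mD _ _ i1); first exact: measurable_indic.
by move=> t _ /=; rewrite indicE normr_nat; case: (_ \in _).
Qed.

Lemma sm_integral_joint (s : simple_map leb D L2) x : Omega x ->
  sm_integral s x = \int[leb]_(t in D) sm_joint s (t, x).
Proof.
move=> Ox; have i1 : leb.-integrable D (EFin \o (fun=> 1 : R)).
  by apply: (sqi_ri mD (leb_oo_fin a b)); exact: sqi_cst (leb_oo_fin a b).
have iA i : leb.-integrable D (EFin \o (\1_(sm_set (s := s) i) : R -> R)).
  have [mA _ _] := sm_setP (s := s) i; apply: (ri_le mD _ _ i1); first exact: measurable_indic.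
  by move=> t _ /=; rewrite indicE normr_nat; case: (_ \in _).
rewrite /sm_joint Rint_sum//=; last first.
  by move=> i; under [X in _ \o X]funext => t do rewrite /= mulrC; exact: riZ.
apply: eq_bigr => i _; rewrite RintegralZr//; have [mA AD _] := sm_setP (s := s) i.
rewrite patchE mem_set//; congr (_ * _).
rewrite /Rintegral integral_indic//; congr fine; congr (leb _).
by apply/esym/setIidl.
Qed.

(** A simple map is inserted, for which the Bochner integral and the pointwise time integral
    coincide. The two remaining errors tend to zero along an approximating sequence. *)
Lemma bochner_integral_le (s : simple_map leb D L2) v V I :
  measurable_fun setT V -> sqi (leb \x mu)%E (D `*` O) V -> L2 I ->
  {ae leb, forall t, D t -> L2 (v t)} ->
  {ae leb, forall t, D t -> {ae mu, forall x, Omega x -> V (t, x) = v t x}} ->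
  (\int[mu]_(x in O) `|I x - \int[leb]_(t in D) V (t, x)|%:E <=
    (fine (mu O) + 1)%:E * (L2_norm (sm_integral s \- I)%R +
    \int[leb]_(t in D) L2_norm (sm_fun s t \- v t)%R))%E.
Proof.
move=> mV sV lI lv Vv; set c := fine (mu O) + 1.
have c0 : 0 < c by rewrite ltr_wpDl// fine_ge0.
have mJ := measurable_sm_joint s.
have fQ : ((leb \x mu)%E (D `*` O) < +oo)%E.
  rewrite product_measure1E//; apply: lte_mul_pinfty => //.
    by rewrite ge0_fin_numE//; exact: leb_oo_fin.
have iV := sqi_ri (measurableX mD mO) fQ sV.
have lsm : L2 (sm_integral s).
  rewrite (_ : sm_integral s = fun x => \sum_i fine (leb (sm_set (s := s) i)) * sm_val (s := s) i x)//.
  apply/L2P; apply: sqi_sum => // i; apply: sqiZ => //; apply/L2P; exact: sm_valP.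
have mvJ : measurable_fun setT (fun z => `|sm_joint s z - V z|).
  by apply: measurableT_comp => //; exact: measurable_funB.
have h1 : (\int[mu]_(x in O) `|I x - \int[leb]_(t in D) V (t, x)|%:E <=
   \int[mu]_(x in O) (`|(sm_integral s x - I x)%R|%:E + \int[leb]_(t in D) `|sm_joint s (t, x) - V (t, x)|%:E))%E.
  have mK := rect_tonelli_measurable2 leb mD mO mvJ (fun z => normr_ge0 _).
  have mGI : measurable_fun O (fun x => I x - \int[leb]_(t in D) V (t, x)).
    apply: measurable_funB; first by have [] := lI.
    by apply: ri_measurable; exact: rect_integrable2 iV.
  have msI : measurable_fun O (fun x => sm_integral s x - I x).
    by apply: measurable_funB; [have [] := lsm|have [] := lI].
  apply: lower_integral_le_ae => //.
  - by move=> x _; rewrite adde_ge0// integral_ge0.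
  - by apply: emeasurable_funD => //; apply/measurable_EFinP; exact: measurableT_comp.
  apply: (ae_imp (rect_ae2 mD mO iV)) => x hx Ox.
  have i2 : leb.-integrable D (EFin \o (fun t => sm_joint s (t, x) - V (t, x))).
    by apply: (riB mD) => //; [exact: sm_joint_slice|exact: hx].
  rewrite Rint_fin//; last exact: ri_abs.
  rewrite -EFinD lee_fin.
  rewrite (_ : I x - _ = - (sm_integral s x - I x) + (sm_integral s x - \int[leb]_(t in D) V (t, x))); last by ring.
  apply: le_trans (ler_normD _ _) _; rewrite normrN lerD2l sm_integral_joint// -RintegralB//.
  - exact: le_normr_Rintegral.
  - exact: sm_joint_slice.
  - exact: hx.
apply: le_trans h1 _.
rewrite ge0_integralD//; last 3 first.
- by apply/measurable_EFinP; apply: measurableT_comp => //; apply: measurable_funB; [have [] := lsm|have [] := lI].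
- by move=> x _; exact: integral_ge0.
- have mK := rect_tonelli_measurable2 leb mD mO mvJ (fun z => normr_ge0 _); exact: mK.
have n0 t : (0 <= L2_norm (sm_fun s t \- v t)%R)%E by exact: L2_norm_ge0.
rewrite ge0_muleDr//; [|exact: L2_norm_ge0|exact: integral_ge0].
apply: leeD; first exact: L1_le_L2 (L2B mO lsm lI).
rewrite -(rect_tonelli leb mu mD mO mvJ (fun z => normr_ge0 _)).
rewrite -lee_pdivrMl//.
have mK := rect_tonelli_measurable1 mu mD mO mvJ (fun z => normr_ge0 _).
rewrite -ge0_integralZl//; last 2 first.
- by move=> t _; exact: integral_ge0.
- by rewrite lee_fin invr_ge0 ltW.
apply: integral_le_lower_ae => //.
- by move=> t _; apply: mule_ge0; [rewrite lee_fin invr_ge0 ltW|exact: integral_ge0].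
- exact: measurable_funeM.
apply: (ae_imp2 lv Vv) => t hl hV Dt; rewrite lee_pdivrMl//.
have lsf : L2 (sm_fun s t).
  apply/L2P; apply: sqi_sum => // i; apply: sqiZ => //; apply/L2P; exact: sm_valP.
apply: le_trans (L1_le_L2 (L2B mO lsf (hl Dt))).
apply: ae_ge0_le_integral => //.
- by apply/measurable_EFinP; apply: measurable_funTS; exact: measurable_slice1 mvJ.
- apply/measurable_EFinP; apply: measurableT_comp => //.
  by have [] := L2B mO lsf (hl Dt).
by apply: (ae_imp (hV Dt)) => x e Ox; rewrite lee_fin sm_jointE// e.
Qed.

Lemma bochner_integral_joint v V I :
  measurable_fun setT V -> sqi (leb \x mu)%E (D `*` O) V ->
  {ae leb, forall t, D t -> {ae mu, forall x, Omega x -> V (t, x) = v t x}} ->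
  is_bochner_integral leb D L2 L2_norm v I ->
  {ae mu, forall x, Omega x -> I x = \int[leb]_(t in D) V (t, x)}.
Proof.
move=> mV sV Vv [lI [s [hs h1 h2]]].
have lv : {ae leb, forall t, D t -> L2 (v t)}.
  by apply: (ae_imp hs) => t {}hs Dt; have [] := hs Dt.
have fQ : ((leb \x mu)%E (D `*` O) < +oo)%E.
  rewrite product_measure1E//; apply: lte_mul_pinfty => //.
    by rewrite ge0_fin_numE//; exact: leb_oo_fin.
have iV := sqi_ri (measurableX mD mO) fQ sV.
have iG : mu.-integrable O (EFin \o (fun x => I x - \int[leb]_(t in D) V (t, x))).
  by apply: (riB mO); [apply: (sqi_ri mO fO); exact/L2P|exact: rect_integrable2 iV].
suff h0 : \int[mu]_(x in O) `|I x - \int[leb]_(t in D) V (t, x)| = 0.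
  by apply: (ae_imp (Rint_abs_eq0 mO iG h0)) => x e Ox; apply/eqP; rewrite -subr_eq0 e.
have c0 : 0 < fine (mu O) + 1 by rewrite ltr_wpDl// fine_ge0.
apply/eqP; rewrite eq_le Rintegral_ge0 ?andbT//; apply/ler_addgt0Pr => e e0; rewrite add0r.
have p : 0 < e / (2 * (fine (mu O) + 1)) by rewrite divr_gt0// mulr_gt0.
have h10 k : (0 <= \int[leb]_(t in D) L2_norm (sm_fun (s k) t \- v t)%R)%E.
  by apply: integral_ge0 => t _; exact: L2_norm_ge0.
have h20 k : (0 <= L2_norm (sm_integral (s k) \- I)%R)%E by exact: L2_norm_ge0.
have [K1 hK1] := (ecvg0P h10).1 h1 _ p; have [K2 hK2] := (ecvg0P h20).1 h2 _ p.
rewrite -lee_fin -(Rint_fin mO (ri_abs iG)).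
apply: le_trans (bochner_integral_le (s (maxn K1 K2)) mV sV lI lv Vv) _.
have {}hK1 := hK1 _ (leq_maxl K1 K2); have {}hK2 := hK2 _ (leq_maxr K1 K2).
apply: le_trans (lee_wpmul2l _ (leeD hK2 hK1)) _; first by rewrite lee_fin ltW.
rewrite -EFinD -EFinM lee_fin -mulr2n -mulr_natl.
rewrite le_eqVlt; apply/orP; left; apply/eqP; field; exact: lt0r_neq0.
Qed.

End Representative.
End TimeSpace.

(** * Functions continuous in time and measurable in space *)

Section Caratheodory.
Context {R : realType} {n : nat}.
Local Notation E := 'rV[R]_n.+1.
Local Notation leb := (@lebesgue_measure R).
Local Notation oo a b := (`]a, b[%classic : set (measurableTypeR R)).
Variable mu : {sigma_finite_measure set (borelRn R n) -> \bar R}.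
Variable Omega : set E.
Local Notation O := (Omega : set (borelRn R n)).
Hypothesis mO : measurable O.
Hypothesis fO : (mu O < +oo)%E.
Implicit Types (v : R -> E -> R) (V : measurableTypeR R * borelRn R n -> R).
Local Notation L2 := (L2 Omega mu).
Local Notation L2_norm := (L2_norm Omega mu).
Variable T : R.
Hypothesis T0 : 0 < T.
Local Notation D := (oo 0 T).
Let mD : measurable D. Proof. exact: measurable_itv. Qed.

Lemma measurable_fun_real_cvg d (X : measurableType d) (A : set X) (f : nat -> X -> R) (g : X -> R) :
  (forall k, measurable_fun A (f k)) -> (forall x, A x -> f k x @[k --> \oo] --> g x) ->
  measurable_fun A g.
Proof.
move=> mf fg; apply/measurable_EFinP; apply: (emeasurable_fun_cvg (fun k => EFin \o f k)).
  by move=> k; apply/measurable_EFinP.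
by move=> x Ax; apply: (cvg_EFin _ (fg x Ax)); exact: nearW.
Qed.

Section Grid.
Variable v : R -> E -> R.
Hypothesis cv : forall x, Omega x -> contT T (v ^~ x).

Let pt (m i : nat) : R := i%:R * T / m.+1%:R.
Let cell m i : set (measurableTypeR R) := `[pt m i, pt m i.+1[%classic.
Let V m (z : measurableTypeR R * borelRn R n) : R :=
  \sum_(i < m.+1) \1_(cell m i) z.1 * (v (pt m i) \_ Omega) z.2.

Let pt_ge0 m i : 0 <= pt m i.
Proof. by rewrite /pt divr_ge0// mulr_ge0// ltW. Qed.

Let V_out m t x : ~ (0 <= t < T) \/ ~ Omega x -> V m (t, x) = 0.
Proof.
move=> h; rewrite /V big1// => i _ /=; case: h => h; last by rewrite patchE memNset// mulr0.
rewrite indicE memNset ?mul0r// /cell /= in_itv /= => /andP[h1 h2]; apply: h.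
rewrite (le_trans (pt_ge0 m i) h1) /=.
apply: lt_le_trans h2 _; rewrite /pt ler_pdivrMr// mulrC ler_pM2l// ler_nat.
exact: ltn_ord.
Qed.

Let V_in m t x : 0 <= t < T -> Omega x ->
  exists i : nat, [/\ (i < m.+1)%N, pt m i <= t < pt m i.+1 & V m (t, x) = v (pt m i) x].
Proof.
move=> /andP[t0 tT] Ox; pose i := Num.truncn (t * m.+1%:R / T).
have r0 : 0 <= t * m.+1%:R / T by rewrite divr_ge0 ?mulr_ge0// ltW.
have /andP[i1 i2] := truncn_itv r0.
have im : (i < m.+1)%N.
  rewrite -(ltr_nat R); apply: le_lt_trans i1 _; rewrite ltr_pdivrMr// mulrC ltr_pM2l//.
have e1 : pt m i <= t by rewrite /pt ler_pdivrMr// -ler_pdivlMr.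
have e2 : t < pt m i.+1 by rewrite /pt ltr_pdivlMr// -ltr_pdivrMr.
exists i; split => //; first by rewrite e1 e2.
rewrite /V (bigD1 (Ordinal im))//= big1 ?addr0.
  rewrite indicE mem_set; last by rewrite /cell /= in_itv /= e1 e2.
  by rewrite mul1r patchE mem_set.
move=> j ji; rewrite indicE memNset ?mul0r// /cell /= in_itv /= => /andP[h1 h2].
have lti (a b : nat) : pt m a < pt m b -> (a < b)%N.
  by rewrite /pt ltr_pM2r ?invr_gt0// ltr_pM2r// ltr_nat.
have := lti _ _ (le_lt_trans h1 e2); have := lti _ _ (le_lt_trans e1 h2).
rewrite !ltnS => a1 a2; move/eqP : ji; apply; apply/val_inj/eqP => /=.
by rewrite eqn_leq a1 a2.
Qed.

(** Sampling time at the left end points of uniform grids gives jointly measurable functions, which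
    converge by continuity in time. The cells are half-open, so [t = T] is excluded. *)
Lemma caratheodory_joint : (forall t, 0 <= t <= T -> measurable_fun O (v t)) ->
  exists V, measurable_fun setT V /\
    forall t x, 0 <= t < T -> Omega x -> V (t, x) = v t x.
Proof.
move=> mv; pose W (z : measurableTypeR R * borelRn R n) : R :=
  if (0 <= z.1 < T) && (z.2 \in Omega) then v z.1 z.2 else 0.
exists W; split; last by move=> t x h Ox; rewrite /W h mem_set.
apply: (@measurable_fun_real_cvg _ _ setT V W).
  move=> m; apply: measurable_sum => i; apply: measurable_prod.
    by apply: measurable_indic; exact: measurable_itv.
  apply: measurable_patch => //; apply: mv.
  rewrite pt_ge0 /= /pt ler_pdivrMr// mulrC ler_pM2l// ler_nat.
  by rewrite ltnW.
move=> [t x] _; rewrite /W /=; case: ifP; last first.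
  move=> h; rewrite (_ : (fun k => _) = cst 0); first exact: cvg_cst.
  apply/funext => k; apply: V_out; case: (boolP (0 <= t < T)) h => [_ /= h|h _]; last by left; exact/negP.
  by right => Ox; move: h; rewrite mem_set.
move=> /andP[tT /set_mem Ox]; apply/cvgrPdist_lt => e e0.
have tT' : 0 <= t <= T by case/andP: tT => -> /ltW.
have [d [d0 hd]] := (contTP T _).1 (cv Ox) t tT' e e0.
near=> m; have [i [im /andP[i1 i2] ->]] := V_in m tT Ox.
apply: hd.
  by rewrite pt_ge0 (le_trans i1)//; case/andP: tT'.
rewrite ger0_norm ?subr_ge0// ltrBlDr; apply: lt_le_trans i2 _.
rewrite /pt -[i.+1]addn1 natrD !mulrDl mul1r addrC lerD2r.
rewrite ler_pdivrMr// -ler_pdivrMl// mulrC.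
have : T / d <= m%:R by near: m; exact: nbhs_infty_ger.
by move=> /le_trans -> //; rewrite ler_nat.
Unshelve. all: by end_near. Qed.

(** A null set contains no interval, so every time is a limit of times with a measurable slice, and
    continuity passes measurability to the limit. *)
Lemma measurable_slices_dense :
  {ae leb, forall t, D t -> measurable_fun O (v t)} ->
  forall t, 0 <= t <= T -> measurable_fun O (v t).
Proof.
move=> h t tT.
have hm m : exists s : R, [/\ 0 <= s <= T, `|t - s| < m.+1%:R^-1 & measurable_fun O (v s)].
  pose a := Num.max 0 (t - m.+1%:R^-1); pose b := Num.min T (t + m.+1%:R^-1).
  have m0 : (0 : R) < m.+1%:R^-1 by rewrite invr_gt0.
  have ab : a < b.
    rewrite /a /b gt_max !lt_min T0 /=; case/andP: tT => t0 tT; apply/and3P.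
    by move: (m.+1%:R^-1) m0 => r r0; split; lra.
  apply/not_existsP => hn; have [N [mN N0 hN]] := h.
  have sub : oo a b `<=` N.
    move=> s; rewrite /= in_itv /= /a /b gt_max lt_min => /andP[/andP[s0 s1] /andP[s2 s3]].
    apply: hN => /= hs; apply: (hn s); split; first by rewrite !ltW.
      by rewrite ltr_norml; apply/andP; move: (m.+1%:R^-1) s1 s3 => r s1 s3; split; lra.
    by apply: hs; rewrite /= in_itv /= s0.
  have : (leb (oo a b) <= leb N)%E by apply: le_measure => //; rewrite inE//; exact: measurable_itv.
  by rewrite N0 lebesgue_measure_itv /= lte_fin ab -EFinB lee_fin leNgt subr_gt0 ab.
have [s hs] := choice hm.
apply: (@measurable_fun_real_cvg _ _ O (fun m => v (s m))).
  by move=> m; have [] := hs m.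
move=> x Ox; apply/cvgrPdist_lt => e e0.
have [d [d0 hd]] := (contTP T _).1 (cv Ox) t tT e e0.
near=> m; have [sT ts _] := hs m; apply: hd => //; apply: lt_trans ts _.
rewrite invf_plt ?posrE//.
have : d^-1 <= m%:R by near: m; exact: nbhs_infty_ger.
by move=> /le_lt_trans; apply; rewrite ltr_nat.
Unshelve. all: by end_near. Qed.

End Grid.

Lemma continuous_bounded_itv (g : R -> R) : continuous g ->
  exists M, 0 <= M /\ forall t, 0 <= t <= T -> `|g t| <= M.
Proof.
move=> cg; have ck : compact (g @` `[0, T]%classic).
  by apply: continuous_compact; [exact: continuous_subspaceT|exact: segment_compact].
have [M [_ hM]] := compact_bounded ck; exists (`|M| + 1); split; first by rewrite addr_ge0.
move=> t tT; apply: (hM (`|M| + 1)); first by rewrite ltr_pwDr// ler_norm.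
by exists t => //=; rewrite in_itv.
Qed.

Lemma sqi_time_mul (g : R -> R) V : continuous g -> measurable_fun setT V ->
  sqi (leb \x mu)%E (D `*` O) V ->
  measurable_fun setT (fun z : measurableTypeR R * borelRn R n => g z.1 * V z) /\
  sqi (leb \x mu)%E (D `*` O) (fun z => g z.1 * V z).
Proof.
move=> cg mV sV; have mQ : measurable (D `*` O) by exact: measurableX.
have mg : measurable_fun setT (fun z : measurableTypeR R * borelRn R n => g z.1 * V z).
  apply: measurable_funM => //; apply: measurableT_comp; last exact: measurable_fst.
  exact: continuous_measurable_fun.
split=> //; have [M [M0 hM]] := continuous_bounded_itv cg.
apply: (sqi_le mQ _ _ (sqiZ mQ M sV)); first exact: measurable_funTS.
move=> [t x] [/= + _]; rewrite in_itv /= => /andP[t0 tT].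
by rewrite !normrM (ger0_norm M0) ler_wpM2r// hM// !ltW.
Qed.

(** The passage from Bochner calculus to calculus at fixed [x]. Both Bochner integrals of [H1_time]
    are the same [I]; identified with pointwise time integrals, they give the weak identity at
    almost every [x], to which [weak_prim] applies. *)
Lemma H1_time_prim v vt : (forall x, Omega x -> contT T (v ^~ x)) ->
  {ae leb, forall t, D t -> measurable_fun O (v t)} ->
  H1_time Omega mu T v vt ->
  exists V, [/\ measurable_fun setT V, sqi (leb \x mu)%E (D `*` O) V,
    {ae leb, forall t, D t -> {ae mu, forall x, Omega x -> V (t, x) = vt t x}} &
    {ae mu, forall x, Omega x -> sqi leb D (fun t => V (t, x)) /\
      forall t, 0 <= t <= T -> v t x = v 0 x + prim (fun s => V (s, x)) t}].
Proof.
move=> cv mv [hv hvt hw]; have [V [mV Vvt]] := bochner_joint mO fO hvt.1.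
have sV := bochner_L2_sqi mO mV Vvt hvt.
have [U [mU Uv]] := caratheodory_joint cv (measurable_slices_dense cv mv).
have Uv' : {ae leb, forall t, D t -> {ae mu, forall x, Omega x -> U (t, x) = v t x}}.
  apply: aeW => t; rewrite /= in_itv /= => /andP[t0 tT]; apply: aeW => x Ox.
  by apply: Uv => //; rewrite ltW.
have sU := bochner_L2_sqi mO mU Uv' hv.
exists V; split => //.
have fQ : ((leb \x mu)%E (D `*` O) < +oo)%E.
  rewrite product_measure1E//; apply: lte_mul_pinfty => //.
    by rewrite ge0_fin_numE//; exact: leb_oo_fin.
pose P (p : rat * rat * nat) x := Omega x -> 0 < ratr p.1.1 :> R -> 0 < ratr p.1.2 :> R ->
  ratr p.1.1 + p.2.+1%:R^-1 < T -> ratr p.1.2 + p.2.+1%:R^-1 < T ->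
  let phi := kern_prim T (ratr p.1.1) (ratr p.1.2) p.2.+1%:R^-1 in
  \int[leb]_(t in D) (v t x * phi^`()%classic t) = - \int[leb]_(t in D) (V (t, x) * phi t).
have hP p : {ae mu, forall x, P p x}.
  case: p => [[a b] m]; rewrite /P /=.
  case: (pselect ([/\ 0 < ratr a :> R, 0 < ratr b :> R, ratr a + m.+1%:R^-1 < T & ratr b + m.+1%:R^-1 < T])); last first.
    by move=> hn; apply: aeW => x _ h1 h2 h3 h4; exfalso; apply: hn.
  move=> [h1 h2 h3 h4]; set phi := kern_prim _ _ _ _.
  have tp : test_fun_time T phi by apply: kern_prim_test => //; rewrite invr_gt0.
  have sp := derive1n_smooth tp.
  have [I [I1 I2]] := hw phi tp.
  have [m1 s1] := sqi_time_mul (smooth_continuous (smooth_derive sp)) mU sU.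
  have [m2 s2] := sqi_time_mul (smooth_continuous sp) mV sV.
  have e1 := bochner_integral_joint mO fO m1 s1 _ I1.
  have e2 := bochner_integral_joint mO fO (measurable_funN m2) (sqiN (measurableX mD mO) s2) _ I2.
  have {}e1 := e1 _; have {}e2 := e2 _.
  have {}e1 : {ae mu, forall x, Omega x -> I x = \int[leb]_(t in D) (phi^`()%classic t * U (t, x))}.
    by apply: e1; apply: (ae_imp Uv') => t h Dt; apply: (ae_imp (h Dt)) => x e Ox /=; rewrite e.
  have {}e2 : {ae mu, forall x, Omega x -> I x = \int[leb]_(t in D) - (phi t * V (t, x))}.
    by apply: e2; apply: (ae_imp Vvt) => t h Dt; apply: (ae_imp (h Dt)) => x e Ox /=; rewrite e.
  have e3 := rect_ae2 mD mO (sqi_ri (measurableX mD mO) fQ s2).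
  apply: (ae_imp3 e1 e2 e3) => x {}e1 {}e2 {}e3 Ox _ _ _ _.
  transitivity (I x).
    rewrite e1//; apply: eq_Rintegral => t; rewrite mem_setE in_itv /= => /andP[t0 tT].
    have tT' : 0 <= t < T by rewrite (ltW t0) tT.
    by rewrite (Uv _ _ tT' Ox) mulrC.
  rewrite e2//; under [in RHS]eq_Rintegral do rewrite mulrC.
  rewrite -[RHS]mulN1r -RintegralZl//; last exact: e3.
  by apply: eq_Rintegral => t _; rewrite mulN1r.
(* The rational kernels are enumerated through [unpickle]; numbers that code no triple carry a
   trivial condition. *)
have hP' : {ae mu, forall x, forall k, if unpickle k is Some p then P p x else True}.
  by apply: ae_forall => k; case: (unpickle k) => [p|]; [exact: hP|exact: aeW].
have hs := rect_sqi_ae2 mD mO mV sV.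
apply: (ae_imp2 hP' hs) => x hx sx Ox; split; first exact: sx.
apply: weak_prim => //; [exact: cv|by apply: (sqi_ri mD (leb_oo_fin 0 T)); exact: sx|].
move=> a b m h1 h2 h3 h4; have := hx (pickle (a, b, m)); rewrite pickleK.
exact.
Qed.

End Caratheodory.

(** * The energy estimate at a fixed point of space *)

Section Grid.
Context {R : realType}.
Local Notation leb := (@lebesgue_measure R).
Local Notation oo a b := (`]a, b[%classic : set (measurableTypeR R)).
Local Notation ri a b f := (leb.-integrable (oo a b) (EFin \o f)).

Lemma leb_oo (a b : R) : a <= b -> fine (leb (oo a b)) = b - a.
Proof.
move=> ab; rewrite lebesgue_measure_itv /= lte_fin; case: ltP => //= ba.
by apply/eqP; rewrite eq_sym subr_eq0 eq_le ab ba.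
Qed.

Lemma Rint_oo_cst (a b c : R) : a <= b -> \int[leb]_(t in oo a b) c = c * (b - a).
Proof. by move=> ab; rewrite Rintegral_cst ?leb_oo//; exact: measurable_itv. Qed.

Lemma ri_oo_cst (a b c : R) : ri a b (fun=> c).
Proof.
have mD : measurable (oo a b) by exact: measurable_itv.
by apply: (sqi_ri mD (leb_oo_fin a b)); exact: sqi_cst (leb_oo_fin a b).
Qed.

Lemma Rint_abs_sqr (a b : R) (f : R -> R) : a < b -> sqi leb (oo a b) f ->
  (\int[leb]_(t in oo a b) `|f t|) ^+ 2 <= (b - a) * \int[leb]_(t in oo a b) (f t ^+ 2).
Proof.
move=> ab sf; have mD : measurable (oo a b) by exact: measurable_itv.
have iaf := ri_abs (sqi_ri mD (leb_oo_fin a b) sf).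
set A := \int[leb]_(t in _) `|_|; set B := \int[leb]_(t in _) _.
(* [l] is the mean of the modulus of [f]; Cauchy-Schwarz comes from integrating the square of the
   deviation from it. *)
pose l := A / (b - a); have ba : 0 < b - a by rewrite subr_gt0.
have h : 0 <= \int[leb]_(t in oo a b) ((f t ^+ 2 + (- (2 * l)) * `|f t|) + l ^+ 2).
  apply: Rintegral_ge0 => t _; rewrite -(real_normK (num_real (f t))).
  by have := sqr_ge0 (`|f t| - l); nra.
move: h; rewrite RintegralD//; last 2 first.
- by apply: (riD mD); [exact: sf.2|apply: (riZ mD)].
- exact: ri_oo_cst.
rewrite RintegralD//; [|exact: sf.2|by apply: (riZ mD)].
have ab' := ltW ab; rewrite RintegralZl// Rint_oo_cst// -/A -/B => h.
have lA : A = l * (b - a) by rewrite /l divfK// gt_eqF.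
by rewrite lA in h *; move: h; nra.
Qed.

Variables (T : R) (K : nat).
Hypotheses (T0 : 0 < T) (K0 : (0 < K)%N).
Let tau : R := T / K%:R.
Definition tk (k : nat) : R := k%:R * (T / K%:R).
Local Notation slab k := (oo (tk k) (tk k.+1)).

Let K0' : (0 : R) < K%:R. Proof. by rewrite ltr0n. Qed.

Lemma tau_gt0 : 0 < tau. Proof. by rewrite divr_gt0. Qed.

Lemma tkS k : tk k.+1 = tk k + tau.
Proof. by rewrite /tk -[k.+1]addn1 natrD mulrDl mul1r. Qed.

Lemma tk_lt k : tk k < tk k.+1. Proof. by rewrite tkS ltrDl tau_gt0. Qed.

Lemma tk0 : tk 0 = 0. Proof. by rewrite /tk mul0r. Qed.

Lemma tkK : tk K = T. Proof. by rewrite /tk mulrCA divff ?mulr1// gt_eqF. Qed.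

Lemma tk_mono i j : (i <= j)%N -> tk i <= tk j.
Proof. by move=> ij; rewrite /tk ler_pM2r ?tau_gt0// ler_nat. Qed.

Lemma tk_ge0 k : 0 <= tk k. Proof. by rewrite -tk0 tk_mono. Qed.

Lemma tk_leT k : (k <= K)%N -> tk k <= T. Proof. by move=> kK; rewrite -tkK tk_mono. Qed.

Lemma ri_slab k f : (k < K)%N -> ri 0 T f -> ri (tk k) (tk k.+1) f.
Proof.
move=> kK; apply: ri_sub; [exact: measurable_itv|exact: measurable_itv|].
by apply: subset_itvW; [exact: tk_ge0|exact: tk_leT].
Qed.

Lemma sqi_slab k f : (k < K)%N -> sqi leb (oo 0 T) f -> sqi leb (slab k) f.
Proof.
move=> kK; apply: sqi_sub; [exact: measurable_itv|exact: measurable_itv|].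
by apply: subset_itvW; [exact: tk_ge0|exact: tk_leT].
Qed.

(** The interval is cut at the grid nodes. The relational form serves estimates of increments and
    identities between them alike. *)
Lemma grid_chain (P : R -> R -> Prop) :
  (forall a b c : R, P a b -> P b c -> P a c) ->
  (forall k (a b : R), (k < K)%N -> tk k <= a -> a <= b -> b <= tk k.+1 -> P a b) ->
  forall a b : R, 0 <= a -> a <= b -> b <= T -> P a b.
Proof.
move=> tr sl; suff h k : (k <= K)%N -> forall a b : R, 0 <= a -> a <= b -> b <= tk k -> P a b.
  by move=> a b a0 ab bT; apply: (h K) => //; rewrite tkK.
elim: k => [_ a b a0 ab|k IH kK a b a0 ab bk].
  rewrite tk0 => b0; apply: (sl 0%N) => //; first by rewrite tk0.
  by rewrite (le_trans b0)// tk_ge0.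
have [bk'|kb] := leP b (tk k); first by apply: IH => //; exact: ltnW.
have [ak|ka] := leP (tk k) a; first by apply: (sl k).
apply: (tr _ (tk k)); first by apply: IH => //; [exact: ltnW|exact: ltW].
by apply: (sl k) => //; exact: ltW.
Qed.

Lemma prim_slabs f j : ri 0 T f -> (j <= K)%N ->
  prim f (tk j) = \sum_(k < j) \int[leb]_(t in slab k) f t.
Proof.
move=> hf; elim: j => [_|j IH jK]; first by rewrite big_ord0 prim_le0// tk0.
rewrite big_ord_recr /= -IH ?(ltnW jK)//.
by rewrite -(prim_diff (T := T)) ?tk_ge0 ?tk_leT// ?(ltW (tk_lt j))//; ring.
Qed.

Definition step (c : nat -> R) (t : R) : R :=
  \sum_(k < K) c k * \1_(`[tk k, tk k.+1[%classic : set R) t.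

Lemma stepE c k t : (k < K)%N -> tk k <= t < tk k.+1 -> step c t = c k.
Proof.
move=> kK /andP[t1 t2]; rewrite /step (bigD1 (Ordinal kK))//= big1 ?addr0.
  by rewrite indicE mem_set ?mulr1//= in_itv /= t1 t2.
move=> j ji; rewrite indicE memNset ?mulr0//= in_itv /= => /andP[h1 h2].
move/eqP : ji; apply; apply/val_inj/eqP => /=.
have lti (a b : nat) : tk a < tk b -> (a < b)%N.
  by rewrite /tk ltr_pM2r ?tau_gt0// ltr_nat.
have := lti _ _ (le_lt_trans h1 t2); have := lti _ _ (le_lt_trans t1 h2).
by rewrite !ltnS => a1 a2; rewrite eqn_leq a1 a2.
Qed.

Lemma ri_step c : ri 0 T (step c).
Proof.
have mD : measurable (oo 0 T) by exact: measurable_itv.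
apply: (ri_sum mD) => k; apply: (riZ mD); apply: (ri_le mD _ _ (ri_oo_cst 0 T 1)).
  by apply: measurable_indic; exact: measurable_itv.
by move=> t _ /=; rewrite indicE normr_nat; case: (_ \in _).
Qed.

Lemma prim_step c k (a b : R) : (k < K)%N -> tk k <= a -> a <= b -> b <= tk k.+1 ->
  prim (step c) b - prim (step c) a = c k * (b - a).
Proof.
move=> kK ka ab bk; rewrite (prim_diff (T := T)) ?ri_step//.
- rewrite -Rint_oo_cst//; apply: eq_Rintegral => t; rewrite mem_setE in_itv /= => /andP[h1 h2].
  by rewrite (stepE c kK)// (le_trans ka (ltW h1)) (lt_le_trans h2 bk).
- exact: le_trans (tk_ge0 k) ka.
- exact: le_trans bk (tk_leT kK).
Qed.

(** With [A] the primitive of the slab constants, [A + z] and [A - z] are both nondecreasing and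
    Lipschitz. Half the difference of their densities is a density of [z], and its modulus is at
    most half their sum, a density of [A]. The bound thus stays local to each slab, where a global
    Lipschitz constant would lose the tau-weighted sums of squares. *)
Lemma slab_lipschitz_prim (z : R -> R) (M : nat -> R) : (forall k, 0 <= M k) ->
  (forall k (a b : R), (k < K)%N -> tk k <= a -> a <= b -> b <= tk k.+1 ->
     `|z b - z a| <= M k * (b - a)) ->
  exists g, [/\ ri 0 T g, forall t, 0 <= t <= T -> z t = z 0 + prim g t &
    forall k, (k < K)%N -> \int[leb]_(t in slab k) `|g t| <= M k * tau].
Proof.
move=> M0 hz; pose A := prim (step M).
have h1 : forall a b : R, 0 <= a -> a <= b -> b <= T -> `|z b - z a| <= A b - A a.
  apply: grid_chain => [a b c h h'|k a b kK ka ab bk]; last by rewrite (prim_step M kK)//; exact: hz kK _ _ _.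
  rewrite (_ : z c - z a = (z b - z a) + (z c - z b)); last by ring.
  by apply: le_trans (ler_normD _ _) _; apply: le_trans (lerD h h') _; lra.
pose B := \sum_(k < K) M k; have B0 : 0 <= B by apply: sumr_ge0 => k _.
have h2 : forall a b : R, 0 <= a -> a <= b -> b <= T -> A b - A a <= B * (b - a).
  apply: grid_chain => [a b c h h'|k a b kK ka ab bk]; first by lra.
  rewrite (prim_step M kK)// ler_wpM2r ?subr_ge0// /B (bigD1 (Ordinal kK))//= lerDl.
  by apply: sumr_ge0 => i _.
have T0' := ltW T0; have B2 : 0 <= 2 * B by rewrite mulr_ge0.
have [|G1 [G10 iG1 hG1]] := @lipschitz_density _ T (fun t => A t + z t) (2 * B) T0' B2.
  move=> a b a0 ab bT; have := h1 a b a0 ab bT; have := h2 a b a0 ab bT.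
  by rewrite ler_norml => h3 /andP[h4 h5]; apply/andP; split; lra.
have [|G2 [G20 iG2 hG2]] := @lipschitz_density _ T (fun t => A t - z t) (2 * B) T0' B2.
  move=> a b a0 ab bT; have := h1 a b a0 ab bT; have := h2 a b a0 ab bT.
  by rewrite ler_norml => h3 /andP[h4 h5]; apply/andP; split; lra.
have mD (a b : R) : measurable (oo a b) by exact: measurable_itv.
have iG : ri 0 T (fun t => 2^-1 * (G1 t - G2 t)) by apply: (riZ (mD _ _)); exact: riB.
exists (fun t => 2^-1 * (G1 t - G2 t)); split => //.
  move=> t /andP[t0 tT].
  have sub : oo 0 t `<=` oo 0 T by apply: subset_itvW.
  have i1 := ri_sub (mD 0 T) (mD 0 t) sub iG1; have i2 := ri_sub (mD 0 T) (mD 0 t) sub iG2.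
  rewrite /prim RintegralZl//; last exact: riB.
  rewrite RintegralB// hG1// hG2//; lra.
move=> k kK; have i1 := ri_slab kK iG1; have i2 := ri_slab kK iG2.
have -> : M k * tau = \int[leb]_(t in slab k) (2^-1 * (G1 t + G2 t)).
  rewrite RintegralZl//; last exact: riD.
  rewrite RintegralD// hG1 ?hG2 ?tk_ge0 ?tk_leT// ?(ltW (tk_lt k))//.
  have := @prim_step M k (tk k) (tk k.+1) kK (lexx _) (ltW (tk_lt k)) (lexx _).
  rewrite -/A (_ : tk k.+1 - tk k = tau); last by rewrite tkS addrAC subrr add0r.
  by move=> <-; lra.
apply: Rint_le_ae => //; [apply: ri_abs; exact: ri_slab|by apply: (riZ (mD _ _)); exact: riD|].
apply: aeW => t _; rewrite normrM ger0_norm// ler_wpM2l//.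
by rewrite (le_trans (ler_normB _ _))// !ger0_norm.
Qed.

Section Interpolant.
Variables (v : nat -> R) (y : R -> R).
Hypothesis hy : forall k (s : R), (k < K)%N -> 0 <= s <= 1 ->
  y ((k%:R + s) * tau) = s * v k.+1 + (1 - s) * v k.
Definition slope (v : nat -> R) (k : nat) : R := (v k.+1 - v k) / (T / K%:R).

Lemma interp_slab k t : (k < K)%N -> tk k <= t <= tk k.+1 ->
  y t = v k + (t - tk k) * slope v k.
Proof.
move=> kK /andP[t1 t2]; have tp := tau_gt0; have tn : tau != 0 by rewrite gt_eqF.
pose s := (t - tk k) / tau.
have -> : t = (k%:R + s) * tau by rewrite mulrDl divfK// /tk -/tau; ring.
rewrite hy//; last first.
  apply/andP; split; first by rewrite /s divr_ge0 ?subr_ge0// ltW.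
  by rewrite /s ler_pdivrMr// mul1r lerBlDl -tkS.
by rewrite /slope -/tau mulrDl /tk -/tau; field.
Qed.

Lemma interp_node k : (k <= K)%N -> y (tk k) = v k.
Proof.
case: k => [_|k kK]; first by rewrite (@interp_slab 0%N) ?subrr ?mul0r ?addr0// lexx ltW// tk_lt.
rewrite (@interp_slab k)//; last by rewrite lexx ltW// tk_lt.
have tn : tau != 0 by rewrite gt_eqF// tau_gt0.
by rewrite tkS /slope -/tau; field.
Qed.

Lemma interp_prim t : 0 <= t <= T -> y t = y 0 + prim (step (slope v)) t.
Proof.
move=> /andP[t0 tT].
suff : y t - y 0 = prim (step (slope v)) t - prim (step (slope v)) 0.
  by rewrite (prim_le0 _ (lexx 0)) subr0 => <-; ring.
apply: (@grid_chain (fun a b => y b - y a = prim (step (slope v)) b - prim (step (slope v)) a)) => //.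
  by move=> a b c h h'; lra.
move=> k a b kK ka ab bk; rewrite (prim_step _ kK)// !(@interp_slab k)//; first by ring.
  by rewrite ka (le_trans ab).
by rewrite (le_trans ka ab).
Qed.

Lemma interp_contT : contT T y.
Proof.
have h := prim_continuous (ltW T0) (ri_step (slope v)).
have := (contTP T _).1 h => h'; apply/contTP => t tT e e0.
have [d [d0 hd]] := h' t tT e e0; exists d; split => // s sT ts.
rewrite (interp_prim tT) (interp_prim sT) (_ : _ - _ = prim (step (slope v)) t - prim (step (slope v)) s); last by ring.
exact: hd.
Qed.

Lemma interp_affine k : (k < K)%N -> affine_on_interval (tk k) (tk k.+1) y.
Proof.
move=> kK; exists (slope v k), (v k - tk k * slope v k) => t h.
by rewrite (interp_slab kK h); ring.
Qed.

Lemma interp_affine_sub k a b : (k < K)%N -> tk k <= a -> b <= tk k.+1 -> affine_on_interval a b y.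
Proof.
move=> kK ka bk; have [c [d h]] := interp_affine kK; exists c, d => t /andP[h1 h2].
by apply: h; rewrite (le_trans ka h1) (le_trans h2 bk).
Qed.

End Interpolant.

End Grid.

(** * The energy inequality for one trajectory *)

Section PointwiseEnergy.
Context {R : realType}.
Local Notation leb := (@lebesgue_measure R).
Local Notation oo a b := (`]a, b[%classic : set (measurableTypeR R)).
Local Notation ri a b f := (leb.-integrable (oo a b) (EFin \o f)).

Let moo (a b : R) : measurable (oo a b). Proof. exact: measurable_itv. Qed.

Lemma zero_mean_bound (a b m : R) (h z : R -> R) : ri a b h -> ri a b (fun t => h t * z t) ->
  \int[leb]_(t in oo a b) h t = 0 -> (forall t, a < t < b -> `|z t - z a| <= m) ->
  `|\int[leb]_(t in oo a b) (h t * z t)| <= m * \int[leb]_(t in oo a b) `|h t|.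
Proof.
move=> ih ihz h0 hz.
have i1 : ri a b (fun t => h t * z t - z a * h t) by apply: (riB (moo a b)) => //; exact: riZ.
have -> : \int[leb]_(t in oo a b) (h t * z t) = \int[leb]_(t in oo a b) (h t * z t - z a * h t).
  by rewrite RintegralB//; [rewrite RintegralZl// h0 mulr0 subr0|exact: riZ].
apply: le_trans (le_normr_Rintegral (moo a b) i1) _.
have iah := ri_abs ih; rewrite -RintegralZl//.
apply: Rint_le_ae; [exact: moo|exact: ri_abs|by apply: (riZ (moo a b))|].
apply: aeW => t; rewrite /= in_itv /= => tab.
by rewrite (mulrC (z a)) -mulrBr normrM mulrC ler_wpM2r// hz.
Qed.

Lemma mean_dev_bound (a b : R) (h : R -> R) : a < b -> ri a b h ->
  \int[leb]_(t in oo a b) (h t - (\int[leb]_(s in oo a b) h s) / (b - a)) = 0 /\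
  \int[leb]_(t in oo a b) `|h t - (\int[leb]_(s in oo a b) h s) / (b - a)| <=
    2 * \int[leb]_(t in oo a b) `|h t|.
Proof.
move=> ab ih; have ab' := ltW ab; have iah := ri_abs ih; set m := _ / (b - a).
have ba : 0 < b - a by rewrite subr_gt0.
have mE : m * (b - a) = \int[leb]_(s in oo a b) h s by rewrite /m divfK// gt_eqF.
have ic := ri_oo_cst a b m; split.
  by rewrite RintegralB// Rint_oo_cst// mE subrr.
have h1 : \int[leb]_(t in oo a b) `|h t - m| <= \int[leb]_(t in oo a b) (`|h t| + `|m|).
  apply: Rint_le_ae; [exact: moo|by apply: ri_abs; exact: riB|by apply: riD => //; exact: ri_oo_cst|].
  by apply: aeW => t _; exact: ler_normB.
apply: le_trans h1 _; rewrite RintegralD//; last exact: ri_oo_cst.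
rewrite Rint_oo_cst// mulr_natl mulr2n lerD2l -{1}(gtr0_norm ba) -normrM mE.
exact: le_normr_Rintegral.
Qed.

Lemma Rint_sub_le (a b c d : R) (h : R -> R) : a <= b -> c <= d -> a <= c -> d <= b -> ri a b h ->
  (forall t, 0 <= h t) ->
  \int[leb]_(t in oo c d) h t <= \int[leb]_(t in oo a b) h t.
Proof.
move=> ab cd ac db ih h0; have sub : oo c d `<=` oo a b by apply: subset_itvW.
have ih' := ri_sub (moo a b) (moo c d) sub ih.
rewrite -lee_fin -(Rint_fin (moo c d) ih') -(Rint_fin (moo a b) ih).
apply: ge0_subset_integral => //.
  by apply/measurable_EFinP; exact: ri_measurable ih.
by move=> t _; rewrite lee_fin.
Qed.

Lemma ri_mul_AC (T : R) (h z r : R -> R) : 0 <= T -> ri 0 T h -> ri 0 T r ->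
  (forall t, 0 <= t <= T -> z t = z 0 + prim r t) -> ri 0 T (fun t => h t * z t).
Proof.
move=> T0 ih ir hz.
have : ri 0 T (fun t => z 0 * h t + prim r t * h t).
  by apply: (riD (moo 0 T)); [exact: (riZ (moo 0 T))|exact: prim_mul_integrable].
apply: eq_integrable; first exact: moo.
move=> t; rewrite mem_setE in_itv /= => /andP[t0 tT]; rewrite /= (hz t); last by rewrite (ltW t0) (ltW tT).
by congr EFin; ring.
Qed.

(** [P] and [F1] are slab integrals of moduli, [P2] and [F2] those of squares. The factor
    [P + tau * |d|] bounds the oscillation of the error, the other factors bound L1 norms of
    mean-zero functions. An L1 norm over a slab is at most sqrt(tau) times the L2 norm, so every
    product gains a factor tau. *)
Lemma slab_defect_arith (tau L P P2 F1 F2 d : R) : 0 < tau -> 0 < L -> 0 <= P -> 0 <= F1 ->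
  P ^+ 2 <= tau * P2 -> F1 ^+ 2 <= tau * F2 ->
  (P + tau * `|d|) * (2 * (L * `|d| * tau)) + (P + tau * `|d|) * (2 * F1) <=
  tau * ((L + 1) * P2 + (3 * L + 1) * (tau * d ^+ 2) + 2 * F2).
Proof.
move=> t0 L0 P0 F0 hP hF; rewrite -(real_normK (num_real d)).
have : 0 <= `|d| by []. move: (`|d|) => {}d d0.
have h1 : 2 * P * (tau * d) <= tau * (P2 + tau * d ^+ 2).
  by have := sqr_ge0 (P - tau * d); nra.
have h2 : (P + tau * d) * (2 * F1) <= tau * (P2 + 2 * F2 + tau * d ^+ 2).
  by have := sqr_ge0 (P - F1); have := sqr_ge0 (tau * d - F1); nra.
have h3 := ler_wpM2l (ltW L0) h1.
have -> : (P + tau * d) * (2 * (L * d * tau)) = L * (2 * P * (tau * d)) + 2 * L * (tau * (tau * d ^+ 2)) by ring.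
apply: le_trans (lerD (lerD h3 (lexx _)) h2) _.
by rewrite le_eqVlt; apply/orP; left; apply/eqP; ring.
Qed.

Lemma sum_ord_le (j K : nat) (a : nat -> R) : (j <= K)%N -> (forall k, (k < K)%N -> 0 <= a k) ->
  \sum_(k < j) a k <= \sum_(k < K) a k.
Proof.
move=> jK a0; rewrite (big_ord_widen K a jK) big_mkcond; apply: ler_sum => k _.
by case: ifP => // _; exact: a0.
Qed.

Variables (T : R) (K : nat) (F : (R -> R) -> R -> (R -> R)).
Hypotheses (T0 : 0 < T) (K0 : (0 < K)%N) (hF : maps_to_contT T F).
Variables (L c : R).
Hypotheses (L0 : 0 < L) (c0 : 0 < c).
Hypothesis hL : forall u w0 t1 t2, contT T u -> 0 <= t1 -> t1 <= t2 -> t2 <= T ->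
  affine_on_interval t1 t2 u -> `|F u w0 t1 - F u w0 t2| <= L * `|u t1 - u t2|.
Hypothesis hc : forall u1 u2 w1 w2, W11 T u1 -> W11 T u2 ->
  let ubar := u1 \- u2 in
  let wbar := F u1 w1 \- F u2 w2 in
  forall g, weak_deriv T wbar g ->
  forall t1 t2, 0 <= t1 -> t1 <= t2 -> t2 <= T ->
    (2 * c)^-1 * (wbar t2 ^+ 2 - wbar t1 ^+ 2) <=
      \int[leb]_(t in `[t1, t2]) (g t * ubar t).
Let tau : R := T / K%:R.
Local Notation tk := (tk T K).
Local Notation slab k := (oo (tk k) (tk k.+1)).
Variables (w0 : R) (y1 p q ff : R -> R) (v : nat -> R) (y : R -> R).
Hypothesis hy : forall k (s : R), (k < K)%N -> 0 <= s <= 1 ->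
  y ((k%:R + s) * tau) = s * v k.+1 + (1 - s) * v k.
Hypotheses (cy1 : contT T y1) (sp : sqi leb (oo 0 T) p) (iq : ri 0 T q) (sf : sqi leb (oo 0 T) ff).
Hypothesis hp : forall t, 0 <= t <= T -> y1 t = y1 0 + prim p t.
Hypothesis hq : forall t, 0 <= t <= T -> F y1 w0 t = F y1 w0 0 + prim q t.

Let del := slope T K v.
Let om := slope T K (fun k => F y w0 (tk k)).
Let fb k : R := tau^-1 * \int[leb]_(t in slab k) ff t.
Let e t : R := y1 t - y t.
Let W t : R := F y1 w0 t - F y w0 t.
Let ip : ri 0 T p. Proof. exact: sqi_ri (leb_oo_fin 0 T) sp. Qed.
Let iff : ri 0 T ff. Proof. exact: sqi_ri (leb_oo_fin 0 T) sf. Qed.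
Let cy : contT T y. Proof. exact: interp_contT hy. Qed.
Let tau0 : 0 < tau. Proof. exact: tau_gt0. Qed.
Let tkd k : tk k.+1 - tk k = tau. Proof. by rewrite tkS addrAC subrr add0r. Qed.

Lemma interp_hysteresis_slab k (a b : R) : (k < K)%N -> tk k <= a -> a <= b -> b <= tk k.+1 ->
  `|F y w0 b - F y w0 a| <= L * `|del k| * (b - a).
Proof.
move=> kK ka ab bk; rewrite distrC; apply: le_trans (hL w0 cy _ ab _ _) _.
- exact: le_trans (tk_ge0 T0 K0 k) ka.
- exact: le_trans bk (tk_leT T0 K0 kK).
- exact: interp_affine_sub hy _ _ _ kK ka bk.
have hb : tk k <= b <= tk k.+1 by rewrite (le_trans ka ab).
have ha : tk k <= a <= tk k.+1 by rewrite ka (le_trans ab bk).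
rewrite (interp_slab T0 K0 hy kK ha) (interp_slab T0 K0 hy kK hb) -/del.
rewrite (_ : _ - _ = - ((b - a) * del k)); last by ring.
by rewrite normrN normrM ger0_norm ?subr_ge0// (mulrC (b - a)) mulrA.
Qed.

Let e_prim t : 0 <= t <= T -> e t = e 0 + prim (fun s => p s - step T K del s) t.
Proof.
move=> /[dup] tT /andP[t0 tT']; have sub : oo 0 t `<=` oo 0 T by apply: subset_itvW.
have i1 := ri_sub (moo 0 T) (moo 0 t) sub ip.
have i2 := ri_sub (moo 0 T) (moo 0 t) sub (ri_step T K del).
rewrite /prim RintegralB// -/(prim p t) -/(prim _ t) /e hp//.
by rewrite (interp_prim T0 K0 hy tT) -/del; ring.
Qed.

Let ir : ri 0 T (fun s => p s - step T K del s).
Proof. by apply: (riB (moo 0 T)) => //; exact: ri_step. Qed.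

Let e_slab k t : (k < K)%N -> tk k < t < tk k.+1 ->
  `|e t - e (tk k)| <= \int[leb]_(s in slab k) `|p s| + tau * `|del k|.
Proof.
move=> kK /andP[t1 t2]; have k0 := tk_ge0 T0 K0 k; have kT := tk_leT T0 K0 kK.
have hk : 0 <= tk k <= T by rewrite k0 (le_trans _ kT)// ltW// tk_lt.
have ht : 0 <= t <= T by rewrite (le_trans k0 (ltW t1)) (le_trans (ltW t2) kT).
rewrite /e (hp hk) (hp ht).
have st : tk k <= t <= tk k.+1 by rewrite !ltW.
have sk : tk k <= tk k <= tk k.+1 by rewrite lexx ltW// tk_lt.
rewrite (interp_slab T0 K0 hy kK st) (interp_slab T0 K0 hy kK sk) -/del.
rewrite (_ : _ - _ = (prim p t - prim p (tk k)) - (t - tk k) * del k); last by ring.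
rewrite (@prim_diff _ T)//; [|exact: ltW|by case/andP: ht].
apply: le_trans (ler_normB _ _) _; apply: lerD.
  have i1 : ri (tk k) t p.
    by apply: (ri_sub (moo 0 T) (moo _ _)) ip; apply: subset_itvW => //; case/andP: ht.
  apply: le_trans (le_normr_Rintegral (moo _ _) i1) _.
  apply: Rint_sub_le => //; [by rewrite ltW// tk_lt|exact: ltW|exact: ltW|].
  by apply: ri_abs; exact: ri_slab.
rewrite normrM ler_wpM2r// ger0_norm ?subr_ge0 ?ltW//.
by rewrite ltrBlDl -tkS.
Qed.

(* Replacing the derivative [g] of F y w0 by its slope [om], and [ff] by its
   mean [fb], changes the integrand by functions of mean zero on each slab; there
   [e] may be replaced by [e t - e (tk k)], which is small by [e_slab]. *)
Lemma pointwise_energy j : (j <= K)%N ->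
  2^-1 * e (tk j) ^+ 2 + (2 * c)^-1 * W (tk j) ^+ 2 <=
  2^-1 * e 0 ^+ 2 + (2 * c)^-1 * W 0 ^+ 2 +
  \sum_(k < j) \int[leb]_(t in slab k) (((p t - del k) + (q t - om k) - (ff t - fb k)) * e t) +
  tau * ((L + 1) * \int[leb]_(t in oo 0 T) (p t ^+ 2) +
    (3 * L + 1) * \sum_(k < K) (tau * del k ^+ 2) + 2 * \int[leb]_(t in oo 0 T) (ff t ^+ 2)).
Proof.
move=> jK; have T0' := ltW T0; have jT := tk_leT T0 K0 jK; have j0 := tk_ge0 T0 K0 j.
have M0 k : 0 <= L * `|del k| by rewrite mulr_ge0// ltW.
(* The derivative of the discrete output is not given; piecewise Lipschitz continuity produces it,
   with slab integral of its modulus at most [L * |del k| * tau]. *)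
have [g [ig hg gk]] := slab_lipschitz_prim T0 K0 M0 interp_hysteresis_slab.
have iqg : ri 0 T (fun t => q t - g t) by exact: (riB (moo 0 T)).
have W_prim t : 0 <= t <= T -> W t = W 0 + prim (fun t => q t - g t) t.
  move=> /[dup] tT /andP[t0 tT']; have sub : oo 0 t `<=` oo 0 T by apply: subset_itvW.
  have i1 := ri_sub (moo 0 T) (moo 0 t) sub iq; have i2 := ri_sub (moo 0 T) (moo 0 t) sub ig.
  rewrite /prim RintegralB// -/(prim q t) -/(prim g t) /W hq// hg//; by ring.
have wW : weak_deriv T (F y1 w0 \- F y w0) (fun t => q t - g t).
  exact: (weak_deriv_prim T0' iqg W_prim).
have W1 : W11 T y1 by split => //; exists p; exact: weak_deriv_prim.
have W2 : W11 T y.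
  split => //; exists (step T K del); apply: weak_deriv_prim => //; first exact: ri_step.
  by move=> t tT; exact: interp_prim.
have iqe := ri_mul_AC T0' iqg ir e_prim.
have ire := ri_mul_AC T0' ir ir e_prim.
have sub : oo 0 (tk j) `<=` oo 0 T by apply: subset_itvW.
have h1 : (2 * c)^-1 * (W (tk j) ^+ 2 - W 0 ^+ 2) <= prim (fun t => (q t - g t) * e t) (tk j).
  rewrite /prim Rint_closed; last by apply: ri_sub sub iqe.
  exact: (hc W1 W2 wW (lexx _) j0 jT).
have h2 : 2 * prim (fun t => (p t - step T K del t) * e t) (tk j) = e (tk j) ^+ 2 - e 0 ^+ 2.
  apply: AC_energy => //; first by apply: ri_sub sub ir.
  by move=> t /andP[t0 tj]; apply: e_prim; rewrite t0 (le_trans tj).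
move: h1 h2; rewrite !(prim_slabs T0 K0)// => h1 h2.
pose P2 k := \int[leb]_(t in slab k) (p t ^+ 2); pose F2 k := \int[leb]_(t in slab k) (ff t ^+ 2).
have key k : (k < K)%N ->
  \int[leb]_(t in slab k) ((q t - g t) * e t) + \int[leb]_(t in slab k) ((p t - step T K del t) * e t) <=
  \int[leb]_(t in slab k) (((p t - del k) + (q t - om k) - (ff t - fb k)) * e t) +
  tau * ((L + 1) * P2 k + (3 * L + 1) * (tau * del k ^+ 2) + 2 * F2 k).
  move=> kK; have mS := moo (tk k) (tk k.+1); have sk := tk_lt T0 K0 k.
  have i1 := ri_slab T0 K0 kK iqe; have i2 := ri_slab T0 K0 kK ire.
  have ig' := ri_slab T0 K0 kK ig; have if' := ri_slab T0 K0 kK iff.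
  have icst (a : R) : ri (tk k) (tk k.+1) (fun=> a) by exact: ri_oo_cst.
  have ice (h : R -> R) : ri 0 T h -> ri (tk k) (tk k.+1) (fun t => h t * e t).
    by move=> ih; apply: (ri_slab T0 K0 kK); exact: ri_mul_AC ih ir e_prim.
  have i3 : ri (tk k) (tk k.+1) (fun t => (g t - om k) * e t).
    by apply: ice; apply: (riB (moo 0 T)) => //; exact: ri_oo_cst.
  have i4 : ri (tk k) (tk k.+1) (fun t => (ff t - fb k) * e t).
    by apply: ice; apply: (riB (moo 0 T)) => //; exact: ri_oo_cst.
  have i5 : ri (tk k) (tk k.+1) (fun t => ((p t - del k) + (q t - om k) - (ff t - fb k)) * e t).
    apply: ice; apply: (riB (moo 0 T)); last by apply: (riB (moo 0 T)) => //; exact: ri_oo_cst.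
    apply: (riD (moo 0 T)); apply: (riB (moo 0 T)) => //; exact: ri_oo_cst.
  have Ps := sqi_slab T0 K0 kK sp; have Fs := sqi_slab T0 K0 kK sf.
  have hP := Rint_abs_sqr sk Ps; have hFs := Rint_abs_sqr sk Fs; rewrite tkd in hP hFs.
  set P := \int[leb]_(t in slab k) `|p t| in hP.
  set F1 := \int[leb]_(t in slab k) `|ff t| in hFs.
  have es t : tk k < t < tk k.+1 -> `|e t - e (tk k)| <= P + tau * `|del k| by exact: e_slab.
  have m0 : 0 <= P + tau * `|del k|.
    by apply: addr_ge0; [exact: Rintegral_ge0|rewrite mulr_ge0// ltW].
  have [f0 f1] := mean_dev_bound sk if'; have [g0 g1] := mean_dev_bound sk ig'.
  have omE : om k = (\int[leb]_(s in slab k) g s) / (tk k.+1 - tk k).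
    rewrite /om /slope -/tau tkd -(prim_diff (T := T))//; last 3 first.
    - exact: tk_ge0.
    - exact: ltW.
    - exact: tk_leT.
    have k1 : 0 <= tk k.+1 <= T by rewrite (tk_ge0 T0 K0 k.+1) (tk_leT T0 K0 kK).
    have k2 : 0 <= tk k <= T by rewrite (tk_ge0 T0 K0 k) (tk_leT T0 K0 (ltnW kK)).
    by congr (_ / _); rewrite (hg _ k1) (hg _ k2); ring.
  have fbE : fb k = (\int[leb]_(s in slab k) ff s) / (tk k.+1 - tk k) by rewrite tkd mulrC.
  rewrite -omE in g0 g1; rewrite -fbE in f0 f1.
  have b1 := zero_mean_bound (riB mS ig' (icst _)) i3 g0 es.
  have b2 := zero_mean_bound (riB mS if' (icst _)) i4 f0 es.
  have {}b1 : `|\int[leb]_(t in slab k) ((g t - om k) * e t)| <= (P + tau * `|del k|) * (2 * (L * `|del k| * tau)).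
    apply: le_trans b1 _; apply: ler_wpM2l => //; apply: le_trans g1 _.
    by rewrite ler_wpM2l//; exact: gk.
  have {}b2 : `|\int[leb]_(t in slab k) ((ff t - fb k) * e t)| <= (P + tau * `|del k|) * (2 * F1).
    by apply: le_trans b2 _; apply: ler_wpM2l.
  have P_ge0 : 0 <= P by apply: Rintegral_ge0.
  have F_ge0 : 0 <= F1 by apply: Rintegral_ge0.
  have ar := slab_defect_arith (del k) tau0 L0 P_ge0 F_ge0 hP hFs.
  have -> : \int[leb]_(t in slab k) ((q t - g t) * e t) + \int[leb]_(t in slab k) ((p t - step T K del t) * e t) =
    \int[leb]_(t in slab k) (((p t - del k) + (q t - om k) - (ff t - fb k)) * e t)
    - \int[leb]_(t in slab k) ((g t - om k) * e t) + \int[leb]_(t in slab k) ((ff t - fb k) * e t).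
    rewrite -RintegralD// -RintegralB// -RintegralD//; last by exact: (riB mS).
    apply: eq_Rintegral => t; rewrite mem_setE in_itv /= => /andP[t1 t2].
    by rewrite (stepE T0 K0 del kK) ?(ltW t1)//; ring.
  move: b1 b2; rewrite !ler_norml => /andP[b1 _] /andP[_ b2].
  apply: le_trans (_ : _ <= _ + ((P + tau * `|del k|) * (2 * (L * `|del k| * tau)) + (P + tau * `|del k|) * (2 * F1))) _.
    by rewrite addrA; apply: lerD => //; apply: lerD => //; rewrite lerNl.
  by rewrite lerD2l.
have hsum : \sum_(k < j) \int[leb]_(t in slab k) ((q t - g t) * e t) +
   \sum_(k < j) \int[leb]_(t in slab k) ((p t - step T K del t) * e t) <=
   \sum_(k < j) \int[leb]_(t in slab k) (((p t - del k) + (q t - om k) - (ff t - fb k)) * e t) +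
   \sum_(k < j) tau * ((L + 1) * P2 k + (3 * L + 1) * (tau * del k ^+ 2) + 2 * F2 k).
  rewrite -big_split -[leRHS]big_split; apply: ler_sum => k _ /=; apply: key.
  exact: leq_trans (ltn_ord k) jK.
have hE : \sum_(k < j) tau * ((L + 1) * P2 k + (3 * L + 1) * (tau * del k ^+ 2) + 2 * F2 k) <=
   tau * ((L + 1) * \int[leb]_(t in oo 0 T) (p t ^+ 2) +
    (3 * L + 1) * \sum_(k < K) (tau * del k ^+ 2) + 2 * \int[leb]_(t in oo 0 T) (ff t ^+ 2)).
  have L1 : 0 <= L + 1 by rewrite addr_ge0// ltW.
  have L3 : 0 <= 3 * L + 1 by rewrite addr_ge0// mulr_ge0// ltW.
  apply: le_trans (sum_ord_le jK (a := fun k => tau * ((L + 1) * P2 k + (3 * L + 1) * (tau * del k ^+ 2) + 2 * F2 k)) _) _.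
    move=> k kK; apply: mulr_ge0; first exact: ltW.
    apply: addr_ge0; last by apply: mulr_ge0 => //; apply: Rintegral_ge0 => t _; exact: sqr_ge0.
    apply: addr_ge0; apply: mulr_ge0 => //; first by apply: Rintegral_ge0 => t _; exact: sqr_ge0.
    by apply: mulr_ge0; [exact: ltW|exact: sqr_ge0].
  have eP : \int[leb]_(t in oo 0 T) (p t ^+ 2) = \sum_(k < K) P2 k.
    by rewrite -(prim_slabs T0 K0 sp.2 (leqnn K)) /prim tkK.
  have eF : \int[leb]_(t in oo 0 T) (ff t ^+ 2) = \sum_(k < K) F2 k.
    by rewrite -(prim_slabs T0 K0 sf.2 (leqnn K)) /prim tkK.
  by rewrite -mulr_sumr !big_split /= -!mulr_sumr eP eF.
set S1 := \sum_(k < j) _ in h1; set S2 := \sum_(k < j) _ in h2.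
rewrite -/S1 -/S2 in hsum; set S3 := \sum_(k < j) _ in hsum *; set S4 := \sum_(k < j) _ in hsum hE.
move: hE; set EE := tau * _ => hE.
by rewrite mulrBr in h1; lra.
Qed.

End PointwiseEnergy.

(** [G] is arbitrary: only the countably many fibres of [k] have to be measurable. In this way
    functionals without known measurability, such as the squared H2 norm and [F], are evaluated. *)
Lemma measurable_countable_comp d (T : measurableType d) (R : realType) (X : countType)
    (D : set T) (k : T -> X) (G : X -> R) :
  (forall x, measurable (D `&` [set t | k t = x])) -> measurable_fun D (G \o k).
Proof.
move=> mk mD Y mY.
rewrite (_ : D `&` _ = \bigcup_x (if G x \in Y then D `&` [set t | k t = x] else set0)); last first.
  apply/seteqP; split => [t [Dt Yt]|t [x _]].
    by exists (k t) => //; rewrite mem_set.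
  by case: ifP => // /set_mem Yx [Dt /= kt]; split => //=; rewrite kt.
apply: countable_bigcupT_measurable => [|x]; first exact: countableP.
by case: ifP => _; [exact: mk|exact: measurable0].
Qed.

Lemma measurable_ffun_preimage d (T : measurableType d) (I : finType) (X : eqType) (D : set T)
    (k : T -> {ffun I -> X}) (x : {ffun I -> X}) : measurable D ->
  (forall i, measurable (D `&` [set t | k t i = x i])) -> measurable (D `&` [set t | k t = x]).
Proof.
move=> mD mk.
rewrite (_ : D `&` _ = D `&` \bigcap_(i in [set: I]) (D `&` [set t | k t i = x i])); last first.
  apply/seteqP; split => [t [Dt kt]|t [Dt h]]; split => //=.
    by move=> i _; split => //=; rewrite -kt.
  by apply/ffunP => i; have [] := h i Logic.I.
apply: measurableI => //; apply: fin_bigcap_measurable => [|i _]; last exact: mk.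
exact: finite_finset.
Qed.

(** * An integrable majorant of the squared H2 norm *)

Section H2Majorant.
Context {R : realType} {n : nat}.
Local Notation E := 'rV[R]_n.+1.
Local Notation leb := (@lebesgue_measure R).
Local Notation oo a b := (`]a, b[%classic : set (measurableTypeR R)).
Variable mu : {measure set (borelRn R n) -> \bar R}.
Hypothesis hmu : is_lebesgue_measure mu.
Variable Omega : set E.
Hypothesis hO : convex_polyhedral_domain Omega.
Local Notation H2 := (H2 Omega mu).
Local Notation H2_norm := (H2_norm Omega mu).
Local Notation H2sq := (H2sq mu Omega).

(** The value of a simple map at [t] depends only on which of its finitely many sets contain [t]. *)
Lemma measurable_sm_comp (D : set (measurableTypeR R)) (X : set (E -> R))
    (s : simple_map leb D X) (G : (E -> R) -> R) :
  measurable_fun setT (fun t => G (sm_fun s t)).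
Proof.
pose k (t : measurableTypeR R) : {ffun 'I_(sm_size s) -> bool} :=
  [ffun i => t \in sm_set (s := s) i].
pose G' (b : {ffun 'I_(sm_size s) -> bool}) : R :=
  G (fun a => \sum_(i < sm_size s) (b i)%:R * sm_val (s := s) i a).
rewrite (_ : (fun t => _) = G' \o k); last first.
  apply/funext => t; rewrite /G' /k /=; congr G; apply/funext => a.
  by apply: eq_bigr => i _; rewrite indicE ffunE.
apply: measurable_countable_comp => b; apply: measurable_ffun_preimage => // i.
rewrite setTI; have [mA _ _] := sm_setP (s := s) i.
case: (b i).
  rewrite (_ : [set t | _] = sm_set (s := s) i)//.
  by apply/seteqP; split => t /=; rewrite /k ffunE => h; [exact/set_mem|exact/mem_set].
rewrite (_ : [set t | _] = ~` sm_set (s := s) i); first exact: measurableC.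
apply/seteqP; split => t /=; rewrite /k ffunE => h; first by move=> /mem_set; rewrite h.
exact: memNset.
Qed.

Lemma H2_sm (D : set (measurableTypeR R)) (s : simple_map leb D H2) t : H2 (sm_fun s t).
Proof.
rewrite /sm_fun; elim: (index_enum _) => [|i r IH].
  rewrite (_ : (fun a => _) = fun a => 0 * cst 0 a + 0 * cst 0 a); last first.
    by apply/funext => a; rewrite big_nil !mul0r addr0.
  have h0 : H2 (cst 0).
    have z : L2 Omega mu (cst 0) by apply: (continuous_L2 hmu hO); exact: cst_continuous.
    have w i : is_weak_partial Omega mu i (cst 0) (cst 0).
      move=> phi _; rewrite /inner; under eq_Rintegral do rewrite mul0r.
      under [in RHS]eq_Rintegral do rewrite mul0r.
      by rewrite Rintegral_cst ?mul0r ?oppr0//; exact: domain_measurable.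
    have z1 : H1 Omega mu (cst 0) by split => // i; exists (cst 0).
    split => // i; have e := weak_partial_ae hmu hO z1 z (w i).
    apply: (H1_ae hmu hO z1 _ _).1; first by have [] := weak_partialP i z1.
    by apply: (ae_imp e) => x h Ox; rewrite h.
  exact: (weak_partial2_lin hmu hO 0 0 h0 h0).1.
rewrite (_ : (fun a => _) = fun a => \1_(sm_set (s := s) i) t * sm_val (s := s) i a +
    1 * \sum_(j <- r) \1_(sm_set (s := s) j) t * sm_val (s := s) j a); last first.
  by apply/funext => a; rewrite big_cons mul1r.
by apply: (weak_partial2_lin hmu hO _ _ _ IH).1; exact: sm_valP.
Qed.

Let young_arith (A B C e : R) : A <= 2 * B + 2 * C -> C <= e / 2 -> A <= 2 * B + e.
Proof. by lra. Qed.

Let young_arith2 (A B C e : R) : A <= 2 * B + 2 * C -> C <= e / 4 -> 2 * A <= 4 * B + e.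
Proof. by lra. Qed.

(* The H^2 norm of [v t] is not known to be measurable in t, hence the majorant,
   an upper limit of norms of the approximating simple functions. *)
Lemma H2_majorant (a b : R) v : bochner_L2 leb (oo a b) H2 H2_norm v ->
  exists M : R -> R, [/\ forall t, 0 <= M t, leb.-integrable (oo a b) (EFin \o M) &
    {ae leb, forall t, oo a b t -> H2 (v t) /\ H2sq (v t) <= M t}].
Proof.
(* The factor 2 comes from [H2sq_le2]. In the limit [L t] lies between the squared norm of [v t] and
   four times it: the lower bound makes it a majorant, the upper one makes it integrable. *)
move=> [[s hs] fv]; pose u m t := 2 * H2sq (sm_fun (s m) t).
have mD : measurable (oo a b) by exact: measurable_itv.
have mu_ m : measurable_fun (oo a b) (fun t => (u m t)%:E).
  apply/measurable_EFinP; apply: measurable_funTS; apply: measurable_funM => //.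
  exact: measurable_sm_comp.
pose L t := limn_esup (fun m => (u m t)%:E).
have mL : measurable_fun (oo a b) L by exact: measurable_fun_limn_esup.
have LE t : L t = ereal_inf (range (esups (fun m => (u m t)%:E))).
  by rewrite /L limn_esup_lim; apply: cvg_lim => //; exact: cvg_esups_inf.
have L0 t : (0 <= L t)%E.
  rewrite LE; apply: le_ereal_inf_tmp => _ [k _ <-].
  apply: (@le_trans _ _ (u k t)%:E); first by rewrite lee_fin mulr_ge0// H2sq_ge0.
  by apply: ereal_sup_ubound; exists k => /=.
have bnd : {ae leb, forall t, oo a b t -> [/\ H2 (v t), ((H2sq (v t))%:E <= L t)%E &
    (L t <= (4 * H2sq (v t))%:E)%E]}.
  apply: (ae_imp hs) => t {}hs Dt; have [hv cv] := hs Dt.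
  have hd m : H2 (sm_fun (s m) t \- v t).
    rewrite (_ : _ \- _ = fun x => 1 * sm_fun (s m) t x + (-1) * v t x).
      by apply: (weak_partial2_lin hmu hO _ _ _ hv).1; exact: H2_sm.
    by apply/funext => x; rewrite mul1r mulN1r.
  have q1 m : H2sq (v t) <= 2 * H2sq (sm_fun (s m) t) + 2 * H2sq (sm_fun (s m) t \- v t).
    have := H2sq_le2 hmu hO 1 (-1) (H2_sm (s m) t) (hd m); rewrite sqrrN expr1n !mulr1.
    by rewrite (_ : (fun x => _) = v t)//; apply/funext => x /=; ring.
  have q2 m : H2sq (sm_fun (s m) t) <= 2 * H2sq (v t) + 2 * H2sq (sm_fun (s m) t \- v t).
    have := H2sq_le2 hmu hO 1 1 hv (hd m); rewrite expr1n !mulr1.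
    by rewrite (_ : (fun x => _) = sm_fun (s m) t)//; apply/funext => x /=; ring.
  have small e : 0 < e -> exists k, forall m, (k <= m)%N -> H2sq (sm_fun (s m) t \- v t) <= e.
    move=> e0; have h0 m : (0 <= H2_norm (sm_fun (s m) t \- v t)%R)%E by exact: H2_norm_ge0.
    have se : 0 < Num.sqrt e by rewrite sqrtr_gt0.
    have [k hk] := (ecvg0P h0).1 cv _ se; exists k => m km.
    rewrite -lee_fin -(H2_norm_sqr hO (hd m)); have := hk m km => h.
    rewrite expe2; apply: le_trans (lee_pmul (h0 m) (h0 m) h h) _.
    by rewrite -EFinM lee_fin -expr2 sqr_sqrtr// ltW.
  split => //.
    rewrite LE; apply: le_ereal_inf_tmp => _ [k _ <-]; apply/lee_addgt0Pr => e e0.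
    have [k' hk'] := small _ (divr_gt0 e0 (ltr0n R 2)).
    have h1 := q1 (maxn k k'); have h2 := hk' _ (leq_maxr k k').
    apply: (@le_trans _ _ ((u (maxn k k') t)%:E + e%:E)%E).
      by rewrite -EFinD lee_fin; exact: young_arith h1 h2.
    by apply: leeD => //; apply: ereal_sup_ubound; exists (maxn k k') => //=; exact: leq_maxl.
  rewrite LE; apply/lee_addgt0Pr => e e0.
  have [k hk] := small _ (divr_gt0 e0 (ltr0n R 4)).
  apply: (@le_trans _ _ (esups (fun m => (u m t)%:E) k)); first by apply: ereal_inf_lbound; exists k.
  apply: ge_ereal_sup => _ [m /= km <-]; rewrite -EFinD lee_fin.
  exact: young_arith2 (q2 m) (hk m km).
have iL : (\int[leb]_(t in oo a b) L t < +oo)%E.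
  apply: (@le_lt_trans _ _ (4%:E * (\int[leb]_(t in oo a b) H2_norm (v t) ^+ 2))%E); last first.
    by apply: lte_mul_pinfty => //; rewrite ge0_fin_numE//; apply: integral_ge0 => t _; exact: sqre_ge0.
  rewrite -lee_pdivrMl// -ge0_integralZl//.
  apply: integral_le_lower_ae => //.
  - by move=> t _; apply: mule_ge0; [rewrite lee_fin invr_ge0|exact: L0].
  - by move=> t _; exact: sqre_ge0.
  - exact: measurable_funeM.
  apply: (ae_imp bnd) => t h Dt; have [hv _ h2] := h Dt.
  by rewrite (H2_norm_sqr hO hv) lee_pdivrMl// -EFinM.
exists (fun t => fine (L t)); split.
- by move=> t; exact: fine_ge0.
- apply/integrableP; split; first by apply/measurable_EFinP; exact: measurableT_comp.
  apply: le_lt_trans iL; apply: ge0_le_integral => //.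
  + apply: measurableT_comp => //; apply/measurable_EFinP; exact: measurableT_comp.
  + move=> t _ /=; rewrite ger0_norm ?fine_ge0//.
    by case: (L t) (L0 t) => [r| |] //=; rewrite ?leey.
apply: (ae_imp bnd) => t h Dt; have [hv h1 h2] := h Dt; split => //.
have fL : L t \is a fin_num by rewrite ge0_fin_numE//; apply: le_lt_trans h2 _; exact: ltry.
by rewrite -lee_fin fineK.
Qed.

End H2Majorant.

(** * Spatial measurability of the discrete hysteresis output *)

Section HysteresisMeasurable.
Context {R : realType} {n : nat}.
Local Notation E := 'rV[R]_n.+1.
Variable Omega : set E.
Local Notation O := (Omega : set (borelRn R n)).
Hypothesis mO : measurable O.
Variables (T : R) (F : (R -> R) -> R -> (R -> R)).
Hypotheses (T0 : 0 < T) (hF : maps_to_contT T F).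

Lemma contT_bounded u : contT T u -> exists M, forall t, 0 <= t <= T -> `|u t| <= M.
Proof.
move=> cu; have ck : compact (u @` `[0, T]%classic).
  by apply: continuous_compact => //; exact: segment_compact.
have [M [_ hM]] := compact_bounded ck; exists (`|M| + 1).
move=> t tT; apply: (hM (`|M| + 1)); first by rewrite ltr_pwDr// ler_norm.
by exists t => //=; rewrite in_itv.
Qed.

Lemma supnorm_le (u : R -> R) (M : R) : (forall t, 0 <= t <= T -> `|u t| <= M) -> supnorm T u <= M.
Proof.
move=> h; apply: ge_sup; first by exists `|u 0|; exists 0 => //=; rewrite in_itv /= lexx ltW.
by move=> _ [t + <-]; rewrite /= in_itv /=; exact: h.
Qed.

Lemma contTB u1 u2 : contT T u1 -> contT T u2 -> contT T (u1 \- u2).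
Proof.
move=> /contTP c1 /contTP c2; apply/contTP => t tT e e0.
have e2 : 0 < e / 2 by rewrite divr_gt0.
have [d1 [d10 h1]] := c1 t tT _ e2; have [d2 [d20 h2]] := c2 t tT _ e2.
exists (Num.min d1 d2); split; first by rewrite lt_min d10.
move=> s sT; rewrite lt_min => /andP[s1 s2].
rewrite (_ : _ - _ = (u1 t - u1 s) - (u2 t - u2 s)); last by rewrite /=; ring.
apply: le_lt_trans (ler_normB _ _) _; have := h1 s sT s1; have := h2 s sT s2; lra.
Qed.

Lemma le_supnorm u t : contT T u -> 0 <= t <= T -> `|u t| <= supnorm T u.
Proof.
move=> cu tT; have [M hM] := contT_bounded cu.
apply: sup_upper_bound; last by exists t => //=; rewrite in_itv.
split; first by exists `|u t|; exists t => //=; rewrite in_itv.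
by exists M => _ [s + <-]; rewrite /= in_itv /=; exact: hM.
Qed.

Variable L : R.
Hypotheses (L0 : 0 < L) (hL : forall u1 u2 w1 w2, contT T u1 -> contT T u2 ->
  supnorm T (F u1 w1 \- F u2 w2) <= L * Num.max (supnorm T (u1 \- u2)) `|w1 - w2|).

Lemma hysteresis_lip u1 u2 w1 w2 d t : contT T u1 -> contT T u2 -> 0 <= t <= T ->
  (forall s, 0 <= s <= T -> `|u1 s - u2 s| <= d) -> `|w1 - w2| <= d ->
  `|F u1 w1 t - F u2 w2 t| <= L * d.
Proof.
move=> c1 c2 tT hd wd.
have c12 : contT T (F u1 w1 \- F u2 w2) by apply: contTB; exact: hF.
apply: le_trans (le_supnorm c12 tT) _; apply: le_trans (hL _ _ c1 c2) _.
by apply: ler_wpM2l; [exact: ltW|rewrite ge_max wd andbT; exact: supnorm_le].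
Qed.

Variables (K : nat) (uh : nat -> E -> R) (uht : R -> E -> R) (w0 : E -> R).
Hypotheses (K0 : (0 < K)%N) (hu : time_interpolant (T / K%:R) K uh uht).
Hypotheses (mu_ : forall k, (k <= K)%N -> measurable_fun O (uh k)) (mw : measurable_fun O w0).

Let tau : R := T / K%:R.
(** The interpolant of arbitrary nodal values as a primitive of its slopes: a continuous input for
    [F] when the nodal values are rounded. *)
Let interp (f : nat -> R) (t : R) : R := f 0%N + prim (step T K (slope T K f)) t.

Let interp_tk f k : (k <= K)%N -> interp f (tk T K k) = f k.
Proof.
elim: k => [_|k IH kK]; first by rewrite /interp tk0 prim_le0 ?addr0.
have := prim_step T0 K0 (slope T K f) kK (lexx _) (ltW (tk_lt T0 K0 k)) (lexx _).
have tn : T / K%:R != 0 by rewrite gt_eqF// (tau_gt0 T0 K0).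
rewrite (_ : tk T K k.+1 - tk T K k = T / K%:R); last by rewrite tkS addrAC subrr add0r.
rewrite {3}/slope divfK// => h.
by have := IH (ltnW kK); rewrite /interp; lra.
Qed.

Let interpE f k (s : R) : (k < K)%N -> 0 <= s <= 1 ->
  interp f ((k%:R + s) * (T / K%:R)) = s * f k.+1 + (1 - s) * f k.
Proof.
move=> kK /andP[s0 s1]; have t0 := tau_gt0 T0 K0; set t := (k%:R + s) * (T / K%:R).
have tE : t = tk T K k + s * (T / K%:R) by rewrite /t mulrDl.
have t1 : tk T K k <= t by rewrite tE lerDl mulr_ge0// ltW.
have t2 : t <= tk T K k.+1 by rewrite tkS tE lerD2l ler_piMl// ltW.
have tn : T / K%:R != 0 by rewrite gt_eqF.
have := prim_step T0 K0 (slope T K f) kK (lexx _) t1 t2.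
have := interp_tk f (ltnW kK); rewrite /interp tE /slope => h1 h2.
have {}h2 : prim (step T K (fun k => (f k.+1 - f k) / (T / K%:R))) (tk T K k + s * (T / K%:R)) =
  prim (step T K (fun k => (f k.+1 - f k) / (T / K%:R))) (tk T K k) + s * (f k.+1 - f k).
  rewrite (_ : _ * (_ + _ - _) = s * (f k.+1 - f k)) in h2; last by set d := T / K%:R in tn *; field.
  by rewrite -h2; ring.
by rewrite -/(slope T K f) in h1 h2 *; rewrite h2; move: h1; lra.
Qed.

Let interp_close f (d : R) x t : (forall k, (k <= K)%N -> `|uh k x - f k| <= d) ->
  0 <= t <= T -> `|uht t x - interp f t| <= d.
Proof.
move=> hd /andP[t0 tT].
(* The relation ignores its left end, so [grid_chain] merely finds the slab that contains [t]. *)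
apply: (@grid_chain _ T K T0 K0 (fun a b => `|uht b x - interp f b| <= d)) (lexx 0) t0 tT => //.
move=> k a b kK ka ab bk; have tp := tau_gt0 T0 K0.
pose s := (b - tk T K k) / (T / K%:R).
have s01 : 0 <= s <= 1.
  apply/andP; split; first by rewrite divr_ge0 ?subr_ge0 ?(le_trans ka)// ltW.
  by rewrite /s ler_pdivrMr// mul1r lerBlDl -tkS.
have -> : b = (k%:R + s) * (T / K%:R) by rewrite mulrDl divfK ?gt_eqF// /tk; ring.
rewrite interpE// hu//; clearbody s.
rewrite (_ : _ - _ = s * (uh k.+1 x - f k.+1) + (1 - s) * (uh k x - f k)); last by ring.
case/andP: s01 => s0 s1; have s1' : 0 <= 1 - s by rewrite subr_ge0.
apply: le_trans (ler_normD _ _) _; rewrite !normrM (ger0_norm s0) (ger0_norm s1').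
have h1 := ler_wpM2l s0 (hd k.+1 kK); have h2 := ler_wpM2l s1' (hd k (ltnW kK)).
by apply: le_trans (lerD h1 h2) _; rewrite -mulrDl addrC subrK mul1r.
Qed.

(* Rounding the nodal values to multiples of 1/m leaves countably many arguments
   of F, so measurability is clear; Lipschitz continuity gives the limit. *)
Lemma measurable_distributed t : 0 <= t <= T -> measurable_fun O (distributed F uht w0 t).
Proof.
move=> tT; pose c (m : nat) : R := m.+1%:R.
pose k m (x : borelRn R n) : {ffun 'I_K.+1 -> int} * int :=
  ([ffun i : 'I_K.+1 => Num.floor (c m * uh i x)], Num.floor (c m * w0 x)).
pose G m (p : {ffun 'I_K.+1 -> int} * int) : R :=
  F (interp (fun i => (p.1 (inord i))%:~R / c m)) (p.2%:~R / c m) t.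
have mfl m (g : E -> R) z : measurable_fun O g -> measurable (O `&` [set x | Num.floor (c m * g x) = z]).
  move=> mg; rewrite (_ : [set x | _] = (fun x => c m * g x) @^-1` `[z%:~R, (z + 1)%:~R[%classic).
    have mcg : measurable_fun O (fun x => c m * g x) by exact: measurable_funM.
    by apply: mcg => //; exact: measurable_itv.
  apply/seteqP; split => x /=; rewrite in_itv /=; first by move=> <-; exact: floor_itv.
  exact: floor_def.
have mk m : measurable_fun O (G m \o k m).
  apply: measurable_countable_comp => -[f z].
  rewrite (_ : O `&` _ = (O `&` [set x | [ffun i : 'I_K.+1 => Num.floor (c m * uh i x)] = f]) `&`
      (O `&` [set x | Num.floor (c m * w0 x) = z])); last first.
    apply/seteqP; split => [x [Ox [<- <-]]//|x [[Ox /= <-] [_ /= <-]]]; by split.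
  apply: measurableI; last exact: mfl.
  apply: measurable_ffun_preimage => // i.
  under eq_set do rewrite ffunE; apply: mfl; apply: mu_.
  by rewrite -ltnS.
apply: (measurable_fun_real_cvg mk) => x Ox; apply/cvgrPdist_lt => e e0.
have qc m r : `|r - (Num.floor (c m * r))%:~R / c m| <= (c m)^-1.
  have cm : 0 < c m by rewrite /c.
  have /andP[h1 h2] := floor_itv (c m * r).
  have -> : r - (Num.floor (c m * r))%:~R / c m = (c m * r - (Num.floor (c m * r))%:~R) / c m.
    by rewrite mulrBl mulrAC divff ?mul1r// gt_eqF.
  rewrite normrM normfV (gtr0_norm cm) ler_piMl ?invr_ge0 ?ltW//.
  rewrite ger0_norm ?subr_ge0//; move: h2; rewrite intrD => h2.
  by rewrite ltrBlDl.
near=> m; have cm : 0 < c m by rewrite /c.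
have hcl : forall s, 0 <= s <= T -> `|uht s x - interp (fun i => ((k m x).1 (inord i))%:~R / c m) s| <= (c m)^-1.
  move=> s sT; apply: interp_close => // i iK.
  by rewrite /k /= ffunE inordK ?ltnS//; exact: qc.
have cy : contT T (uht ^~ x) by apply: (interp_contT T0 K0 (v := fun i => uh i x)) => i s iK s01; exact: hu.
have ci f : contT T (interp f) by exact: (interp_contT T0 K0 (interpE f)).
have := hysteresis_lip cy (ci _) tT hcl (qc m (w0 x)).
rewrite /distributed /G /= => /le_lt_trans; apply.
rewrite ltr_pdivrMr// -ltr_pdivrMl// mulrC.
have : L / e < m%:R by near: m; exact: nbhs_infty_gtr.
by move=> /lt_le_trans; apply; rewrite ler_nat.
Unshelve. all: by end_near. Qed.

End HysteresisMeasurable.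

(** * The fully discrete scheme *)

Lemma ri_le_ae d (R : realType) (X : measurableType d) (m : {measure set X -> \bar R}) (A : set X) (f g : X -> R) :
  measurable A -> measurable_fun A f -> {ae m, forall x, A x -> `|f x| <= g x} ->
  m.-integrable A (EFin \o g) -> m.-integrable A (EFin \o f).
Proof.
move=> mA mf fg ig; have [mg fg'] := integrableP _ _ _ (ri_abs ig).
apply/integrableP; split; first exact/measurable_EFinP.
apply: le_lt_trans fg'; apply: ae_ge0_le_integral => //.
- by apply: measurableT_comp => //; exact/measurable_EFinP.
- by apply: measurableT_comp => //; exact: measurable_int ig.
apply: (ae_imp fg) => x hx Ax /=; rewrite lee_fin normr_id.
exact: le_trans (hx Ax) (ler_norm _).
Qed.

Lemma Vspace_H1 (R : realType) (n : nat) (Omega : set 'rV[R]_n.+1)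
    (mu : {measure set (borelRn R n) -> \bar R}) bc v : Vspace Omega mu bc v -> H1 Omega mu v.
Proof. by case: bc => // -[]. Qed.

(** Jensen's inequality on each slab, through [Rint_abs_sqr]. *)
Lemma slab_mean_sqr (R : realType) (T : R) (K : nat) (ff : R -> R) : 0 < T -> (0 < K)%N ->
  sqi lebesgue_measure (`]0%R, T[%classic : set (measurableTypeR R)) ff ->
  \sum_(k < K) (T / K%:R) *
    ((T / K%:R)^-1 * \int[lebesgue_measure]_(t in `]tk T K k, tk T K k.+1[) ff t) ^+ 2 <=
  \int[lebesgue_measure]_(t in `]0, T[) (ff t ^+ 2).
Proof.
move=> T0 K0 sf; have t0 := tau_gt0 T0 K0.
rewrite -[in leRHS](tkK T K0) -/(prim _ _) (prim_slabs T0 K0 sf.2 (leqnn K)).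
apply: ler_sum => k _; have sk := tk_lt T0 K0 k.
have sfk := sqi_slab T0 K0 (ltn_ord k) sf.
have := Rint_abs_sqr sk sfk; rewrite (_ : tk T K k.+1 - tk T K k = T / K%:R); last first.
  by rewrite tkS addrAC subrr add0r.
set B := \int[_]_(t in _) (_ ^+ 2); set A := \int[_]_(t in _) `|_| => h.
set I := (X in (_ * X) ^+ 2); have IA : I ^+ 2 <= A ^+ 2.
  rewrite -[I ^+ 2]real_normK ?num_real// lerXn2r ?nnegrE//; first by apply: Rintegral_ge0.
  by apply: le_normr_Rintegral; [exact: measurable_itv|apply: sqi_ri sfk; [exact: measurable_itv|exact: leb_oo_fin]].
move: t0 h; generalize (T / K%:R) => d d0 h.
rewrite exprMn mulrA exprVn expr2 invfM mulVKf ?gt_eqF// mulrC ler_pdivrMr// mulrC.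
exact: le_trans IA h.
Qed.

Lemma inner_ge0_pointwise (R : realType) (n : nat) (mu : {measure set (borelRn R n) -> \bar R})
    (Omega : set 'rV[R]_n.+1) (f g : 'rV[R]_n.+1 -> R) :
  (forall x, Omega x -> 0 <= f x * g x) -> 0 <= inner Omega mu f g.
Proof. by move=> h; rewrite /inner; apply: Rintegral_ge0 => x Ox; exact: h. Qed.

Lemma innerE (R : realType) (n : nat) (mu : {measure set (borelRn R n) -> \bar R})
    (Omega : set 'rV[R]_n.+1) (f g : 'rV[R]_n.+1 -> R) :
  inner Omega mu f g = \int[mu]_(x in (Omega : set (borelRn R n))) (f x * g x).
Proof. by []. Qed.

Lemma inner_sqrE (R : realType) (n : nat) (mu : {measure set (borelRn R n) -> \bar R})
    (Omega : set 'rV[R]_n.+1) (f : 'rV[R]_n.+1 -> R) :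
  inner Omega mu f f = \int[mu]_(x in (Omega : set (borelRn R n))) (f x ^+ 2).
Proof. by []. Qed.

Opaque Defs.inner Defs.dirichlet_form.

Section Scheme.
Context {R : realType} {n : nat}.
Local Notation E := 'rV[R]_n.+1.
Local Notation leb := (@lebesgue_measure R).
Local Notation oo a b := (`]a, b[%classic : set (measurableTypeR R)).
Variable mu : {sigma_finite_measure set (borelRn R n) -> \bar R}.
Hypothesis hmu : is_lebesgue_measure mu.
Variable Omega : set E.
Hypothesis hO : convex_polyhedral_domain Omega.
Local Notation O := (Omega : set (borelRn R n)).
Local Notation L2 := (L2 Omega mu).
Local Notation H1 := (H1 Omega mu).
Local Notation inner := (inner Omega mu).
Local Notation D := (dirichlet_form Omega mu).
Variables (bc : boundary_condition) (T : R) (F : (R -> R) -> R -> (R -> R)).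
Hypotheses (T0 : 0 < T) (hF : maps_to_contT T F) (hmono : piecewise_monotonicity T F).
Variables (L Lh : R).
Hypotheses (L0 : 0 < L) (Lh0 : 0 < Lh).
Hypothesis hL : forall u w0 t1 t2, contT T u -> 0 <= t1 -> t1 <= t2 -> t2 <= T ->
  affine_on_interval t1 t2 u -> `|F u w0 t1 - F u w0 t2| <= L * `|u t1 - u t2|.
Hypothesis hLh : forall u1 u2 w1 w2, contT T u1 -> contT T u2 ->
  supnorm T (F u1 w1 \- F u2 w2) <= Lh * Num.max (supnorm T (u1 \- u2)) `|w1 - w2|.
Variables (w0 : E -> R) (f : R -> E -> R) (Fj : measurableTypeR R * borelRn R n -> R).
Hypotheses (hw0 : L2 w0) (mFj : measurable_fun setT Fj) (sFj : sqi (leb \x mu)%E (oo 0 T `*` O) Fj).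
Hypothesis hFj : {ae leb, forall t, oo 0 T t -> {ae mu, forall x, Omega x -> Fj (t, x) = f t x}}.
Variables (Th : triangulation (R := R) (n := n)) (K : nat) (uh : nat -> E -> R) (uht : R -> E -> R).
Hypothesis K0 : (0 < K)%N.
Hypothesis hd : discrete_solution Omega mu bc T F w0 f Th K uh uht.
Local Notation tau := (T / K%:R).
Local Notation tk := (tk T K).
Local Notation slab k := (oo (tk k) (tk k.+1)).

Definition slopes (uh : nat -> E -> R) (k : nat) (x : E) : R := slope T K (fun i => uh i x) k.
(** The coefficients 1 and -1 match the shape of the lemmas on linear combinations. *)
Definition increment (uh : nat -> E -> R) (k : nat) (x : E) : R := 1 * uh k.+1 x + (-1) * uh k x.
Definition w_nodes (uht : R -> E -> R) (k : nat) : E -> R := distributed F uht w0 (tk k).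
Definition slab_mean (Fj : measurableTypeR R * borelRn R n -> R) (k : nat) (x : E) : R :=
  tau^-1 * \int[leb]_(t in slab k) Fj (t, x).

Local Notation del := (slopes uh).
Local Notation om := (slopes (w_nodes uht)).
Local Notation fb := (slab_mean Fj).

Let mO : measurable O. Proof. exact: domain_measurable. Qed.
Let fO : (mu O < +oo)%E. Proof. exact: (domain_fin hmu hO). Qed.
Let tau0 : 0 < tau. Proof. exact: tau_gt0. Qed.
Let moo (a b : R) : measurable (oo a b). Proof. exact: measurable_itv. Qed.

Lemma slab_sub k : (k < K)%N -> slab k `<=` oo 0 T.
Proof. by move=> kK; apply: subset_itvW; [exact: tk_ge0|exact: tk_leT]. Qed.

Lemma slab_rect_sqi k V : (k < K)%N -> sqi (leb \x mu)%E (oo 0 T `*` O) V ->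
  sqi (leb \x mu)%E (slab k `*` O) V.
Proof.
move=> kK; apply: sqi_sub; [exact: measurableX|exact: measurableX|].
by apply: setSX => //; exact: slab_sub.
Qed.

Lemma rect_fin k : ((leb \x mu)%E (slab k `*` O) < +oo)%E.
Proof.
rewrite product_measure1E//; apply: lte_mul_pinfty => //.
by rewrite ge0_fin_numE//; exact: leb_oo_fin.
Qed.

Lemma uh_interp x k (s : R) : (k < K)%N -> 0 <= s <= 1 ->
  uht ((k%:R + s) * tau) x = s * uh k.+1 x + (1 - s) * uh k x.
Proof. by case: hd => _ h _ kK s01; exact: h. Qed.

Lemma uh_Vh k : (k <= K)%N -> Vh Omega mu bc Th (uh k). Proof. by case: hd => h _ _; exact: h. Qed.

Lemma Vh_H1 v : Vh Omega mu bc Th v -> H1 v.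
Proof. by case=> h _ _; exact: Vspace_H1 h. Qed.

Lemma uh_H1 k : (k <= K)%N -> H1 (uh k). Proof. by move=> kK; apply: Vh_H1; exact: uh_Vh. Qed.

Lemma uh_L2 k : (k <= K)%N -> L2 (uh k). Proof. by move=> kK; apply: H1_L2; exact: uh_H1. Qed.

Lemma slopes_L2 (v : nat -> E -> R) k : L2 (v k.+1) -> L2 (v k) -> L2 (slopes v k).
Proof.
move=> h1 h2; have := L2_lin mO tau^-1 (- tau^-1) h1 h2; congr L2; apply/funext => x.
by rewrite /slopes /slope; ring.
Qed.

Lemma del_L2 k : (k < K)%N -> L2 (del k).
Proof. by move=> kK; apply: slopes_L2; apply: uh_L2 => //; exact: ltnW. Qed.

Lemma uht_contT x : contT T (uht ^~ x).
Proof. exact: (interp_contT T0 K0 (uh_interp x)). Qed.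

Lemma w_nodes_measurable k : (k <= K)%N -> measurable_fun O (w_nodes uht k).
Proof.
move=> kK; apply: (measurable_distributed (Omega := Omega) mO T0 hF Lh0 hLh K0).
- by case: hd => _ h _; exact: h.
- by move=> i iK; have [] := uh_L2 iK.
- by have [] := hw0.
- by rewrite tk_ge0// tk_leT.
Qed.

Lemma om_le k x : (k < K)%N -> `|om k x| <= L * `|del k x|.
Proof.
move=> kK; have := @interp_hysteresis_slab _ T K F T0 K0 L hL (w0 x) (uh ^~ x) (uht ^~ x) (uh_interp x) k _ _ kK (lexx _) (ltW (tk_lt T0 K0 k)) (lexx _).
rewrite (_ : tk k.+1 - tk k = tau); last by rewrite tkS addrAC subrr add0r.
by move=> h; rewrite /slopes /slope normrM normfV (gtr0_norm tau0) ler_pdivrMr.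
Qed.

Lemma om_L2 k : (k < K)%N -> L2 (om k).
Proof.
move=> kK; apply/L2P; have /L2P sd := del_L2 kK.
apply: (sqi_le mO _ _ (sqiZ mO L sd)).
  have m1 := w_nodes_measurable kK; have m2 := w_nodes_measurable (ltnW kK).
  by rewrite /slopes /slope; apply: measurable_funM => //; exact: measurable_funB.
by move=> x _; rewrite [leRHS]normrM (gtr0_norm L0); exact: om_le.
Qed.

(** On a slab the interpolant is affine, hence monotone in the direction given by the sign of
    [del k x], and the output of [F] moves the same way. *)
Lemma om_del_ge0 k x : (k < K)%N -> 0 <= om k x * del k x.
Proof.
move=> kK; have sk := ltW (tk_lt T0 K0 k).
have [hm1 hm2] := hmono (w0 x) (@uht_contT x) (tk_ge0 T0 K0 k) sk (tk_leT T0 K0 kK).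
have ik1 : tk k \in `[tk k, tk k.+1] by rewrite in_itv /= lexx sk.
have ik2 : tk k.+1 \in `[tk k, tk k.+1] by rewrite in_itv /= lexx sk.
have hu a : tk k <= a <= tk k.+1 -> uht a x = uh k x + (a - tk k) * del k x.
  by move=> ha; exact: (@interp_slab _ T K T0 K0 (uh ^~ x) (uht ^~ x) (uh_interp x) k a kK ha).
have omE : om k x = (F (uht ^~ x) (w0 x) (tk k.+1) - F (uht ^~ x) (w0 x) (tk k)) / tau by [].
have [d0|d0] := leP 0 (del k x).
  apply: mulr_ge0 => //; rewrite omE; apply: divr_ge0; last exact: ltW.
  rewrite subr_ge0; apply: hm1 => //.
  move=> a b; rewrite !in_itv /= => ha hb ab; rewrite !hu// lerD2l ler_wpM2r//.
  by rewrite lerD2r.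
apply: mulr_le0; last exact: ltW.
rewrite omE; apply: mulr_le0_ge0; last by rewrite invr_ge0 ltW.
rewrite subr_le0; apply: hm2 => // a b; rewrite !in_itv /= => ha hb ab.
by rewrite (hu _ ha) (hu _ hb) lerD2l; apply: ler_wnM2r; [exact: ltW|rewrite lerD2r].
Qed.

Lemma slab_Fj_ae k : (k < K)%N ->
  {ae leb, forall t, slab k t -> {ae mu, forall x, Omega x -> Fj (t, x) = f t x}}.
Proof.
by move=> kK; apply: (ae_imp hFj) => t h Dt; apply: h; exact: slab_sub kK _ Dt.
Qed.

Lemma slab_mean_measurable k : (k < K)%N -> measurable_fun O (fb k).
Proof.
move=> kK; apply: measurable_funM => //; apply: ri_measurable.
apply: (rect_integrable2 (moo _ _) mO).
by apply: (sqi_ri (measurableX (moo _ _) mO) (rect_fin k)); exact: slab_rect_sqi.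
Qed.

Lemma scheme k phi : (k < K)%N -> Vh Omega mu bc Th phi ->
  inner (del k) phi + inner (om k) phi + D (uh k.+1) phi = inner (fb k) phi.
Proof.
move=> kK hphi; have [_ _ /(_ k kK)[I hI hs]] := hd.
have e := bochner_integral_joint mO fO mFj (slab_rect_sqi kK sFj) (slab_Fj_ae kK) hI.
have lI : L2 I by case: hI.
rewrite -[LHS]/(_ + _ + _) (hs phi hphi); apply: inner_ae => //.
- by apply: measurable_funM => //; case: lI.
- exact: slab_mean_measurable.
- by have [[]] := Vh_H1 hphi.
- by apply: (ae_imp e) => x h Ox; rewrite /slab_mean h.
Qed.

Lemma fb_L2 k : (k < K)%N -> L2 (fb k).
Proof.
move=> kK; have [_ _ /(_ k kK)[I hI _]] := hd.
have e := bochner_integral_joint mO fO mFj (slab_rect_sqi kK sFj) (slab_Fj_ae kK) hI.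
have /L2P lI : L2 I by case: hI.
apply/L2P; apply: (sqi_ae mO (sqiZ mO tau^-1 lI)); first exact: slab_mean_measurable.
by apply: (ae_imp e) => x h Ox; rewrite /slab_mean h.
Qed.

Lemma innerDr2 g a b (p1 p2 : E -> R) : L2 g -> L2 p1 -> L2 p2 ->
  inner g (fun x => a * p1 x + b * p2 x) = a * inner g p1 + b * inner g p2.
Proof.
move=> hg h1 h2; rewrite innerC (inner_lin mO a b h1 h2 hg).
by rewrite (innerC mu Omega p1 g) (innerC mu Omega p2 g).
Qed.

Lemma dirichletDr2 g a b (p1 p2 : E -> R) : H1 g -> H1 p1 -> H1 p2 ->
  D g (fun x => a * p1 x + b * p2 x) = a * D g p1 + b * D g p2.
Proof.
move=> hg h1 h2; rewrite dirichlet_formC (dirichlet_form_lin hmu hO a b h1 h2 hg).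
by rewrite (dirichlet_formC mu Omega p1 g) (dirichlet_formC mu Omega p2 g).
Qed.

Let comb_arith (a b x1 x2 y1 y2 z1 z2 f1 f2 : R) : x1 + y1 + z1 = f1 -> x2 + y2 + z2 = f2 ->
  (a * x1 + b * x2) + (a * y1 + b * y2) + (a * z1 + b * z2) = a * f1 + b * f2.
Proof. by move=> <- <-; ring. Qed.

(** Combinations of test functions are handled by combining the tested equations, which asks only
    [H1] of the functions combined; membership in [Vspace] or [Vh] is used for single functions. *)
Lemma balance_lin a b (g1 g2 v g3 p1 p2 : E -> R) : L2 g1 -> L2 g2 -> H1 v -> L2 g3 -> H1 p1 -> H1 p2 ->
  inner g1 p1 + inner g2 p1 + D v p1 = inner g3 p1 ->
  inner g1 p2 + inner g2 p2 + D v p2 = inner g3 p2 ->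
  let phi x := a * p1 x + b * p2 x in
  inner g1 phi + inner g2 phi + D v phi = inner g3 phi.
Proof.
move=> l1 l2 hv l3 H1p1 H1p2 e1 e2 /=; have lp1 := H1_L2 H1p1; have lp2 := H1_L2 H1p2.
rewrite (innerDr2 a b l1 lp1 lp2) (innerDr2 a b l2 lp1 lp2) (innerDr2 a b l3 lp1 lp2).
rewrite (dirichletDr2 a b hv H1p1 H1p2); exact: comb_arith e1 e2.
Qed.

Lemma scheme_lin k a b p1 p2 : (k < K)%N -> Vh Omega mu bc Th p1 -> Vh Omega mu bc Th p2 ->
  let phi x := a * p1 x + b * p2 x in
  inner (del k) phi + inner (om k) phi + D (uh k.+1) phi = inner (fb k) phi.
Proof.
move=> kK h1 h2; apply: balance_lin; [exact: del_L2|exact: om_L2|exact: uh_H1|exact: fb_L2| | | |].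
- exact: Vh_H1 h1.
- exact: Vh_H1 h2.
- exact: scheme.
- exact: scheme.
Qed.

Lemma increment_H1 k : (k < K)%N -> H1 (increment uh k).
Proof. by move=> kK; apply: (H1_lin hmu hO); apply: uh_H1 => //; exact: ltnW. Qed.

Let stab_arith (d A B C dd od fd ff : R) : 0 < d -> d * dd + d * od + (A - B) = d * fd ->
  fd <= 2^-1 * ff + 2^-1 * dd -> 0 <= od ->
  d * dd + ((A - B) - (B - C)) + (A - C) <= d * ff.
Proof.
move=> d0 h h1 h2; have h3 := ler_wpM2l (ltW d0) h1; have h4 := mulr_ge0 (ltW d0) h2.
by rewrite mulrDr in h3; lra.
Qed.

(** The test function is the increment, [tau * del k]. After doubling, the Dirichlet term splits by
    2 (a, a - b) = a^2 - b^2 + (a - b)^2, Young's inequality uses one of the two copies of the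
    squared slope, and the hysteresis term is dropped for its sign. *)
Lemma slab_stability k : (k < K)%N ->
  tau * inner (del k) (del k) + D (increment uh k) (increment uh k) +
  (D (uh k.+1) (uh k.+1) - D (uh k) (uh k)) <= tau * inner (fb k) (fb k).
Proof.
move=> kK; have := scheme_lin 1 (-1) kK (uh_Vh kK) (uh_Vh (ltnW kK)).
rewrite -/(increment uh k) => /= h.
have ld := del_L2 kK; have lo := om_L2 kK; have lf := fb_L2 kK.
have h1 := uh_H1 kK; have h0 := uh_H1 (ltnW kK).
have incE : increment uh k = fun x => tau * del k x.
  by apply/funext => x; rewrite /increment /slopes /slope [RHS]mulrCA divff ?gt_eqF//; ring.
have in1 g : L2 g -> inner g (increment uh k) = tau * inner g (del k).
  by move=> lg; rewrite incE innerC innerZl// innerC.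
have io : 0 <= inner (om k) (del k).
  by apply: inner_ge0_pointwise => x _; exact: om_del_ge0.
have e1 : D (uh k.+1) (increment uh k) = D (uh k.+1) (uh k.+1) - D (uh k.+1) (uh k).
  by have := dirichletDr2 1 (-1) h1 h1 h0; rewrite mul1r mulN1r.
have e2 : D (uh k) (increment uh k) = D (uh k.+1) (uh k) - D (uh k) (uh k).
  have := dirichletDr2 1 (-1) h0 h1 h0; rewrite mul1r mulN1r.
  by rewrite (dirichlet_formC mu Omega (uh k) (uh k.+1)).
have e3 : D (increment uh k) (increment uh k) = D (uh k.+1) (increment uh k) - D (uh k) (increment uh k).
  by have := dirichlet_form_lin hmu hO 1 (-1) h1 h0 (increment_H1 kK); rewrite mul1r mulN1r.
have y2 : inner (fb k) (del k) <= 2^-1 * inner (fb k) (fb k) + 2^-1 * inner (del k) (del k).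
  have p2 : 0 < 2^-1 :> R by rewrite invr_gt0.
  have := inner_young mO p2 lf ld.
  by rewrite (_ : (4 * 2^-1)^-1 = 2^-1 :> R)//; field.
rewrite (in1 _ ld) (in1 _ lo) (in1 _ lf) e1 in h; rewrite e3 e1 e2.
exact: stab_arith tau0 h y2 io.
Qed.

Definition space_time_sqr (V : measurableTypeR R * borelRn R n -> R) : R :=
  \int[mu]_(x in O) \int[leb]_(t in oo 0 T) (V (t, x) ^+ 2).

Lemma slab_mean_sum : \sum_(k < K) tau * inner (fb k) (fb k) <= space_time_sqr Fj.
Proof.
have sfb (k : 'I_K) : mu.-integrable O (EFin \o (fun x => tau * fb k x ^+ 2)).
  by apply: (riZ mO); have /L2P[] := fb_L2 (ltn_ord k).
have mT := moo 0 T.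
rewrite (_ : \sum_(k < K) _ = \int[mu]_(x in O) \sum_(k < K) tau * fb k x ^+ 2); last first.
  rewrite Rint_sum//; apply: eq_bigr => k _.
  by rewrite inner_sqrE RintegralZl//; have /L2P[] := fb_L2 (ltn_ord k).
apply: Rint_le_ae => //; first exact: (ri_sum mO).
  exact: (rect_integrable2 mT mO sFj.2).
have h := rect_sqi_ae2 mT mO mFj sFj.
by apply: (ae_imp h) => x {}h Ox; exact: (slab_mean_sqr T0 K0 (h Ox)).
Qed.

Let sum_arith (S AK A0 B : R) : 0 <= AK -> S + (AK - A0) <= B -> S <= A0 + B.
Proof. by lra. Qed.

(** Telescoping in time. The squared gradients of the increments are kept: weighted with [tau], they
    later control the lag between the interpolant and the right node. *)
Lemma stability :
  \sum_(k < K) tau * inner (del k) (del k) +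
  \sum_(k < K) D (increment uh k) (increment uh k) <= D (uh 0%N) (uh 0%N) + space_time_sqr Fj.
Proof.
have h1 : \sum_(k < K) (tau * inner (del k) (del k) + D (increment uh k) (increment uh k) +
  (D (uh k.+1) (uh k.+1) - D (uh k) (uh k))) <= \sum_(k < K) tau * inner (fb k) (fb k).
  by apply: ler_sum => k _; exact: slab_stability.
have := le_trans h1 slab_mean_sum; rewrite !big_split /=.
have -> : \sum_(k < K) D (uh k.+1) (uh k.+1) + \sum_(k < K) - D (uh k) (uh k) = D (uh K) (uh K) - D (uh 0%N) (uh 0%N).
  rewrite -big_split /= -(big_mkord xpredT (fun k => D (uh k.+1) (uh k.+1) - D (uh k) (uh k))).
  by rewrite telescope_sumr.
have := dirichlet_form_ge0 mu Omega (uh K).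
rewrite -big_split /=; exact: sum_arith.
Qed.

Local Notation I2 k J := (\int[(leb \x mu)%E]_(z in slab k `*` O) J z).
Local Notation ri2 k J := ((leb \x mu)%E.-integrable (slab k `*` O) (EFin \o J)).
Local Notation sqi2 k J := (sqi (leb \x mu)%E (slab k `*` O) J).

Let mQ k : measurable (slab k `*` O). Proof. exact: measurableX. Qed.

Lemma space_joint_measurable (g : E -> R) : L2 g ->
  measurable_fun setT (fun z : measurableTypeR R * borelRn R n => (g \_ Omega) z.2).
Proof.
move=> [mg _]; apply: measurableT_comp; last exact: measurable_snd.
exact: measurable_patch.
Qed.

Lemma space_joint_sqi k (g : E -> R) : L2 g -> sqi2 k (fun z => (g \_ Omega) z.2).
Proof.
move=> lg; apply: (rect_sqi (moo _ _) mO (space_joint_measurable lg)).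
have /L2P[_ ig] := lg.
rewrite [ltLHS](_ : _ = \int[leb]_(t in slab k) (inner g g)%:E)%E.
  rewrite integral_cst//; apply: lte_mul_pinfty => //; first by rewrite lee_fin inner_ge0.
  exact: leb_oo_fin.
apply: eq_integral => t _; rewrite inner_sqrE -Rint_fin//.
by apply: eq_integral => x Ox; rewrite /= patchE Ox.
Qed.

Lemma space_joint_I2 k (g : E -> R) : (k < K)%N -> L2 g ->
  I2 k (fun z => (g \_ Omega) z.2 ^+ 2) = tau * inner g g.
Proof.
move=> kK lg; have [_ ig] := space_joint_sqi k lg.
rewrite -(rect_fubini1 (moo _ _) mO ig) inner_sqrE.
rewrite [LHS](_ : _ = \int[leb]_(t in slab k) (\int[mu]_(x in O) (g x ^+ 2))).
  rewrite Rint_oo_cst; last by rewrite ltW// tk_lt.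
  by rewrite mulrC tkS addrAC subrr add0r.
apply: eq_Rintegral => t _; apply: eq_Rintegral => x Ox.
by rewrite /= patchE Ox.
Qed.

Lemma space_time_slabs V : measurable_fun setT V -> sqi (leb \x mu)%E (oo 0 T `*` O) V ->
  \sum_(k < K) I2 k (fun z => V z ^+ 2) = space_time_sqr V.
Proof.
move=> mV sV; have ik (k : 'I_K) : ri2 k (fun z => V z ^+ 2) := (slab_rect_sqi (ltn_ord k) sV).2.
rewrite (_ : \sum_(k < K) _ = \int[mu]_(x in O) \sum_(k < K) \int[leb]_(t in slab k) (V (t, x) ^+ 2)); last first.
  rewrite Rint_sum//.
    by apply: eq_bigr => k _; rewrite -(rect_fubini2 (moo _ _) mO (ik k)).
  by move=> k; exact: (rect_integrable2 (moo _ _) mO (ik k)).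
apply: Rint_ae => //.
- apply: ri_measurable; apply: (ri_sum mO) => k.
  exact: (rect_integrable2 (moo _ _) mO (ik k)).
- by apply: ri_measurable; exact: (rect_integrable2 (moo _ _) mO sV.2).
apply: (ae_imp (rect_sqi_ae2 (moo _ _) mO mV sV)) => x {}h Ox.
by rewrite -(prim_slabs T0 K0 (h Ox).2 (leqnn K)) /prim tkK.
Qed.

Lemma space_time_sqr_ge0 V : 0 <= space_time_sqr V.
Proof. by apply: Rintegral_ge0 => x _; apply: Rintegral_ge0 => t _; exact: sqr_ge0. Qed.

Hypothesis hcausal : causality T F.
Variable c : R.
Hypothesis c0 : 0 < c.
Hypothesis hc : forall u1 u2 w1 w2, W11 T u1 -> W11 T u2 ->
  let ubar := u1 \- u2 in
  let wbar := F u1 w1 \- F u2 w2 in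
  forall g, weak_deriv T wbar g ->
  forall t1 t2, 0 <= t1 -> t1 <= t2 -> t2 <= T ->
    (2 * c)^-1 * (wbar t2 ^+ 2 - wbar t1 ^+ 2) <=
      \int[leb]_(t in `[t1, t2]) (g t * ubar t).
Variables (u : R -> E -> R) (P Q U : measurableTypeR R * borelRn R n -> R) (M : R -> R).
Hypotheses (cu : forall x, Omega x -> contT T (u ^~ x)) (lu : forall t, 0 <= t <= T -> L2 (u t)).
Hypothesis mwu : forall t, 0 <= t <= T -> measurable_fun O (distributed F u w0 t).
Hypotheses (mP : measurable_fun setT P) (sP : sqi (leb \x mu)%E (oo 0 T `*` O) P).
Hypotheses (mQ' : measurable_fun setT Q) (sQ : sqi (leb \x mu)%E (oo 0 T `*` O) Q).
Hypotheses (mU : measurable_fun setT U) (sU : sqi (leb \x mu)%E (oo 0 T `*` O) U).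
Hypothesis hU : forall t x, 0 <= t < T -> Omega x -> U (t, x) = u t x.
Hypothesis hux : {ae mu, forall x, Omega x -> sqi leb (oo 0 T) (fun t => P (t, x)) /\
  forall t, 0 <= t <= T -> u t x = u 0 x + prim (fun s => P (s, x)) t}.
Hypothesis hwx : {ae mu, forall x, Omega x -> sqi leb (oo 0 T) (fun t => Q (t, x)) /\
  forall t, 0 <= t <= T -> distributed F u w0 t x = distributed F u w0 0 x + prim (fun s => Q (s, x)) t}.
Hypotheses (M0 : forall t, 0 <= M t) (iM : leb.-integrable (oo 0 T) (EFin \o M)).
Hypothesis hweak : {ae leb, forall t, oo 0 T t ->
  [/\ Vspace Omega mu bc (u t), H2 Omega mu (u t), H2sq mu Omega (u t) <= M t &
    forall phi, Vspace Omega mu bc phi ->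
      inner (fun x => P (t, x)) phi + inner (fun x => Q (t, x)) phi + D (u t) phi =
      inner (fun x => Fj (t, x)) phi]}.
Variables (h Cp B0 : R).
Hypotheses (h0 : 0 <= h) (Cp0 : 0 <= Cp) (B00 : 0 <= B0).
Hypothesis hproj : forall v, Vspace Omega mu bc v -> H2 Omega mu v -> exists vh, Vh Omega mu bc Th vh /\
  let rho x := 1 * v x + (-1) * vh x in
  inner rho rho <= (h ^+ 2) ^+ 2 * (Cp * H2sq mu Omega v) /\ D rho rho <= h ^+ 2 * (Cp * H2sq mu Omega v).
Let e (k : nat) (x : E) : R := u (tk k) x - uh k x.
Let W (k : nat) (x : E) : R := distributed F u w0 (tk k) x - w_nodes uht k x.
Hypothesis hinit : inner (e 0%N) (e 0%N) <= h ^+ 2 * B0.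
Hypothesis hinitD : D (uh 0%N) (uh 0%N) <= B0.

Definition residual (k : nat) (z : measurableTypeR R * borelRn R n) : R :=
  (P z - (del k \_ Omega) z.2) + (Q z - (om k \_ Omega) z.2) - (Fj z - (fb k \_ Omega) z.2).
(** On slab [k] and over [Omega] this is [u - uht], with [U] representing [u] and the interpolant
    written out; extension by zero makes it jointly measurable. *)
Definition error_slab (k : nat) (z : measurableTypeR R * borelRn R n) : R :=
  U z - ((uh k \_ Omega) z.2 + (z.1 - tk k) * (del k \_ Omega) z.2).
Local Notation NN := residual.
Local Notation EE := error_slab.
Local Notation SS := (\sum_(k < K) tau * inner (del k) (del k)).

Lemma residual_sqi k : (k < K)%N -> measurable_fun setT (NN k) /\ sqi2 k (NN k).
Proof.
move=> kK; have ld := del_L2 kK; have lo := om_L2 kK; have lf := fb_L2 kK.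
have s1 := space_joint_sqi k ld; have s2 := space_joint_sqi k lo; have s3 := space_joint_sqi k lf.
split.
  apply: measurable_funB; last by apply: measurable_funB => //; exact: space_joint_measurable.
  by apply: measurable_funD; apply: measurable_funB => //; exact: space_joint_measurable.
have q1 := slab_rect_sqi kK sP; have q2 := slab_rect_sqi kK sQ; have q3 := slab_rect_sqi kK sFj.
apply: (sqiB (mQ k)); last exact: (sqiB (mQ k)).
by apply: (sqiD (mQ k)); exact: (sqiB (mQ k)).
Qed.

Lemma error_slab_sqi k : (k < K)%N -> measurable_fun setT (EE k) /\ sqi2 k (EE k).
Proof.
move=> kK; have ld := del_L2 kK; have lk := uh_L2 (ltnW kK).
have m1 : measurable_fun setT (fun z : measurableTypeR R * borelRn R n => (z.1 - tk k) * (del k \_ Omega) z.2).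
  apply: measurable_funM; last exact: space_joint_measurable.
  by apply: measurable_funB => //; exact: measurable_fst.
split.
  apply: measurable_funB => //; apply: measurable_funD => //; exact: space_joint_measurable.
apply: (sqiB (mQ k)); first exact: slab_rect_sqi.
apply: (sqiD (mQ k)); first exact: space_joint_sqi.
apply: (sqi_le (mQ k) _ _ (sqiZ (mQ k) tau (space_joint_sqi k ld))); first exact: measurable_funTS.
move=> [t x] [/= + _]; rewrite in_itv /= => /andP[t1 t2].
rewrite normrM [leRHS]normrM (gtr0_norm tau0) ler_wpM2r// ger0_norm ?subr_ge0 ?(ltW t1)//.
by rewrite lerBlDl -tkS ltW.
Qed.

Lemma residual_error_ri k : (k < K)%N -> ri2 k (fun z => NN k z * EE k z).
Proof. by move=> kK; apply: (sqiM (mQ k)); [case: (residual_sqi kK)|case: (error_slab_sqi kK)]. Qed.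

(** By causality at time 0 each input may be replaced by the constant equal to its initial value.
    Lipschitz continuity then sees the initial error only, not the error over [0,T]. *)
Lemma W0_le x : Omega x -> `|W 0%N x| <= Lh * `|e 0%N x|.
Proof.
move=> Ox; rewrite /W /e /w_nodes /distributed tk0.
have t00 : (0 : R) <= 0 <= T by rewrite lexx (ltW T0).
have cc (a : R) : contT T (fun=> a) by apply: continuous_subspaceT => t; exact: cst_continuous.
have ce v : contT T v -> F v (w0 x) 0 = F (fun=> v 0) (w0 x) 0.
  by move=> cv; apply: hcausal => // s /andP[s0 s1]; congr v; apply/eqP; rewrite eq_le s0 s1.
have u0 : uht 0 x = uh 0%N x.
  have := @interp_node _ T K T0 K0 (uh ^~ x) (uht ^~ x) (uh_interp x) 0%N (leq0n K); rewrite tk0; exact.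
rewrite (ce _ (cu Ox)) (ce _ (@uht_contT x)) u0.
apply: (hysteresis_lip T0 hF Lh0 hLh (cc _) (cc _) t00) => //.
by rewrite subrr normr0.
Qed.

Let node_range k : (k <= K)%N -> 0 <= tk k <= T.
Proof. by move=> kK; rewrite tk_ge0// tk_leT. Qed.

Lemma e_L2 k : (k <= K)%N -> L2 (e k).
Proof. by move=> kK; apply: (L2B mO); [apply: lu; exact: node_range|exact: uh_L2]. Qed.

Lemma W_measurable k : (k <= K)%N -> measurable_fun O (W k).
Proof.
by move=> kK; apply: measurable_funB; [apply: mwu; exact: node_range|exact: w_nodes_measurable].
Qed.

Lemma W0_L2 : L2 (W 0%N).
Proof.
have /L2P se := e_L2 (leq0n K); apply/L2P.
apply: (sqi_le mO _ _ (sqiZ mO Lh se)); first exact: W_measurable.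
by move=> x Ox; rewrite [leRHS]normrM (gtr0_norm Lh0); exact: W0_le.
Qed.

Definition defect : R := (L + 1) * space_time_sqr P + (3 * L + 1) * SS + 2 * space_time_sqr Fj.

Let energy_density (j : nat) (x : E) : R := 2^-1 * e j x ^+ 2 + (2 * c)^-1 * W j x ^+ 2.

Let pointwise_error x j : Omega x -> (j <= K)%N ->
  sqi leb (oo 0 T) (fun t => P (t, x)) -> sqi leb (oo 0 T) (fun t => Q (t, x)) ->
  sqi leb (oo 0 T) (fun t => Fj (t, x)) ->
  (forall t, 0 <= t <= T -> u t x = u 0 x + prim (fun s => P (s, x)) t) ->
  (forall t, 0 <= t <= T -> distributed F u w0 t x = distributed F u w0 0 x + prim (fun s => Q (s, x)) t) ->
  energy_density j x <= energy_density 0 x +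
    \sum_(k < j) \int[leb]_(t in slab k) (NN k (t, x) * EE k (t, x)) +
    tau * ((L + 1) * \int[leb]_(t in oo 0 T) (P (t, x) ^+ 2) +
      (3 * L + 1) * \sum_(k < K) (tau * del k x ^+ 2) + 2 * \int[leb]_(t in oo 0 T) (Fj (t, x) ^+ 2)).
Proof.
move=> Ox jK s1 s2 s3 e1 e2.
have i2 := sqi_ri (moo 0 T) (leb_oo_fin 0 T) s2.
have := @pointwise_energy _ T K F T0 K0 L c L0 hL hc (w0 x) (u ^~ x) _ _ _ (uh ^~ x) (uht ^~ x) (uh_interp x)
  (cu Ox) s1 i2 s3 e1 e2 j jK.
have nd i : (i <= K)%N -> uht (tk i) x = uh i x.
  by move=> iK; exact: (@interp_node _ T K T0 K0 (uh ^~ x) (uht ^~ x) (uh_interp x) i iK).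
have nd0 := nd 0%N (leq0n K); rewrite tk0 in nd0; rewrite /= (nd j jK) nd0.
rewrite (_ : \sum_(k < j) _ = \sum_(k < j) \int[leb]_(t in slab k) (NN k (t, x) * EE k (t, x))); last first.
  apply: eq_bigr => k _; apply: eq_Rintegral => t; rewrite mem_setE in_itv /= => /andP[t1 t2].
  have kK := leq_trans (ltn_ord k) jK.
  have tT : 0 <= t < T.
    by rewrite (le_trans (tk_ge0 T0 K0 k) (ltW t1)) (lt_le_trans t2 (tk_leT T0 K0 kK)).
  have st : tk k <= t <= tk k.+1 by rewrite !ltW.
  rewrite /NN /EE /= !patchE !(mem_set Ox) (hU tT Ox).
  by rewrite (@interp_slab _ T K T0 K0 (uh ^~ x) (uht ^~ x) (uh_interp x) k t kK st).
by rewrite /energy_density /e /W /w_nodes /distributed tk0.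
Qed.

Lemma integrated_energy j : (j <= K)%N ->
  L2 (W j) /\
  2^-1 * inner (e j) (e j) + (2 * c)^-1 * inner (W j) (W j) <=
  2^-1 * inner (e 0%N) (e 0%N) + (2 * c)^-1 * inner (W 0%N) (W 0%N) +
  \sum_(k < j) I2 k (fun z => NN k z * EE k z) + tau * defect.
Proof.
move=> jK; have kK (k : 'I_j) : (k < K)%N := leq_trans (ltn_ord k) jK.
pose S x := \sum_(k < j) \int[leb]_(t in slab k) (NN k (t, x) * EE k (t, x)).
pose AP x := \int[leb]_(t in oo 0 T) (P (t, x) ^+ 2).
pose AF x := \int[leb]_(t in oo 0 T) (Fj (t, x) ^+ 2).
pose AD x := \sum_(k < K) (tau * del k x ^+ 2).
pose RHS x := energy_density 0 x + S x + tau * ((L + 1) * AP x + (3 * L + 1) * AD x + 2 * AF x).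
have /L2P[_ ie0] := e_L2 (leq0n K); have /L2P[_ iW0] := W0_L2.
have iek := fun k (h : (k <= K)%N) => ((L2P _ _ _).1 (e_L2 h)).2.
have mT := moo 0 T.
have iS : mu.-integrable O (EFin \o S).
  by apply: (ri_sum mO) => k; exact: (rect_integrable2 (moo _ _) mO (residual_error_ri (kK k))).
have iAP : mu.-integrable O (EFin \o AP) by exact: (rect_integrable2 mT mO sP.2).
have iAF : mu.-integrable O (EFin \o AF) by exact: (rect_integrable2 mT mO sFj.2).
have idk (k : 'I_K) : mu.-integrable O (EFin \o (fun x => del k x ^+ 2)).
  by have /L2P[] := del_L2 (ltn_ord k).
have iAD : mu.-integrable O (EFin \o AD).
  by apply: (ri_sum mO) => k; exact: (riZ mO).
have i1 : mu.-integrable O (EFin \o (fun x => (L + 1) * AP x)) by exact: (riZ mO).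
have i2 : mu.-integrable O (EFin \o (fun x => (3 * L + 1) * AD x)) by exact: (riZ mO).
have i3 : mu.-integrable O (EFin \o (fun x => 2 * AF x)) by exact: (riZ mO).
have i12 := riD mO i1 i2; have i123 := riD mO i12 i3.
have i4 : mu.-integrable O (EFin \o (fun x => tau * ((L + 1) * AP x + (3 * L + 1) * AD x + 2 * AF x))).
  exact: (riZ mO).
have j1 : mu.-integrable O (EFin \o (fun x => 2^-1 * e 0 x ^+ 2)) by exact: (riZ mO).
have j2 : mu.-integrable O (EFin \o (fun x => (2 * c)^-1 * W 0 x ^+ 2)) by exact: (riZ mO).
have jE : mu.-integrable O (EFin \o energy_density 0) by exact: (riD mO j1 j2).
have jES := riD mO jE iS; have iR : mu.-integrable O (EFin \o RHS) by exact: (riD mO jES i4).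
have key : {ae mu, forall x, Omega x -> energy_density j x <= RHS x}.
  have h1 := rect_sqi_ae2 mT mO mFj sFj.
  apply: (ae_imp3 h1 hux hwx) => x k1 k2 k3 Ox.
  have [s1 e1] := k2 Ox; have [s2 e2] := k3 Ox.
  exact: pointwise_error Ox jK s1 s2 (k1 Ox) e1 e2.
have c2 : 0 < (2 * c)^-1 by rewrite invr_gt0 mulr_gt0.
have mW : measurable_fun O (fun x => W j x ^+ 2) by apply: measurable_funX; exact: W_measurable.
(* Square integrability of [W j] is drawn from the energy inequality itself, which bounds
   [W j x ^+ 2] by a multiple of the integrable right-hand side. *)
have iWj : mu.-integrable O (EFin \o (fun x => W j x ^+ 2)).
  have iR2 : mu.-integrable O (EFin \o (fun x => (2 * c) * RHS x)) by exact: (riZ mO).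
  apply: (ri_le_ae mO mW _ iR2); apply: (ae_imp key) => x hx Ox.
  rewrite ger0_norm ?sqr_ge0// -ler_pdivrMl ?mulr_gt0//; apply: le_trans (hx Ox).
  by rewrite /energy_density lerDr mulr_ge0// sqr_ge0.
have lWj : L2 (W j) by apply/L2P; split => //; exact: W_measurable.
split=> //; have iej := iek j jK.
have k1 : mu.-integrable O (EFin \o (fun x => 2^-1 * e j x ^+ 2)) by exact: (riZ mO).
have k2 : mu.-integrable O (EFin \o (fun x => (2 * c)^-1 * W j x ^+ 2)) by exact: (riZ mO).
have := Rint_le_ae mO (riD mO k1 k2) iR key.
rewrite (RintegralD mO k1 k2) (RintegralZl _ mO iej) (RintegralZl _ mO iWj).
rewrite (RintegralD mO jES i4) (RintegralD mO jE iS) (RintegralD mO j1 j2).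
rewrite (RintegralZl _ mO ie0) (RintegralZl _ mO iW0) (RintegralZl _ mO i123).
rewrite (RintegralD mO i12 i3) (RintegralD mO i1 i2) (RintegralZl _ mO iAP) (RintegralZl _ mO iAD) (RintegralZl _ mO iAF).
have -> : \int[mu]_(x in O) S x = \sum_(k < j) I2 k (fun z => NN k z * EE k z).
  rewrite Rint_sum//; last first.
    by move=> k; exact: (rect_integrable2 (moo _ _) mO (residual_error_ri (kK k))).
  apply: eq_bigr => k _; exact: (rect_fubini2 (moo _ _) mO (residual_error_ri (kK k))).
have -> : \int[mu]_(x in O) AD x = SS.
  rewrite Rint_sum//; last by move=> k; exact: (riZ mO).
  by apply: eq_bigr => k _; rewrite (RintegralZl _ mO (idk k)) inner_sqrE.
by rewrite !inner_sqrE.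
Qed.

(** The names are pairings of [n] the residual, [e] the error, [r] the projection error, [i] the
    increment: [ne], [nr], [nn] in L2, the others in the Dirichlet form. Two quarters of [Dee] are
    absorbed on the left, and doubling the remaining half produces the constants 2 and 3. *)
Let dissipation_arith (Dee ne nr er ie ir rr ii nn X k hh : R) :
  0 <= k <= 1 -> 0 <= hh -> 0 <= Dee -> 0 <= ii -> 0 <= rr ->
  Dee + ne = nr + er + k * ie - k * ir ->
  nr <= hh * (nn + X) -> er <= 4^-1 * Dee + rr -> ie <= ii + 4^-1 * Dee ->
  0 <= ii + 2 * ir + rr -> rr <= hh * X ->
  Dee <= - 2 * ne + (2 * hh * (nn + X) + 3 * (hh * X) + 3 * ii).
Proof.
move=> /andP[k0 k1] hh0 D0 i0 r0 e1 e2 e3 e4 e5 e6.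
have f1 : k * ie <= ii + 4^-1 * Dee.
  apply: le_trans (ler_wpM2l k0 e4) _; apply: ler_piMl => //; first by rewrite addr_ge0// mulr_ge0.
have f2 : - (k * ir) <= 2^-1 * (ii + rr).
  have : k * - ir <= k * (2^-1 * (ii + rr)) by apply: ler_wpM2l => //; lra.
  rewrite mulrN => /le_trans; apply; apply: ler_piMl => //.
  by rewrite mulr_ge0// addr_ge0.
lra.
Qed.

Let lin_arith (A x y : R) : A = 1 * x + (-1) * y -> A = x - y.
Proof. by move=> ->; ring. Qed.

Let lin_arith2 (A x y z w k : R) : A = 1 * x + (-1) * y -> A = 1 * z + (- k) * w -> x - y = z - k * w.
Proof. by lra. Qed.

Let sum4_arith (a b d : R) : 0 <= 1 * (1 * a + 1 * b) + 1 * (1 * b + 1 * d) -> 0 <= a + 2 * b + d.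
Proof. by lra. Qed.

Let balance_arith (ne nr ee er ie ir k : R) : (ne - nr) + ((ee - er) - k * (ie - ir)) = 0 ->
  ee + ne = nr + er + k * ie - k * ir.
Proof. by move=> hb; lra. Qed.

Let split_arith (n1 p q r d o b dv du : R) : p + q + dv = r -> d + o + du = b ->
  n1 = (p - d) + (q - o) - (r - b) -> n1 + (dv - du) = 0.
Proof. by move=> <- <- ->; ring. Qed.

(** The scheme carries the gradient of the right node [a], not of the interpolant;
    [v - a = et - kappa * inc] moves the difference into the increment, [kappa] being the fraction
    of the slab still to come. [rho] is the projection error of [v], and [phi = et - rho] the
    discrete test function. *)
Lemma dissipation_bound (kappa hh X : R) (nn et rho inc v a phi : E -> R) :
  0 <= kappa <= 1 -> 0 <= hh -> 0 <= X -> L2 nn -> H1 et -> H1 rho -> H1 inc -> H1 v -> H1 a -> H1 phi ->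
  phi = (fun x => 1 * et x + (-1) * rho x) ->
  (fun x => 1 * v x + (-1) * a x) = (fun x => 1 * et x + (- kappa) * inc x) ->
  inner nn phi + (D v phi - D a phi) = 0 ->
  inner rho rho <= hh ^+ 2 * X -> D rho rho <= hh * X ->
  D et et <= - 2 * inner nn et + (2 * hh * (inner nn nn + X) + 3 * (hh * X) + 3 * D inc inc).
Proof.
move=> k01 hh0 X0 ln Het Hrho Hinc Hv Ha Hphi phiE gE bal r1 r2.
have gD : D v phi - D a phi = D et phi - kappa * D inc phi.
  have eq1 := dirichlet_form_lin hmu hO 1 (-1) Hv Ha Hphi; rewrite gE in eq1.
  exact: lin_arith2 eq1 (dirichlet_form_lin hmu hO 1 (- kappa) Het Hinc Hphi).
have n1 : inner nn phi = inner nn et - inner nn rho.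
  rewrite phiE; exact: lin_arith (innerDr2 1 (-1) ln (H1_L2 Het) (H1_L2 Hrho)).
have d1 : D et phi = D et et - D et rho.
  rewrite phiE; exact: lin_arith (dirichletDr2 1 (-1) Het Het Hrho).
have d2 : D inc phi = D inc et - D inc rho.
  rewrite phiE; exact: lin_arith (dirichletDr2 1 (-1) Hinc Het Hrho).
have q1 := inner_le_scaled mO hh0 X0 ln (H1_L2 Hrho) r1.
have p4 : 0 < 4^-1 :> R by rewrite invr_gt0.
have p44 : (4 * 4^-1)^-1 = 1 :> R by field.
have q2 := dirichlet_form_young hO p4 Het Hrho; rewrite p44 mul1r in q2.
have q3 := dirichlet_form_young hO ltr01 Hinc Het; rewrite mul1r mulr1 in q3.
have q4 : 0 <= D inc inc + 2 * D inc rho + D rho rho.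
  have Hs : H1 (fun x => 1 * inc x + 1 * rho x) by apply: (H1_lin hmu hO).
  have := dirichlet_form_ge0 mu Omega (fun x => 1 * inc x + 1 * rho x).
  rewrite (dirichlet_form_lin hmu hO 1 1 Hinc Hrho Hs).
  rewrite (dirichletDr2 1 1 Hinc Hinc Hrho) (dirichletDr2 1 1 Hrho Hinc Hrho).
  rewrite (dirichlet_formC mu Omega rho inc); exact: sum4_arith.
rewrite gD n1 d1 d2 in bal.
exact: (dissipation_arith k01 hh0 (dirichlet_form_ge0 mu Omega et) (dirichlet_form_ge0 mu Omega inc)
  (dirichlet_form_ge0 mu Omega rho) (balance_arith bal) q1 q2 q3 q4 r2).
Qed.

Lemma slab_dissipation k : (k < K)%N -> {ae leb, forall t, slab k t ->
  [/\ H1 (u t \- uht t),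
    inner (u t \- uht t) (u t \- uht t) = \int[mu]_(x in O) (EE k (t, x) ^+ 2),
    0 <= D (u t \- uht t) (u t \- uht t) &
    D (u t \- uht t) (u t \- uht t) <= - 2 * \int[mu]_(x in O) (NN k (t, x) * EE k (t, x)) +
      (2 * h ^+ 2 * (\int[mu]_(x in O) (NN k (t, x) ^+ 2) + Cp * M t) + 3 * (h ^+ 2 * (Cp * M t)) +
       3 * D (increment uh k) (increment uh k))]}.
Proof.
move=> kK; have mT := moo 0 T.
have aP := rect_sqi_ae1 mT mO mP sP; have aQ := rect_sqi_ae1 mT mO mQ' sQ.
have aF := rect_sqi_ae1 mT mO mFj sFj.
apply: (ae_imp2 (ae_imp2 aP aQ (fun t a b => conj a b)) (ae_imp2 aF hweak (fun t a b => conj a b))).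
move=> t [kP kQ] [kF kw] St; have Dt := slab_sub kK St.
have lP : L2 (fun x => P (t, x)) by apply/L2P; exact: kP.
have lQ : L2 (fun x => Q (t, x)) by apply/L2P; exact: kQ.
have lF : L2 (fun x => Fj (t, x)) by apply/L2P; exact: kF.
have [vu h2u Mu weq] := kw Dt.
move: St; rewrite /= in_itv /= => /andP[t1 t2].
have [vh [hvh [r1 r2]]] := hproj vu h2u.
have hu1 := Vspace_H1 vu; have hk1 := uh_H1 kK; have hk0 := uh_H1 (ltnW kK); have hv1 := Vh_H1 hvh.
have ld := del_L2 kK; have lo := om_L2 kK; have lf := fb_L2 kK.
(* Local time in the slab; the interpolant lags behind the right node by [1 - s] times the
   increment, which is the [kappa] of [dissipation_bound]. *)
pose s := (t - tk k) / tau.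
have s01 : 0 <= 1 - s <= 1.
  have sa : 0 <= s by rewrite divr_ge0 ?subr_ge0// ltW.
  have sb : s <= 1 by rewrite ler_pdivrMr// mul1r lerBlDl -tkS ltW.
  by rewrite subr_ge0 sb lerBlDr lerDl.
pose U' x := s * uh k.+1 x + (1 - s) * uh k x.
pose et x := 1 * u t x + (-1) * U' x.
pose rho x := 1 * u t x + (-1) * vh x.
pose phi x := 1 * vh x + (-1) * U' x.
pose inc := increment uh k.
have HU : H1 U' by apply: (H1_lin hmu hO).
have Het : H1 et by apply: (H1_lin hmu hO).
have Hrho : H1 rho by apply: (H1_lin hmu hO).
have Hinc : H1 inc by exact: increment_H1.
have st : tk k <= t <= tk k.+1 by rewrite !ltW.
have uhtE x : uht t x = uh k x + (t - tk k) * del k x.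
  exact: (@interp_slab _ T K T0 K0 (uh ^~ x) (uht ^~ x) (uh_interp x) k t kK st).
have tn : tau != 0 by rewrite gt_eqF.
have etE : u t \- uht t = et.
  apply/funext => x /=; rewrite uhtE /et /U' /s /slopes /slope.
  by move: tn; generalize tau => d d0; field.
have vV : Vspace Omega mu bc vh by case: hvh.
have uV i : (i <= K)%N -> Vspace Omega mu bc (uh i) by move=> iK; case: (uh_Vh iK).
have w1 := weq _ vV; have w2 := weq _ (uV _ kK); have w3 := weq _ (uV _ (ltnW kK)).
have wU := balance_lin s (1 - s) lP lQ hu1 lF hk1 hk0 w2 w3; rewrite /= -/U' in wU.
have wphi := balance_lin 1 (-1) lP lQ hu1 lF hv1 HU w1 wU; rewrite /= -/phi in wphi.
have sU' := scheme_lin s (1 - s) kK (uh_Vh kK) (uh_Vh (ltnW kK)); rewrite /= -/U' in sU'.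
have sphi := balance_lin 1 (-1) ld lo hk1 lf hv1 HU (scheme kK hvh) sU'; rewrite /= -/phi in sphi.
have Hphi : H1 phi by apply: (H1_lin hmu hO).
have Lphi := H1_L2 Hphi.
pose nn x := (P (t, x) - del k x) + (Q (t, x) - om k x) - (Fj (t, x) - fb k x).
have l1 := L2B mO lP ld; have l2 := L2B mO lQ lo; have l3 := L2B mO lF lf.
have l12 := L2D mO l1 l2; have ln : L2 nn := L2B mO l12 l3.
have nphi : inner nn phi = (inner (fun x => P (t, x)) phi - inner (del k) phi) +
    (inner (fun x => Q (t, x)) phi - inner (om k) phi) - (inner (fun x => Fj (t, x)) phi - inner (fb k) phi).
  rewrite (innerBl mO l12 l3 Lphi) (innerDl mO l1 l2 Lphi) (innerBl mO lP ld Lphi).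
  by rewrite (innerBl mO lQ lo Lphi) (innerBl mO lF lf Lphi).
have bal := split_arith wphi sphi nphi.
have phiE : phi = fun x => 1 * et x + (-1) * rho x.
  by apply/funext => x; rewrite /phi /et /rho; ring.
have gE : (fun x => 1 * u t x + (-1) * uh k.+1 x) = fun x => 1 * et x + (- (1 - s)) * inc x.
  by apply/funext => x; rewrite /et /U' /inc /increment; ring.
have X0 : 0 <= Cp * M t by rewrite mulr_ge0.
have hM : Cp * H2sq mu Omega (u t) <= Cp * M t by rewrite ler_wpM2l.
have hh0 : 0 <= h ^+ 2 by exact: sqr_ge0.
have r1' : inner rho rho <= (h ^+ 2) ^+ 2 * (Cp * M t).
  by apply: le_trans r1 _; rewrite ler_wpM2l// sqr_ge0.
have r2' : D rho rho <= h ^+ 2 * (Cp * M t) by apply: le_trans r2 _; rewrite ler_wpM2l.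
have bound := dissipation_bound s01 hh0 X0 ln Het Hrho Hinc hu1 hk1 Hphi phiE gE bal r1' r2'.
have nnE x : Omega x -> NN k (t, x) = nn x by move=> Ox; rewrite /NN /= !patchE !(mem_set Ox).
have tT : 0 <= t < T.
  by move: Dt; rewrite /= in_itv /= => /andP[a0 ->]; rewrite ltW.
have etE' x : Omega x -> EE k (t, x) = et x.
  by move=> Ox; rewrite /EE /= !patchE !(mem_set Ox) (hU tT Ox) -etE /= uhtE.
have i1 : \int[mu]_(x in O) (NN k (t, x) * EE k (t, x)) = inner nn et.
  by rewrite innerE; apply: eq_Rintegral => x /set_mem Ox; rewrite nnE// etE'.
have i2 : \int[mu]_(x in O) (NN k (t, x) ^+ 2) = inner nn nn.
  by rewrite inner_sqrE; apply: eq_Rintegral => x /set_mem Ox; rewrite nnE.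
have i3 : \int[mu]_(x in O) (EE k (t, x) ^+ 2) = inner et et.
  by rewrite inner_sqrE; apply: eq_Rintegral => x /set_mem Ox; rewrite etE'.
by rewrite etE i1 i2 i3; split => //; exact: dirichlet_form_ge0.
Qed.

Let I2D k (J1 J2 : measurableTypeR R * borelRn R n -> R) : ri2 k J1 -> ri2 k J2 ->
  I2 k (fun z => J1 z + J2 z) = I2 k J1 + I2 k J2.
Proof. by move=> i1 i2; rewrite RintegralD//; exact: mQ. Qed.

Lemma om_inner_le k : (k < K)%N -> inner (om k) (om k) <= L ^+ 2 * inner (del k) (del k).
Proof.
move=> kK; have /L2P[_ io] := om_L2 kK; have /L2P[_ id] := del_L2 kK.
rewrite !inner_sqrE -(RintegralZl _ mO id); apply: Rint_le_ae => //; first exact: (riZ mO).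
apply: aeW => x _; rewrite -exprMn -[leLHS]real_normK ?num_real// -[leRHS]real_normK ?num_real//.
rewrite lerXn2r ?nnegrE// [`|L * _|]normrM (gtr0_norm L0); exact: om_le.
Qed.

Let six_arith (p d q o r b : R) : ((p - d) + (q - o) - (r - b)) ^+ 2 <=
  6 * (p ^+ 2 + d ^+ 2 + (q ^+ 2 + o ^+ 2) + (r ^+ 2 + b ^+ 2)).
Proof.
have := sqr_ge0 (p + d); have := sqr_ge0 (p - q); have := sqr_ge0 (p + o); have := sqr_ge0 (p + r).
have := sqr_ge0 (p - b); have := sqr_ge0 (d + q); have := sqr_ge0 (d - o); have := sqr_ge0 (d - r).
have := sqr_ge0 (d + b); have := sqr_ge0 (q + o); have := sqr_ge0 (q + r); have := sqr_ge0 (q - b).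
have := sqr_ge0 (o - r); have := sqr_ge0 (o + b); have := sqr_ge0 (r + b); nra.
Qed.

Lemma residual_slab_le k : (k < K)%N ->
  I2 k (fun z => NN k z ^+ 2) <= 6 * (I2 k (fun z => P z ^+ 2) + tau * inner (del k) (del k) +
    (I2 k (fun z => Q z ^+ 2) + L ^+ 2 * (tau * inner (del k) (del k))) +
    (I2 k (fun z => Fj z ^+ 2) + tau * inner (fb k) (fb k))).
Proof.
move=> kK; have ld := del_L2 kK; have lo := om_L2 kK; have lf := fb_L2 kK.
have [_ [_ iN]] := residual_sqi kK.
have i1 := (slab_rect_sqi kK sP).2; have i2 := (slab_rect_sqi kK sQ).2; have i3 := (slab_rect_sqi kK sFj).2.
have i4 := (space_joint_sqi k ld).2; have i5 := (space_joint_sqi k lo).2; have i6 := (space_joint_sqi k lf).2.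
have j1 := riD (mQ k) i1 i4; have j2 := riD (mQ k) i2 i5; have j3 := riD (mQ k) i3 i6.
have j12 := riD (mQ k) j1 j2; have j123 := riD (mQ k) j12 j3.
have := Rint_le_ae (mQ k) iN (riZ (mQ k) 6 j123) => /(_ _)/wrap[].
  by apply: aeW => z _; exact: six_arith.
rewrite (RintegralZl _ (mQ k) j123) (I2D j12 j3) (I2D j1 j2) (I2D i1 i4) (I2D i2 i5) (I2D i3 i6).
rewrite (space_joint_I2 kK ld) (space_joint_I2 kK lo) (space_joint_I2 kK lf) => /le_trans; apply.
rewrite ler_wpM2l// lerD2r lerD2l lerD2l mulrCA ler_wpM2l//; first exact: ltW.
exact: om_inner_le.
Qed.

(** No smallness is claimed here: the residual is bounded by the data, and gains its factor h^2 from
    the projection error in [slab_dissipation]. *)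
Lemma residual_sum_le : \sum_(k < K) I2 k (fun z => NN k z ^+ 2) <=
  6 * (space_time_sqr P + SS + (space_time_sqr Q + L ^+ 2 * SS) + (space_time_sqr Fj + space_time_sqr Fj)).
Proof.
apply: le_trans (ler_sum _ (fun k _ => residual_slab_le (ltn_ord k))) _.
rewrite -mulr_sumr ler_wpM2l// !big_split /= !space_time_slabs//.
have -> : \sum_(k < K) L ^+ 2 * (tau * inner (del k) (del k)) = L ^+ 2 * SS by rewrite mulr_sumr.
by rewrite lerD2l lerD2l; exact: slab_mean_sum.
Qed.

Let quad_arith (E0 A d I2 tau' Er : R) : 0 < tau' -> 0 <= A -> A ^+ 2 <= tau' * I2 ->
  `|Er - E0| <= A + tau' * `|d| -> Er ^+ 2 <= 2 * E0 ^+ 2 + 4 * (tau' * I2) + 4 * (tau' ^+ 2 * d ^+ 2).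
Proof.
move=> t0 A0 hA; rewrite -(real_normK (num_real d)); have : 0 <= `|d| by []. 
move: (`|d|) => {}d d0; rewrite ler_norml => /andP[h1 h2].
have td := mulr_ge0 (ltW t0) d0; rewrite -exprMn; move: (tau' * d) td h1 h2 => b b0 h1 h2.
have h3 : (Er - E0) ^+ 2 <= (A + b) ^+ 2.
  by rewrite -[leLHS]real_normK ?num_real// lerXn2r ?nnegrE ?addr_ge0// ler_norml h1 h2.
have := sqr_ge0 (Er - 2 * E0); have := sqr_ge0 (A - b); nra.
Qed.

Let expand_arith (d a b r : R) : (2 * a + 4 * (d * b) + 4 * (d ^+ 2 * r)) * d =
  2 * d * a + 4 * d ^+ 2 * b + 4 * (d ^+ 2 * d) * r.
Proof. by ring. Qed.

(** Passes from the nodal errors to the L2 part of the time integral: inside a slab the error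
    departs from its value at the left node by at most the integral of the modulus of [P] plus
    [tau * |del k x|]. *)
Lemma error_slab_le k : (k < K)%N ->
  I2 k (fun z => EE k z ^+ 2) <= 2 * (tau * inner (e k) (e k)) + 4 * (tau ^+ 2 * I2 k (fun z => P z ^+ 2)) +
    4 * (tau ^+ 2 * (tau * inner (del k) (del k))).
Proof.
move=> kK; have [_ [_ iE]] := error_slab_sqi kK; have iP := (slab_rect_sqi kK sP).2.
have /L2P[_ id] := del_L2 kK; have /L2P[_ ie] := e_L2 (ltnW kK).
have mS := moo (tk k) (tk k.+1).
have iPx := rect_integrable2 mS mO iP.
rewrite -(rect_fubini2 mS mO iE) -(rect_fubini2 mS mO iP) !inner_sqrE.
have j1 := riZ mO (2 * tau) ie; have j2 := riZ mO (4 * tau ^+ 2) iPx.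
have j3 := riZ mO (4 * (tau ^+ 2 * tau)) id.
have j12 := riD mO j1 j2; have j123 := riD mO j12 j3.
have := Rint_le_ae mO (rect_integrable2 mS mO iE) j123 => /(_ _)/wrap[]; last first.
  rewrite (RintegralD mO j12 j3) (RintegralD mO j1 j2).
  rewrite (RintegralZl _ mO ie) (RintegralZl _ mO iPx) (RintegralZl _ mO id).
  by rewrite !mulrA.
apply: (ae_imp2 hux (rect_ae2 mS mO iE)) => x hx hE Ox; have [s1 e1] := hx Ox.
have sk := tk_lt T0 K0 k; have sS := sqi_slab T0 K0 kK s1.
have hA := Rint_abs_sqr sk sS; rewrite (_ : tk k.+1 - tk k = tau) in hA; last first.
  by rewrite tkS addrAC subrr add0r.
have iabs := ri_abs (sqi_ri mS (leb_oo_fin _ _) sS).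
set A := \int[leb]_(t in slab k) `|P (t, x)| in hA.
set B := \int[leb]_(t in slab k) (P (t, x) ^+ 2) in hA *.
have A0 : 0 <= A by apply: Rintegral_ge0.
have pt t : tk k < t < tk k.+1 -> EE k (t, x) ^+ 2 <=
    2 * e k x ^+ 2 + 4 * (tau * B) + 4 * (tau ^+ 2 * del k x ^+ 2).
  move=> /andP[t1 t2]; apply: (quad_arith tau0 A0 hA).
  have tT : 0 <= t < T.
    by rewrite (le_trans (tk_ge0 T0 K0 k) (ltW t1)) (lt_le_trans t2 (tk_leT T0 K0 kK)).
  rewrite /EE /= !patchE !(mem_set Ox) (hU tT Ox) /e.
  have tT' : 0 <= t <= T by case/andP: tT => -> /ltW.
  rewrite (e1 t tT') (e1 _ (node_range (ltnW kK))).
  rewrite (_ : _ - _ = (prim (fun s => P (s, x)) t - prim (fun s => P (s, x)) (tk k)) - (t - tk k) * del k x); last by ring.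
  have iT := sqi_ri (moo 0 T) (leb_oo_fin 0 T) s1.
  rewrite (prim_diff (T := T) (tk_ge0 T0 K0 k) (ltW t1) _ iT); last by case/andP: tT'.
  apply: le_trans (ler_normB _ _) _; apply: lerD.
    have i1 : leb.-integrable (oo (tk k) t) (EFin \o (fun s => P (s, x))).
      apply: (ri_sub (moo 0 T) (moo _ _)) iT; apply: subset_itvW; first exact: tk_ge0.
      by case/andP: tT'.
    apply: le_trans (le_normr_Rintegral (moo _ _) i1) _.
    by apply: Rint_sub_le => //; [exact: ltW|exact: ltW|exact: ltW].
  rewrite normrM ler_wpM2r// ger0_norm ?subr_ge0 ?ltW//.
  by rewrite ltrBlDl -tkS.
have ic := ri_oo_cst (tk k) (tk k.+1) (2 * e k x ^+ 2 + 4 * (tau * B) + 4 * (tau ^+ 2 * del k x ^+ 2)).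
have := Rint_le_ae mS (hE Ox) ic => /(_ _)/wrap[].
  by apply: aeW => t; rewrite /= in_itv /=; exact: pt.
rewrite Rint_oo_cst ?(ltW sk)// (_ : tk k.+1 - tk k = tau); last by rewrite tkS addrAC subrr add0r.
move=> /le_trans; apply; rewrite le_eqVlt; apply/orP; left; apply/eqP.
exact: expand_arith.
Qed.

Let Rk k t := 2 * h ^+ 2 * (\int[mu]_(x in O) (NN k (t, x) ^+ 2) + Cp * M t) + 3 * (h ^+ 2 * (Cp * M t)) +
       3 * D (increment uh k) (increment uh k).
Let NE k t := \int[mu]_(x in O) (NN k (t, x) * EE k (t, x)).
Let E2 k t := \int[mu]_(x in O) (EE k (t, x) ^+ 2).

Let iM_slab k : (k < K)%N -> leb.-integrable (slab k) (EFin \o M).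
Proof. by move=> kK; exact: (ri_slab T0 K0 kK). Qed.

Let iNE k : (k < K)%N -> leb.-integrable (slab k) (EFin \o NE k).
Proof. by move=> kK; exact: (rect_integrable1 (moo _ _) mO (residual_error_ri kK)). Qed.

Let iE2 k : (k < K)%N -> leb.-integrable (slab k) (EFin \o E2 k).
Proof. by move=> kK; exact: (rect_integrable1 (moo _ _) mO (error_slab_sqi kK).2.2). Qed.

Let RkE k : (k < K)%N -> leb.-integrable (slab k) (EFin \o Rk k) /\
  \int[leb]_(t in slab k) Rk k t = 2 * h ^+ 2 * I2 k (fun z => NN k z ^+ 2) +
    5 * (h ^+ 2 * Cp) * \int[leb]_(t in slab k) M t + 3 * (tau * D (increment uh k) (increment uh k)).
Proof.
move=> kK; have mS := moo (tk k) (tk k.+1).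
have iN := (residual_sqi kK).2.2; have iN1 := rect_integrable1 mS mO iN.
have iMk := iM_slab kK.
have j1 := riZ mS (2 * h ^+ 2) iN1; have j2 := riZ mS (5 * (h ^+ 2 * Cp)) iMk.
have j3 := ri_oo_cst (tk k) (tk k.+1) (3 * D (increment uh k) (increment uh k)).
have j12 := riD mS j1 j2; have j123 := riD mS j12 j3.
have -> : Rk k = fun t => 2 * h ^+ 2 * (\int[mu]_(x in O) (NN k (t, x) ^+ 2)) +
    5 * (h ^+ 2 * Cp) * M t + 3 * D (increment uh k) (increment uh k).
  apply/funext => t; rewrite /Rk; move: (\int[mu]_(x in O) _) (D _ _) => a b; ring.
split; first exact: j123.
rewrite (RintegralD mS j12 j3) (RintegralD mS j1 j2) (RintegralZl _ mS iN1) (RintegralZl _ mS iMk).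
rewrite (rect_fubini1 mS mO iN) Rint_oo_cst; last by rewrite ltW// tk_lt.
rewrite (_ : tk k.+1 - tk k = tau); last by rewrite tkS addrAC subrr add0r.
by congr (_ + _); rewrite -mulrA; congr (_ * _); exact: mulrC.
Qed.

Let ne_arith (a b : R) : 0 <= - 2 * a + b -> 2 * a <= b.
Proof. by lra. Qed.

(** Nonnegativity of the Dirichlet form turns the dissipation inequality into an upper bound for the
    work of the residual; inserted into the energy inequality, it closes the nodal estimate. *)
Let NE_le k : (k < K)%N -> 2 * I2 k (fun z => NN k z * EE k z) <= \int[leb]_(t in slab k) Rk k t.
Proof.
move=> kK; have mS := moo (tk k) (tk k.+1); have [iR _] := RkE kK; have iN := iNE kK.
rewrite -(rect_fubini1 mS mO (residual_error_ri kK)) -(RintegralZl _ mS iN).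
apply: Rint_le_ae => //; first exact: (riZ mS).
apply: (ae_imp (slab_dissipation kK)) => t ht St; have [_ _ d0 d1] := ht St.
exact: ne_arith (le_trans d0 d1).
Qed.

Let Rk_ge0 k : (k < K)%N -> 0 <= \int[leb]_(t in slab k) Rk k t.
Proof.
move=> kK; apply: Rintegral_ge0 => t _; apply: addr_ge0; last by rewrite mulr_ge0// dirichlet_form_ge0.
have h2 : 0 <= h ^+ 2 by exact: sqr_ge0.
have cM : 0 <= Cp * M t by exact: mulr_ge0.
apply: addr_ge0; last by rewrite !mulr_ge0.
apply: mulr_ge0; first exact: mulr_ge0.
by apply: addr_ge0 => //; apply: Rintegral_ge0 => x _; exact: sqr_ge0.
Qed.

Let Rtot := \sum_(k < K) \int[leb]_(t in slab k) Rk k t.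

Let X0Y0 := inner (e 0%N) (e 0%N) + c^-1 * inner (W 0%N) (W 0%N).

Let double_arith (X Y X' Y' S d : R) : 2^-1 * X + (2 * c)^-1 * Y <= 2^-1 * X' + (2 * c)^-1 * Y' + S + d ->
  X + c^-1 * Y <= X' + c^-1 * Y' + 2 * S + 2 * d.
Proof.
have -> : c^-1 = 2 * (2 * c)^-1 by field; exact: lt0r_neq0.
by move: ((2 * c)^-1) => a; rewrite -!mulrA; lra.
Qed.

Lemma node_error j : (j <= K)%N -> L2 (W j) /\
  inner (e j) (e j) + c^-1 * inner (W j) (W j) <= X0Y0 + 2 * (tau * defect) + Rtot.
Proof.
move=> jK; have [lW hE] := integrated_energy jK; split => //.
apply: le_trans (double_arith hE) _; rewrite addrAC lerD2l mulr_sumr.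
apply: le_trans (ler_sum _ (fun k _ => NE_le (leq_trans (ltn_ord k) jK))) _.
exact: (sum_ord_le (a := fun k => \int[leb]_(t in slab k) Rk k t) jK Rk_ge0).
Qed.

Let Bk k t := E2 k t + (- 2 * NE k t + Rk k t).

Let iBk k : (k < K)%N -> leb.-integrable (slab k) (EFin \o Bk k).
Proof.
move=> kK; have mS := moo (tk k) (tk k.+1); have [iR _] := RkE kK.
exact: (riD mS (iE2 kK) (riD mS (riZ mS (- 2) (iNE kK)) iR)).
Qed.

Let BkE k : (k < K)%N -> \int[leb]_(t in slab k) Bk k t = I2 k (fun z => EE k z ^+ 2) +
  (- 2 * I2 k (fun z => NN k z * EE k z) + \int[leb]_(t in slab k) Rk k t).
Proof.
move=> kK; have mS := moo (tk k) (tk k.+1); have [iR _] := RkE kK.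
have j1 := riZ mS (- 2) (iNE kK).
rewrite (RintegralD mS (iE2 kK) (riD mS j1 iR)) (RintegralD mS j1 iR) (RintegralZl _ mS (iNE kK)).
by rewrite (rect_fubini1 mS mO (error_slab_sqi kK).2.2) (rect_fubini1 mS mO (residual_error_ri kK)).
Qed.

(** The slab majorants glued into one integrable function of time, since the H1 norm of the error is
    not known to be measurable. The grid nodes are left out and form a null set. *)
Let B t := \sum_(k < K) (Bk k \_ (slab k)) t.

Let B_slab k t : (k < K)%N -> slab k t -> B t = Bk k t.
Proof.
move=> kK St; rewrite /B (bigD1 (Ordinal kK))//= big1 ?addr0; first by rewrite patchE mem_set.
move=> i ik; rewrite patchE memNset// => Si; move/eqP : ik; apply; apply/val_inj/eqP => /=.
move: St Si; rewrite /= !in_itv /= => /andP[t1 t2] /andP[t3 t4].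
have lti (a b : nat) : tk a < tk b -> (a < b)%N by move=> ab; rewrite ltnNge; apply/negP => /(tk_mono T0 K0); rewrite leNgt ab.
have := lti _ _ (lt_trans t3 t2); have := lti _ _ (lt_trans t1 t4).
by rewrite !ltnS => a1 a2; rewrite eqn_leq a1 a2.
Qed.

Let iB : leb.-integrable (oo 0 T) (EFin \o B).
Proof.
apply: (ri_sum (moo 0 T)) => k; apply: (@integrableS _ _ _ _ setT) => //.
have := iBk (ltn_ord k) => /(integrable_mkcond _ (moo _ _)); apply: eq_integrable => //.
by move=> t _ /=; rewrite !patchE; case: ifP.
Qed.

Let grid_null : {ae leb, forall t : measurableTypeR R, forall k, t <> tk k}.
Proof.
apply: ae_forall => k; exists [set tk k : measurableTypeR R]; split => //.
- exact: lebesgue_measure_set1.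
- by move=> t /= /contrapT.
Qed.

Let find_slab j t : (forall k, t <> tk k) -> 0 < t < tk j -> exists k, (k < j)%N /\ slab k t.
Proof.
move=> tn; elim: j => [|j IH /andP[t0 tj]]; first by rewrite tk0 => /andP[a b]; have := lt_trans a b; rewrite ltxx.
have [tl|tl|te] := ltgtP t (tk j).
- by have [|k [kj St]] := IH; [rewrite t0|exists k; split => //; exact: ltnW].
- by exists j; split => //; rewrite /= in_itv /= tl.
- by have := tn j te.
Qed.

Let h1_arith (a d b : R) : d <= b -> a + d <= a + b.
Proof. by rewrite lerD2l. Qed.

Let B_bound : {ae leb, forall t, oo 0 T t ->
  0 <= B t /\ ((H1_norm Omega mu (u t \- uht t)%R) ^+ 2 <= (B t)%:E)%E}.
Proof.
have hs : {ae leb, forall t, forall k, (k < K)%N -> slab k t ->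
    0 <= Bk k t /\ ((H1_norm Omega mu (u t \- uht t)%R) ^+ 2 <= (Bk k t)%:E)%E}.
  apply: ae_forall => k; have [kK|kK] := ltnP k K; last first.
    by apply: aeW.
  apply: (ae_imp (slab_dissipation kK)) => t ht _ St; have [g1 g2 g3 g4] := ht St.
  have g5 : inner (u t \- uht t) (u t \- uht t) + D (u t \- uht t) (u t \- uht t) <= Bk k t.
    by rewrite g2; exact: h1_arith g4.
  rewrite (H1_norm_sqr hO g1) lee_fin; split => //; apply: le_trans g5.
  by apply: addr_ge0 => //; exact: inner_ge0.
apply: (ae_imp2 hs grid_null) => t ht tn; rewrite /= in_itv /= => t0.
have [|k [kK St]] := find_slab (j := K) tn; first by rewrite tkK.
by rewrite (B_slab kK St); exact: ht.
Qed.

(** The energies [XY] are nonnegative, so the energy inequality bounds the work [S2] from below;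
    this is what the gradient estimate needs. *)
Let grad_arith (S1 S2 S3 X0 d XY : R) : 0 <= XY -> XY <= X0 + 2 * S2 + 2 * d ->
  S1 + (- 2 * S2 + S3) <= S1 + (X0 + 2 * d + S3).
Proof. by lra. Qed.

Lemma gradient_error j : (j <= K)%N ->
  (\int[leb]_(s in oo 0%R (tk j)) (H1_norm Omega mu (u s \- uht s)%R) ^+ 2 <=
  (\sum_(k < K) I2 k (fun z => (EE k z ^+ 2)%R) + (X0Y0 + 2 * (tau * defect) + Rtot))%:E)%E.
Proof.
move=> jK; have mj := moo 0 (tk j).
have sub : oo 0 (tk j) `<=` oo 0 T by apply: subset_itvW => //; exact: tk_leT.
have iBj := ri_sub (moo 0 T) mj sub iB.
(* [B] is known to be nonnegative only almost everywhere, while [lower_integral_le_ae] asks for a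
   majorant nonnegative everywhere. *)
pose C t := Num.max 0 (B t).
have iC : leb.-integrable (oo 0 (tk j)) (EFin \o C).
  apply: (ri_le mj _ _ (ri_abs iBj)).
    by apply: measurable_maxr => //; exact: ri_measurable iBj.
  move=> t _; rewrite ger0_norm ?le_max ?lexx// ge_max normr_ge0 /=; exact: ler_norm.
have h1 : (\int[leb]_(s in oo 0%R (tk j)) (H1_norm Omega mu (u s \- uht s)%R) ^+ 2 <=
    \int[leb]_(s in oo 0%R (tk j)) (C s)%:E)%E.
  apply: lower_integral_le_ae => //.
  - by move=> t _; exact: sqre_ge0.
  - by move=> t _; rewrite lee_fin le_max lexx.
  - exact: measurable_int iC.
  apply: (ae_imp B_bound) => t ht /sub Dt; have [b0 b1] := ht Dt.
  by apply: le_trans b1 _; rewrite lee_fin le_max lexx orbT.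
apply: le_trans h1 _; rewrite (Rint_fin mj iC) lee_fin.
have h2 : \int[leb]_(s in oo 0 (tk j)) C s <= \int[leb]_(s in oo 0 (tk j)) B s.
  apply: Rint_le_ae => //; apply: (ae_imp B_bound) => t ht /sub Dt; have [b0 _] := ht Dt.
  by rewrite /C max_r.
apply: le_trans h2 _; rewrite -/(prim B (tk j)) (prim_slabs T0 K0 iB jK).
have -> : \sum_(k < j) \int[leb]_(t in slab k) B t = \sum_(k < j) I2 k (fun z => EE k z ^+ 2) +
   (- 2 * \sum_(k < j) I2 k (fun z => NN k z * EE k z) + \sum_(k < j) \int[leb]_(t in slab k) Rk k t).
  rewrite mulr_sumr -!big_split; apply: eq_bigr => k _ /=.
  have kK := leq_trans (ltn_ord k) jK; rewrite -(BkE kK).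
  by apply: eq_Rintegral => t /set_mem St; rewrite (B_slab kK St).
have [lW hE] := integrated_energy jK; have hE' := double_arith hE.
have XY0 : 0 <= inner (e j) (e j) + c^-1 * inner (W j) (W j).
  by apply: addr_ge0; [exact: inner_ge0|rewrite mulr_ge0 ?inner_ge0// invr_ge0 ltW].
apply: le_trans (grad_arith _ _ XY0 hE') _; apply: lerD.
  apply: (sum_ord_le (a := fun k => I2 k (fun z => EE k z ^+ 2)) jK) => k kK.
  by apply: Rintegral_ge0 => z _; exact: sqr_ge0.
rewrite lerD2l; exact: (sum_ord_le (a := fun k => \int[leb]_(t in slab k) Rk k t) jK Rk_ge0).
Qed.

Let sF0 : 0 <= space_time_sqr Fj.
Proof. exact: space_time_sqr_ge0. Qed.
Let sP0 : 0 <= space_time_sqr P.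
Proof. exact: space_time_sqr_ge0. Qed.
Let sQ0 : 0 <= space_time_sqr Q.
Proof. exact: space_time_sqr_ge0. Qed.
Let IM0 : 0 <= \int[leb]_(t in oo 0 T) M t.
Proof. by apply: Rintegral_ge0. Qed.

Definition stability_const : R := B0 + space_time_sqr Fj.

(** In order: the initial errors of [u] and [w]; twice the defect; 12 = 2 * 6, from the weight 2 in
    the dissipation bound and the six terms of the residual; 5 = 2 + 3, from the two occurrences of
    the projection error; 3 from the increments. *)
Definition node_const : R :=
  (1 + c^-1 * Lh ^+ 2) * B0 +
  2 * ((L + 1) * space_time_sqr P + (3 * L + 1) * stability_const + 2 * space_time_sqr Fj) +
  12 * (space_time_sqr P + stability_const + (space_time_sqr Q + L ^+ 2 * stability_const) +
        (space_time_sqr Fj + space_time_sqr Fj)) +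
  5 * Cp * (\int[leb]_(t in oo 0 T) M t) + 3 * stability_const.

(** The terms with [T] bound the L2 part of the H1 norm, through [error_slab_le] summed with
    [tau * K = T] and [tau <= T]; the last term bounds the gradient part. *)
Definition gradient_const : R :=
  2 * T * node_const + 4 * T * (space_time_sqr P + stability_const) + node_const.

Let SC := stability_const.

Let SC0 : 0 <= SC. Proof. exact: (addr_ge0 B00 sF0). Qed.

Let sumD0 : 0 <= \sum_(k < K) D (increment uh k) (increment uh k).
Proof. by apply: sumr_ge0 => k _; exact: dirichlet_form_ge0. Qed.

Let SS0 : 0 <= SS.
Proof. by apply: sumr_ge0 => k _; rewrite mulr_ge0 ?inner_ge0// ltW. Qed.

Let stab_split (a b d r : R) : 0 <= a -> 0 <= b -> a + b <= d + r -> d <= B0 -> a <= B0 + r /\ b <= B0 + r.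
Proof. by move=> ? ? ? ?; split; lra. Qed.

Let SS_le : SS <= SC /\ \sum_(k < K) D (increment uh k) (increment uh k) <= SC.
Proof. exact: stab_split SS0 sumD0 stability hinitD. Qed.

Let N6_le : \sum_(k < K) I2 k (fun z => NN k z ^+ 2) <=
  6 * (space_time_sqr P + SC + (space_time_sqr Q + L ^+ 2 * SC) + (space_time_sqr Fj + space_time_sqr Fj)).
Proof.
apply: le_trans residual_sum_le _; have [S1 _] := SS_le.
rewrite ler_wpM2l// lerD2r; apply: lerD; first by rewrite lerD2l.
by rewrite lerD2l ler_wpM2l// sqr_ge0.
Qed.

Let Rtot_le : Rtot <= 2 * h ^+ 2 * (6 * (space_time_sqr P + SC +
    (space_time_sqr Q + L ^+ 2 * SC) + (space_time_sqr Fj + space_time_sqr Fj))) +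
    5 * (h ^+ 2 * Cp) * (\int[leb]_(t in oo 0 T) M t) + 3 * (tau * SC).
Proof.
have -> : Rtot = 2 * h ^+ 2 * (\sum_(k < K) I2 k (fun z => NN k z ^+ 2)) +
    5 * (h ^+ 2 * Cp) * (\sum_(k < K) \int[leb]_(t in slab k) M t) +
    3 * (tau * (\sum_(k < K) D (increment uh k) (increment uh k))).
  rewrite !mulr_sumr -!big_split; apply: eq_bigr => k _ /=; exact: (RkE (ltn_ord k)).2.
have [_ S2] := SS_le; have h2 : 0 <= h ^+ 2 by exact: sqr_ge0.
rewrite -(prim_slabs T0 K0 iM (leqnn K)) /prim (tkK T K0).
apply: lerD; last by rewrite ler_wpM2l// ler_wpM2l// ltW.
by rewrite lerD2r; apply: (ler_wpM2l _ N6_le); exact: mulr_ge0.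
Qed.

Let X0Y0_le : X0Y0 <= (1 + c^-1 * Lh ^+ 2) * (h ^+ 2 * B0).
Proof.
rewrite mulrDl mul1r; apply: lerD => //; rewrite -mulrA ler_wpM2l//; first by rewrite invr_ge0 ltW.
apply: le_trans (ler_wpM2l (sqr_ge0 Lh) hinit).
have /L2P[_ iW] := W0_L2; have /L2P[_ ie] := e_L2 (leq0n K).
rewrite !inner_sqrE -(RintegralZl _ mO ie); apply: Rint_le_ae => //; first exact: (riZ mO).
apply: aeW => x Ox; rewrite -exprMn -[leLHS]real_normK ?num_real// -[leRHS]real_normK ?num_real//.
rewrite lerXn2r ?nnegrE// [`|Lh * _|]normrM (gtr0_norm Lh0); exact: W0_le.
Qed.

Let defect_le : defect <= (L + 1) * space_time_sqr P + (3 * L + 1) * SC + 2 * space_time_sqr Fj.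
Proof.
rewrite /defect lerD2r lerD2l ler_wpM2l//; last exact: SS_le.1.
by rewrite addr_ge0// mulr_ge0// ltW.
Qed.

Let Z_arith (t h2 b0 k x d dd r q m s : R) : 0 <= t -> 0 <= h2 -> 0 <= k -> 0 <= b0 -> 0 <= dd ->
  0 <= q -> 0 <= m -> 0 <= s -> x <= k * (h2 * b0) -> d <= dd ->
  r <= 2 * h2 * (6 * q) + 5 * (h2 * Cp) * m + 3 * (t * s) ->
  x + 2 * (t * d) + r <= (k * b0 + 2 * dd + 12 * q + 5 * Cp * m + 3 * s) * (t + h2).
Proof.
move=> t0 h20 k0 b00 dd0 q0 m0 s0 hx hdd hr.
have := ler_wpM2l t0 hdd; have := mulr_ge0 (mulr_ge0 k0 b00) t0.
have := mulr_ge0 dd0 h20; have := mulr_ge0 q0 t0; have := mulr_ge0 (mulr_ge0 Cp0 m0) t0.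
have := mulr_ge0 s0 h20.
have -> : (k * b0 + 2 * dd + 12 * q + 5 * Cp * m + 3 * s) * (t + h2) =
  k * b0 * t + k * (h2 * b0) + 2 * (dd * h2) + 2 * (t * dd) + 12 * (q * t) + 2 * h2 * (6 * q) +
  5 * (Cp * m * t) + 5 * (h2 * Cp) * m + 3 * (s * h2) + 3 * (t * s) by ring.
by lra.
Qed.

Let dd0 : 0 <= (L + 1) * space_time_sqr P + (3 * L + 1) * SC + 2 * space_time_sqr Fj.
Proof.
have L1 : 0 <= L + 1 by rewrite addr_ge0// ltW.
have L3 : 0 <= 3 * L + 1 by rewrite addr_ge0// mulr_ge0// ltW.
exact: (addr_ge0 (addr_ge0 (mulr_ge0 L1 sP0) (mulr_ge0 L3 SC0)) (mulr_ge0 (ler0n R 2) sF0)).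
Qed.

Let nn0 : 0 <= space_time_sqr P + SC + (space_time_sqr Q + L ^+ 2 * SC) + (space_time_sqr Fj + space_time_sqr Fj).
Proof. have q0 : 0 <= L ^+ 2 * SC by rewrite mulr_ge0// sqr_ge0.
exact: (addr_ge0 (addr_ge0 (addr_ge0 sP0 SC0) (addr_ge0 sQ0 q0)) (addr_ge0 sF0 sF0)). Qed.

Let kk0 : 0 <= 1 + c^-1 * Lh ^+ 2.
Proof. by rewrite addr_ge0// mulr_ge0 ?sqr_ge0// invr_ge0 ltW. Qed.

Let Z_le : X0Y0 + 2 * (tau * defect) + Rtot <= node_const * (tau + h ^+ 2).
Proof.
exact: (Z_arith (ltW tau0) (sqr_ge0 h) kk0 B00 dd0 nn0 IM0 SC0 X0Y0_le defect_le Rtot_le).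
Qed.

Lemma node_const_ge0 : 0 <= node_const.
Proof.
apply: addr_ge0; last exact: mulr_ge0.
apply: addr_ge0; last by rewrite mulr_ge0// mulr_ge0.
apply: addr_ge0; last exact: mulr_ge0.
by apply: addr_ge0; [exact: mulr_ge0|exact: mulr_ge0].
Qed.

Let W_arith (X Y Z : R) : 0 <= X -> 0 <= Y -> X + c^-1 * Y <= Z -> X <= Z /\ Y <= c * Z.
Proof.
move=> X0 Y0 hz; have cY : 0 <= c^-1 * Y by rewrite mulr_ge0// invr_ge0 ltW.
split; first lra.
have -> : Y = c * (c^-1 * Y) by rewrite mulrA mulfV ?mul1r// lt0r_neq0.
by rewrite ler_wpM2l ?(ltW c0)//; lra.
Qed.

Lemma node_error_bound j : (j <= K)%N ->
  inner (e j) (e j) <= node_const * (tau + h ^+ 2) /\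
  inner (W j) (W j) <= c * (node_const * (tau + h ^+ 2)).
Proof.
move=> jK; have [_ hZ] := node_error jK.
exact: W_arith (inner_ge0 _ _ _) (inner_ge0 _ _ _) (le_trans hZ Z_le).
Qed.

Let tau_leT : tau <= T.
Proof. by rewrite ler_pdivrMr ?ltr0n// ler_peMr ?ler1n// ltW. Qed.

Let tauK : tau * K%:R = T.
Proof. by rewrite mulfVK// pnatr_eq0 -lt0n. Qed.

Let E_arith (x z p s t' h2 : R) : 0 < t' -> t' <= T -> 0 <= h2 -> 0 <= p + s ->
  x <= 2 * (T * (z * (t' + h2))) + 4 * (t' ^+ 2 * p) + 4 * (t' ^+ 2 * s) ->
  x + z * (t' + h2) <= (2 * T * z + 4 * T * (p + s) + z) * (t' + h2).
Proof.
move=> t0 tT h20 ps hx.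
have h1 : t' ^+ 2 * (p + s) <= T * (p + s) * t'.
  by rewrite [leRHS]mulrAC expr2 ler_wpM2r// ler_wpM2r// ltW.
have h3 : 0 <= T * (p + s) * h2 by rewrite !mulr_ge0// ltW.
have -> : (2 * T * z + 4 * T * (p + s) + z) * (t' + h2) =
  2 * (T * (z * (t' + h2))) + 4 * (T * (p + s) * t') + 4 * (T * (p + s) * h2) + z * (t' + h2) by ring.
by move: h1; rewrite mulrDr => h1; lra.
Qed.

Let esum_le : \sum_(k < K) I2 k (fun z => EE k z ^+ 2) <=
  2 * (T * (node_const * (tau + h ^+ 2))) + 4 * (tau ^+ 2 * space_time_sqr P) + 4 * (tau ^+ 2 * SC).
Proof.
apply: le_trans (ler_sum _ (fun k _ => error_slab_le (ltn_ord k))) _.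
rewrite !big_split /=.
have -> : \sum_(k < K) 4 * (tau ^+ 2 * (tau * inner (del k) (del k))) = 4 * (tau ^+ 2 * SS) by rewrite !mulr_sumr.
have -> : \sum_(k < K) 2 * (tau * inner (e k) (e k)) = 2 * (tau * \sum_(k < K) inner (e k) (e k)) by rewrite !mulr_sumr.
have -> : \sum_(k < K) 4 * (tau ^+ 2 * I2 k (fun z => P z ^+ 2)) = 4 * (tau ^+ 2 * space_time_sqr P).
  by rewrite -!mulr_sumr space_time_slabs.
apply: lerD; last exact: (ler_wpM2l (ler0n R 4) (ler_wpM2l (sqr_ge0 tau) SS_le.1)).
rewrite lerD2r ler_wpM2l//.
apply: (@le_trans _ _ (tau * \sum_(k < K) node_const * (tau + h ^+ 2))).
  rewrite ler_wpM2l// ?(ltW tau0)//; apply: ler_sum => k _.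
  exact: (node_error_bound (ltnW (ltn_ord k))).1.
by rewrite sumr_const card_ord -(mulr_natr (node_const * _)) mulrCA tauK [leRHS]mulrC.
Qed.

Lemma gradient_error_bound j : (j <= K)%N ->
  (\int[leb]_(s in oo 0%R (tk j)) (H1_norm Omega mu (u s \- uht s)%R) ^+ 2 <=
  (gradient_const * (tau + h ^+ 2))%:E)%E.
Proof.
move=> jK; apply: le_trans (gradient_error jK) _; rewrite lee_fin.
apply: le_trans (_ : _ <= \sum_(k < K) I2 k (fun z => EE k z ^+ 2) + node_const * (tau + h ^+ 2)) _.
  by rewrite lerD2l; exact: Z_le.
exact: (E_arith tau0 tau_leT (sqr_ge0 h) (addr_ge0 sP0 SC0) esum_le).
Qed.

Let root_arith (X Z : R) : 0 <= Z -> X <= Z * (tau + h ^+ 2) -> Num.sqrt X <= Num.sqrt Z * (Num.sqrt tau + h).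
Proof.
move=> Z0 hX; apply: le_trans (ler_wsqrtr hX) _; rewrite sqrtrM// ler_wpM2l ?sqrtr_ge0//.
rewrite -[leRHS]ger0_norm ?addr_ge0 ?sqrtr_ge0// -sqrtr_sqr ler_wsqrtr// sqrrD sqr_sqrtr; last exact: ltW.
by rewrite lerD2r lerDl mulrn_wge0// mulr_ge0 ?sqrtr_ge0.
Qed.

Lemma scheme_error j : (j <= K)%N ->
  (L2_norm Omega mu (u (tk j) \- uh j)%R +
   L2_norm Omega mu (distributed F u w0 (tk j) \- distributed F uht w0 (tk j))%R +
   \int[leb]_(s in oo 0%R (tk j)) (H1_norm Omega mu (u s \- uht s)%R) ^+ 2 <=
  ((Num.sqrt node_const + Num.sqrt (c * node_const)) * (Num.sqrt tau + h) +
    gradient_const * (tau + h ^+ 2))%:E)%E.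
Proof.
move=> jK; have [lW _] := node_error jK; have [he hw] := node_error_bound jK.
rewrite EFinD; apply: leeD; last exact: gradient_error_bound.
have -> : L2_norm Omega mu (u (tk j) \- uh j)%R = (Num.sqrt (inner (e j) (e j)))%:E.
  by apply: (L2_norm_fin mO); exact: e_L2.
have -> : L2_norm Omega mu (distributed F u w0 (tk j) \- distributed F uht w0 (tk j))%R =
    (Num.sqrt (inner (W j) (W j)))%:E by exact: (L2_norm_fin mO lW).
rewrite -EFinD lee_fin mulrDl; have Z0 := node_const_ge0.
apply: lerD; first exact: root_arith.
by apply: root_arith; [rewrite mulr_ge0// ltW|rewrite -mulrA].
Qed.

End Scheme.

(** * The error estimate *)

Section Mesh.
Context {R : realType} {n : nat}.
Local Notation E := 'rV[R]_n.+1.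
Variable Omega : set E.
Hypothesis bO : bounded_set Omega.

Lemma mesh_size_ge0 (Th : triangulation (R := R) (n := n)) : 0 <= mesh_size Th.
Proof. exact: bigmax_ge_id. Qed.

(** The simplices lie in the closure of the bounded domain, so their diameters have a common bound.
    It lets h^2 be absorbed into h in the final rate. *)
Lemma mesh_size_bounded : exists H : R, 0 <= H /\
  forall Th, conforming_triangulation Omega Th -> mesh_size Th <= H.
Proof.
have [k Ok] := bounded_sub_cube bO.
exists (Num.sqrt (\sum_(i < n.+1) (2 * k%:R) ^+ 2)); split; first exact: sqrtr_ge0.
move=> Th [_ cO _]; rewrite /mesh_size big_seq.
apply: (big_ind (fun x => x <= _)) => [|a b ha hb|K KT]; first exact: sqrtr_ge0.
  by rewrite ge_max ha hb.
have Kk : simplex K `<=` cube k.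
  move=> x Kx; have : closure Omega x by rewrite cO; exists K.
  by rewrite (closure_id (cube k)).1; [exact: closureS|exact: closed_cube].
rewrite /diameter; set S := [set r | _].
have [/set0P S0|/negPn/eqP ->] := boolP (S != set0); last by rewrite sup0 sqrtr_ge0.
apply: ge_sup => // _ [x [y [/Kk Kx /Kk Ky ->]]].
apply: ler_wsqrtr; apply: ler_sum => i _.
rewrite -[leLHS]real_normK ?num_real// lerXn2r ?nnegrE// ?mulr_ge0//.
rewrite !mxE; apply: le_trans (ler_normB _ _) _.
have := Kx i; have := Ky i; rewrite -!ler_norml; lra.
Qed.
End Mesh.

Lemma sqre_le_scaled (R : realType) (a b : \bar R) (c A B : R) : (0 <= a)%E -> (0 <= b)%E ->
  (a ^+ 2 = A%:E)%E -> (b ^+ 2 = B%:E)%E -> (a <= c%:E * b)%E -> A <= c ^+ 2 * B.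
Proof.
case: a b => [a| |] [b| |]; rewrite ?expe2 ?mulyy// -!EFinM !lee_fin => a0 b0 [<-] [<-] ab.
by rewrite -!expr2 -exprMn lerXn2r ?nnegrE// (le_trans a0).
Qed.

(** * Error and stability of the elliptic projection *)

Section EllipticProjection.
Context {R : realType} {n : nat}.
Local Notation E := 'rV[R]_n.+1.
Variable mu : {measure set (borelRn R n) -> \bar R}.
Hypothesis hmu : is_lebesgue_measure mu.
Variable Omega : set E.
Hypothesis hO : convex_polyhedral_domain Omega.
Local Notation inner := (inner Omega mu).
Local Notation D := (dirichlet_form Omega mu).
Variables (v vh : E -> R) (C h : R).
Hypotheses (hv : H1 Omega mu v) (hvh : H1 Omega mu vh).
Hypothesis hE : forall m l, (1 <= m <= 2)%N -> (l <= 1)%N -> Hm Omega mu m v ->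
  (Hm_norm Omega mu l (v \- vh)%R <= (C * h ^+ (m - l))%:E * Hm_norm Omega mu m v)%E.

Let rho : E -> R := fun x => 1 * v x + (-1) * vh x.

Let rhoE : (v \- vh) = rho.
Proof. by apply/funext => x; rewrite /rho /= mul1r mulN1r. Qed.

Let rho_H1 : H1 Omega mu rho.
Proof. exact: H1_lin. Qed.

Let rho_L2sq : (L2_norm Omega mu (v \- vh)%R ^+ 2 = (inner rho rho)%:E)%E.
Proof.
rewrite rhoE L2_norm_sqr (sqint_fin (domain_measurable hO))//; exact: H1_L2 rho_H1.
Qed.

Let rho_H1sq : (H1_norm Omega mu (v \- vh)%R ^+ 2 = (inner rho rho + D rho rho)%:E)%E.
Proof. by rewrite rhoE (H1_norm_sqr hO rho_H1). Qed.

Let drop_left (a b d : R) : 0 <= a -> a + b <= d -> b <= d. Proof. by move=> ? ?; lra. Qed.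

Lemma projection_error_H1 :
  inner rho rho <= h ^+ 2 * (C ^+ 2 * (inner v v + D v v)) /\
  D rho rho <= C ^+ 2 * (inner v v + D v v).
Proof.
have e2 := H1_norm_sqr hO hv; split.
  have := sqre_le_scaled (L2_norm_ge0 _ _ _) (H1_norm_ge0 _ _ _) rho_L2sq e2 (hE (m := 1) (l := 0) isT isT hv).
  by rewrite subn0 expr1 exprMn mulrA [h ^+ 2 * _]mulrC.
have := sqre_le_scaled (H1_norm_ge0 _ _ _) (H1_norm_ge0 _ _ _) rho_H1sq e2 (hE (m := 1) (l := 1) isT isT hv).
rewrite subnn expr0 mulr1; apply: drop_left; exact: inner_ge0.
Qed.

Lemma projection_error_H2 : H2 Omega mu v ->
  inner rho rho <= (h ^+ 2) ^+ 2 * (C ^+ 2 * H2sq mu Omega v) /\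
  D rho rho <= h ^+ 2 * (C ^+ 2 * H2sq mu Omega v).
Proof.
move=> h2; have e2 := H2_norm_sqr hO h2; split.
  have := sqre_le_scaled (L2_norm_ge0 _ _ _) (H2_norm_ge0 _ _ _) rho_L2sq e2 (hE (m := 2) (l := 0) isT isT h2).
  by rewrite subn0 exprMn mulrA [(h ^+ 2) ^+ 2 * _]mulrC.
have := sqre_le_scaled (H1_norm_ge0 _ _ _) (H2_norm_ge0 _ _ _) rho_H1sq e2 (hE (m := 2) (l := 1) isT isT h2).
rewrite expr1 exprMn mulrA [h ^+ 2 * _]mulrC; apply: drop_left; exact: inner_ge0.
Qed.

(** The H1 error estimate with [m = l = 1] has the power h^0, so the initial discrete energy is
    bounded independently of the mesh. *)
Lemma projection_stability : D vh vh <= 2 * D v v + 2 * (C ^+ 2 * (inner v v + D v v)).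
Proof.
have [_ hD] := projection_error_H1.
have -> : vh = (fun x => 1 * v x + (-1) * rho x).
  by apply/funext => x; rewrite /rho; ring.
have h2 := dirichlet_form_le2 hmu hO 1 (-1) hv rho_H1; apply: le_trans h2 _.
by rewrite sqrrN expr1n !mulr1 lerD2l ler_wpM2l.
Qed.
End EllipticProjection.

(** The squared H1 term is of order tau + h^2; the bounds [T] on [tau] and [H] on [h] turn it into
    the slower rate of the L2 norms. *)
Lemma rate_arith (R : realType) (a G T H tau h : R) : 0 <= T -> 0 <= tau -> tau <= T ->
  0 <= h -> h <= H ->
  a * (Num.sqrt tau + h) + G * (tau + h ^+ 2) <=
  (a + `|G| * (Num.sqrt T + H) + 1) * (Num.sqrt tau + h).
Proof.
move=> T0 t0 tT h0 hH; set s := Num.sqrt tau; have s0 : 0 <= s := sqrtr_ge0 _.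
have sT : s <= Num.sqrt T by apply: ler_wsqrtr.
have -> : tau = s ^+ 2 by rewrite sqr_sqrtr.
have sh : 0 <= s + h by exact: addr_ge0.
have hq : s ^+ 2 + h ^+ 2 <= (Num.sqrt T + H) * (s + h) by nra.
have q0 : 0 <= s ^+ 2 + h ^+ 2 by rewrite addr_ge0 ?sqr_ge0.
have h1 : G * (s ^+ 2 + h ^+ 2) <= `|G| * ((Num.sqrt T + H) * (s + h)).
  apply: le_trans (ler_wpM2l (normr_ge0 G) hq); rewrite ler_wpM2r//; exact: ler_norm.
rewrite !mulrDl mul1r -!mulrA -addrA lerD2l; lra.
Qed.

Lemma inner_joint_slice (R : realType) (n : nat) (mu : {measure set (borelRn R n) -> \bar R})
    (Omega : set 'rV[R]_n.+1) (v : R -> 'rV[R]_n.+1 -> R)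
    (V : measurableTypeR R * borelRn R n -> R) (t : R) phi :
  measurable (Omega : set (borelRn R n)) ->
  measurable_fun setT V -> L2 Omega mu (v t) -> L2 Omega mu phi ->
  {ae mu, forall x, Omega x -> V (t, x) = v t x} ->
  inner Omega mu (fun x => V (t, x)) phi = inner Omega mu (v t) phi.
Proof.
move=> mO mV lv lp e; apply: inner_ae => //; [|exact: lv.1|exact: lp.1].
by apply: measurable_funTS; exact: measurable_slice1.
Qed.

Theorem theorem3p7 (R : realType) (n : nat)
    (mu : {measure set (borelRn R n) -> \bar R}) (hmu : is_lebesgue_measure mu)
    (Omega : set 'rV[R]_n.+1) (hOmega : convex_polyhedral_domain Omega)
    (bc : boundary_condition)
    (T : R) (hT : 0 < T)
    (F : (R -> R) -> R -> (R -> R))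
    (hF : maps_to_contT T F)
    (hcausal : causality T F)
    (hcont : strong_continuity T F)
    (haff : affine_boundedness T F)
    (hmono : piecewise_monotonicity T F)
    (hplip : piecewise_lipschitz_continuity T F)
    (haccr : L1_accretivity T F)
    (hlip : lipschitz_continuity T F)
    (hmt : monotonicity_type T F)
    (u0 w0 : 'rV[R]_n.+1 -> R) (f : R -> 'rV[R]_n.+1 -> R)
    (hu0 : Vspace Omega mu bc u0) (hw0 : L2 Omega mu w0)
    (hf : exists ft, H1_time Omega mu T f ft)
    (u : R -> 'rV[R]_n.+1 -> R)
    (hu : weak_solution Omega mu bc T F u0 w0 f u)
    (fam : set (triangulation (R := R) (n := n)))
    (hfam : regular_family Omega fam)
    (lambda : R)
    (hlambda : elliptic_projection_property Omega mu bc lambda fam) :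
  let w := distributed F u w0 in
  exists C : R, 0 < C /\
    forall (Th : triangulation) (K : nat), fam Th -> (0 < K)%N ->
    forall (uh : nat -> 'rV[R]_n.+1 -> R) (uht : R -> 'rV[R]_n.+1 -> R),
      is_elliptic_projection Omega mu bc lambda Th u0 (uh 0%N) ->
      discrete_solution Omega mu bc T F w0 f Th K uh uht ->
    let tau := T / K%:R in
    let t k := k%:R * tau in
    let wh k := distributed F uht w0 (t k) in
    forall k : nat, (1 <= k <= K)%N ->
      (L2_norm Omega mu (u (t k) \- uh k)%R +
       L2_norm Omega mu (w (t k) \- wh k)%R +
       \int[lebesgue_measure]_(s in `]0%R, t k[)
         (H1_norm Omega mu (u s \- uht s)%R) ^+ 2
       <= (C * (Num.sqrt tau + mesh_size Th))%:E)%E.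
Proof.
move=> w.
have em := sigma_finite_ofE (sigma_finite_lebesgue hmu).
(* Product measures ask for sigma-finiteness, so the given measure is replaced by its alias carrying
   that structure. *)
set m := sigma_finite_of _ in em; move: m em => m em; subst mu.
have mO := domain_measurable hOmega; have fO := domain_fin hmu hOmega.
have [ft [hf2 _ _]] := hf.
have [Fj [mFj hFj]] := bochner_joint mO fO hf2.1.
have sFj := bochner_L2_sqi mO mFj hFj hf2.
have [[lu cu] [hLinf hL2] hu0' _ [ut [wt [hut hwt hw]]]] := hu.
have [hu2 hut2 _] := hut; have [hw2 hwt2 _] := hwt.
have in_oo t : (`]0, T[%classic : set (measurableTypeR R)) t -> 0 <= t <= T.
  by rewrite /= in_itv /= => /andP[t0 tT]; rewrite !ltW.
have mut : {ae lebesgue_measure, forall t : measurableTypeR R, `]0, T[%classic t ->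
    measurable_fun (Omega : set (borelRn R n)) (u t)}.
  by apply: aeW => t /in_oo tT; exact: (lu t tT).1.
have [P [mP sP hP hux]] := H1_time_prim mO fO hT cu mut hut.
have cw x : Omega x -> contT T (fun t => distributed F u w0 t x) by move=> Ox; apply: hF; exact: cu.
have mw : {ae lebesgue_measure, forall t : measurableTypeR R, `]0, T[%classic t ->
    measurable_fun (Omega : set (borelRn R n)) (distributed F u w0 t)}.
  by have [s hs] := hw2.1; apply: (ae_imp hs) => t ht Dt; have [[]] := ht Dt.
have [Q [mQ sQ hQ hwx]] := H1_time_prim mO fO hT cw mw hwt.
have mwu := measurable_slices_dense hT cw mw.
have [U [mU hU]] := caratheodory_joint mO hT cu (fun t tT => (lu t tT).1).
have hU' : {ae lebesgue_measure, forall t : measurableTypeR R, `]0, T[%classic t ->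
    {ae m, forall x, Omega x -> U (t, x) = u t x}}.
  apply: aeW => t; rewrite /= in_itv /= => /andP[t0 tT]; apply: aeW => x Ox.
  by apply: hU => //; rewrite (ltW t0) tT.
have sU := bochner_L2_sqi mO mU hU' hu2.
have [M [M0 iM hM]] := H2_majorant hmu hOmega hL2.
(* At almost every time the weak derivatives and the source are replaced by their jointly measurable
   representatives, uniting finitely many null sets. *)
have hweak : {ae lebesgue_measure, forall t : measurableTypeR R, `]0, T[%classic t ->
  [/\ Vspace Omega m bc (u t), H2 Omega m (u t), H2sq m Omega (u t) <= M t &
    forall phi, Vspace Omega m bc phi ->
      inner Omega m (fun x => P (t, x)) phi + inner Omega m (fun x => Q (t, x)) phi +
        dirichlet_form Omega m (u t) phi = inner Omega m (fun x => Fj (t, x)) phi]}.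
  have [s1 h1] := hLinf.1; have [s2 h2] := hut2.1; have [s3 h3] := hwt2.1; have [s4 h4] := hf2.1.
  have h12 := ae_imp2 h1 h2 (fun _ => @conj _ _); have h34 := ae_imp2 h3 h4 (fun _ => @conj _ _).
  have hPQ := ae_imp2 hP hQ (fun _ => @conj _ _); have hFM := ae_imp2 hFj hM (fun _ => @conj _ _).
  have hs := ae_imp2 h12 h34 (fun _ => @conj _ _); have hj := ae_imp2 hPQ hFM (fun _ => @conj _ _).
  have hall := ae_imp2 hs hj (fun _ => @conj _ _).
  apply: (ae_imp2 hall hw) => t [[[k1 k2] [k3 k4]] [[k5 k6] [k7 k8]]] k9 Dt.
  have [v1 _] := k1 Dt; have [l2 _] := k2 Dt; have [l3 _] := k3 Dt; have [l4 _] := k4 Dt.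
  have [m1 m2] := k8 Dt; split => // phi hphi; have lphi := (Vspace_H1 hphi).1.
  rewrite (inner_joint_slice mO mP l2 lphi (k5 Dt)) (inner_joint_slice mO mQ l3 lphi (k6 Dt)).
  rewrite (inner_joint_slice mO mFj l4 lphi (k7 Dt)); exact: k9.
have [L [L0 hL]] := hplip; have [Lh [Lh0 hLh]] := hlip; have [c [c0 hc]] := hmt.
have [hproj [C hC]] := hlambda; have [hconf _] := hfam.
have [H [H0 hH]] := mesh_size_bounded (domain_bounded hOmega).
have u0H1 := Vspace_H1 hu0.
pose S0 := inner Omega m u0 u0 + dirichlet_form Omega m u0 u0.
have S00 : 0 <= S0 by apply: addr_ge0; [exact: inner_ge0|exact: dirichlet_form_ge0].
(* [B0] dominates both the initial L2 error divided by h^2, which is at most [C ^+ 2 * S0], and the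
   initial discrete energy bounded by [projection_stability]. *)
pose B0 := 2 * dirichlet_form Omega m u0 u0 + 3 * (C ^+ 2 * S0).
have D00 := dirichlet_form_ge0 m Omega u0.
have CS0 : 0 <= C ^+ 2 * S0 by rewrite mulr_ge0 ?sqr_ge0.
have B00 : 0 <= B0 by apply: addr_ge0; exact: mulr_ge0.
pose Z := node_const m Omega T L Lh Fj c P Q M (C ^+ 2) B0.
pose G := gradient_const m Omega T L Lh Fj c P Q M (C ^+ 2) B0.
have a0 : 0 <= Num.sqrt Z + Num.sqrt (c * Z) by rewrite addr_ge0 ?sqrtr_ge0.
(* The three parts come from the nodal errors of [u] and [w], from the gradient term through
   [rate_arith], and from the required positivity. *)
exists (Num.sqrt Z + Num.sqrt (c * Z) + `|G| * (Num.sqrt T + H) + 1); split.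
  by rewrite ltr_pwDr// addr_ge0// mulr_ge0// addr_ge0 ?sqrtr_ge0.
move=> Th K famTh K0 uh uht hinit hd tau t wh k /andP[_ kK].
have h0 := mesh_size_ge0 Th; have hH' := hH _ (hconf _ famTh).
set h := mesh_size Th in h0 hH' *.
have hE v vh : Vspace Omega m bc v -> is_elliptic_projection Omega m bc lambda Th v vh ->
    forall i l, (1 <= i <= 2)%N -> (l <= 1)%N -> Hm Omega m i v ->
    (Hm_norm Omega m l (v \- vh)%R <= (C * h ^+ (i - l))%:E * Hm_norm Omega m i v)%E.
  by move=> hv hvh i l hi hl hvi; exact: hC hvh.
have hproj2 v : Vspace Omega m bc v -> H2 Omega m v -> exists vh, Vh Omega m bc Th vh /\
    let rho x := 1 * v x + (-1) * vh x in
    inner Omega m rho rho <= (h ^+ 2) ^+ 2 * (C ^+ 2 * H2sq m Omega v) /\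
    dirichlet_form Omega m rho rho <= h ^+ 2 * (C ^+ 2 * H2sq m Omega v).
  move=> hv hv2; have [vh [hvh _]] := hproj Th v famTh hv; exists vh; split; first exact: hvh.1.
  have vhH1 : H1 Omega m vh by have [[hvV _ _] _] := hvh; exact: Vspace_H1 hvV.
  exact: (projection_error_H2 hmu hOmega (Vspace_H1 hv) vhH1 (hE _ _ hv hvh) hv2).
have uhH1 : H1 Omega m (uh 0%N) by have [[huV _ _] _] := hinit; exact: Vspace_H1 huV.
have [r1 _] := projection_error_H1 hmu hOmega u0H1 uhH1 (hE _ _ hu0 hinit).
have r2 := projection_stability hmu hOmega u0H1 uhH1 (hE _ _ hu0 hinit).
have hB : C ^+ 2 * S0 <= B0 by apply: ler_wpDl; [exact: mulr_ge0|apply: ler_peMl => //; rewrite ler1n].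
(* The initial condition holds almost everywhere only, so [u 0] is exchanged for [u0] in each
   argument of the inner product. *)
have initL2 : let e0 x := u (tk T K 0) x - uh 0%N x in inner Omega m e0 e0 <= h ^+ 2 * B0.
  move=> e0; apply: le_trans (ler_wpM2l (sqr_ge0 h) hB); apply: le_trans r1.
  have t00 : (0 : R) <= 0 <= T by rewrite lexx ltW.
  have l1 : L2 Omega m e0 by rewrite /e0 tk0; apply: (L2B mO); [exact: lu|exact: uhH1.1].
  have l2 : L2 Omega m (fun x => 1 * u0 x + (-1) * uh 0%N x) := (H1_lin hmu hOmega 1 (-1) u0H1 uhH1).1.
  have ee : {ae m, forall x, Omega x -> e0 x = 1 * u0 x + (-1) * uh 0%N x}.
    by apply: (ae_imp hu0') => x hx Ox; rewrite /e0 tk0 (hx Ox) mul1r mulN1r.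
  rewrite (inner_ae mO l1.1 l2.1 l1.1 ee) innerC.
  by rewrite (inner_ae mO l1.1 l2.1 l2.1 ee).
have initD : dirichlet_form Omega m (uh 0%N) (uh 0%N) <= B0.
  by apply: le_trans r2 _; rewrite /B0 lerD2l ler_wpM2r// ler_nat.
have := scheme_error hmu hOmega hT hF hmono L0 Lh0 hL hLh hw0 mFj sFj hFj K0 hd hcausal c0 hc cu lu
  mwu mP sP mQ sQ mU sU hU hux hwx M0 iM hweak h0 (sqr_ge0 C) B00 hproj2 initL2 initD kK.
move=> /le_trans; apply; rewrite lee_fin.
apply: rate_arith => //; [exact: ltW|exact: divr_ge0 (ltW hT) _|].
by rewrite ler_pdivrMr ?ltr0n// ler_peMr ?ler1n// ltW.
Qed.
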